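(* Assume that $U \subset \mathbb R^n$ is bounded and open with $\dim_{\rm box}(\partial U) < n$. For all $\delta \in \,]\dim_{\rm box}(\partial U),n[$ there is a constant $C(n,\delta,U)\geq 0$ and compact sets $R_k \subset U$, $k\ge 0$, with (1) $\chi_U = \sum_{k \geq 0} \chi_{R_k}$ almost everywhere and in $L^1$; (2) $\mathscr L^n(R_k) \leq C(n,\delta,U)2^{k(\delta-n)}$ and $\mathbf V(\chi_{R_k}) \leq C(n,\delta,U)2^{k(\delta-(n-1))}$ for all $k\ge0$. In particular, $[\![U]\!] \in \mathscr F_{n,\delta}(\mathbb R^n)$ and $\partial [\![U]\!] \in \mathscr F_{\delta,n-2}(\mathbb R^n)$ for all $\delta \in \,]\dim_{\rm box}(\partial U),n[$.
   Context: $n\ge1$; $\mathscr L^n$ is Lebesgue measure. For a bounded set $A\subset\mathbb R^n$ let $N_A(\epsilon)$ be the minimal number of balls of radius $\epsilon$ needed to cover $A$; $\dim_{\rm box}(A)=\lim_{\epsilon\downarrow0}\log N_A(\epsilon)/\log(1/\epsilon)$, in case the limit exists. $\mathbf V(u)=\sup\{\int u\operatorname{div}\varphi:\varphi\in C_c^1(\mathbb R^n,\mathbb R^n),\|\varphi\|_\infty\le1\}$. Metric currents (with compact support). For a metric space $X$ and $m\ge0$, $\mathscr D_m(X)$ is the space of multilinear maps $T:\mathrm{Lip}(X)^{m+1}\to\mathbb R$ such that (i) $T(f,g^1,\dots,g^m)=0$ whenever some $g^i$ is constant in a neighbourhood of $\operatorname{spt}(f)$; (ii) there is a compact $K\subset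 X$ with $T(f,g)=0$ whenever $\operatorname{spt}(f)\cap K=\emptyset$; (iii) $T(f_k,g_k)\to T(f,g)$ whenever $f_k\to f$, $g^i_k\to g^i$ uniformly with uniformly bounded Lipschitz constants. $\operatorname{spt}(T)$ is the smallest closed set $A$ such that $T(f,g)=0$ whenever $\operatorname{spt}(f)\cap A=\emptyset$. $\partial T(f,g^1,\dots,g^{m-1})=T(1,f,g^1,\dots,g^{m-1})$ (and $\partial T=0$ if $m=0$). $\mathbf M(T)$ is the supremum of $\sum_{\lambda}T(f_\lambda,g^1_\lambda,\dots,g_\lambda^m)$ over finite families with $\sum_\lambda|f_\lambda|\le1$, $\mathrm{Lip}(g^i_\lambda)\le1$. $\mathbf I_m(X)$ is the space of integral currents with compact support (in the sense of Ambrosio–Kirchheim/Lang). Weak convergence: supports in one compact set and pointwise convergence. $[\![U]\!](f,g^1,\dots,g^n)=\int_U f\det D(g^1,\dots,g^n)\,dx$. Integral fractal currents. For $\gamma\in[m,m+1[$ and $\delta\in[m-1,m[$, $T\in\mathscr D_m(X)$ is in $\mathscr F_{\gamma,\delta}(X)$ if there are a compact $K\subset X$, sequences $(R_k)_{k\ge0}$ in $\mathbf I_m(X)$, $(S_k)_{k\ge0}$ in $\mathbf I_{m+1}(X)$ with supports in $K$, and $\sigma,\rho>1$ such that the partial sums of $\sum_k(R_k+\partial S_k)$ converge weakly to $T$ and the series $\sum_k\mathbf M(S_k)\sigma^{k((m+1)-\gamma)}$, $\sum_k\mathbf M(\partial S_k)\sigma^{k(m-\gamma)}$, $\sum_k\mathbf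 M(R_k)\rho^{k(m-\delta)}$, $\sum_k\mathbf M(\partial R_k)\rho^{k((m-1)-\delta)}$ are finite. (For $m=0$ the convention is that $R_k=0$ for $k\ge1$.) *)

(* Defs.v *)
From HB Require Import structures.
From mathcomp Require Import all_boot all_order all_algebra.
From mathcomp Require Import ring.
From mathcomp Require Import all_classical all_reals all_analysis.

Set Implicit Arguments.
Unset Strict Implicit.
Unset Printing Implicit Defensive.

Import Order.TTheory GRing.Theory Num.Theory.
Import numFieldNormedType.Exports.

Local Open Scope classical_set_scope.
Local Open Scope ring_scope.

#[short(type="pmetricType")]
HB.structure Definition PointedMetric (K : numDomainType) :=
  {M of Metric K M & isPointed M}.

Definition enorm (R : realType) (n : nat) (x : 'rV[R]_n) : R :=
  Num.sqrt (\sum_i x ord0 i ^+ 2).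

Section enorm_lemmas.
Context {R : realType} {n : nat}.
Implicit Types x y : 'rV[R]_n.

Lemma sqr_sum_ge0 (a : 'I_n -> R) : 0 <= \sum_i a i ^+ 2.
Proof. by apply: sumr_ge0 => i _; exact: sqr_ge0. Qed.

Lemma sum_cauchy_schwarz (a b : 'I_n -> R) :
  \sum_i a i * b i <= Num.sqrt (\sum_i a i ^+ 2) * Num.sqrt (\sum_i b i ^+ 2).
Proof.
have lag : (\sum_i a i * b i) ^+ 2 <= (\sum_i a i ^+ 2) * (\sum_i b i ^+ 2).
  rewrite -subr_ge0.
  have : 0 <= \sum_i \sum_j (a i * b j - a j * b i) ^+ 2.
    by apply: sumr_ge0 => i _; apply: sumr_ge0 => j _; exact: sqr_ge0.
  have -> : \sum_i \sum_j (a i * b j - a j * b i) ^+ 2 =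
      ((\sum_i a i ^+ 2) * (\sum_i b i ^+ 2) - (\sum_i a i * b i) ^+ 2) *+ 2.
    rewrite mulrnBl expr2 !big_distrlr/= [X in X - _]mulr2n.
    rewrite [X in (_ + X) - _]exchange_big/= -sumrMnl -big_split/= -sumrB.
    apply: eq_bigr => i _; rewrite -sumrMnl -big_split/= -sumrB.
    by apply: eq_bigr => j _; ring.
  by rewrite pmulrn_lge0.
rewrite -sqrtrM ?sqr_sum_ge0//.
by rewrite (le_trans (ler_norm _))// -sqrtr_sqr ler_wsqrtr.
Qed.

Lemma enorm_ge0 x : 0 <= enorm x. Proof. exact: sqrtr_ge0. Qed.

Lemma ler_enormD x y : enorm (x + y) <= enorm x + enorm y.
Proof.
rewrite -ler_sqr ?nnegrE ?addr_ge0 ?enorm_ge0//.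
rewrite sqrrD !sqr_sqrtr ?sqr_sum_ge0//.
under eq_bigr do rewrite mxE sqrrD.
rewrite 2!big_split/= lerD2r lerD2l sumrMnl ler_wMn2r//.
exact: sum_cauchy_schwarz.
Qed.

Lemma enormN x : enorm (- x) = enorm x.
Proof. by congr Num.sqrt; apply: eq_bigr => i _; rewrite mxE sqrrN. Qed.

Lemma enorm_eq0 x : enorm x = 0 -> x = 0.
Proof.
move=> /eqP; rewrite sqrtr_eq0 => x0; apply/rowP => i; rewrite mxE.
have /eqP : \sum_i x ord0 i ^+ 2 = 0.
  by apply/eqP; rewrite eq_le x0 sqr_sum_ge0.
rewrite psumr_eq0 => [/allP/(_ i)|j _]; last exact: sqr_ge0.
by rewrite mem_index_enum => /(_ isT); rewrite sqrf_eq0 => /eqP.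
Qed.

Lemma ler_enorm_sum x : enorm x <= \sum_i `|x ord0 i|.
Proof.
rewrite -ler_sqr ?nnegrE ?enorm_ge0 ?sumr_ge0//.
rewrite sqr_sqrtr ?sqr_sum_ge0// expr2 big_distrlr/=.
apply: ler_sum => i _; rewrite (bigD1 i)//= -normrM -expr2 -[leLHS]addr0.
by rewrite lerD ?ler_norm// sumr_ge0// => j _; rewrite mulr_ge0.
Qed.

End enorm_lemmas.

(* The library norm of 'rV[R]_n is the sup norm; [euclid R n] is R^n with the
   Euclidean distance. The two types are convertible, and differentials are
   taken in 'rV[R]_n, where the choice of the norm is irrelevant. *)
Definition euclid (R : realType) (n : nat) : Type := 'rV[R]_n.

HB.instance Definition _ (R : realType) (n : nat) :=
  Choice.copy (euclid R n) 'rV[R]_n.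
HB.instance Definition _ (R : realType) (n : nat) :=
  isPointed.Build (euclid R n) (0 : 'rV[R]_n).

Section euclid_metric.
Context {R : realType} {n : nat}.

Definition euclid_dist (x y : euclid R n) : R := enorm ((x : 'rV[R]_n) - y).

Let edistxx x : euclid_dist x x = 0.
Proof.
by rewrite /euclid_dist subrr /enorm big1 ?sqrtr0// => i _; rewrite mxE expr0n.
Qed.

Let edist_positivity x y : euclid_dist x y = 0 -> x = y.
Proof. by move=> /enorm_eq0/eqP; rewrite subr_eq0 => /eqP. Qed.

Let edist_sym x y : euclid_dist x y = euclid_dist y x.
Proof. by rewrite /euclid_dist -enormN opprB. Qed.

Let edist_triangle y x z : euclid_dist x z <= euclid_dist x y + euclid_dist y z.
Proof. by rewrite (le_trans _ (ler_enormD _ _))// addrA subrK. Qed.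

HB.instance Definition _ := isMetric.Build R (euclid R n)
  edistxx edist_positivity edist_sym edist_triangle.

End euclid_metric.

Definition borel (K : numDomainType) (X : pmetricType K) : Type :=
  g_sigma_algebraType (@open X).

HB.instance Definition _ (K : numDomainType) (X : pmetricType K) :=
  Measurable.copy (borel X) (g_sigma_algebraType (@open X)).

Definition pushforward_measure d1 d2 (T1 : measurableType d1)
    (T2 : measurableType d2) (R : realFieldType)
    (m : {measure set T1 -> \bar R}) (f : T1 -> T2)
    (mf : measurable_fun [set: T1] f) : {measure set T2 -> \bar R} :=
  measure_function_pushforward__canonical__measure_function_Measure m mf.

Section lebesgue.
Context {R : realType}.

Definition row_of_tuple n (t : n.-tuple (measurableTypeR R)) :
  borel (euclid R n) := (\row_i tnth t i : 'rV[R]_n).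

Let cube n (q : 'rV[R]_n) (k : nat) : set (euclid R n) :=
  [set y : 'rV[R]_n | forall i, `|q ord0 i - y ord0 i| < k.+1%:R^-1].

Lemma measurable_row_of_tuple n : measurable_fun setT (@row_of_tuple n).
Proof.
apply: (@measurability _ _ _ (borel (euclid R n)) _ _
  (@open (euclid R n) : set (set (borel (euclid R n))))) => //.
move=> _ [V oV <-]; rewrite setTI.
pose P (p : n.-tuple rat * nat) := cube (\row_i ratr (tnth p.1 i)) p.2 `<=` V.
have -> : @row_of_tuple n @^-1` V = \bigcup_(p in P)
    (@row_of_tuple n @^-1` cube (\row_i ratr (tnth p.1 i)) p.2).
  apply/seteqP; split=> [t /= Vt|t [p Pp]/=]; last exact: Pp.
  have [e /= e0 eV] : nbhs_ball (row_of_tuple t : euclid R n) V.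
    by rewrite nbhs_ballE; exact: open_nbhs_nbhs.
  have e20 : 0 < e / (n.+1%:R * 2) by rewrite divr_gt0// mulr_gt0.
  have [k _ kP] := near_infty_natSinv_lt (PosNum e20).
  have k0 : 0 < k.+1%:R^-1 :> R by rewrite invr_gt0.
  have /= {}kP := kP _ (leqnn k).
  have tk i : tnth t i - k.+1%:R^-1 < tnth t i + k.+1%:R^-1.
    by rewrite ltrBlDr -addrA ltrDl addr_gt0.
  pose q i : rat := projT1 (cid (rat_in_itvoo (tk i))).
  have qP i : `|tnth t i - ratr (q i)| < k.+1%:R^-1.
    rewrite /q; case: cid => r /=; rewrite in_itv/= => /andP[r1 r2].
    by rewrite ltr_distl ltrBlDr r2 -ltrBlDr r1.
  exists ([tuple q i | i < n], k) => /=; last first.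
    by move=> i; rewrite !mxE tnth_mktuple distrC; exact: qP.
  move=> y yq; apply: eV; rewrite ballEmdist/=.
  apply: le_lt_trans (ler_enorm_sum _) _.
  apply: (@le_lt_trans _ _ (\sum_(i < n) k.+1%:R^-1 *+ 2)).
    apply: ler_sum => i _; have := yq i; rewrite !mxE tnth_mktuple => yqi.
    by rewrite mulr2n (le_trans (ler_distD (ratr (q i)) _ _))// lerD// ltW.
  rewrite sumr_const card_ord -mulrnA -[ltLHS]mulr_natl.
  rewrite ltr_pdivlMr ?mulr_gt0// in kP.
  apply: le_lt_trans kP; rewrite [leRHS]mulrC ler_wpM2r ?ltW//.
  by rewrite -natrM ltr_nat mulnC ltn_pmul2r.
rewrite bigcup_mkcond; apply: countable_bigcupT_measurable => // p.
case: ifPn => // _.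
have -> : @row_of_tuple n @^-1` cube (\row_i ratr (tnth p.1 i)) p.2 =
    \bigcap_(i in [set: 'I_n])
      ((fun t : n.-tuple (measurableTypeR R) => tnth t i) @^-1`
       ball (ratr (tnth p.1 i) : R) p.2.+1%:R^-1).
  apply/seteqP; split=> t /= tP i; first by move=> _; have := tP i; rewrite !mxE.
  by rewrite !mxE; exact: tP.
apply: fin_bigcap_measurable => // i _.
rewrite -[X in measurable X]setTI.
apply: (@measurable_tnth _ (measurableTypeR R)) => //.
by rewrite ball_itv; exact: (@measurable_itv R).
Qed.

Definition tuple_cons n
    (p : n.-tuple (measurableTypeR R) * measurableTypeR R) :
  n.+1.-tuple (measurableTypeR R) := [tuple of p.2 :: p.1].

Lemma measurable_tuple_cons n : measurable_fun setT (@tuple_cons n).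
Proof. exact: measurable_cons. Qed.

Fixpoint lebesgue_tuple n :
    {measure set (n.-tuple (measurableTypeR R)) -> \bar R} :=
  match n with
  | 0 => dirac [tuple]
  | n'.+1 => pushforward_measure (lebesgue_tuple n' \x lebesgue_measure)%E
               (@measurable_tuple_cons n')
  end.

Definition lebesgueRn n : {measure set (borel (euclid R n)) -> \bar R} :=
  pushforward_measure (lebesgue_tuple n) (@measurable_row_of_tuple n).

Lemma lebesgue_tuple_box n (a b : 'I_n -> R) : (forall i, a i <= b i) ->
  lebesgue_tuple n [set t | forall i, a i <= tnth t i <= b i] =
  (\prod_(i < n) (b i - a i))%:E /\
  measurable [set t : n.-tuple (measurableTypeR R) |
    forall i, a i <= tnth t i <= b i].
Proof.
elim: n => [|n IH] in a b *.
  move=> _; rewrite big_ord0; have -> : [set t : 0.-tuple (measurableTypeR R) |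
      forall i, a i <= tnth t i <= b i] = setT.
    by apply/seteqP; split=> // t _ [].
  by rewrite /= diracT; split => //; exact: measurableT.
move=> ab; set B := [set t | _].
have mB : measurable B.
  have -> : B = \bigcap_(i in [set: 'I_n.+1])
      ((fun t : n.+1.-tuple (measurableTypeR R) => tnth t i) @^-1`
       `[a i, b i]%classic).
    apply/seteqP; split=> t tB i; first by move=> _; rewrite /= in_itv/=; exact: tB.
    by have := tB i I; rewrite /= in_itv.
  apply: fin_bigcap_measurable => // i _; rewrite -[X in measurable X]setTI.
  by apply: (@measurable_tnth _ (measurableTypeR R)) => //; exact: measurable_itv.
split=> //.
have [IH1 IH2] := IH (fun i => a (lift ord0 i)) (fun i => b (lift ord0 i))
  (fun i => ab _).
rewrite /= /pushforward (_ : _ @^-1` B = [set t | forall i,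
    a (lift ord0 i) <= tnth t i <= b (lift ord0 i)] `*` `[a ord0, b ord0]%classic).
  rewrite product_measure1E; [|exact: IH2|exact: measurable_itv].
  rewrite IH1 big_ord_recl/= EFinM muleC lebesgue_measure_itv/= lte_fin.
  case: ltgtP (ab ord0) => // -> _.
  by rewrite subrr mul0e.
apply/seteqP; split=> -[t x] /=.
  by move=> tB; split=> [i|]; [have := tB (lift ord0 i); rewrite tnthS|
    have := tB ord0; rewrite in_itv].
move=> [tB]; rewrite in_itv/= => xB i.
by case: (unliftP ord0 i) => [j|] ->; rewrite ?tnthS.
Qed.

Lemma lebesgueRn_box n (a b : 'rV[R]_n) : (forall i, a ord0 i <= b ord0 i) ->
  lebesgueRn n
    [set x : 'rV[R]_n | forall i, a ord0 i <= x ord0 i <= b ord0 i] =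
  (\prod_(i < n) (b ord0 i - a ord0 i))%:E.
Proof.
move=> ab; rewrite /= /pushforward.
have [<- _] := lebesgue_tuple_box ab; congr (lebesgue_tuple n _).
by apply/seteqP; split=> t /= tB i; have := tB i; rewrite mxE.
Qed.

End lebesgue.

Section metric_notions.
Context {R : realType} {X : pmetricType R}.
Implicit Types (f g : X -> R) (A : set X).

Definition lip_with (L : R) f := forall x y, `|f x - f y| <= L * mdist x y.

Definition is_lip f := exists L, lip_with L f.

Definition lip_map {Y : pmetricType R} (A : set X) (F : X -> Y) :=
  exists L, forall x y, A x -> A y -> mdist (F x) (F y) <= L * mdist x y.

Definition spt f : set X := closure [set x | f x != 0].

Definition unif_cvg (f_ : nat -> X -> R) f :=
  forall e, 0 < e -> \forall k \near \oo, forall x, `|f_ k x - f x| < e.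

Definition bounded_subset A := exists r, forall x y, A x -> A y -> mdist x y <= r.

Definition topo_boundary A : set X := closure A `\` interior A.

Definition covering_number A (e : R) : \bar R :=
  ereal_inf [set N%:R%:E | N in [set N : nat |
    exists c : 'I_N -> X, A `<=` \bigcup_(i in [set: 'I_N]) ball (c i) e]].

(* As [lne 0 = -oo], the empty set has no (real) box dimension. *)
Definition has_box_dim A (d : R) :=
  (lne (covering_number A e) * ((ln e^-1)^-1)%:E)%E @[e --> 0^'+] --> d%:E.

End metric_notions.

Section currents.
Context {R : realType}.

(* The elements of [mfunctional X m] are arbitrary functionals; all the notions
   below evaluate them only on tuples of Lipschitz functions, so an element of
   D_m(X) is represented by any of its extensions to arbitrary functions. *)
Definition mfunctional (X : pmetricType R) (m : nat) :=
  (X -> R) -> ('I_m -> X -> R) -> R.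

Section metric_currents.
Context {X : pmetricType R}.

Definition lip_tuple m (f : X -> R) (g : 'I_m -> X -> R) :=
  is_lip f /\ forall i, is_lip (g i).

Record current m (T : mfunctional X m) : Prop := {
  current_linear_l : forall a f f' g, lip_tuple f g -> is_lip f' ->
    T (fun x => a * f x + f' x) g = a * T f g + T f' g ;
  current_linear_r : forall i a h h' f g, lip_tuple f g ->
    is_lip h -> is_lip h' ->
    T f [eta g with i |-> fun x => a * h x + h' x] =
    a * T f [eta g with i |-> h] + T f [eta g with i |-> h'] ;
  current_local : forall f g, lip_tuple f g ->
    (exists i (V : set X) (c : R),
      [/\ open V, spt f `<=` V & forall x, V x -> g i x = c]) ->
    T f g = 0 ;
  current_compact : exists2 K : set X, compact K &
    forall f g, lip_tuple f g -> spt f `&` K = set0 -> T f g = 0 ;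
  current_continuous : forall (f_ : nat -> X -> R)
      (g_ : nat -> 'I_m -> X -> R) f g (L : R),
    (forall k, lip_with L (f_ k)) -> (forall k i, lip_with L (g_ k i)) ->
    unif_cvg f_ f -> (forall i, unif_cvg (fun k => g_ k i) (g i)) ->
    T (f_ k) (g_ k) @[k --> \oo] --> T f g }.

Definition current_spt m (T : mfunctional X m) : set X :=
  \bigcap_(A in [set A : set X | closed A /\
    forall f g, lip_tuple f g -> spt f `&` A = set0 -> T f g = 0]) A.

(* [m.-1] makes the boundary a total operation; it is 0 when m = 0. *)
Definition current_bd m : mfunctional X m -> mfunctional X m.-1 :=
  match m with
  | 0 => fun=> fun _ _ => 0
  | m'.+1 => fun T f g =>
      T (fun=> 1) (fun i => if unlift ord0 i is Some j then g j else f)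
  end.

Definition mass m (T : mfunctional X m) : \bar R :=
  ereal_sup [set s | exists N (f : 'I_N -> X -> R) (g : 'I_N -> 'I_m -> X -> R),
    [/\ forall l, is_lip (f l),
        forall x, \sum_(l < N) `|f l x| <= 1,
        forall l i, lip_with 1 (g l i) &
        s = (\sum_(l < N) T (f l) (g l))%:E]].

Definition weak_cvg m (T_ : nat -> mfunctional X m) (T : mfunctional X m) :=
  (exists2 K : set X, compact K &
     current_spt T `<=` K /\ forall k, current_spt (T_ k) `<=` K) /\
  forall f g, lip_tuple f g -> T_ k f g @[k --> \oo] --> T f g.

(* The mass measure ||T||: the least finite Borel measure mu such that
   |T(f, g^1, ..., g^m)| <= (prod_i Lip(g^i)) * \int |f| dmu. *)
Definition mass_bound m (T : mfunctional X m)
    (mu : {finite_measure set (borel X) -> \bar R}) :=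
  forall f g, is_lip f -> (forall i, lip_with 1 (g i)) ->
  (`|T f g|%:E <= \int[mu]_x `|f x|%:E)%E.

Definition mass_measure m (T : mfunctional X m)
    (mu : {finite_measure set (borel X) -> \bar R}) :=
  mass_bound T mu /\
  forall nu, mass_bound T nu ->
  forall B : set (borel X), measurable B -> (mu B <= nu B)%E.

(* Extension of T( . , g) from Lipschitz functions to L^1(||T||) by density. *)
Definition current_ext m (T : mfunctional X m)
    (mu : {finite_measure set (borel X) -> \bar R})
    (v : X -> R) (g : 'I_m -> X -> R) : R :=
  get [set s : R | exists h : nat -> X -> R,
    [/\ forall k, is_lip (h k),
        (\int[mu]_x `|h k x - v x|%:E)%E @[k --> \oo] --> 0%E &
        T (h k) g @[k --> \oo] --> s]].

Definition current_restr m (T : mfunctional X m)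
    (mu : {finite_measure set (borel X) -> \bar R}) (B : set X) : mfunctional X m :=
  fun f g => current_ext T mu (fun x => \1_B x * f x) g.

Definition current_push {Y : pmetricType R} m (F : X -> Y) (T : mfunctional X m) :
  mfunctional Y m := fun f g => T (f \o F) (fun i => g i \o F).

Definition countably_rectifiable m (E : set X) :=
  exists (A : nat -> set (euclid R m)) (F : nat -> euclid R m -> X),
    (forall k, lip_map (A k) (F k)) /\ E `<=` \bigcup_k (F k @` A k).

End metric_currents.

(* [jacobian] acts on row vectors, so this is the transpose of the usual
   matrix D(g^1, ..., g^m); by Rademacher's theorem it is the derivative at
   almost every point when the g^i are Lipschitz. *)
Definition Dmx m (g : 'I_m -> euclid R m -> R) (x : euclid R m) : 'M[R]_m :=
  jacobian (fun y : 'rV[R]_m => \row_i g i y) x.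

Definition fun_current m (u : euclid R m -> R) : mfunctional (euclid R m) m :=
  fun f g => \int[lebesgueRn m]_x (u x * f x * \det (Dmx g x)).

Definition set_current m (U : set (euclid R m)) : mfunctional (euclid R m) m :=
  fun f g => \int[lebesgueRn m]_(x in U) (f x * \det (Dmx g x)).

(* Integer rectifiability in Lang's formulation. In Ambrosio-Kirchheim the
   absolute continuity of ||T|| with respect to the Hausdorff measure H^m is
   required separately; here it is a consequence of the last condition. *)
Definition integer_rectifiable (X : pmetricType R) m (T : mfunctional X m) :=
  exists mu : {finite_measure set (borel X) -> \bar R},
  [/\ mass_measure T mu,
      exists E : set (borel X),
        [/\ measurable E, countably_rectifiable m (E : set X) &
            mu (~` E) = 0%E] &
      forall (B : set (borel X)) (F : X -> euclid R m),
        measurable B -> lip_map setT F ->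
        exists u : euclid R m -> R,
        [/\ (lebesgueRn m).-integrable setT (EFin \o u),
            forall x, u x \is a Num.int &
            forall f g, lip_tuple f g ->
              current_push F (current_restr T mu B) f g = fun_current u f g]].

(* Integer rectifiable and normal, as in Ambrosio-Kirchheim; the boundary is
   then integer rectifiable by the boundary rectifiability theorem. *)
Definition integral_current (X : pmetricType R) m (T : mfunctional X m) :=
  [/\ current T, integer_rectifiable T &
      (mass T < +oo)%E /\ (mass (current_bd T) < +oo)%E].

(* The R_k of the usual notation are called A k here. *)
Definition fractal_current (X : pmetricType R) m (gamma delta : R)
    (T : mfunctional X m) :=
  [/\ m%:R <= gamma < m%:R + 1, m%:R - 1 <= delta < m%:R, current T &
    exists (K : set X) (A : nat -> mfunctional X m) (S : nat -> mfunctional X m.+1)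
      (sigma rho : R),
    [/\ compact K,
        forall k, integral_current (A k) /\ current_spt (A k) `<=` K,
        forall k, integral_current (S k) /\ current_spt (S k) `<=` K,
        1 < sigma /\ 1 < rho &
    [/\ weak_cvg (fun N f g =>
          \sum_(k < N) (A k f g + current_bd (S k) f g)) T,
        (\sum_(0 <= k <oo) mass (S k) *
           (sigma `^ (k%:R * (m%:R + 1 - gamma)))%:E < +oo)%E
        /\ (\sum_(0 <= k <oo) mass (current_bd (S k)) *
           (sigma `^ (k%:R * (m%:R - gamma)))%:E < +oo)%E,
        (\sum_(0 <= k <oo) mass (A k) *
           (rho `^ (k%:R * (m%:R - delta)))%:E < +oo)%E
        /\ (\sum_(0 <= k <oo) mass (current_bd (A k)) *
           (rho `^ (k%:R * (m%:R - 1 - delta)))%:E < +oo)%E &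
        m = 0%N -> forall k, (0 < k)%N ->
          forall f g, lip_tuple f g -> A k f g = 0]]].

Definition divergence n (phi : euclid R n -> euclid R n) (x : euclid R n) : R :=
  \tr (jacobian (phi : 'rV[R]_n -> 'rV[R]_n) x).

Definition C1c n (phi : euclid R n -> euclid R n) :=
  [/\ forall x, differentiable (phi : 'rV[R]_n -> 'rV[R]_n) x,
      continuous (jacobian (phi : 'rV[R]_n -> 'rV[R]_n)) &
      compact (closure [set x | phi x != 0])].

Definition bv_variation n (u : euclid R n -> R) : \bar R :=
  ereal_sup [set (\int[lebesgueRn n]_x (u x * divergence phi x)%:E)%E |
    phi in [set phi | C1c phi /\ forall x, enorm (phi x) <= 1]].

End currents.

(* Main.v *)
Require Import Defs.
From HB Require Import structures.
From mathcomp Require Import all_boot all_order all_algebra.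
From mathcomp Require Import fingroup perm.
From mathcomp Require Import ring lra zify.
From mathcomp Require Import all_classical all_reals all_analysis.
From mathcomp Require Import measurable_realfun.

(** [R_k] is the union of the maximal dyadic cubes of side [2^-k] contained in
    [U].  For [k >= 1] the parent of such a cube meets the complement of [U], so
    [R_k] lies within [2^(1-k)] of the boundary; covering the boundary by
    [2^(k delta)] balls bounds the volume of [R_k], hence the number of its cubes.
    A cube of side [s] has perimeter at most [c s^(n-1)]: integrate by parts
    against the cutoff at distance [e] from the cube, estimate its gradient by
    [1/e] on a shell of volume about [e s^(n-1)], and let [e] tend to [0].

    For Lipschitz [g] of compact support, [det D(id + t g)] has, for small [t],
    the same integral over a large ball as the constant [1], because [id + t g]
    maps the ball onto itself injectively; being polynomial in [t], this gives
    that the integral of [det Dg] vanishes.  This yields integration by parts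
    for Lipschitz determinants, and with it the continuity of [[A]] as a current.
    Integer rectifiability of [[A]] comes from the area formula: a push-forward
    to [R^n] is integration against the degree, i.e. the sum of the signs of the
    Jacobian determinant over the fibre. *)

Set Implicit Arguments.
Unset Strict Implicit.
Unset Printing Implicit Defensive.

Import Order.TTheory GRing.Theory Num.Theory.
Import numFieldNormedType.Exports.

Local Open Scope classical_set_scope.
Local Open Scope ring_scope.

(** * Metric and Euclidean spaces *)

(** Both fractal statements require [delta >= n - 1], so the box dimension of the boundary has to be
    bounded below by [n - 1] ([boundary_dim_ge]); there the existence of the dimension is what makes
    the boundary nonempty. Integer rectifiability tests against every Lipschitz map, hence
    Rademacher's theorem, the area formula and a chain rule valid almost everywhere even though the
    outer function may fail to be differentiable along the image. Volume comparisons rest on one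
    principle: the selection of maximal cubes splits any open set into disjoint dyadic cubes, so by
    outer regularity an inequality between two measures need only be checked on cubes
    ([cube_comparison]). Scaling, the determinant factor and the distortion under Lipschitz maps all
    come from it. The constant [1] in Hadamard's inequality, not just some dimensional constant,
    identifies the mass measure of a set with Lebesgue measure on it. The series converge because
    the estimates are taken at an exponent strictly between [d] and [delta], which leaves a
    geometric factor. The same sets serve as the first family for [U] and as the second family for
    its boundary, with [sigma = rho = 2]. *)

Section metric_tools.
Context {R : realType} {X : pmetricType R}.
Implicit Types (f g : X -> R) (A V : set X).

Lemma lip_withW (L M : R) f : L <= M -> lip_with L f -> lip_with M f.
Proof. by move=> LM fL x y; rewrite (le_trans (fL x y))// ler_wpM2r// mdist_ge0. Qed.

Lemma is_lip_ge1 f : is_lip f -> exists2 L, 1 <= L & lip_with L f.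
Proof.
move=> [L fL]; exists (Num.max 1 L); first by rewrite le_max lexx.
by apply: lip_withW fL; rewrite le_max lexx orbT.
Qed.

Lemma lip_with_cst (L c : R) : 0 <= L -> lip_with L (fun _ : X => c).
Proof. by move=> L0 x y; rewrite subrr normr0 mulr_ge0// mdist_ge0. Qed.

Lemma is_lip_cst (c : R) : is_lip (fun _ : X => c).
Proof. by exists 0; exact: lip_with_cst. Qed.

Lemma lip_withD (L M : R) f g :
  lip_with L f -> lip_with M g -> lip_with (L + M) (fun x => f x + g x).
Proof.
move=> fL gM x y; rewrite opprD addrACA mulrDl.
by rewrite (le_trans (ler_normD _ _))// lerD.
Qed.

Lemma lip_withZ (L a : R) f : lip_with L f -> lip_with (`|a| * L) (fun x => a * f x).
Proof. by move=> fL x y; rewrite -mulrBr normrM -mulrA ler_wpM2l. Qed.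

Lemma lip_withM (L M a b : R) f g : 0 <= L -> 0 <= M ->
  (forall x, `|f x| <= a) -> (forall x, `|g x| <= b) ->
  lip_with L f -> lip_with M g -> lip_with (b * L + a * M) (fun x => f x * g x).
Proof.
move=> L0 M0 fa gb fL gM x y.
have -> : f x * g x - f y * g y = (f x - f y) * g x + f y * (g x - g y) by ring.
rewrite (le_trans (ler_normD _ _))// !normrM mulrDl lerD//.
  by rewrite -mulrA mulrC ler_pM.
by rewrite -mulrA ler_pM.
Qed.

Lemma is_lipD f g : is_lip f -> is_lip g -> is_lip (fun x => f x + g x).
Proof. by move=> [L fL] [M gM]; exists (L + M); exact: lip_withD. Qed.

Lemma is_lipZ (a : R) f : is_lip f -> is_lip (fun x => a * f x).
Proof. by move=> [L fL]; exists (`|a| * L); exact: lip_withZ. Qed.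

Lemma lip_min (L : R) f g : lip_with L f -> lip_with L g ->
  lip_with L (fun x => Num.min (f x) (g x)).
Proof.
move=> fL gL x y; have := fL x y; have := gL x y.
rewrite !ler_norml => /andP[g1 g2] /andP[f1 f2]; apply/andP; split.
  by rewrite lerBrDr le_min; case: (leP (f y) (g y)) => fg; apply/andP; split; lra.
by rewrite lerBlDr ge_min; case: (leP (f y) (g y)) => fg; apply/orP; [left|right]; lra.
Qed.

Lemma lip_max (L : R) f g : lip_with L f -> lip_with L g ->
  lip_with L (fun x => Num.max (f x) (g x)).
Proof.
move=> fL gL.
have -> : (fun x => Num.max (f x) (g x)) =
   (fun x => -1 * Num.min (-1 * f x) (-1 * g x)).
  by apply/funext => x; rewrite !mulN1r oppr_min !opprK.
have L1 : L = `|-1| * L :> R by rewrite normrN1 mul1r.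
rewrite L1; apply: lip_withZ; rewrite L1; apply: lip_min => //; exact: lip_withZ.
Qed.

Lemma lip_continuous (L : R) f : lip_with L f -> continuous f.
Proof.
move=> fL x; apply/cvgrPdist_le => e e0; near=> y.
have L0 : 0 <= `|L| + 1 by rewrite addr_ge0.
rewrite (le_trans (fL x y))// (@le_trans _ _ ((`|L| + 1) * mdist x y))//.
  by rewrite ler_wpM2r ?mdist_ge0// (le_trans (ler_norm _))// lerDl.
rewrite mulrC -ler_pdivlMr ?ltr_wpDl//; apply/ltW.
near: y; have := @nbhsx_ballx _ _ x (e / (`|L| + 1)).
by rewrite ballEmdist; apply; rewrite divr_gt0// ltr_wpDl.
Unshelve. all: by end_near. Qed.

Lemma open_borel V : open V -> measurable (V : set (borel X)).
Proof. by move=> oV; exact: sub_sigma_algebra. Qed.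

Lemma closed_borel V : closed V -> measurable (V : set (borel X)).
Proof.
by move=> cV; rewrite -[V]setCK; apply: measurableC; apply: open_borel; exact: closed_openC.
Qed.

Lemma continuous_borel (f : borel X -> R) (D : set (borel X)) :
  continuous (f : X -> R) -> measurable_fun D f.
Proof.
move=> cf; apply: (@measurable_funS _ _ _ _ setT) => //.
apply: (measurability _ (RGenOpens.measurableE R)).
move=> _ [_ [a [b ->] <-]]; rewrite setTI.
apply: open_borel; apply: open_comp => // x _; exact: cf.
Qed.

(** The infimum of the empty set is [0] here, so nonnegativity and the Lipschitz bound hold for
    every [A]. *)
Definition dist_set A (x : X) : R := inf [set mdist x a | a in A].

Lemma dist_set_lb A x a : A a -> dist_set A x <= mdist x a.
Proof.
move=> Aa; apply: ge_inf; last by exists a.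
by exists 0 => _ [b _ <-]; exact: mdist_ge0.
Qed.

Lemma dist_set_glb A x c : A !=set0 -> (forall a, A a -> c <= mdist x a) ->
  c <= dist_set A x.
Proof.
move=> [a0 Aa0] h; apply: lb_le_inf; first by exists (mdist x a0), a0.
by move=> _ [b Ab <-]; exact: h.
Qed.

Lemma dist_set_ge0 A x : 0 <= dist_set A x.
Proof.
have [->|/set0P A0] := eqVneq A set0; first by rewrite /dist_set image_set0 inf0.
by apply: dist_set_glb => // a _; exact: mdist_ge0.
Qed.

Lemma dist_set_lip A : lip_with 1 (dist_set A).
Proof.
have [->|/set0P A0] := eqVneq A set0.
  have -> : dist_set set0 = fun=> 0.
    by apply/funext => x; rewrite /dist_set image_set0 inf0.
  exact: lip_with_cst.
have h x y : dist_set A x <= dist_set A y + mdist x y.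
  rewrite -lerBlDr; apply: dist_set_glb => // a Aa.
  rewrite lerBlDr addrC (le_trans (dist_set_lb x Aa))//.
  exact: metric_triangle.
move=> x y; rewrite mul1r ler_norml.
have := h x y; have := h y x; rewrite [mdist y x]metric_sym => h1 h2.
by apply/andP; split; lra.
Qed.

Lemma dist_set0 A x : A x -> dist_set A x = 0.
Proof.
move=> Ax; apply/eqP; rewrite eq_le dist_set_ge0 andbT.
by rewrite (le_trans (dist_set_lb x Ax))// mdistxx.
Qed.

Lemma dist_set_gt0 V x : open V -> ~` V !=set0 -> V x -> 0 < dist_set (~` V) x.
Proof.
move=> oV V0 Vx.
have [e /= e0 eV] : nbhs_ball x V by rewrite nbhs_ballE; exact: open_nbhs_nbhs.
apply: (lt_le_trans e0); apply: dist_set_glb => // a Va.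
by rewrite leNgt; apply/negP => xa; apply: Va; apply: eV; rewrite ballEmdist.
Qed.

(* The case [V = setT] is separated because [dist_set set0] is [0]. *)
Definition cutoff V (k : nat) (x : X) : R :=
  if `[< V = setT >] then 1 else Num.min 1 (k%:R * dist_set (~` V) x).

Lemma cutoffE V k : V <> setT ->
  cutoff V k = fun x => Num.min 1 (k%:R * dist_set (~` V) x).
Proof. by move=> VT; rewrite /cutoff asboolF. Qed.

Lemma cutoff_ge0 V k x : 0 <= cutoff V k x.
Proof. by rewrite /cutoff; case: ifP => // _; rewrite le_min ler01 mulr_ge0// dist_set_ge0. Qed.

Lemma cutoff_le1 V k x : cutoff V k x <= 1.
Proof. by rewrite /cutoff; case: ifP => // _; rewrite ge_min lexx. Qed.

Lemma cutoff_lip V k : lip_with k%:R (cutoff V k).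
Proof.
have [VT|/cutoffE ->] := pselect (V = setT).
  by rewrite /cutoff asboolT//; exact: lip_with_cst.
apply: lip_min => //; first exact: lip_with_cst.
by have := lip_withZ k%:R (@dist_set_lip (~` V)); rewrite mulr1 ger0_norm.
Qed.

Lemma cutoff_out V k x : ~ V x -> cutoff V k x = 0.
Proof.
move=> Vx; rewrite cutoffE; last by move=> VT; apply: Vx; rewrite VT.
by rewrite dist_set0// mulr0 min_r.
Qed.

Lemma cutoff_le_indic V k x : cutoff V k x <= \1_V x.
Proof.
rewrite indicE; case: (boolP (x \in V)) => xV; first exact: cutoff_le1.
by rewrite cutoff_out//; rewrite notin_setE in xV.
Qed.

(** A point of an open [V] has positive distance to the complement, so its values are eventually
    [1]; off [V] they are all [0]. These Lipschitz functions replace [\1_V] wherever a functional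
    may only be tested on Lipschitz functions. *)
Lemma cutoff_cvg V x : open V -> cutoff V k x @[k --> \oo] --> (\1_V x : R).
Proof.
move=> oV; rewrite indicE; case: (boolP (x \in V)); last first.
  rewrite notin_setE => Vx.
  by under eq_fun do rewrite cutoff_out//; exact: cvg_cst.
rewrite inE => Vx; have [VT|VT] := pselect (V = setT).
  by rewrite /cutoff asboolT//; exact: cvg_cst.
have V0 : ~` V !=set0 by apply/set0P/negP => /eqP V0; apply: VT; rewrite -[V]setCK V0 setC0.
have d0 := dist_set_gt0 oV V0 Vx.
apply: cvg_near_cst; near=> k; rewrite cutoffE//.
apply/min_idPl; rewrite -ler_pdivrMr// div1r.
by near: k; exact: nbhs_infty_ger.
Unshelve. all: by end_near. Qed.

End metric_tools.

Section euclid_bridge.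
Context {R : realType} {n : nat}.
Implicit Types (x y : 'rV[R]_n).

Lemma coord_le_enorm x i : `|x ord0 i| <= enorm x.
Proof.
rewrite -ler_sqr ?nnegrE ?enorm_ge0// sqr_sqrtr ?sqr_sum_ge0//.
rewrite (bigD1 i)//= real_normK ?num_real// lerDl.
by apply: sumr_ge0 => j _; exact: sqr_ge0.
Qed.

Lemma rV_norm_le x (c : R) : 0 <= c -> (forall i, `|x ord0 i| <= c) -> `|x| <= c.
Proof.
move=> c0 h; rewrite [leLHS]/Num.Def.normr/= mx_normrE.
by apply/bigmax_leP; split => //= -[i j] _ /=; rewrite ord1.
Qed.

Lemma coord_le_norm x i : `|x ord0 i| <= `|x|.
Proof.
rewrite [leRHS]/Num.Def.normr/= mx_normrE.
by apply/bigmax_geP; right => /=; exists (ord0, i).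
Qed.

Lemma norm_le_enorm x : `|x| <= enorm x.
Proof. by apply: rV_norm_le; [exact: enorm_ge0|exact: coord_le_enorm]. Qed.

Lemma enorm_le_norm x : enorm x <= n%:R * `|x|.
Proof.
rewrite (le_trans (ler_enorm_sum x))//.
apply: (@le_trans _ _ (\sum_(i < n) `|x|)); first by apply: ler_sum => i _; exact: coord_le_norm.
by rewrite sumr_const card_ord mulr_natl.
Qed.

Lemma euclid_mdist (x y : euclid R n) : mdist x y = enorm ((x : 'rV[R]_n) - y).
Proof. by []. Qed.

(** Equivalence of the sup norm and the Euclidean norm. The radius is divided by [n + 1] instead of
    [n] so that the divisor is positive for [n = 0] too. *)
Lemma nbhs_euclid (x : euclid R n) (A : set (euclid R n)) :
  nbhs x A <-> nbhs (x : 'rV[R]_n) (A : set 'rV[R]_n).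
Proof.
split=> [|/nbhs_ballP[e /= e0 eA]].
  rewrite -nbhs_ballE => -[e /= e0 eA].
  have n0 : 0 < n%:R + 1 :> R by rewrite ltr_wpDl.
  apply/nbhs_ballP; exists (e / (n%:R + 1)) => /=; first by rewrite divr_gt0.
  move=> y; rewrite -ball_normE/= => xy; apply: eA; rewrite ballEmdist/= euclid_mdist.
  rewrite (le_lt_trans (enorm_le_norm _))// (@le_lt_trans _ _ ((n%:R + 1) * `|x - y : 'rV_n|))//.
    by rewrite ler_wpM2r// lerDl.
  by rewrite mulrC -ltr_pdivlMr.
rewrite -nbhs_ballE; exists e => // y; rewrite ballEmdist/= euclid_mdist => xy.
by apply: eA; rewrite -ball_normE/=; exact: le_lt_trans (norm_le_enorm _) xy.
Qed.

Lemma open_euclid (A : set (euclid R n)) : open A <-> open (A : set 'rV[R]_n).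
Proof.
by rewrite !openE; split=> h x /h; rewrite /interior/= => /nbhs_euclid.
Qed.

Lemma closed_euclid (A : set (euclid R n)) : closed A <-> closed (A : set 'rV[R]_n).
Proof. by rewrite -!openC open_euclid. Qed.

Lemma compact_euclid (A : set (euclid R n)) : compact A <-> compact (A : set 'rV[R]_n).
Proof.
split=> cA F FF FA; have [x [Ax cx]] := cA F FF FA; exists x; split=> // B C FB /nbhs_euclid; exact: cx.
Qed.

Lemma measurable_coord (i : 'I_n) (D : set (borel (euclid R n))) :
  measurable_fun D (fun x : borel (euclid R n) => (x : 'rV[R]_n) ord0 i).
Proof.
apply: continuous_borel; apply: (@lip_continuous _ _ 1) => x y.
by rewrite mul1r euclid_mdist; have := coord_le_enorm ((x : 'rV_n) - y) i; rewrite !mxE.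
Qed.

(** The Borel sets of [euclid R n] are generated by open sets, not by coordinates; the measurability
    of [row_of_tuple] makes the coordinatewise criterion available. *)
Lemma measurable_to_rV d (T : measurableType d) (D : set T)
    (F : T -> borel (euclid R n)) :
  (forall i, measurable_fun setT (fun t => (F t : 'rV[R]_n) ord0 i)) ->
  measurable_fun D F.
Proof.
move=> mF; apply: (@measurable_funS _ _ _ _ setT) => //.
have -> : F = @row_of_tuple R n \o (fun t => [tuple (F t : 'rV[R]_n) ord0 i | i < n]).
  by apply/funext => t /=; apply/rowP => i; rewrite mxE tnth_mktuple.
apply: (@measurableT_comp _ _ _ _ _ _ _ _ _ (@measurable_row_of_tuple R n)).
apply/measurable_fun_tnthP => i; have := mF i; congr (measurable_fun _ _).
by apply/funext => t /=; rewrite tnth_mktuple.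
Qed.

End euclid_bridge.

Global Opaque lebesgueRn.

Lemma measure_le {d} {T : measurableType d} {R : realType}
    (mu : {measure set T -> \bar R}) (A B : set T) :
  measurable A -> measurable B -> A `<=` B -> (mu A <= mu B)%E.
Proof. by move=> mA mB; apply: le_measure; rewrite inE. Qed.

Section regularity.
Context {R : realType} {X : pmetricType R}.
Variable mu : {measure set (borel X) -> \bar R}.
Hypothesis mufin : (mu setT < +oo)%E.

Let fin (A : set (borel X)) : measurable A -> (mu A < +oo)%E.
Proof. by move=> mA; apply: le_lt_trans mufin; exact: measure_le. Qed.

(** Approximation from inside and from outside is demanded together, because outer approximation by
    open sets alone is not stable under complements. *)
Let regular (B : set (borel X)) := measurable B /\ forall e : R, 0 < e ->
  exists C V : set X, [/\ closed C, open V, C `<=` B, B `<=` V &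
    (mu (V `\` C : set (borel X)) <= e%:E)%E].

Lemma cutoff_nd (V : set X) x k l : (k <= l)%N -> cutoff V k x <= cutoff V l x.
Proof.
move=> kl; have [VT|VT] := pselect (V = setT); first by rewrite /cutoff asboolT.
rewrite !cutoffE// le_min ge_min lexx/= ge_min ler_wpM2r ?orbT ?dist_set_ge0//.
by rewrite ler_nat.
Qed.

Let regular_open (V : set X) : open V -> regular V.
Proof.
move=> oV; split; first exact: open_borel.
(* Closed sets increasing to [V]: the points where the [k]-th cutoff has reached [1]. As [mu] is
   finite, the measures of the decreasing differences tend to [0]. *)
move=> e e0; pose C k := [set x | 1 <= cutoff V k x].
have cC k : closed (C k).
  have -> : C k = cutoff V k @^-1` [set y | 1 <= y] by [].
  apply: closed_comp => [x _|]; last exact: closed_ge.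
  by apply: lip_continuous; exact: cutoff_lip.
have CV k : C k `<=` V.
  move=> x /= h; apply: contrapT => Vx; move: h.
  by rewrite /C/= cutoff_out// ler10.
have VC0 : \bigcap_k (V `\` C k) = set0.
  rewrite -subset0 => x h; have [Vx _] := h 0%N I.
  have [VT|VT] := pselect (V = setT).
    by have [_] := h 0%N I; apply; rewrite /C/= /cutoff asboolT.
  have V0 : ~` V !=set0 by apply/set0P/negP => /eqP V0; apply: VT; rewrite -[V]setCK V0 setC0.
  have d0 := dist_set_gt0 oV V0 Vx.
  have [k _ /(_ _ (leqnn _)) /= dk] := nbhs_infty_ger (dist_set (~` V) x)^-1.
  have [_] := h k I; apply; rewrite /C/= cutoffE// le_min lexx/=.
  by rewrite -ler_pdivrMr// div1r.
have mVC k : measurable (V `\` C k : set (borel X)).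
  by apply: measurableD; [exact: open_borel|exact: closed_borel].
have : mu (V `\` C k : set (borel X)) @[k --> \oo] --> mu (\bigcap_k (V `\` C k) : set (borel X)).
  apply: (@nonincreasing_cvg_mu _ _ _ mu (fun k => V `\` C k)) => //.
  - exact: fin.
  - by rewrite VC0.
  - move=> k l kl; apply/subsetPset => x [Vx Cx]; split => // Ck; apply: Cx.
    by move: Ck; rewrite /C/= => h; apply: (le_trans h); exact: cutoff_nd.
rewrite VC0 measure0 => /fine_cvgP[_ /cvgrPdist_le/(_ _ e0)[N _ /(_ _ (leqnn _))]] /=.
rewrite sub0r normrN => hN; exists (C N), V; split => //.
rewrite -lee_fin in hN; apply: le_trans hN; rewrite ger0_norm ?fine_ge0//.
by rewrite fineK// ge0_fin_numE// fin.
Qed.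

Let regular_sigma : sigma_algebra setT regular.
Proof.
split.
- by apply: regular_open; exact: open0.
- move=> B [mB hB]; split; first exact: measurableD.
  move=> e e0; have [C [V [cC oV CB BV h]]] := hB e e0.
  exists (~` V), (~` C); split; rewrite ?setTD//.
  + exact: open_closedC.
  + exact: closed_openC.
  + exact: subsetC.
  + exact: subsetC.
  + by move: h; rewrite !setDE setCK setIC.
- move=> B hB; have mB := fun i => (hB i).1; split; first exact: bigcupT_measurable.
  move=> e e0; have e20 : 0 < e / 2 by rewrite divr_gt0.
  have ei0 i : 0 < e / 2 / (2 ^ i.+1)%:R by rewrite divr_gt0// ltr0n expn_gt0.
  have /choice[C hC] : forall i, exists C, exists V : set X, [/\ closed C, open V, C `<=` B i, B i `<=` V &
      (mu (V `\` C : set (borel X)) <= (e / 2 / (2 ^ i.+1)%:R)%:E)%E].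
    by move=> i; exact: (hB i).2.
  have /choice[V hV] := hC.
  (* A countable union of closed sets need not be closed. Half of [e] pays for all the gaps
     [V i \ C i], the other half for stopping the inner union after finitely many terms. *)
  pose W := \bigcup_i V i; pose K N := \bigcup_(i in `I_N) C i.
  have cK N : closed (K N).
    by apply: closed_bigcup => // i _; case: (hV i).
  have mK N : measurable (K N : set (borel X)) by exact: closed_borel.
  have oW : open W by apply: bigcup_open => i _; case: (hV i).
  have mW : measurable (W : set (borel X)) by exact: open_borel.
  have mKi : measurable (\bigcup_i C i : set (borel X)).
    by apply: bigcupT_measurable => i; apply: closed_borel; case: (hV i).
  have mVC i : measurable (V i `\` C i : set (borel X)).
    by apply: measurableD; [apply: open_borel|apply: closed_borel]; case: (hV i).
  have capE : \bigcap_N (W `\` K N) = W `\` \bigcup_i C i.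
    apply/seteqP; split=> x h; last by move=> N _; split; [exact: h.1|move=> [i _ Ci]; apply: h.2; exists i].
    split; first exact: (h 0%N I).1.
    by move=> [i _ Ci]; apply: (h i.+1 I).2; exists i => /=.
  have cv : mu (W `\` K N : set (borel X)) @[N --> \oo] --> mu (\bigcap_N (W `\` K N) : set (borel X)).
    apply: (@nonincreasing_cvg_mu _ _ _ mu (fun k => W `\` K k)) => //.
    + by apply: fin; exact: measurableD.
    + by move=> N; exact: measurableD.
    + by rewrite capE; exact: measurableD.
    + move=> k l kl; apply/subsetPset => x [Wx Kx]; split => // -[i /= ik Ci]; apply: Kx.
      by exists i => //=; exact: leq_trans kl.
  have lim_le : (mu (\bigcap_N (W `\` K N) : set (borel X)) <= (e / 2)%:E)%E.
    rewrite capE; apply: (le_trans (y := (\sum_(0 <= i <oo) mu (V i `\` C i : set (borel X)))%E)).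
      apply: measure_sigma_subadditive => //; first exact: measurableD.
      move=> x [[i _ Vx] Cx]; exists i => //; split => // Ci; apply: Cx; by exists i.
    apply: le_trans (epsilon_trick0 xpredT (ltW e20)).
    by apply: lee_nneseries => // i _; case: (hV i).
  have finl : mu (\bigcap_N (W `\` K N) : set (borel X)) \is a fin_num.
    by rewrite ge0_fin_numE// (le_lt_trans lim_le) ?ltry.
  move: cv; rewrite -(fineK finl) => /fine_cvgP[_ /cvgrPdist_le/(_ _ e20)[N _ /(_ _ (leqnn _))]] /= hN.
  exists (K N), W; split => //.
  + by move=> x [i _ Ci]; exists i => //; case: (hV i) => _ _ h _ _; exact: h.
  + by move=> x [i _ Bi]; exists i => //; case: (hV i) => _ _ _ h _; exact: h.
  + rewrite -(@fineK _ (mu _)) ?ge0_fin_numE ?fin//; last exact: measurableD.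
    rewrite lee_fin; rewrite -(fineK finl) lee_fin in lim_le.
    by move: hN; rewrite distrC => /ler_normlW; lra.
Qed.

Lemma outer_regular (B : set (borel X)) : measurable B -> forall e : R, 0 < e ->
  exists V : set X, [/\ open V, B `<=` V &
    (mu (V : set (borel X)) <= mu B + e%:E)%E].
Proof.
move=> mB e e0.
have [_ /(_ _ e0)[C [V [cC oV CB BV h]]]] : regular B.
  have : (@open X).-sigma.-measurable `<=` regular.
    apply: smallest_sub; first exact: regular_sigma.
    by move=> V; exact: regular_open.
  by apply; exact: mB.
exists V; split => //; have mV := open_borel oV; have mC := closed_borel cC.
rewrite (@measureDI _ _ _ mu V C)// addeC leeD//.
by apply: measure_le => //; [exact: measurableI|move=> x [_]; exact: CB].
Qed.

End regularity.

Section countable_union.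
Context {d : measure_display} {T : measurableType d} {R : realType} {I : countType}.
Implicit Types (F : I -> set T) (mu nu : {measure set T -> \bar R}).

(** Reindexing of a countable family by [nat], with empty sets at the codes of no index. The exact
    inverse [pickle_inv] is used so that no member appears twice and disjointness survives. *)
Definition seq_of F (j : nat) : set T :=
  if @pickle_inv I j is Some i then F i else set0.

Lemma seq_of_pickle F i : seq_of F (pickle i) = F i.
Proof. by rewrite /seq_of pickleK_inv. Qed.

Lemma bigcup_seq_of F : \bigcup_j seq_of F j = \bigcup_i F i.
Proof.
apply/seteqP; split=> x [j _].
  by rewrite /seq_of; case: pickle_inv => // i Fi; exists i.
by move=> Fj; exists (pickle j) => //; rewrite seq_of_pickle.
Qed.

Lemma trivIset_seq_of F : trivIset setT F -> trivIset setT (seq_of F).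
Proof.
move=> tF i j _ _; rewrite /seq_of.
case Ei : (pickle_inv i) => [a|]; last by move=> [x []].
case Ej : (pickle_inv j) => [b|]; last by move=> [x []].
move=> /(tF _ _ Logic.I Logic.I) ab; have := @pickle_invK I i; have := @pickle_invK I j.
by rewrite Ei Ej /= => <- <-; rewrite ab.
Qed.

Lemma measurable_seq_of F : (forall i, measurable (F i)) -> forall j, measurable (seq_of F j).
Proof. by move=> mF j; rewrite /seq_of; case: pickle_inv. Qed.

Lemma measurable_bigcup_count F : (forall i, measurable (F i)) -> measurable (\bigcup_i F i).
Proof.
by move=> mF; rewrite -bigcup_seq_of; apply: bigcupT_measurable; exact: measurable_seq_of.
Qed.

Lemma measure_bigcup_seq mu F : (forall i, measurable (F i)) -> trivIset setT F ->
  mu (\bigcup_i F i) = (\sum_(0 <= j <oo) mu (seq_of F j))%E.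
Proof.
move=> mF tF; rewrite -bigcup_seq_of measure_bigcup//.
- by apply: eq_eseriesl => i; rewrite in_setT.
- by move=> i _; exact: measurable_seq_of.
- exact: trivIset_seq_of.
Qed.

Lemma measure_bigcup_le mu nu F : (forall i, measurable (F i)) -> trivIset setT F ->
  (forall i, (mu (F i) <= nu (F i))%E) -> (mu (\bigcup_i F i) <= nu (\bigcup_i F i))%E.
Proof.
move=> mF tF h; rewrite !measure_bigcup_seq//; apply: lee_nneseries => // j _.
by rewrite /seq_of; case: pickle_inv => //; rewrite !measure0.
Qed.

Lemma measure_bigcup_eq0 mu F : (forall i, measurable (F i)) ->
  (forall i, mu (F i) = 0%E) -> mu (\bigcup_i F i) = 0%E.
Proof.
move=> mF h; apply/eqP; rewrite eq_le measure_ge0 andbT -bigcup_seq_of.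
apply: (@le_trans _ _ (\sum_(0 <= j <oo) mu (seq_of F j))%E).
  apply: measure_sigma_subadditive => //; first exact: measurable_seq_of.
  by apply: bigcupT_measurable; exact: measurable_seq_of.
by rewrite eseries0// => j _ _; rewrite /seq_of; case: pickle_inv.
Qed.

End countable_union.

(** * Dyadic cubes *)

Section dyadic.
Context {R : realType} {n : nat}.
Local Notation E := (euclid R n).
Local Notation idx := {ffun 'I_n -> int}.

Definition zof (k : nat) (x : 'rV[R]_n) : idx :=
  [ffun i => Num.floor (2 ^+ k * x ord0 i)].

(** Dyadic cubes of side [2^-k]. The half-open ones partition the space and serve for comparing
    measures; the closed [ccube] are compact but overlap along faces. *)
Definition dcube (k : nat) (z : idx) : set E := [set x | zof k x = z].

Definition ccube (k : nat) (z : idx) : set E :=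
  [set x : 'rV[R]_n | forall i, (z i)%:~R <= 2 ^+ k * x ord0 i <= (z i)%:~R + 1].

Definition parent (z : idx) : idx := [ffun i => Num.floor ((z i)%:~R / 2 : R)].

Lemma zofP k (x : 'rV[R]_n) i :
  (zof k x i)%:~R <= 2 ^+ k * x ord0 i < (zof k x i)%:~R + 1.
Proof. by rewrite ffunE; have := floor_itv (2 ^+ k * x ord0 i); rewrite intrD. Qed.

Lemma zof_eq k (x : 'rV[R]_n) (z : idx) :
  (forall i, (z i)%:~R <= 2 ^+ k * x ord0 i < (z i)%:~R + 1) -> zof k x = z.
Proof. by move=> h; apply/ffunP => i; rewrite ffunE; apply: floor_def; rewrite intrD; exact: h. Qed.

Lemma dcube_ccube k z : dcube k z `<=` ccube k z.
Proof. by move=> x <- i; have /andP[-> /ltW ->] := zofP k x i. Qed.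

Lemma parentP (z : idx) i :
  2 * (parent z i)%:~R <= (z i)%:~R :> R /\ (z i)%:~R + 1 <= 2 * (parent z i)%:~R + 2 :> R.
Proof.
rewrite ffunE; set w : R := (z i)%:~R; set f := Num.floor _.
have /andP[f1 f2] := floor_itv (w / 2); rewrite -/f intrD in f1 f2.
split; first lra.
(* Between integers the strict inequality improves by one; this puts the upper face of the cube
   inside its parent. *)
have : w < (2 * (f + 1))%:~R by rewrite intrM intrD; lra.
by rewrite ltr_int -lezD1 -(ler_int R) intrM !intrD; lra.
Qed.

Lemma ccube_parent k z : ccube k.+1 z `<=` ccube k (parent z).
Proof.
move=> x xz i; have := xz i; have [h1 h2] := parentP z i.
rewrite exprS -mulrA => /andP[a b]; apply/andP; split; lra.
Qed.

Lemma parent_zof k (x : 'rV[R]_n) : parent (zof k.+1 x) = zof k x.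
Proof.
apply/esym/zof_eq => i; have := zofP k.+1 x i; have [h1 h2] := parentP (zof k.+1 x) i.
by rewrite exprS -mulrA => /andP[a b]; apply/andP; split; lra.
Qed.

Lemma ccube_zof_le k l (x : 'rV[R]_n) : (k <= l)%N ->
  ccube l (zof l x) `<=` ccube k (zof k x).
Proof.
move=> /subnKC <-; elim: (l - k)%N => [|m IH]; first by rewrite addn0.
by rewrite addnS; apply: subset_trans IH; rewrite -(parent_zof (k + m) x); exact: ccube_parent.
Qed.

Lemma dcube_zof_le k l (x : 'rV[R]_n) : (k <= l)%N ->
  dcube l (zof l x) `<=` dcube k (zof k x).
Proof.
move=> /subnKC <-; elim: (l - k)%N => [|m IH]; first by rewrite addn0.
rewrite addnS; apply: subset_trans IH => y /= yx.
by rewrite /dcube/= -(parent_zof _ y) yx parent_zof.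
Qed.

Lemma ccube_norm k z (x y : 'rV[R]_n) : ccube k z x -> ccube k z y ->
  `|x - y| <= 2 ^- k.
Proof.
move=> xz yz; apply: rV_norm_le => [|i]; first by rewrite invr_ge0 exprn_ge0.
have k0 : 0 < 2 ^+ k :> R by rewrite exprn_gt0.
have := xz i; have := yz i; rewrite !mxE => /andP[a b] /andP[c d].
rewrite -(ler_pM2l k0) divff ?gt_eqF// -{1}(ger0_norm (ltW k0)) -normrM mulrBr.
by rewrite ler_norml; apply/andP; split; lra.
Qed.

Lemma measurable_dcube k z : measurable (dcube k z : set (borel E)).
Proof.
have -> : dcube k z = \bigcap_(i in [set: 'I_n])
   ((fun x : borel E => 2 ^+ k * (x : 'rV[R]_n) ord0 i) @^-1` `[(z i)%:~R, (z i)%:~R + 1[%classic).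
  apply/seteqP; split=> x /= h.
    by move=> i _; rewrite /= in_itv/= -h; exact: zofP.
  by apply: zof_eq => i; have := h i I; rewrite /= in_itv.
apply: fin_bigcap_measurable => // i _; rewrite -[X in measurable X]setTI.
have : measurable_fun setT (fun x : borel E => 2 ^+ k * (x : 'rV[R]_n) ord0 i).
  by apply: measurable_funM => //; exact: measurable_coord.
by apply => //; exact: measurable_itv.
Qed.

Lemma trivIset_dcube k : trivIset setT (dcube k).
Proof. by move=> z w _ _ [x [/= <- <-]]. Qed.

Lemma bigcup_dcube k : \bigcup_z dcube k z = setT.
Proof. by rewrite -subTset => x _; exists (zof k x). Qed.

(** Maximality is expressed by the parent alone, since all larger dyadic cubes contain it. In
    generation [0] nothing is asked of the parent, so no cube has side larger than [1]. The closed
    cubes are tested although the half-open ones will partition [V]. *)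
Definition selected (V : set E) k z := ccube k z `<=` V /\
  if k is k'.+1 then ~ (ccube k' (parent z) `<=` V) else True.

Lemma open_ccube (V : set E) x : open V -> V x -> exists k, ccube k (zof k x) `<=` V.
Proof.
move=> /open_euclid oV Vx.
have [e /= e0 eV] : nbhs_ball (x : 'rV[R]_n) V by rewrite nbhs_ballE; exact: open_nbhs_nbhs.
have [k _ /(_ _ (leqnn _))/= ke] := nbhs_infty_gtr (e^-1).
exists k => y yx; apply: eV; rewrite -ball_normE/=.
apply: (@le_lt_trans _ _ (2 ^- k)).
  by apply: (ccube_norm _ yx); apply: dcube_ccube.
rewrite invf_plt ?posrE ?exprn_gt0//; apply: lt_le_trans ke _.
by rewrite -natrX ler_nat ltnW// ltn_expl.
Qed.

(** The selected generation is the least one whose closed cube about [x] lies in [V]; some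
    generation does, because [V] is open and the cubes shrink. *)
Lemma selected_exists (V : set E) x : open V -> V x -> exists k, selected V k (zof k x).
Proof.
move=> oV Vx; have [k0 hk0] := open_ccube oV Vx.
pose P k := `[< ccube k (zof k x) `<=` V >].
have exP : exists k, P k by exists k0; exact/asboolP.
case: (ex_minnP exP) => k /asboolP kV kmin; exists k; split=> //.
case: k => // k in kV kmin *; rewrite parent_zof => h.
by have := kmin k (asboolT h); rewrite ltnn.
Qed.

(** The closed cubes about [x] decrease with the generation. If a later one were selected too, its
    parent would lie in the earlier selected cube and hence in [V]. *)
Lemma selected_uniq (V : set E) x k l : selected V k (zof k x) -> selected V l (zof l x) -> k = l.
Proof.
move=> sk sl; wlog kl : k l sk sl / (k <= l)%N.
  by move=> h; have [/h|/ltnW/h] := leqP k l; [exact|move=> /(_ sl sk)].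
apply/eqP; rewrite eqn_leq kl leqNgt; apply/negP => {}kl.
case: l => // l in sl kl *; case: sl => _; rewrite parent_zof; apply.
by apply: subset_trans sk.1; exact: ccube_zof_le.
Qed.

Definition sel_cube (V : set E) (p : nat * idx) : set E :=
  if `[< selected V p.1 p.2 >] then dcube p.1 p.2 else set0.

Lemma bigcup_sel_cube V : open V -> \bigcup_p sel_cube V p = V.
Proof.
move=> oV; apply/seteqP; split=> [x [[k z] _]|x Vx].
  by rewrite /sel_cube; case: ifPn => //= /asboolP[kV _] /dcube_ccube /kV.
have [k sk] := selected_exists oV Vx; exists (k, zof k x) => //.
by rewrite /sel_cube asboolT.
Qed.

Lemma trivIset_sel_cube V : trivIset setT (sel_cube V).
Proof.
move=> [k z] [l w] _ _ [x []]; rewrite /sel_cube.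
case: ifPn => //= /asboolP sk xk; case: ifPn => //= /asboolP sl xl.
by rewrite -xk in sk *; rewrite -xl in sl *; rewrite (selected_uniq sk sl).
Qed.

Lemma measurable_sel_cube V p : measurable (sel_cube V p : set (borel E)).
Proof. by rewrite /sel_cube; case: ifPn => _ //; exact: measurable_dcube. Qed.

Lemma dcube_ind0 k (z w : idx) : dcube k z `<=` dcube 0 w \/ dcube k z `&` dcube 0 w = set0.
Proof.
have [->|/set0P[x [xk xw]]] := eqVneq (dcube k z `&` dcube 0 w) set0; first by right.
by left; rewrite -xk -xw; apply: dcube_zof_le.
Qed.

(** Outer regularity of [nu] replaces a Borel set by an open one, and an open set is a countable
    disjoint union of dyadic cubes, on which the inequality is assumed. *)
Lemma cube_comparison (mu nu : {measure set (borel E) -> \bar R}) :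
  (forall k z, (mu (dcube k z : set (borel E)) <= nu (dcube k z : set (borel E)))%E) ->
  (forall z, (nu (dcube 0 z : set (borel E)) < +oo)%E) ->
  forall B : set (borel E), measurable B -> (mu B <= nu B)%E.
Proof.
move=> mn nfin B mB.
have -> : B = \bigcup_z (B `&` dcube 0 z) by rewrite -setI_bigcupr bigcup_dcube setIT.
apply: measure_bigcup_le.
- by move=> z; apply: measurableI => //; exact: measurable_dcube.
- by apply: trivIset_setIl; exact: trivIset_dcube.
move=> w; have mw := measurable_dcube 0 w.
apply/lee_addgt0Pr => e e0.
(* Regularity is available for finite measures only, so everything is done inside one unit cube. A
   selected cube lies in that unit cube or is disjoint from it. *)
have [|V [oV BV hV]] := @outer_regular _ _ (mrestr nu mw) _ B mB e e0.
  by rewrite /= /mrestr setTI; exact: nfin.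
rewrite /= /mrestr in hV; apply: le_trans hV.
apply: (@le_trans _ _ (mu (V `&` dcube 0 w : set (borel E)))).
  apply: measure_le.
  - exact: measurableI.
  - by apply: measurableI => //; exact: open_borel.
  - exact: setSI.
rewrite -(bigcup_sel_cube oV) setI_bigcupl.
apply: measure_bigcup_le.
- by move=> p; apply: measurableI => //; exact: measurable_sel_cube.
- by apply: trivIset_setIr; exact: trivIset_sel_cube.
move=> [k z]; rewrite /sel_cube; case: ifPn => _ /=; last by rewrite set0I !measure0.
by case: (dcube_ind0 k z w) => [/setIidPl ->|->]; rewrite ?measure0.
Qed.

Lemma cube_uniqueness (mu nu : {measure set (borel E) -> \bar R}) :
  (forall k z, mu (dcube k z : set (borel E)) = nu (dcube k z : set (borel E))) ->
  (forall z, (nu (dcube 0 z : set (borel E)) < +oo)%E) ->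
  forall B : set (borel E), measurable B -> mu B = nu B.
Proof.
move=> mn nfin B mB; apply/eqP; rewrite eq_le; apply/andP; split;
  by apply: cube_comparison => // *; rewrite mn.
Qed.

End dyadic.

(** A crude linear bound for [x] in [[0, 1]]. The base [3] makes the induction close: [(1 + x)(1 +
    3^m x) <= 1 + (1 + 2 * 3^m) x]. *)
Lemma expr1D_le {R : realFieldType} (x : R) m : 0 <= x <= 1 -> (1 + x) ^+ m <= 1 + 3 ^+ m * x.
Proof.
move=> /andP[x0 x1]; elim: m => [|m IH]; first by rewrite !expr0 lerDl mul1r.
have : (1 + x) ^+ m.+1 <= (1 + x) * (1 + 3 ^+ m * x).
  by rewrite exprS ler_wpM2l// addr_ge0.
move=> /le_trans; apply.
have h3 : 1 <= 3 ^+ m :> R by rewrite exprn_ege1// ler1n.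
have : 3 ^+ m * x * x <= 3 ^+ m * x.
  by rewrite ler_piMr// mulr_ge0// (le_trans ler01).
have : x <= 3 ^+ m * x by rewrite ler_peMl.
by rewrite exprS; set u := 3 ^+ m * x => h1 h2; rewrite -mulrA -/u; lra.
Qed.

Lemma maxBmin {R : realDomainType} (x : R) : Num.max 0 x - Num.min 0 x = `|x|.
Proof. by case: (leP 0 x) => h; [rewrite subr0 ger0_norm|rewrite sub0r ltr0_norm]. Qed.

(** * Lebesgue measure *)

Section lebesgue_boxes.
Context {R : realType} {n : nat}.
Local Notation E := (euclid R n).
Local Notation L := (@lebesgueRn R n).

Lemma measurable_hyperplane i (c : R) :
  measurable [set x : borel E | (x : 'rV[R]_n) ord0 i = c].
Proof.
have -> : [set x : borel E | (x : 'rV[R]_n) ord0 i = c] =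
    setT `&` (fun x : borel E => (x : 'rV[R]_n) ord0 i) @^-1` [set c].
  by rewrite setTI.
by apply: (measurable_coord i) => //; exact: measurable_set1.
Qed.

Lemma measurable_cbox (a b : 'I_n -> R) :
  measurable [set x : borel E | forall i, a i <= (x : 'rV[R]_n) ord0 i <= b i].
Proof.
have -> : [set x : borel E | forall i, a i <= (x : 'rV[R]_n) ord0 i <= b i] =
    \bigcap_(i in [set: 'I_n])
    (setT `&` (fun x : borel E => (x : 'rV[R]_n) ord0 i) @^-1` `[a i, b i]%classic).
  apply/seteqP; split=> x /= h i; first by move=> _; split => //; rewrite /= in_itv/=; exact: h.
  by have [_] := h i I; rewrite /= in_itv.
apply: fin_bigcap_measurable => // i _.
by apply: (measurable_coord i) => //; exact: measurable_itv.
Qed.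

(** The only access to the opaque [lebesgueRn] is its value on closed boxes; null hyperplanes,
    scaling and linear changes of variables are derived from it. *)
Lemma lebesgue_cbox (a b : 'I_n -> R) : (forall i, a i <= b i) ->
  L [set x : 'rV[R]_n | forall i, a i <= x ord0 i <= b i] = (\prod_(i < n) (b i - a i))%:E.
Proof.
move=> ab; rewrite (_ : \prod_(i < n) _ = \prod_(i < n) ((\row_i b i) ord0 i - (\row_i a i) ord0 i)).
  rewrite -lebesgueRn_box; last by move=> i; rewrite !mxE.
  by congr (L _); apply/seteqP; split => x /= h i; have := h i; rewrite ?mxE.
by apply: eq_bigr => i _; rewrite !mxE.
Qed.

Lemma lebesgue_hyperplane i (c : R) : L [set x : 'rV[R]_n | x ord0 i = c] = 0%E.
Proof.
(* Boxes exhausting the hyperplane: side [0] in direction [i], sides [2 m] in the others. *)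
pose H m := [set x : 'rV[R]_n |
  forall j, (if j == i then c else - m%:R) <= x ord0 j <= (if j == i then c else m%:R)].
apply/eqP; rewrite eq_le measure_ge0 andbT.
apply: (@le_trans _ _ (\sum_(0 <= m <oo) L (H m))%E).
  apply: measure_sigma_subadditive => //.
  - by move=> m; exact: measurable_cbox.
  - exact: measurable_hyperplane.
  move=> x /= xi; have [m _ /(_ _ (leqnn _))/= hm] := nbhs_infty_ger `|x|.
  exists m => // j; case: eqP => [->|_]; first by rewrite xi lexx.
  by rewrite -ler_norml (le_trans (coord_le_norm x j)).
rewrite eseries0// => m _ _; rewrite lebesgue_cbox; last first.
  by move=> j; case: eqP => // _; rewrite ge0_cp.
by rewrite (bigD1 i)//= eqxx subrr mul0r.
Qed.

(** A set between an open box and its closure differs from the closed box only on faces, which lie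
    in finitely many hyperplanes. This covers half-open cubes and their preimages under affine maps
    without treating boundary conventions one by one. *)
Lemma lebesgue_between (a b : 'I_n -> R) (A : set (borel E)) : (forall i, a i <= b i) ->
  measurable A ->
  (forall x : 'rV[R]_n, (forall i, a i < x ord0 i < b i) -> A x) ->
  (forall x : 'rV[R]_n, A x -> forall i, a i <= x ord0 i <= b i) ->
  L A = (\prod_(i < n) (b i - a i))%:E.
Proof.
move=> ab mA oA Ac; rewrite -lebesgue_cbox//.
set C := [set x : 'rV[R]_n | _]; have mC : measurable (C : set (borel E)) by exact: measurable_cbox.
pose H (p : 'I_n * bool) := [set x : 'rV[R]_n | x ord0 p.1 = if p.2 then a p.1 else b p.1] : set (borel E).
have mH p : measurable (H p) by exact: measurable_hyperplane.
apply/eqP; rewrite eq_le measure_le//=.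
apply: (@le_trans _ _ (L (A `|` \bigcup_p H p))).
  apply: measure_le => //; first by apply: measurableU => //; exact: measurable_bigcup_count.
  move=> x xC; have [Hx|Hx] := pselect ((\bigcup_p H p) x); first by right.
  left; apply: oA => i; have /andP[h1 h2] := xC i.
  rewrite !lt_neqAle h1 h2 !andbT; apply/andP; split; apply/eqP => h; apply: Hx.
    by exists (i, true).
  by exists (i, false).
apply: (le_trans (measureU2 _ _ _)) => //; first exact: measurable_bigcup_count.
rewrite [X in (_ + X)%E]measure_bigcup_eq0 ?adde0//.
by move=> [i s]; exact: lebesgue_hyperplane.
Qed.

Lemma pow2_gt0 k : 0 < 2 ^+ k :> R. Proof. by rewrite exprn_gt0. Qed.

Lemma lebesgue_dcube k z : L (@dcube R n k z) = ((2 ^- k) ^+ n)%:E.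
Proof.
have k0 := pow2_gt0 k.
rewrite (@lebesgue_between (fun i => (z i)%:~R / 2 ^+ k) (fun i => ((z i)%:~R + 1) / 2 ^+ k)).
- congr _%:E; rewrite -[in RHS](card_ord n) -prodr_const; apply: eq_bigr => i _.
  by rewrite -mulrBl [_ + 1]addrC addrK div1r.
- by move=> i; rewrite ler_pM2r ?invr_gt0// lerDl.
- exact: measurable_dcube.
- move=> x h; apply: zof_eq => i; have := h i.
  rewrite ltr_pdivrMr// ltr_pdivlMr// mulrC => /andP[/ltW -> /=].
  by rewrite mulrC.
- move=> x <- i; have := zofP k x i.
  by rewrite ler_pdivrMr// ler_pdivlMr// ![x _ _ * _]mulrC => /andP[-> /ltW].
Qed.

Lemma lebesgue_dcube_lty k z : (L (@dcube R n k z) < +oo)%E.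
Proof. by rewrite lebesgue_dcube ltry. Qed.

Lemma measurable_affine (s : R) (v : 'rV[R]_n) :
  measurable_fun setT (fun x : borel E => s *: (x : 'rV[R]_n) + v : borel E).
Proof.
apply: measurable_to_rV => i; under eq_fun do rewrite !mxE.
by apply: measurable_funD => //; apply: measurable_funM => //; exact: measurable_coord.
Qed.

(** Both sides are measures in [B], and the preimage of a dyadic cube is a box up to its faces, so
    uniqueness on cubes applies. *)
Lemma lebesgue_affine (s : R) (v : 'rV[R]_n) (B : set (borel E)) : 0 < s ->
  measurable B ->
  L [set x : 'rV[R]_n | B (s *: x + v)] = ((s ^- n)%:E * L B)%E.
Proof.
move=> s0 mB.
have sn0 : 0 <= s ^- n by rewrite invr_ge0 exprn_ge0// ltW.
have := @cube_uniqueness R n (pushforward_measure L (measurable_affine s v))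
  (mscale (NngNum sn0) L).
apply => //; last by move=> z; rewrite /mscale/= lte_mul_pinfty// lebesgue_dcube_lty.
move=> k z; rewrite -[RHS]/((s ^- n)%:E * L (dcube k z))%E.
rewrite -[LHS]/(L [set x : 'rV[R]_n | dcube k z (s *: x + v)]) lebesgue_dcube.
have k0 := pow2_gt0 k.
rewrite (@lebesgue_between (fun i => ((z i)%:~R / 2 ^+ k - v ord0 i) / s)
    (fun i => (((z i)%:~R + 1) / 2 ^+ k - v ord0 i) / s)).
- rewrite -EFinM -[s ^- n]exprVn -exprMn; congr _%:E.
  rewrite -[in RHS](card_ord n) -prodr_const; apply: eq_bigr => i _.
  by field; rewrite !gt_eqF.
- by move=> i; rewrite ler_pM2r ?invr_gt0// lerD2r ler_pM2r ?invr_gt0// lerDl.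
- rewrite -[X in measurable X]setTI; apply: measurable_affine => //; exact: measurable_dcube.
- move=> x h; apply: zof_eq => i; have := h i; rewrite !mxE.
  rewrite ltr_pdivrMr// ltr_pdivlMr// ltrBlDr ltrBrDr.
  by rewrite ltr_pdivrMr// ltr_pdivlMr// ![_ * 2 ^+ _]mulrC [s * _]mulrC => /andP[/ltW -> ->].
- move=> x hx i; have := zofP k (s *: x + v) i; rewrite hx !mxE.
  rewrite ler_pdivrMr// ler_pdivlMr// lerBlDr lerBrDr.
  by rewrite ler_pdivrMr// ler_pdivlMr// ![_ * 2 ^+ _]mulrC [s * _]mulrC => /andP[-> /ltW ->].
Qed.

Lemma lebesgue_translation (v : 'rV[R]_n) (B : set (borel E)) : measurable B ->
  L [set x : 'rV[R]_n | B (x + v)] = L B.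
Proof.
move=> mB; have := lebesgue_affine v ltr01 mB; rewrite expr1n invr1 mul1e => <-.
by congr (L _); apply/funext => x /=; rewrite scale1r.
Qed.

(** In the sup norm a set of diameter [c] sits in a box of side exactly [c]. The absence of a
    further constant is what lets the volume distortion of a map close to an isometry tend to
    [1]. *)
Lemma lebesgue_diam_le (A : set (borel E)) (c : R) : measurable A -> 0 <= c ->
  (forall x y : 'rV[R]_n, A x -> A y -> `|x - y| <= c) -> (L A <= (c ^+ n)%:E)%E.
Proof.
move=> mA c0 h; have [->|/set0P[x0 Ax0]] := eqVneq A set0.
  by rewrite measure0 lee_fin exprn_ge0.
pose p i := [set (x : 'rV[R]_n) ord0 i | x in A].
have pb i : has_lbound (p i).
  exists (x0 ord0 i - c) => _ [x Ax <-].
  have := le_trans (coord_le_norm _ i) (h _ _ Ax0 Ax); rewrite !mxE ler_norml => /andP[_ ?]; lra.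
apply: (@le_trans _ _ (\prod_(i < n) ((inf (p i) + c) - inf (p i)))%:E); last first.
  rewrite lee_fin -[X in _ ^+ X](card_ord n) -prodr_const le_eqVlt; apply/orP; left; apply/eqP.
  by apply: eq_bigr => i _; rewrite addrC addKr.
rewrite -(lebesgue_cbox (a := fun i => inf (p i)) (b := fun i => inf (p i) + c)); last first.
  by move=> i; rewrite lerDl.
apply: measure_le => //; first exact: measurable_cbox.
move=> x Ax i; apply/andP; split; first by apply: ge_inf => //; exists x.
rewrite -lerBlDr; apply: lb_le_inf; first by exists (x0 ord0 i), x0.
move=> _ [y Ay <-]; rewrite lerBlDr.
by have := le_trans (coord_le_norm _ i) (h _ _ Ax Ay); rewrite !mxE ler_norml => /andP[_ ?]; lra.
Qed.

End lebesgue_boxes.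

(** * Linear changes of variables *)

Section linear_change.
Context {R : realType} {n : nat}.
Local Notation E := (euclid R n).
Local Notation L := (@lebesgueRn R n).
Implicit Types (A : 'M[R]_n) (B : set (borel E)).

Lemma measurable_mulmx A :
  measurable_fun setT (fun x : borel E => (x : 'rV[R]_n) *m A : borel E).
Proof.
apply: measurable_to_rV => i; under eq_fun do rewrite !mxE.
apply: measurable_sum => j; apply: measurable_funM => //; exact: measurable_coord.
Qed.

Lemma measurable_preimage_mulmx A B : measurable B ->
  measurable [set x : borel E | B ((x : 'rV[R]_n) *m A)].
Proof.
move=> mB; rewrite -[X in measurable X]setTI.
by apply: (measurable_mulmx A) => //.
Qed.

(** Volume of the preimage of the unit cube. It is shown to be finite and multiplicative on
    invertible matrices before it is identified with [|det A|^-1]. *)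
Definition vol_factor A : R := fine (L [set x : 'rV[R]_n | dcube 0 0%R (x *m A)]).

Lemma vol_factor_ge0 A : 0 <= vol_factor A. Proof. by apply: fine_ge0; exact: measure_ge0. Qed.

(** A point of the preimage is [y *m invmx A] with the entries of [y] in [[0, 1]]. Its [j]-th
    coordinate thus lies between the sum of the negative entries and the sum of the positive entries
    of column [j]. *)
Lemma preimage_cube_le A : A \in unitmx ->
  (L [set x : 'rV[R]_n | dcube 0 0%R (x *m A)] <=
    (\prod_j \sum_i `|invmx A i j|)%:E)%E.
Proof.
move=> uA; have := @lebesgue_cbox R n (fun j => \sum_i Num.min 0 (invmx A i j))
  (fun j => \sum_i Num.max 0 (invmx A i j)).
have -> : \prod_j \sum_i `|invmx A i j| = \prod_j
   (\sum_i Num.max 0 (invmx A i j) - \sum_i Num.min 0 (invmx A i j)).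
  by apply: eq_bigr => j _; rewrite -sumrB; apply: eq_bigr => i _; rewrite maxBmin.
move=> <-; last first.
  by move=> j; apply: ler_sum => i _; rewrite (le_trans (y := 0))// ?ge_min ?le_max lexx.
apply: measure_le; [by apply: measurable_preimage_mulmx; exact: measurable_dcube|exact: measurable_cbox|].
move=> x /= h j.
have xE : x = (x *m A) *m invmx A by rewrite mulmxK.
have hy i : 0 <= (x *m A) ord0 i <= 1.
  have := zofP 0 (x *m A) i; rewrite h ffunE mul1r add0r => /andP[-> /ltW ->]//.
rewrite xE; set y := x *m A in hy *; rewrite mxE; apply/andP; split; apply: ler_sum => i _.
  have /andP[y0 y1] := hy i; case: (leP 0 (invmx A i j)) => hi; first exact: mulr_ge0.
  by rewrite -[leLHS]mul1r ler_wnM2r// ltW.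
have /andP[y0 y1] := hy i; case: (leP 0 (invmx A i j)) => hi; first by rewrite ler_piMl.
by rewrite mulr_ge0_le0// ltW.
Qed.

Lemma vol_factorE A : A \in unitmx ->
  L [set x : 'rV[R]_n | dcube 0 0%R (x *m A)] = (vol_factor A)%:E.
Proof.
by move=> uA; rewrite fineK// ge0_fin_numE// (le_lt_trans (preimage_cube_le uA))// ltry.
Qed.

(** Every dyadic cube is a scaled translate of the unit cube, and scalings and translations can be
    carried through [A]; so the factor found on the unit cube is the same on all cubes. *)
Lemma lebesgue_vol_factor A B : A \in unitmx -> measurable B ->
  L [set x : 'rV[R]_n | B (x *m A)] = ((vol_factor A)%:E * L B)%E.
Proof.
move=> uA mB.
have := @cube_uniqueness R n (pushforward_measure L (measurable_mulmx A))
  (mscale (NngNum (vol_factor_ge0 A)) L).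
apply => //; last by move=> z; rewrite /mscale/= lte_mul_pinfty// lebesgue_dcube_lty.
move=> k z; rewrite -[RHS]/((vol_factor A)%:E * L (dcube k z))%E.
rewrite -[LHS]/(L [set x : 'rV[R]_n | dcube k z (x *m A)]) lebesgue_dcube.
have k0 := @pow2_gt0 R k.
rewrite -(vol_factorE uA) exprVn muleC.
rewrite -(@lebesgue_affine R n (2 ^+ k) (- (\row_i (z i)%:~R) *m invmx A))//; last first.
  by apply: measurable_preimage_mulmx; exact: measurable_dcube.
congr (L _); apply/funext => x /=; apply/propext.
rewrite mulmxDl -scalemxAl mulmxKV//; split=> h.
  by apply: zof_eq => i; have := zofP k (x *m A) i; rewrite h !mxE expr0 ffunE => /andP[? ?]; apply/andP; split; lra.
apply: zof_eq => i; have := zofP 0 (2 ^+ k *: (x *m A) - \row_i (z i)%:~R) i.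
by rewrite h !mxE expr0 ffunE => /andP[? ?]; apply/andP; split; lra.
Qed.

Lemma vol_factorM A1 A2 : A1 \in unitmx -> A2 \in unitmx ->
  vol_factor (A1 *m A2) = vol_factor A1 * vol_factor A2.
Proof.
move=> u1 u2; apply/EFin_inj; rewrite -vol_factorE ?unitmx_mul ?u1// EFinM.
rewrite -(vol_factorE u2) -lebesgue_vol_factor//; last first.
  by apply: measurable_preimage_mulmx; exact: measurable_dcube.
by congr (L _); apply/funext => x /=; rewrite mulmxA.
Qed.

Lemma vol_factor1 : vol_factor 1%:M = 1.
Proof.
rewrite /vol_factor; under eq_set do rewrite mulmx1.
by rewrite lebesgue_dcube expr0 invr1 expr1n.
Qed.

Lemma vol_factor_inv A : A \in unitmx -> vol_factor A * vol_factor (invmx A) = 1.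
Proof. by move=> uA; rewrite -vol_factorM ?unitmx_inv// mulmxV// vol_factor1. Qed.

Lemma vol_factor_gt0 A : A \in unitmx -> 0 < vol_factor A.
Proof.
move=> uA; rewrite lt_def vol_factor_ge0 andbT; apply/eqP => h.
by have := vol_factor_inv uA; rewrite h mul0r => /esym/eqP; rewrite oner_eq0.
Qed.

Lemma vol_factor_perm (s : 'S_n) : vol_factor (perm_mx s) = 1.
Proof.
rewrite /vol_factor [X in L X](_ : _ = dcube 0 0%R) ?lebesgue_dcube ?expr0 ?invr1 ?expr1n//.
have cE (x : 'rV[R]_n) i : (x *m perm_mx s) ord0 (s i) = x ord0 i.
  rewrite mxE (bigD1 i)//= !mxE eqxx mulr1 big1 ?addr0// => j ji.
  by rewrite !mxE (inj_eq perm_inj) (negbTE ji) mulr0.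
apply/funext => x /=; apply/propext; split => h; apply/zof_eq => i.
  by have := zofP 0 (x *m perm_mx s) (s i); rewrite h cE !ffunE.
rewrite -(permKV s i) cE.
by have := zofP 0 x ((s^-1)%g i); rewrite h !ffunE.
Qed.

Lemma vol_factor_diag (d : 'rV[R]_n) : (forall i, d ord0 i != 0) ->
  vol_factor (diag_mx d) = `|\det (diag_mx d)|^-1.
Proof.
move=> d0; rewrite /vol_factor det_diag normr_prod -prodfV.
rewrite (@lebesgue_between R n (fun i => Num.min 0 (d ord0 i)^-1) (fun i => Num.max 0 (d ord0 i)^-1)) /=.
- by apply: eq_bigr => i _; rewrite -normfV maxBmin.
- by move=> i; rewrite (le_trans (y := 0))// ?ge_min ?le_max lexx.
- by apply: measurable_preimage_mulmx; exact: measurable_dcube.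
- move=> x h; apply: zof_eq => i; have := h i; rewrite expr0 mul1r ffunE mulr0z add0r mul_mx_diag mxE.
  case: (ltgtP 0 (d ord0 i)) (d0 i) => // hd _.
    rewrite min_l ?max_r ?invr_ge0 ?(ltW hd)// => /andP[x0 x1].
    rewrite (mulr_ge0 (ltW x0) (ltW hd))/=; by rewrite -ltr_pdivlMr// div1r.
  have di : (d ord0 i)^-1 < 0 by rewrite invr_lt0.
  rewrite min_r ?max_l ?(ltW di)// => /andP[x0 x1].
  by rewrite (mulr_le0 (ltW x1) (ltW hd))/= -ltr_ndivrMr// div1r.
- move=> x h i; have := zofP 0 (x *m diag_mx d) i.
  rewrite h expr0 mul1r ffunE mulr0z add0r mul_mx_diag mxE.
  case: (ltgtP 0 (d ord0 i)) (d0 i) => // hd _.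
    rewrite min_l ?max_r ?invr_ge0 ?(ltW hd)// => /andP[x0 x1].
    by rewrite pmulr_lge0// in x0; rewrite x0/= -[leRHS]div1r ler_pdivlMr// ltW.
  have di : (d ord0 i)^-1 < 0 by rewrite invr_lt0.
  rewrite min_r ?max_l ?(ltW di)// => /andP[x0 x1].
  by rewrite nmulr_lge0// in x0; rewrite x0 andbT -[leLHS]div1r ler_ndivrMr// ltW.
Qed.

(** Conjugation by the diagonal matrix with entries [l ^+ e i] leaves [vol_factor] unchanged and
    multiplies each off-diagonal entry by at least one power of [l]. As [l] tends to [0] the
    bounding box of the conjugate shrinks to the unit cube, so the factor of the inverse is at most
    [1]. The weight [e] covers lower and upper triangular matrices at once. *)
Lemma vol_factor_unipotent A (e : 'I_n -> nat) : A \in unitmx ->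
  (forall i, A i i = 1) -> (forall i j, i != j -> A i j != 0 -> (e j < e i)%N) ->
  1 <= vol_factor A.
Proof.
move=> uA A1 Ae; pose S := \sum_i \sum_j `|A i j|.
have S0 : 0 <= S by apply: sumr_ge0 => i _; apply: sumr_ge0.
have key (l : R) : 0 < l <= 1 -> vol_factor (invmx A) <= (1 + l * S) ^+ n.
  move=> /andP[l0 l1].
  pose d := \row_i l ^+ e i : 'rV[R]_n.
  pose d' := \row_i l ^- e i : 'rV[R]_n.
  have dd' : diag_mx d *m diag_mx d' = 1%:M.
    apply/matrixP => i j; rewrite mul_diag_mx !mxE; case: eqP => // [->|_]; last by rewrite !mulr0n mulr0.
    by rewrite mulr1n divff// expf_neq0// gt_eqF.
  have [ud ud'] := mulmx1_unit dd'.
  pose W := diag_mx d *m A *m diag_mx d'.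
  have uW : W \in unitmx by rewrite !unitmx_mul ud uA.
  have cW : vol_factor W = vol_factor A.
    rewrite !vol_factorM ?unitmx_mul ?ud// mulrAC -vol_factorM// dd' vol_factor1 mul1r//.
  have -> : vol_factor (invmx A) = vol_factor (invmx W).
    have := vol_factor_inv uA; rewrite -cW -(vol_factor_inv uW) => /mulfI; apply.
    by rewrite gt_eqF// vol_factor_gt0.
  have := preimage_cube_le (A := invmx W); rewrite unitmx_inv => /(_ uW).
  rewrite vol_factorE ?unitmx_inv// invmxK lee_fin => /le_trans; apply.
  rewrite -[X in _ <= _ ^+ X](card_ord n) -prodr_const.
  apply: ler_prod => j _; rewrite sumr_ge0//=.
  rewrite (bigD1 j)//=.
  have WE i k : W i k = l ^+ e i * A i k * l ^- e k by rewrite /W mul_mx_diag mul_diag_mx !mxE.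
  rewrite WE A1 mulr1 divff ?expf_neq0 ?gt_eqF// normr1 lerD2l.
  apply: (@le_trans _ _ (\sum_(i | i != j) l * `|A i j|)).
    apply: ler_sum => i ij; rewrite WE.
    have [->|Aij] := eqVneq (A i j) 0; first by rewrite mulr0 mul0r normr0 mulr0.
    have eij := Ae _ _ ij Aij.
    rewrite mulrAC normrM ler_wpM2r// -expfB// ger0_norm ?exprn_ge0 ?(ltW l0)// ?(ltnW eij)//.
    have : (0 < e i - e j)%N by rewrite subn_gt0.
    case: (_ - _)%N => // m _; by rewrite exprS ler_piMr ?(ltW l0)// exprn_ile1// (ltW l0).
  rewrite -mulr_sumr ler_wpM2l ?(ltW l0)// /S exchange_big/= [leRHS](bigD1 j)//=.
  rewrite -[leLHS]addr0 lerD//; last by apply: sumr_ge0 => i _; apply: sumr_ge0.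
  by rewrite [leRHS](bigD1 j)//= lerDr.
have le1 : vol_factor (invmx A) <= 1.
  apply/ler_addgt0Pl => ep ep0; rewrite addrC.
  (* Chosen so that [l * S <= 1], as [expr1D_le] requires, and [3 ^+ n * (l * S) <= ep]. *)
  pose l := Num.min 1 (Num.min ep 1 / (3 ^+ n * (S + 1))).
  have c0 : 0 < 3 ^+ n * (S + 1) by rewrite mulr_gt0 ?exprn_gt0// ltr_wpDl.
  have S1 : 0 < S + 1 by rewrite ltr_wpDl.
  have l0 : 0 < l by rewrite lt_min ltr01/= divr_gt0// lt_min ep0/=.
  have hl : l * (3 ^+ n * (S + 1)) <= Num.min ep 1 by rewrite -ler_pdivlMr// ge_min lexx orbT.
  have hS : l * S <= l * (S + 1) by rewrite ler_pM2l// lerDl.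
  have h3 : 1 <= 3 ^+ n :> R by rewrite exprn_ege1// ler1n.
  have hl2 : l * (S + 1) <= l * (3 ^+ n * (S + 1)) by rewrite ler_pM2l// ler_peMl// ltW.
  have := key l; rewrite l0 ge_min lexx => /(_ isT)/le_trans; apply.
  apply: (le_trans (expr1D_le _ _)).
    by rewrite mulr_ge0 ?(ltW l0)//= (le_trans hS)// (le_trans hl2)// (le_trans hl)// ge_min lexx orbT.
  rewrite lerD2l mulrCA (le_trans _ (le_trans hl _)) ?ge_min ?lexx//.
  by rewrite ler_pM2l// ler_pM2l ?exprn_gt0// lerDl.
rewrite -(vol_factor_inv uA) ler_piMr// vol_factor_ge0//.
Qed.

End linear_change.

Section linear_change_det.
Context {R : realType} {n : nat}.
Local Notation E := (euclid R n.+1).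
Local Notation L := (@lebesgueRn R n.+1).

(** LUP decomposition, with the upper factor split further into a diagonal and a unipotent matrix:
    permutations preserve the unit cube, diagonal matrices are explicit, and unipotent ones
    contribute at least [1]. *)
Lemma vol_factor_ge_det (A : 'M[R]_n.+1) : A \in unitmx -> `|\det A|^-1 <= vol_factor A.
Proof.
move=> uA; have := cormen_lup_correct A; have := cormen_lup_perm A.
have := @cormen_lup_lower _ _ A; have := @cormen_lup_upper _ _ A; have := cormen_lup_detL A.
case: (cormen_lup A) => -[P L'] U /= dL hU hL /is_perm_mxP[s ->] PA.
have uP : (perm_mx s : 'M[R]_n.+1) \in unitmx by exact: unitmx_perm.
have uL : L' \in unitmx by rewrite unitmxE dL unitr1.
have uU : U \in unitmx.
  have : perm_mx s *m A \in unitmx by rewrite unitmx_mul uP.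
  by rewrite [_ *m _]PA unitmx_mul uL.
have dU : \det U = \prod_i U i i.
  rewrite -det_tr det_trig; first by apply: eq_bigr => i _; rewrite mxE.
  by apply/is_trig_mxP => i j ij; rewrite mxE hU.
have U0 i : U i i != 0.
  by move: uU; rewrite unitmxE unitfE dU => /prodf_neq0; apply.
pose D := \row_i U i i : 'rV[R]_n.+1.
pose V := \matrix_(i, j) (U i j / U i i) : 'M[R]_n.+1.
have UE : U = diag_mx D *m V.
  by apply/matrixP => i j; rewrite mul_diag_mx !mxE mulrC divfK.
have /andP[uD uV] : (diag_mx D \in unitmx) && (V \in unitmx) by rewrite -unitmx_mul -UE.
have dD : \det (diag_mx D) = \det U.
  by rewrite det_diag dU; apply: eq_bigr => i _; rewrite mxE.
have cL : 1 <= vol_factor L'.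
  (* Below the diagonal the weight is the row index; for [V], above the diagonal, the order is
     reversed. *)
  apply: (@vol_factor_unipotent _ _ _ (fun i => nat_of_ord i)) => // [i|i j ij].
    by rewrite hL// eqxx.
  by apply: contraNT; rewrite -leqNgt => ij'; rewrite hL// (negbTE ij).
have cV : 1 <= vol_factor V.
  apply: (@vol_factor_unipotent _ _ _ (fun i => n.+1 - i)%N) => // [i|i j ij].
    by rewrite mxE divff.
  apply: contraNT; rewrite ltn_sub2lE ?ltnS ?(ltnW (ltn_ord _))// -leqNgt => ji.
  rewrite mxE hU ?mul0r// ltn_neqAle ji andbT; apply: contra ij => /eqP ij.
  by apply/eqP/val_inj.
have dA : `|\det A| = `|\det U|.
  have := congr1 (fun X => `|\det X|) PA; rewrite !det_mulmx dL mul1r normrM det_perm.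
  by rewrite normr_sign mul1r.
have : vol_factor A = vol_factor L' * (`|\det A|^-1 * vol_factor V).
  have : vol_factor (perm_mx s *m A) = vol_factor (L' *m U) by rewrite [_ *m A]PA.
  rewrite (vol_factorM uP uA) (vol_factorM uL uU) vol_factor_perm mul1r => ->.
  rewrite {1}UE vol_factorM// vol_factor_diag ?dD ?dA// => i; rewrite mxE//.
move=> ->; rewrite mulrCA ler_peMr ?invr_ge0// -[1]mulr1 ler_pM//.
Qed.

(** The lower bound for [invmx A] is the upper bound for [A], because the two factors multiply to
    [1]. *)
Lemma vol_factor_det (A : 'M[R]_n.+1) : A \in unitmx -> vol_factor A = `|\det A|^-1.
Proof.
move=> uA; apply/eqP; rewrite eq_le vol_factor_ge_det// andbT.
have := vol_factor_ge_det (A := invmx A); rewrite unitmx_inv => /(_ uA).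
rewrite det_inv normfV invrK => h; have c0 := vol_factor_gt0 uA.
have d0 : 0 < `|\det A| by rewrite normr_gt0 -unitfE -unitmxE.
rewrite -[leRHS]div1r ler_pdivlMr// -(vol_factor_inv uA) (ler_pM2l c0); exact: h.
Qed.

Lemma lebesgue_preimage_mulmx (A : 'M[R]_n.+1) (B : set (borel E)) : A \in unitmx ->
  measurable B -> L [set x : 'rV[R]_n.+1 | B (x *m A)] = ((`|\det A|^-1)%:E * L B)%E.
Proof. by move=> uA mB; rewrite lebesgue_vol_factor// vol_factor_det. Qed.

End linear_change_det.

(** * Rademacher's theorem *)

Section lipschitz_derivable.
Context {R : realType}.
Local Notation mu := (@lebesgue_measure R).

Lemma stieltjes_itvoc (G : cumulative R R) (a b : R) : a <= b ->
  lebesgue_stieltjes_measure G (`]a, b]%classic : set R) = (G b - G a)%:E.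
Proof.
move=> ab; rewrite /lebesgue_stieltjes_measure /measure_extension/= measurable_mu_extE/=; last exact: is_ocitv.
by rewrite wlength_itv_bnd.
Qed.

(** Adding the slope [1/2] to a function with Lipschitz constant [1/2] makes it nondecreasing, as a
    Stieltjes measure requires. *)
Lemma half_lipschitz_cumulative (h : R -> R) :
  (forall x y, `|h x - h y| <= `|x - y| / 2) ->
  exists G : cumulative R R, forall x, G x = h x + x / 2.
Proof.
move=> hL; pose g x := h x + x / 2.
have gnd : {homo g : x y / x <= y}.
  move=> x y xy; rewrite /g; have := hL x y.
  by rewrite [`|x - y|]distrC [`|y - x|]ger0_norm ?subr_ge0// ler_norml => /andP[? ?]; lra.
have grc : right_continuous g.
  apply: right_continuousW => x; apply: cvgD; last by apply: cvgMl; exact: cvg_id.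
  apply/cvgrPdist_le => e e0; near=> y; rewrite (le_trans (hL _ _))//.
  have : `|x - y| <= e by near: y; exact: cvgr_dist_le.
  by have := normr_ge0 (x - y); lra.
by exists (HB.pack_for (cumulative R R) g (isCumulative.Build R _ R g gnd grc)).
Unshelve. all: by end_near. Qed.

(** Both [h + x/2] and [-h + x/2] are nondecreasing and their sum is [x], so their Stieltjes
    measures add up to Lebesgue measure. Each is then absolutely continuous, and [h] is, up to a
    linear function, the primitive of a Radon-Nikodym density. *)
Lemma half_lipschitz_derivable (h : R -> R) :
  (forall x y, `|h x - h y| <= `|x - y| / 2) ->
  {ae mu, forall t, 0 < t < 1 -> derivable h t 1}.
Proof.
move=> hL.
have [G GE] := half_lipschitz_cumulative hL.
have [G' G'E] : exists G : cumulative R R, forall x, G x = - h x + x / 2.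
  by apply: half_lipschitz_cumulative => x y; rewrite -opprD normrN.
pose nu := lebesgue_stieltjes_measure G; pose nu' := lebesgue_stieltjes_measure G'.
have nuE (A : set (measurableTypeR R)) : measurable A -> mu A = (nu A + nu' A)%E.
  move=> mA; have := @lebesgue_measure_unique R (measure_add nu nu').
  move=> /(_ _ A mA) ->; first exact: measure_addE.
  move=> X [[a b] _ <-]/=; etransitivity; last exact/esym/measure_addE.
  have [ab|ba] := leP a b; last by rewrite set_itv_ge ?measure0 ?adde0// -leNgt bnd_simp ltW.
  transitivity ((G b - G a)%:E + (G' b - G' a)%:E)%E; last first.
    by congr (_ + _)%E; apply/esym; exact: stieltjes_itvoc.
  rewrite lebesgue_measure_itv/= lte_fin !GE !G'E.
  case: ltgtP ab => // [ab|->] _; rewrite -?EFinD; congr (_%:E); lra.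
(* Restriction to a bounded interval makes the measure finite; the margin around []0, 1[] keeps a
   neighbourhood of every relevant point inside. *)
pose D := `]-1, 2]%classic : set R.
have mD : measurable (D : set (measurableTypeR R)) by exact: measurable_itv.
have nuD : (nu D < +oo)%E by rewrite /nu stieltjes_itvoc ?ltry//; lra.
pose nuf : {finite_measure set (measurableTypeR R) -> \bar R} := mfrestr mD nuD.
have nufE A : nuf A = nu (A `&` D) by [].
have nu_mu : nuf `<< mu.
  apply/null_content_dominatesP => A mA muA; rewrite nufE.
  apply/eqP; rewrite eq_le measure_ge0 andbT.
  have : mu (A `&` D) = 0%E.
    apply/eqP; rewrite eq_le measure_ge0 andbT -muA; apply: measure_le => //.
    exact: measurableI.
  rewrite nuE; last exact: measurableI.
  by move=> <-; rewrite leeDl.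
have [f [f0 ffin fi nf]] := radon_nikodym_sigma_finite nu_mu.
have fE : f = EFin \o (fine \o f) by apply/funext => x /=; rewrite fineK.
rewrite fE in fi.
have fiA (A : set (measurableTypeR R)) : measurable A -> mu.-integrable A (EFin \o (fine \o f)).
  by move=> mA; exact: integrableS fi.
have loc : locally_integrable [set: R] (fine \o f).
  by apply: open_integrable_locally => //; exact: openT.
have := @FTC1Ny R (fine \o f) (fun y => fiA _ (measurable_itv _)) loc.
apply: filterS; first exact: (ae_filter_ringOfSetsType mu).
move=> /= t [dF _] /andP[t0 t1].
pose F x := (\int[mu]_(y in `]-oo, x]) (fine \o f) y)%R.
have FE x : -1 < x < 2 -> F x = G x - G (-1).
  move=> /andP[x1 x2]; have -> : F x = fine (nuf `]-oo, x]%classic).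
    rewrite nf; last exact: measurable_itv.
    by rewrite /F /Rintegral; congr fine; apply: eq_integral => y _ /=; rewrite fineK.
  have -> : nuf `]-oo, x]%classic = nu `]-1, x]%classic; last first.
    by rewrite [nu _](stieltjes_itvoc G (ltW x1)).
  rewrite nufE; congr (nu _).
  rewrite /D; apply/seteqP; split => y /=; rewrite !in_itv/=; first by move=> [-> /andP[-> _]].
  by move=> /andP[-> yx]; rewrite yx (le_trans yx)// ltW.
have {}dF : derivable F t 1 by exact: dF.
have nearF : {near t, F =1 (fun x => G x - G (-1))}.
  near=> x; apply: FE; apply/andP; split; near: x.
    by apply: lt_nbhsr => //; lra.
  by apply: lt_nbhsl => //; lra.
have {}dF : derivable (fun x => G x - G (-1)) t 1.
  by apply: near_eq_derivable dF => //; rewrite oner_eq0.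
have -> : h = (fun x => (G x - G (-1)) + (G (-1) - x / 2)).
  by apply/funext => x; rewrite GE; ring.
apply: derivableD => //; apply: derivableB => //.
Unshelve. all: by end_near. Qed.

Lemma lipschitz_derivable (h : R -> R) (C : R) :
  (forall x y, `|h x - h y| <= C * `|x - y|) ->
  {ae mu, forall t, 0 < t < 1 -> derivable h t 1}.
Proof.
move=> hC; have K0 : 0 < 2 * (`|C| + 1) by rewrite mulr_gt0// ltr_wpDl.
have := @half_lipschitz_derivable (fun x => (2 * (`|C| + 1))^-1 * h x).
have hL x y : `|(2 * (`|C| + 1))^-1 * h x - (2 * (`|C| + 1))^-1 * h y| <= `|x - y| / 2.
  rewrite -mulrBr normrM [X in X * _]ger0_norm ?invr_ge0 ?(ltW K0)//.
  rewrite mulrC ler_pdivrMr// (le_trans (hC _ _))//.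
  have := normr_ge0 (x - y); have := ler_norm C; set u := `|x - y|; set v := `|C| => h1 h2.
  have : C * u <= v * u by rewrite ler_wpM2r.
  lra.
move=> /(_ hL); apply: filterS; first exact: (ae_filter_ringOfSetsType mu).
move=> /= t /[apply] dh.
have -> : h = (fun x => (2 * (`|C| + 1)) *: ((2 * (`|C| + 1))^-1 * h x)).
  by apply/funext => x; rewrite /GRing.scale/= mulrA divff ?mul1r// gt_eqF.
exact: derivableZ.
Qed.

End lipschitz_derivable.

Section ae_tools.
Context {d : measure_display} {T : measurableType d} {R : realType}.
Variable mu : {measure set T -> \bar R}.

Lemma ae_and (P Q : T -> Prop) : {ae mu, forall x, P x} -> {ae mu, forall x, Q x} ->
  {ae mu, forall x, P x /\ Q x}.
Proof. by move=> hP hQ; exact: (@filterI _ _ (ae_filter_ringOfSetsType mu)). Qed.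

Lemma ae_imp (P Q : T -> Prop) : (forall x, P x -> Q x) -> {ae mu, forall x, P x} ->
  {ae mu, forall x, Q x}.
Proof. by move=> PQ; apply: (@filterS _ _ (ae_filter_ringOfSetsType mu)). Qed.

Lemma ae_null (A : set T) : measurable A -> mu A = 0%E -> {ae mu, forall x, ~ A x}.
Proof. by move=> mA A0; exists A; split => // x /= /contrapT. Qed.

Lemma ae_null_sub (A : set T) : measurable A -> {ae mu, forall x, ~ A x} -> mu A = 0%E.
Proof.
move=> mA [N [mN N0 AN]]; apply/eqP; rewrite eq_le measure_ge0 andbT -N0.
by apply: measure_le => // x Ax; apply: AN => /=; apply.
Qed.

Lemma ae_count (I : countType) (P : I -> T -> Prop) :
  (forall i, {ae mu, forall x, P i x}) -> {ae mu, forall x, forall i, P i x}.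
Proof.
move=> h; have /choice[N hN] : forall i, exists N : set T,
    [/\ measurable N, mu N = 0%E & ~` [set x | P i x] `<=` N].
  by move=> i; have [N] := h i; exists N.
exists (\bigcup_i N i); split.
- by apply: measurable_bigcup_count => i; case: (hN i).
- by apply: measure_bigcup_eq0 => i; case: (hN i).
- by move=> x /= /existsNP[i Pi]; exists i => //; case: (hN i) => _ _; exact.
Qed.

End ae_tools.

(** Packaging the indefinite integral as a measure makes the comparison theorems on cubes applicable
    to it. *)
Lemma density_measure {d} {T : measurableType d} {R : realType}
    (mu : {measure set T -> \bar R}) (f : T -> \bar R) :
  measurable_fun setT f -> (forall x, (0 <= f x)%E) ->
  exists nu : {measure set T -> \bar R}, forall A, nu A = (\int[mu]_(x in A) f x)%E.
Proof.
move=> mf f0; pose m (A : set T) : \bar R := (\int[mu]_(x in A) f x)%E.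
have m0 : m set0 = 0%E by rewrite /m integral_set0.
have mge0 A : (0 <= m A)%E by apply: integral_ge0.
have madd : semi_sigma_additive m.
  move=> F mF tF mUF; rewrite /m ge0_integral_bigcup//; last first.
    by apply: measurable_funS mf.
  apply: is_cvg_ereal_nneg_natsum_cond => k _ _; exact: integral_ge0.
by exists (HB.pack_for {measure set T -> \bar R} m (isMeasure.Build _ _ _ m m0 mge0 madd)).
Qed.

(** * Bounded functions of bounded support *)

Section bounded_compact_support.
Context {R : realType} {n : nat}.
Local Notation E := (euclid R n).
Local Notation L := (@lebesgueRn R n).

(** A ball of the sup norm, hence a box of known volume, and empty for negative [r]. It is the
    standard bounded container for sets and supports. *)
Definition Bx (r : R) : set (borel E) := [set x : 'rV[R]_n | `|x| <= r].

Lemma BxE (r : R) : 0 <= r ->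
  Bx r = [set x : 'rV[R]_n | forall i, - r <= x ord0 i <= r].
Proof.
move=> r0; apply/seteqP; split => x /= h.
  by move=> i; rewrite -ler_norml (le_trans (coord_le_norm x i)).
by apply: rV_norm_le => // i; rewrite ler_norml.
Qed.

Lemma measurable_Bx r : measurable (Bx r).
Proof.
have [r0|r0] := leP 0 r; first by rewrite BxE//; exact: measurable_cbox.
rewrite [X in measurable X](_ : _ = set0)//; apply/seteqP; split => // x.
by rewrite /Bx/= => /(le_trans (normr_ge0 _)); rewrite leNgt r0.
Qed.

Lemma lebesgue_Bx_lty r : (L (Bx r) < +oo)%E.
Proof.
have [r0|r0] := leP 0 r; first by rewrite BxE// lebesgue_cbox ?ltry// => i; rewrite ge0_cp.
rewrite [X in L X](_ : _ = set0) ?measure0//; apply/seteqP; split => // x.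
by rewrite /Bx/= => /(le_trans (normr_ge0 _)); rewrite leNgt r0.
Qed.

(** Bounded with compact support; both bounds are parameters, so that a sequence sharing them has an
    integrable dominating function at once. *)
Definition bcs (M r : R) (u : borel E -> R) := [/\ measurable_fun setT u,
  forall x, `|u x| <= M & forall x : 'rV[R]_n, r < `|x| -> u x = 0].

Lemma integrable_indic_Bx (M r : R) :
  L.-integrable setT (EFin \o (fun x => M * \1_(Bx r) x)).
Proof.
have : L.-integrable setT (fun x => M%:E * (\1_(Bx r) x)%:E)%E.
  apply: integrableZl => //; apply/integrableP; split.
    by apply/measurable_EFinP; apply: measurable_indic; exact: measurable_Bx.
  under eq_integral do rewrite gee0_abs ?lee_fin//.
  by rewrite integral_indic ?setIT ?lebesgue_Bx_lty//; exact: measurable_Bx.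
by apply: eq_integrable => // x _; rewrite /= EFinM.
Qed.

Lemma bcs_le_indic (M r : R) u : bcs M r u -> forall x, `|u x| <= M * \1_(Bx r) x.
Proof.
move=> [_ uM ur] x; rewrite indicE; case: (boolP (x \in Bx r)); rewrite ?mulr1 ?mulr0//.
by rewrite notin_setE /Bx/= => /negP; rewrite -ltNge => /ur ->; rewrite normr0.
Qed.

Lemma bcs_integrable (M r : R) u : bcs M r u -> L.-integrable setT (EFin \o u).
Proof.
move=> bu; apply: (le_integrable _ _ _ (integrable_indic_Bx M r)) => //.
  by apply/measurable_EFinP; case: bu.
move=> x _ /=; rewrite lee_fin (le_trans (bcs_le_indic bu x))//; exact: ler_norm.
Qed.

Lemma bcs_dct (M r : R) (u_ : nat -> borel E -> R) (u : borel E -> R) :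
  (forall k, bcs M r (u_ k)) -> measurable_fun setT u ->
  {ae L, forall x, u_ k x @[k --> \oo] --> u x} ->
  \int[L]_x u_ k x @[k --> \oo] --> \int[L]_x u x.
Proof.
move=> bu mu cu.
have [|||||iu _ ci] := @dominated_convergence _ _ R L setT measurableT
  (fun k => EFin \o u_ k) (EFin \o u) (EFin \o (fun x => M * \1_(Bx r) x)).
- by move=> k; apply/measurable_EFinP; case: (bu k).
- exact/measurable_EFinP.
- apply: ae_imp cu => x cx _; apply: cvg_EFin => //; exact: nearW.
- exact: integrable_indic_Bx.
- by apply: aeW => x k _; rewrite /= lee_fin; exact: (bcs_le_indic (bu k)).
rewrite /Rintegral; apply: fine_cvg; rewrite fineK//.
exact: integrable_fin_num.
Qed.

Lemma measurable_shift (v : 'rV[R]_n) :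
  measurable_fun setT (fun x : borel E => (x : 'rV[R]_n) + v : borel E).
Proof.
have -> : (fun x : borel E => (x : 'rV[R]_n) + v) = (fun x : borel E => 1 *: (x : 'rV[R]_n) + v).
  by apply/funext => x; rewrite scale1r.
exact: measurable_affine.
Qed.

Lemma bcs_translation (v : 'rV[R]_n) M r u : bcs M r u ->
  \int[L]_x u ((x : 'rV[R]_n) + v) = \int[L]_x u x.
Proof.
move=> bu; pose phi : borel E -> borel E := fun x => (x : 'rV[R]_n) + v.
have mphi : measurable_fun setT phi by exact: measurable_shift.
have bu' : bcs M (r + `|v|) (u \o phi).
  case: bu => mu uM ur; split => [|x|x xr]; [exact: measurableT_comp|exact: uM|].
  apply: ur; rewrite /phi; have := ler_normB ((x : 'rV[R]_n) + v) v.
  by rewrite addrK => h; rewrite -(ltrD2r `|v|); exact: lt_le_trans xr h.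
have muu : measurable_fun setT (EFin \o u) by apply/measurable_EFinP; case: bu.
have iu : L.-integrable (phi @^-1` setT) ((EFin \o u) \o phi) by exact: bcs_integrable bu'.
have := integral_pushforward mphi muu iu measurableT.
rewrite preimage_setT => h; rewrite /Rintegral; congr fine; rewrite -[LHS]h.
apply: eq_measure_integral => A mA _; exact: lebesgue_translation.
Qed.

Lemma bcsM (M N r : R) (u w : borel E -> R) : bcs M r u -> measurable_fun setT w ->
  (forall x, `|w x| <= N) -> bcs (M * N) r (fun x => u x * w x).
Proof.
move=> [mu uM ur] mw wN; split.
- exact: measurable_funM.
- by move=> x; rewrite normrM ler_pM.
- by move=> x /ur ->; rewrite mul0r.
Qed.

Lemma bcsB (M N r : R) (u w : borel E -> R) : bcs M r u -> bcs N r w -> bcs (M + N) r (fun x => u x - w x).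
Proof.
move=> [mu uM ur] [mw wN wr]; split.
- exact: measurable_funB.
- by move=> x; rewrite (le_trans (ler_normB _ _))// lerD.
- by move=> x xr; rewrite ur// wr// subrr.
Qed.

Lemma bcs_widen (M N r s : R) (u : borel E -> R) : M <= N -> r <= s -> bcs M r u -> bcs N s u.
Proof.
move=> MN rs [mu uM ur]; split => // x; first exact: le_trans MN.
by move=> sx; apply: ur; exact: le_lt_trans sx.
Qed.

Lemma bcs_indic (V : set E) (r : R) : measurable (V : set (borel E)) ->
  V `<=` Bx r -> bcs 1 r \1_V.
Proof.
move=> mV Vr; split; first exact: measurable_indic.
- by move=> x; rewrite indicE; case: (_ \in _); rewrite ?normr1 ?normr0.
- move=> x xr; rewrite indicE memNset// => /Vr; rewrite /Bx/= => /(lt_le_trans xr).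
  by rewrite ltxx.
Qed.

Lemma dcube_Bx k z : exists r : R, dcube k z `<=` Bx r.
Proof.
have [->|/set0P[x0 x0z]] := eqVneq (@dcube R n k z) set0; first by exists 0.
exists (`|x0 : 'rV[R]_n| + 2 ^- k) => x xz; rewrite /Bx/=.
have := ccube_norm (dcube_ccube xz) (dcube_ccube x0z).
have := ler_normD ((x : 'rV[R]_n) - x0) x0; rewrite subrK.
by set a := `|x|; set b := `|x - x0|; set c := `|x0| => h1 h2; lra.
Qed.

(** Since [u + M] is nonnegative, it is the density of a measure. This measure agrees with [M] times
    Lebesgue measure on cubes, hence everywhere, and densities are unique almost everywhere. *)
Lemma bcs_eq0 (u : borel E -> R) (M : R) : measurable_fun setT u -> (forall x, `|u x| <= M) ->
  (forall k z, \int[L]_x (\1_(dcube k z) x * u x) = 0) ->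
  {ae L, forall x, u x = 0}.
Proof.
move=> mu uM uQ.
have M0 : 0 <= M by apply: le_trans (uM 0).
have w0 x : (0 <= (u x + M)%:E)%E.
  by rewrite lee_fin; have := uM x; rewrite ler_norml => /andP[? _]; lra.
have mw : measurable_fun setT (fun x => (u x + M)%:E).
  by apply/measurable_EFinP; apply: measurable_funD.
have [nu nuE] := density_measure L mw w0.
have key B : measurable B -> nu B = (M%:E * L B)%E.
  move=> mB.
  have := @cube_uniqueness R n nu (mscale (NngNum M0) L) _ _ B mB; apply.
    move=> k z; rewrite -[RHS]/(M%:E * L (dcube k z))%E nuE.
    have mQ := @measurable_dcube R n k z; have [r Qr] := dcube_Bx k z.
    have bQ := bcs_indic mQ Qr.
    rewrite integral_mkcond/=.
    rewrite (_ : (_ \_ _)%E = fun x => ((\1_(dcube k z) x * u x)%:E + (M * \1_(dcube k z) x)%:E)%E); last first.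
      apply/funext => x; rewrite patchE indicE; case: ifPn => _; rewrite ?mul1r ?mulr1//.
      by rewrite mul0r mulr0 adde0.
    rewrite integralD//; [|exact: (bcs_integrable (bcsM bQ mu uM))|]; last first.
      rewrite (_ : (fun x => _) = EFin \o (fun x => \1_(dcube k z) x * M)); last first.
        by apply/funext => x /=; rewrite mulrC.
      exact: (bcs_integrable (bcsM bQ (measurable_cst M) (fun=> lexx `|M|))).
    rewrite -[X in (X + _)%E]fineK; last first.
      by apply: integrable_fin_num => //; exact: (bcs_integrable (bcsM bQ mu uM)).
    rewrite [fine _]uQ add0e; under eq_integral do rewrite EFinM.
    rewrite integralZl//; last exact: (bcs_integrable bQ).
    by rewrite integral_indic// setIT.
  by move=> z; rewrite -[X in (X < _)%E]/(M%:E * L (dcube 0 z))%E lte_mul_pinfty// lebesgue_dcube_lty.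
suff : forall z, {ae L, forall x, dcube 0 z x -> u x = 0}.
  by move=> /ae_count; apply: ae_imp => x; apply.
move=> z; have mQ := @measurable_dcube R n 0 z; have [r Qr] := dcube_Bx 0 z.
have bQ := bcs_indic mQ Qr.
have iM : L.-integrable (dcube 0 z) (cst M%:E).
  apply/integrableP; split => //; rewrite integral_cst//= lte_mul_pinfty//.
  exact: lebesgue_dcube_lty.
have : ae_eq L (dcube 0 z) (cst M%:E) (fun x => (u x + M)%:E).
  apply: integral_ae_eq => //.
    by apply: measurable_funS mw.
  by move=> B BQ mB; rewrite -nuE key// integral_cst.
apply: ae_imp => x /[apply] /= [[]] h; lra.
Qed.

Lemma coord_lip i : lip_with 1 (fun x : E => (x : 'rV[R]_n) ord0 i).
Proof.
move=> x y; rewrite mul1r euclid_mdist.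
by have := coord_le_enorm ((x : 'rV_n) - y) i; rewrite !mxE.
Qed.

(** Fundamental lemma of the calculus of variations with Lipschitz test functions: the cutoffs of an
    open dyadic cube tend to the indicator of the half-open cube off finitely many null
    hyperplanes. *)
Lemma bcs_lip_eq0 (u : borel E -> R) (M : R) : measurable_fun setT u -> (forall x, `|u x| <= M) ->
  (forall (phi : E -> R) r, is_lip phi -> bcs 1 r phi -> \int[L]_x (phi x * u x) = 0) ->
  {ae L, forall x, u x = 0}.
Proof.
move=> mu uM h; apply: (bcs_eq0 mu uM) => k z.
pose V : set E := [set x : 'rV[R]_n | forall i, (z i)%:~R < 2 ^+ k * x ord0 i < (z i)%:~R + 1].
have k0 := @pow2_gt0 R k.
have oV : open V.
  pose W i := (fun x : E => 2 ^+ k * (x : 'rV[R]_n) ord0 i) @^-1` `](z i)%:~R, (z i)%:~R + 1[%classic.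
  have -> : V = ~` \bigcup_(i in [set: 'I_n]) ~` W i.
    rewrite setC_bigcup; apply/seteqP; split => x Vx i.
      by move=> _; rewrite setCK /W/= in_itv/=; exact: Vx.
    by have := Vx i I; rewrite setCK /W/= in_itv.
  apply: closed_openC; apply: closed_bigcup => [|i _]; first exact: finite_finset.
  apply: open_closedC.
  apply: open_comp; last exact: interval_open.
  move=> x _; exact: (lip_continuous (lip_withZ (2 ^+ k) (coord_lip i))).
have Vd : V `<=` dcube k z by move=> x Vx; apply: zof_eq => i; have /andP[/ltW -> ->] := Vx i.
have [r Qr] := dcube_Bx k z.
have bc j : bcs 1 r (cutoff V j : E -> R).
  split.
  - by apply: continuous_borel; apply: lip_continuous; exact: cutoff_lip.
  - by move=> x; rewrite ger0_norm ?cutoff_ge0// cutoff_le1.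
  - move=> x xr; rewrite cutoff_out// => /Vd/Qr; rewrite /Bx/= => /(lt_le_trans xr).
    by rewrite ltxx.
have mQ := @measurable_dcube R n k z.
have M0 : 0 <= M by apply: le_trans (uM 0).
have := @bcs_dct (1 * M) r (fun j x => cutoff V j x * u x) (fun x => \1_(dcube k z) x * u x).
move=> /(_ (fun j => bcsM (bc j) mu uM)).
have -> : (fun j => \int[L]_x (cutoff V j x * u x)) = cst 0.
  by apply/funext => j; apply: (h _ r) => //; exists j%:R; exact: cutoff_lip.
move=> H; suff H0 : cst (0 : R) x @[x --> \oo] --> \int[L]_x (\1_(dcube k z) x * u x).
  by rewrite -(cvg_lim _ H0)//; exact: lim_cst.
apply: H.
  by apply: measurable_funM => //; exact: measurable_indic.
have : {ae L, forall x : borel E, forall i : 'I_n, (x : 'rV[R]_n) ord0 i <> (z i)%:~R / 2 ^+ k}.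
  apply: ae_count => i; apply: ae_null; first exact: measurable_hyperplane.
  exact: lebesgue_hyperplane.
apply: ae_imp => x hx; apply: cvgMl.
have -> : \1_(dcube k z) x = \1_V x :> R; last exact: cutoff_cvg.
rewrite !indicE; congr (_%:R); congr nat_of_bool; apply/idP/idP; rewrite !inE; last exact: Vd.
move=> xz i; have := zofP k x i; rewrite xz => /andP[h1 h2]; rewrite h2 andbT lt_neqAle h1 andbT.
by apply/eqP => e; apply: (hx i); rewrite e mulrC mulKf// gt_eqF.
Qed.

End bounded_compact_support.

Section partial_derivatives.
Context {R : realType} {n : nat}.
Local Notation E := (euclid R n).
Local Notation L := (@lebesgueRn R n).

Lemma sup_lip_with (K : R) (g : E -> R) : 0 <= K ->
  (forall x y : 'rV[R]_n, `|g x - g y| <= K * `|x - y|) -> lip_with K g.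
Proof.
move=> K0 gK x y; rewrite (le_trans (gK x y))// euclid_mdist ler_wpM2l//.
exact: norm_le_enorm.
Qed.

Lemma lip_with_sup (C : R) (g : E -> R) : lip_with C g ->
  forall x y : 'rV[R]_n, `|g x - g y| <= `|C| * n%:R * `|x - y|.
Proof.
move=> gC x y; rewrite (le_trans (gC x y))// euclid_mdist.
apply: (@le_trans _ _ (`|C| * enorm (x - y))); first by rewrite ler_wpM2r ?enorm_ge0// ler_norm.
by rewrite -mulrA ler_wpM2l// enorm_le_norm.
Qed.

(** Since [0^-1 = 0], the quotient vanishes at [h = 0], and the Lipschitz bound on it holds for all
    [h]. *)
Definition dq (f : E -> R) (v : 'rV[R]_n) (h : R) (x : 'rV[R]_n) : R :=
  h^-1 * (f (x + h *: v) - f x).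

Definition der_set (f : E -> R) (v : 'rV[R]_n) : set (borel E) :=
  [set x | derivable (f : 'rV[R]_n -> R) x v].

Lemma derivable_dq (f : E -> R) (v x : 'rV[R]_n) :
  derivable (f : 'rV[R]_n -> R) x v <-> cvg (dq f v h x @[h --> 0^']).
Proof.
rewrite /derivable (_ : (fun h => _) = (fun h => dq f v h x))//.
by apply/funext => h; rewrite /dq /= [h *: v + x]addrC.
Qed.

Lemma sigma_finite_lebesgueRn : sigma_finite [set: borel E] L.
Proof.
exists (fun k => Bx k%:R) => [|k]; last by split; [exact: measurable_Bx|exact: lebesgue_Bx_lty].
apply/esym; rewrite -subTset => x _.
have [m _ /(_ _ (leqnn _))/= hm] := nbhs_infty_ger `|x : 'rV[R]_n|.
by exists m.
Qed.

(** A named copy of the measure carrying the sigma-finite structure that Tonelli's theorem asks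
    for. *)
Definition sigma_finite_leb : set (borel E) -> \bar R := L.
HB.instance Definition _ := Measure.copy sigma_finite_leb L.
HB.instance Definition _ :=
  Measure_isSigmaFinite.Build _ _ _ sigma_finite_leb sigma_finite_lebesgueRn.

Section fixed_function.
Variables (f : E -> R) (K : R).
Hypothesis K0 : 0 <= K.
Hypothesis fK : forall x y : 'rV[R]_n, `|f x - f y| <= K * `|x - y|.

Lemma dq_bound v h x : `|dq f v h x| <= K * `|v|.
Proof.
rewrite /dq normrM; have [->|h0] := eqVneq h 0.
  by rewrite invr0 normr0 mul0r mulr_ge0.
rewrite normfV ler_pdivrMl ?normr_gt0// mulrCA (le_trans (fK _ _))//.
by rewrite addrAC subrr add0r normrZ.
Qed.

Lemma dq_lip v h : exists C : R, 0 <= C /\ lip_with C (dq f v h : E -> R).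
Proof.
exists (`|h^-1| * (K + K)); split; first by rewrite mulr_ge0// addr_ge0.
apply: lip_withZ; apply: lip_withD.
  apply: sup_lip_with => // x y; rewrite (le_trans (fK _ _))//.
  by rewrite opprD addrACA subrr addr0.
by apply: sup_lip_with => // x y; rewrite -opprD normrN.
Qed.

Lemma measurable_dq v h : measurable_fun setT (dq f v h : borel E -> R).
Proof. by have [C [_ hC]] := dq_lip v h; apply: continuous_borel; exact: lip_continuous hC. Qed.

(** Closed sets in a Cauchy criterion with tolerance [1/(m+1)] and radius [1/(j+1)]: derivability
    becomes a countable intersection of countable unions of them, hence a Borel condition. *)
Let A v (m j : nat) : set E := [set x | forall h k : R,
  0 < `|h| < j.+1%:R^-1 -> 0 < `|k| < j.+1%:R^-1 ->
  `|dq f v h x - dq f v k x| <= m.+1%:R^-1].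

Let closed_A v m j : closed (A v m j).
Proof.
have -> : A v m j = \bigcap_(p in [set p : R * R | 0 < `|p.1| < j.+1%:R^-1 /\ 0 < `|p.2| < j.+1%:R^-1])
   [set x | `|dq f v p.1 x - dq f v p.2 x| <= m.+1%:R^-1].
  apply/seteqP; split => x /= Ax; first by move=> [h k] /= [? ?]; exact: Ax.
  by move=> h k hh hk; exact: (Ax (h, k)).
apply: closed_bigI => -[h k] _ /=.
have [C [C0 hC]] := dq_lip v h; have [D [D0 hD]] := dq_lip v k.
have cg : continuous (fun x : E => dq f v h x - dq f v k x).
  apply: (@lip_continuous _ _ (C + `|-1| * D)).
  have := lip_withD hC (lip_withZ (-1) hD); congr (lip_with _ _).
  by apply/funext => x; rewrite mulN1r.
rewrite (_ : mkset _ = (fun x : E => `|dq f v h x - dq f v k x|) @^-1` [set y | y <= m.+1%:R^-1])//.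
apply: closed_comp => [x _|]; last exact: closed_le.
exact: (cvg_norm (cg x)).
Qed.

Let der_setE v : der_set f v = \bigcap_m \bigcup_j A v m j.
Proof.
apply/seteqP; split => x.
  move=> /derivable_dq/cvg_ex[/= l /cvgrPdist_le cl] m _.
  have e0 : 0 < m.+1%:R^-1 / 2 :> R by rewrite divr_gt0.
  have [e /= eg0 he] := cl _ e0.
  have [j _ /(_ _ (leqnn _))/= je] := near_infty_natSinv_lt (PosNum eg0).
  exists j => // h k /andP[h0 hj] /andP[k0 kj].
  have H t : 0 < `|t| -> `|t| < j.+1%:R^-1 -> `|l - dq f v t x| <= m.+1%:R^-1 / 2.
    move=> t0 tj; apply: he; last by rewrite -normr_gt0.
    by rewrite /ball_/= sub0r normrN (lt_trans tj).
  rewrite [leRHS]splitr (le_trans (ler_distD l _ _))// lerD ?H//.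
  by rewrite distrC H.
move=> h; apply/derivable_dq; apply: cauchy_cvg; apply: cauchy_exP => e e0.
have [m _ /(_ _ (leqnn _))/= me] := near_infty_natSinv_lt (PosNum e0).
have [j _ Aj] := h m I.
have j0 : 0 < j.+1%:R^-1 :> R by rewrite invr_gt0.
exists (dq f v (j.+1%:R^-1 / 2) x); exists (j.+1%:R^-1) => //= k /=.
rewrite /ball_/= sub0r normrN => kj k0; apply: (le_lt_trans _ me).
apply: Aj; last by rewrite normr_gt0 k0.
by rewrite ger0_norm ?divr_ge0 ?ltW// divr_gt0//= ltr_pdivrMr// ltr_pMr// ltr1n.
Qed.

Lemma measurable_der_set v : measurable (der_set f v).
Proof.
rewrite der_setE; apply: bigcapT_measurable => m; apply: bigcupT_measurable => j.
exact: (closed_borel (@closed_A v m j)).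
Qed.

(* The null set is averaged over its translates along v, which Tonelli reduces to the one-dimensional case. *)
Lemma ae_derivable v : {ae L, forall x, derivable (f : 'rV[R]_n -> R) x v}.
Proof.
pose N := ~` der_set f v; have mN : measurable N by apply: measurableC; exact: measurable_der_set.
suff N0 : L N = 0%E by apply: ae_imp (ae_null mN N0) => x /contrapT.
pose LS : {sigma_finite_measure set (borel E) -> \bar R} := sigma_finite_leb.
pose mu := @lebesgue_measure R.
pose phi (p : borel E * measurableTypeR R) : borel E := (p.1 : 'rV[R]_n) + p.2 *: (v : 'rV[R]_n).
have mphi : measurable_fun setT phi.
  apply: measurable_to_rV => i; under eq_fun do rewrite !mxE.
  apply: measurable_funD.
    by apply: (measurableT_comp (f := fun x : borel E => (x : 'rV[R]_n) ord0 i)); [exact: measurable_coord|exact: measurable_fst].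
  by apply: measurable_funM => //; exact: measurable_snd.
pose F p : \bar R := (\1_N (phi p) * \1_(`]0, 1[%classic : set R) p.2)%:E.
have mF : measurable_fun setT F.
  apply/measurable_EFinP; apply: measurable_funM.
    by apply: measurableT_comp => //; exact: measurable_indic.
  by apply: measurableT_comp => //; apply: measurable_indic; exact: measurable_itv.
have F0 p : (0 <= F p)%E by rewrite lee_fin mulr_ge0.
have := @fubini_tonelli _ _ _ _ R LS mu F mF F0.
have -> : (\int[LS]_x \int[mu]_y F (x, y))%E = 0%E.
  apply: integral0_eq => x _.
  pose S := `]0, 1[%classic `&` [set t | N ((x : 'rV[R]_n) + t *: v)] : set (measurableTypeR R).
  have mS : measurable S.
    apply: measurableI; first exact: measurable_itv.
    have := @measurable_xsection _ _ _ _ (phi @^-1` N) x.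
    rewrite -[X in measurable X]setTI => /(_ (mphi measurableT _ mN)).
    congr (measurable _); apply/funext => t; rewrite /xsection/=; apply/propext.
    by split => [|h]; rewrite inE.
  have S0 : mu S = 0%E.
    apply: ae_null_sub => //.
    pose h t := f ((x : 'rV[R]_n) + t *: v).
    have := @lipschitz_derivable R h (K * `|v|).
    have hL s t : `|h s - h t| <= K * `|v| * `|s - t|.
      rewrite (le_trans (fK _ _))// -mulrA ler_wpM2l// opprD addrACA subrr add0r -scalerBl.
      by rewrite normrZ mulrC.
    move=> /(_ hL); apply: ae_imp => t ht [/= t01 Nt]; apply: Nt.
    rewrite in_itv/= in t01; have := ht t01; rewrite /der_set /derivable/=.
    have -> : (fun s : R => s^-1 *: (h (s *: (1 : R) + t) - h t)) =
      (fun s : R => s^-1 *: (f (s *: v + (x + t *: v)) - f (x + t *: v)) : R).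
      by apply/funext => s; rewrite /h [s *: 1]mulr1 scalerDl addrCA.
    by [].
  rewrite (_ : (fun y => F (x, y)) = (fun y => (\1_S y)%:E)); last first.
    by apply/funext => t; rewrite /F /= /S indicI /= mulrC.
  by rewrite integral_indic// setIT.
(* In the other order of integration each slice is a translate of [N], so translation invariance
   gives [L N] for every [t] in []0, 1[]. *)
move=> /esym; rewrite (_ : (fun y => _) = (fun t => (\1_(`]0, 1[%classic : set R) t)%:E * L N)%E); last first.
  apply/funext => t; rewrite /F/=.
  under eq_integral do rewrite mulrC EFinM.
  have mNt : measurable [set x : borel E | N (phi (x, t))].
    by have := measurable_shift (t *: v : 'rV[R]_n) measurableT mN; rewrite setTI.
  rewrite ge0_integralZl//; last by apply/measurable_EFinP; exact: (measurable_indic mNt).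
  congr (_ * _)%E; rewrite -(@lebesgue_translation R n (t *: v) N mN).
  transitivity (\int[L]_x (\1_[set x : borel E | N (phi (x, t))] x)%:E)%E => //.
  by rewrite integral_indic// setIT.
have LN0 : (0 <= L N)%E by [].
rewrite ge0_integralZr//; last first.
  by apply/measurable_EFinP; apply: measurable_indic; exact: measurable_itv.
have mI : measurable (`]0, 1[%classic : set (measurableTypeR R)) by exact: measurable_itv.
have -> : (\int[mu]_x (\1_(`]0, 1[%classic : set R) x)%:E = 1)%E.
  rewrite (integral_indic mu measurableT mI) setIT.
  transitivity (lebesgue_measure (`]0 : R, 1 : R[%classic : set R)) => //.
  by rewrite lebesgue_measure_itv/= lte_fin ltr01 sube0.
by rewrite mul1e.
Qed.

Lemma derive_seq v x : derivable (f : 'rV[R]_n -> R) x v ->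
  dq f v k.+1%:R^-1 x @[k --> \oo] --> ('D_v (f : 'rV[R]_n -> R) x : R).
Proof.
move=> /derivable_dq dx; rewrite /derive.
rewrite (_ : (fun h => h^-1 *: _) = (fun h => dq f v h x)); last first.
  by apply/funext => h; rewrite /dq /= [h *: v + x]addrC.
apply/cvgrPdist_le => e e0; have /cvgrPdist_le/(_ e e0)[d /= d0 hd] := dx.
near=> k; apply: hd => //=; rewrite sub0r normrN ger0_norm//.
by near: k; exact: (near_infty_natSinv_lt (PosNum d0)).
Unshelve. all: by end_near. Qed.

Lemma derive_bound v x : derivable (f : 'rV[R]_n -> R) x v ->
  `|'D_v (f : 'rV[R]_n -> R) x : R| <= K * `|v|.
Proof.
move=> /derive_seq/cvg_norm dc.
rewrite -(cvg_lim _ dc)//; apply: limr_le; first by apply: cvgP dc.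
by near=> k; exact: dq_bound.
Unshelve. all: by end_near. Qed.

Lemma bcs_shift (w : 'rV[R]_n) M r (u : borel E -> R) : bcs M r u ->
  bcs M (r + `|w|) (fun x => u ((x : 'rV[R]_n) + w)).
Proof.
move=> [mu uM ur]; split => [|x|x xr]; [|exact: uM|].
  exact: (measurableT_comp mu (measurable_shift w)).
apply: ur; have := ler_normB ((x : 'rV[R]_n) + w) w.
by rewrite addrK => h; rewrite -(ltrD2r `|w|); exact: lt_le_trans xr h.
Qed.

(** The derivative cut off to a Borel set of derivability points. There it is a limit of continuous
    quotients, so the product is measurable however ['D_v] is defined elsewhere. *)
Let dv (G : set (borel E)) v x : R := \1_G x * 'D_v (f : 'rV[R]_n -> R) x.

Lemma dv_cvg (G : set (borel E)) v x : G `<=` der_set f v ->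
  \1_G x * dq f v k.+1%:R^-1 x @[k --> \oo] --> dv G v x.
Proof.
move=> Gv; rewrite /dv indicE; case: (boolP (x \in G)); last first.
  by under eq_fun do rewrite mul0r; rewrite mul0r => _; exact: cvg_cst.
rewrite inE => /Gv/derive_seq dc; under eq_fun do rewrite mul1r.
by rewrite [true%:R * _]mul1r.
Qed.

Lemma measurable_dv (G : set (borel E)) v : measurable G -> G `<=` der_set f v ->
  measurable_fun setT (dv G v).
Proof.
move=> mG Gv; apply: (measurable_fun_cvg (h := fun k x => \1_G x * dq f v k.+1%:R^-1 x)); last first.
  by move=> x _; exact: dv_cvg.
by move=> k; apply: measurable_funM; [exact: measurable_indic|exact: measurable_dq].
Qed.

Lemma dv_bound (G : set (borel E)) v x : G `<=` der_set f v -> `|dv G v x| <= K * `|v|.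
Proof.
move=> Gv; rewrite /dv indicE; case: (boolP (x \in G)).
  by rewrite inE mul1r => /Gv/derive_bound.
by rewrite mul0r normr0 mulr_ge0.
Qed.

(** The quotient along [v + w] minus the one along [w] is the quotient along [v] taken at [x + t w].
    Against a Lipschitz test function the shift is moved to the test function by translation
    invariance, and there its effect tends to [0] uniformly while the quotients stay bounded. *)
Lemma ae_deriveD v w : {ae L, forall x, 'D_(v + w) (f : 'rV[R]_n -> R) x =
  'D_v (f : 'rV[R]_n -> R) x + 'D_w (f : 'rV[R]_n -> R) x}.
Proof.
pose G := der_set f v `&` der_set f w `&` der_set f (v + w).
have mG : measurable G.
  by apply: measurableI; [apply: measurableI|]; exact: measurable_der_set.
have Gv : G `<=` der_set f v by move=> x [[]].
have Gw : G `<=` der_set f w by move=> x [[]].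
have Gvw : G `<=` der_set f (v + w) by move=> x [].
have aeG : {ae L, forall x, G x}.
  exact: ae_and (ae_and (ae_derivable v) (ae_derivable w)) (ae_derivable (v + w)).
pose u x := dv G (v + w) x - dv G v x - dv G w x.
have mu : measurable_fun setT u.
  by apply: measurable_funB; [apply: measurable_funB|]; exact: measurable_dv.
pose M := K * `|v + w| + K * `|v| + K * `|w|.
have uM x : `|u x| <= M.
  by rewrite (le_trans (ler_normB _ _))// lerD ?dv_bound// (le_trans (ler_normB _ _))// lerD ?dv_bound.
suff : {ae L, forall x, u x = 0}.
  move=> u0; apply: ae_imp (ae_and aeG u0) => x [Gx]; rewrite /u /dv indicE mem_set//= !mul1r.
  by move=> h; lra.
apply: (bcs_lip_eq0 mu uM) => phi r [C phiC] bphi.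
pose t k : R := k.+1%:R^-1.
pose g k x := dq f (v + w) (t k) x - dq f v (t k) x - dq f w (t k) x.
have mg k : measurable_fun setT (g k : borel E -> R).
  by apply: measurable_funB; [apply: measurable_funB|]; exact: measurable_dq.
have gM k x : `|g k x| <= M.
  by rewrite (le_trans (ler_normB _ _))// lerD ?dq_bound// (le_trans (ler_normB _ _))// lerD ?dq_bound.
have lim1 : \int[L]_x (phi x * g k x) @[k --> \oo] --> \int[L]_x (phi x * u x).
  apply: (@bcs_dct _ _ (1 * M) r (fun k x => phi x * g k x)).
  - by move=> k; exact: bcsM bphi (mg k) (gM k).
  - by apply: measurable_funM => //; case: bphi.
  apply: ae_imp aeG => x Gx; apply: cvgMr; rewrite /u /dv indicE mem_set//= !mul1r.
  apply: cvgB; first apply: cvgB; apply: derive_seq; [exact: Gvw|exact: Gv|exact: Gw].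
apply: (cvg_unique _ lim1) => //.
pose psi k (x : 'rV[R]_n) := phi (x - t k *: w) - phi x.
have t1 k : 0 <= t k <= 1 by rewrite /t invr_ge0 ler0n/= invf_le1// ler1n.
have bpsi k : bcs 2 (r + `|w|) (psi k).
  have -> : 2 = 1 + 1 :> R by lra.
  apply: bcsB; last by apply: bcs_widen bphi => //; rewrite lerDl.
  have := bcs_shift (- (t k *: w)) bphi; apply: bcs_widen => //.
  rewrite normrN lerD2l normrZ ger0_norm; last by case/andP: (t1 k).
  by rewrite ler_piMl//; case/andP: (t1 k).
have eqk k : \int[L]_x (phi x * g k x) = \int[L]_x (psi k x * dq f v (t k) x).
  have mdq := measurable_dq v (t k).
  have bdq := fun x => dq_bound v (t k) x.
  have b1 : bcs (1 * (K * `|v|)) (r + `|- (t k *: w)|) (fun x => phi ((x : 'rV[R]_n) - t k *: w) * dq f v (t k) x).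
    exact: bcsM (bcs_shift (- (t k *: w)) bphi) mdq bdq.
  have b2 : bcs (1 * (K * `|v|)) r (fun x => phi x * dq f v (t k) x) by exact: bcsM.
  have b3 := bcs_shift (t k *: w) b1.
  have e1 : \int[L]_x (phi x * dq f v (t k) ((x : 'rV[R]_n) + t k *: w)) =
     \int[L]_x (phi ((x : 'rV[R]_n) - t k *: w) * dq f v (t k) x).
    by rewrite -(bcs_translation (t k *: w) b1); apply: eq_Rintegral => x _; rewrite addrK.
  have b4 : bcs (1 * (K * `|v|)) r (fun x => phi x * dq f v (t k) ((x : 'rV[R]_n) + t k *: w)).
    apply: bcsM => //; exact: (measurableT_comp mdq (measurable_shift _)).
  transitivity (\int[L]_x (phi x * dq f v (t k) ((x : 'rV[R]_n) + t k *: w)) - \int[L]_x (phi x * dq f v (t k) x)).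
    rewrite -RintegralB//; last 2 first.
    - exact: bcs_integrable b4.
    - exact: bcs_integrable b2.
    apply: eq_Rintegral => x _; rewrite -mulrBr /g /dq; congr (_ * _).
    rewrite -!mulrBr; congr (_ * _); rewrite scalerDr addrA [x + _ + _]addrAC.
    by ring.
  rewrite e1 -RintegralB//; last 2 first.
  - exact: bcs_integrable b1.
  - exact: bcs_integrable b2.
  by apply: eq_Rintegral => x _; rewrite -mulrBl.
change (\int[L]_x (phi x * g k x) @[k --> \oo] --> (0 : R)); rewrite (funext eqk).
have -> : 0 = \int[L]_x (fun _ : borel E => 0 : R) x.
  by rewrite /Rintegral integral0.
apply: (@bcs_dct _ _ (2 * (K * `|v|)) (r + `|w|) (fun k x => psi k x * dq f v (t k) x)) => //.
  move=> k; apply: bcsM (bpsi k) (measurable_dq v (t k)) _ => x; exact: dq_bound.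
apply: aeW => x; apply/cvgrPdist_le => e e0.
pose B := `|C| * n%:R * `|w| * (K * `|v|) + 1.
have B0 : 0 < B by rewrite ltr_wpDl// mulr_ge0// mulr_ge0.
near=> k; rewrite sub0r normrN normrM.
apply: (@le_trans _ _ (t k * B)); last first.
  rewrite -ler_pdivlMr//; near: k; apply: filterS (near_infty_natSinv_lt (PosNum (divr_gt0 e0 B0))) => k.
  exact: ltW.
apply: (@le_trans _ _ ((`|C| * n%:R * (t k * `|w|)) * (K * `|v|))).
  apply: ler_pM => //; last exact: dq_bound.
  rewrite (le_trans (lip_with_sup phiC _ _))// addrAC subrr add0r normrN normrZ.
  by rewrite [`|t k|]ger0_norm//; case/andP: (t1 k).
rewrite /B mulrDr mulr1 -[leLHS]addr0 lerD//; last by case/andP: (t1 k).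
by rewrite le_eqVlt; apply/orP; left; apply/eqP; ring.
Unshelve. all: by end_near. Qed.

Lemma derive_cvgE v (x : 'rV[R]_n) (l : R) : dq f v h x @[h --> 0^'] --> l ->
  'D_v (f : 'rV[R]_n -> R) x = l.
Proof.
move=> fl; rewrite /derive (_ : (fun h => h^-1 *: _) = (fun h => dq f v h x)).
  exact: cvg_lim fl.
by apply/funext => h; rewrite /dq /= [h *: v + x]addrC.
Qed.

Lemma derivable_cvg v (x : 'rV[R]_n) : derivable (f : 'rV[R]_n -> R) x v ->
  dq f v h x @[h --> 0^'] --> ('D_v (f : 'rV[R]_n -> R) x : R).
Proof. by move=> /derivable_dq/cvg_ex[/= l fl]; rewrite (derive_cvgE fl). Qed.

Lemma deriveZ v (x : 'rV[R]_n) a : derivable (f : 'rV[R]_n -> R) x v ->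
  'D_(a *: v) (f : 'rV[R]_n -> R) x = a * 'D_v (f : 'rV[R]_n -> R) x.
Proof.
move=> /derivable_cvg; set l := 'D_v _ x => fl; apply: derive_cvgE.
have [->|a0] := eqVneq a 0.
  rewrite mul0r; apply: cvg_near_cst; near=> h.
  by rewrite /dq scale0r scaler0 addr0 subrr mulr0.
have dqE h : dq f (a *: v) h x = a * dq f v (h * a) x.
  by rewrite /dq scalerA invfM mulrA [a * _]mulrCA divff// mulr1.
under eq_fun do rewrite dqE; apply: cvgMr; apply/cvgrPdist_le => e e0.
have /cvgrPdist_le/(_ e e0)[d /= d0 hd] := fl.
have a00 : 0 < `|a| by rewrite normr_gt0.
exists (d / `|a|) => /=; first by rewrite divr_gt0.
move=> h /=; rewrite sub0r normrN ltr_pdivlMr// => hda h0.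
by apply: hd; rewrite ?mulf_neq0//= sub0r normrN normrM.
Unshelve. all: by end_near. Qed.

Lemma ae_derive_linear v : {ae L, forall x, 'D_v (f : 'rV[R]_n -> R) x =
  \sum_i v ord0 i * 'D_(delta_mx ord0 i) (f : 'rV[R]_n -> R) x}.
Proof.
suff key s : {ae L, forall x, 'D_(\sum_(i <- s) v ord0 i *: delta_mx ord0 i) (f : 'rV[R]_n -> R) x =
  \sum_(i <- s) v ord0 i * 'D_(delta_mx ord0 i) (f : 'rV[R]_n -> R) x}.
  by apply: ae_imp (key (index_enum _)) => x; rewrite -row_sum_delta.
elim: s => [|i s IH].
  apply: aeW => x; rewrite !big_nil; apply: derive_cvgE; apply: cvg_near_cst; near=> h.
  by rewrite /dq scaler0 addr0 subrr mulr0.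
have := ae_and (ae_derivable (delta_mx ord0 i))
  (ae_and IH (ae_deriveD (v ord0 i *: delta_mx ord0 i) (\sum_(j <- s) v ord0 j *: delta_mx ord0 j))).
by apply: ae_imp => x [d1 [d2 d3]]; rewrite !big_cons d3 d2 deriveZ.
Unshelve. all: by end_near. Qed.

(** Finitely many rational directions form a net of mesh [1/N] in the unit ball, so the directional
    limits hold along all of them with one radius. The Lipschitz bound transfers the estimate from
    the nearest rational direction to [y] itself. *)
Lemma frechet_of_rational (x : 'rV[R]_n) (l : 'I_n -> R) :
  (forall q : {ffun 'I_n -> rat},
     dq f (\row_i ratr (q i)) h x @[h --> 0^'] --> \sum_i ratr (q i) * l i) ->
  forall e, 0 < e -> exists2 d, 0 < d & forall y : 'rV[R]_n, `|y| < d ->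
    `|f (x + y) - f x - \sum_i y ord0 i * l i| <= e * `|y|.
Proof.
move=> fl e e0; pose La := \sum_i `|l i|.
have La0 : 0 <= La by apply: sumr_ge0.
have KL : 0 < (K + La + 1) / (e / 2) by rewrite !divr_gt0// ltr_wpDl// addr_ge0.
have [N' _ /(_ _ (leqnn _))/= hN'] := nbhs_infty_gtr ((K + La + 1) / (e / 2)).
pose N := N'; have N0 : 0 < N%:R :> R by rewrite (lt_trans KL).
have hN : (K + La) / N%:R <= e / 2.
  rewrite ler_pdivrMr// mulrC -ler_pdivrMr ?divr_gt0//; apply: le_trans (ltW hN').
  by rewrite ler_pM2r ?invr_gt0 ?divr_gt0// lerDl.
(* The grid points [g/N - 1], with [g] from [0] to [2 N] in each coordinate, fill the cube
   [[-1, 1]^n]. *)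
pose q (g : {ffun 'I_n -> 'I_(2 * N).+1}) : {ffun 'I_n -> rat} :=
  [ffun i => (g i)%:R / N%:R - 1].
have : \forall h \near (0 : R)^', forall g : {ffun 'I_n -> 'I_(2 * N).+1},
    `|\sum_i ratr (q g i) * l i - dq f (\row_i ratr (q g i)) h x| <= e / 2.
  apply: filter_forall => g.
  by have /cvgrPdist_le := fl (q g); apply; rewrite divr_gt0.
move=> [d /= d0 hd]; exists d => // y yd.
have [->|y0] := eqVneq y 0.
  rewrite addr0 subrr sub0r normrN normr0 mulr0 big1 ?normr0// => i _.
  by rewrite mxE mul0r.
pose h := `|y|; have h0 : 0 < h by rewrite normr_gt0.
pose v := h^-1 *: y.
have vE : y = h *: v by rewrite scalerA divff ?scale1r// gt_eqF.
have v1 i : `|v ord0 i| <= 1.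
  rewrite mxE normrM ger0_norm ?invr_ge0 ?(ltW h0)// mulrC ler_pdivrMr// mul1r.
  exact: coord_le_norm.
pose g : {ffun 'I_n -> 'I_(2 * N).+1} := [ffun i => inord (Num.truncn (N%:R * (v ord0 i + 1)))].
have gE i : `|v ord0 i - ratr (q g i)| <= N%:R^-1.
  have := v1 i; rewrite ler_norml => /andP[v1a v1b].
  have w0 : 0 <= N%:R * (v ord0 i + 1) by rewrite mulr_ge0 ?ler0n//; lra.
  have /andP[t1 t2] := truncn_itv w0.
  rewrite ffunE rmorphB rmorph1 fmorph_div /= !ratr_nat ffunE inordK; last first.
    rewrite ltnS -(ler_nat R) (le_trans t1)// natrM mulrC ler_pM2r//; lra.
  rewrite -natr1 in t2; set T := _%:R in t1 t2 *.
  have -> : v ord0 i - (T / N%:R - 1) = (N%:R * (v ord0 i + 1) - T) / N%:R.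
    by field; rewrite gt_eqF.
  rewrite normrM [`|N%:R^-1|]ger0_norm ?invr_ge0 ?(ltW N0)//.
  rewrite ler_piMl ?invr_ge0 ?(ltW N0)// ler_norml; apply/andP; split; lra.
pose w : 'rV[R]_n := \row_i ratr (q g i).
have vw : `|v - w| <= N%:R^-1.
  by apply: rV_norm_le; [rewrite invr_ge0 ltW|move=> i; rewrite !mxE; have := gE i; rewrite mxE].
have := hd h; rewrite /= sub0r normrN ger0_norm ?(ltW h0)// => /(_ yd); rewrite gt_eqF// => /(_ isT g).
rewrite -/w => hw.
have -> : f (x + y) - f x - \sum_i y ord0 i * l i =
    (f (x + y) - f (x + h *: w)) + h * (dq f w h x - \sum_i ratr (q g i) * l i)
    - h * \sum_i (v - w) ord0 i * l i.
  rewrite /dq mulrBr mulrA divff ?gt_eqF// mul1r.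
  have -> : \sum_i y ord0 i * l i = h * \sum_i v ord0 i * l i.
    by rewrite mulr_sumr; apply: eq_bigr => i _; rewrite {1}vE mxE mulrA.
  have -> : \sum_i (v - w) ord0 i * l i = \sum_i v ord0 i * l i - \sum_i ratr (q g i) * l i.
    rewrite -sumrB; apply: eq_bigr => i _; rewrite -mulrBl; congr (_ * _).
    by rewrite [LHS]mxE [X in _ + X]mxE [w _ _]mxE.
  by ring.
have b1 : `|f (x + y) - f (x + h *: w)| <= h * (K / N%:R).
  rewrite (le_trans (fK _ _))// opprD addrACA subrr add0r vE -scalerBr normrZ.
  by rewrite (ger0_norm (ltW h0)) mulrCA ler_pM2l// ler_wpM2l.
have b2 : `|h * (dq f w h x - \sum_i ratr (q g i) * l i)| <= h * (e / 2).
  by rewrite normrM (ger0_norm (ltW h0)) ler_pM2l// distrC.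
have b3 : `|h * \sum_i (v - w) ord0 i * l i| <= h * (La / N%:R).
  rewrite normrM (ger0_norm (ltW h0)) ler_pM2l// (le_trans (ler_norm_sum _ _ _))//.
  rewrite /La mulr_suml; apply: ler_sum => i _; rewrite normrM mulrC ler_wpM2l//.
  exact: le_trans (coord_le_norm _ _) vw.
apply: (le_trans (ler_normB _ _)); apply: (@le_trans _ _ (h * (K / N%:R) + h * (e / 2) + h * (La / N%:R))).
  by rewrite lerD// (le_trans (ler_normD _ _))// lerD.
rewrite -!mulrDr mulrC ler_pM2r//; rewrite mulrDl in hN.
by have := splitr e; lra.
Qed.

End fixed_function.
End partial_derivatives.

Section scalar_differentiability.
Context {R : realType} {n : nat}.
Local Notation E := (euclid R n).
Local Notation L := (@lebesgueRn R n).
Local Notation e_ i := (delta_mx ord0 i : 'rV[R]_n).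
Local Notation qv q := (\row_i ratr (q i) : 'rV[R]_n).

Definition frechet (f : E -> R) (x : 'rV[R]_n) (l : 'I_n -> R) :=
  forall e, 0 < e -> exists2 d, 0 < d & forall y : 'rV[R]_n, `|y| < d ->
    `|f (x + y) - f x - \sum_i y ord0 i * l i| <= e * `|y|.

Definition grad (f : E -> R) (x : 'rV[R]_n) (i : 'I_n) : R :=
  'D_(e_ i) (f : 'rV[R]_n -> R) x.

(* For a Lipschitz function this is equivalent to differentiability at x,
   and it is visibly a Borel condition. *)
Definition rational_diff (f : E -> R) : set (borel E) :=
  [set x | (forall i, derivable (f : 'rV[R]_n -> R) x (e_ i)) /\
   forall q : {ffun 'I_n -> rat}, derivable (f : 'rV[R]_n -> R) x (qv q) /\
    'D_(qv q) (f : 'rV[R]_n -> R) x = \sum_i qv q ord0 i * grad f x i].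

Lemma frechet_dq (f : E -> R) x l v : frechet f x l ->
  dq f v h x @[h --> 0^'] --> \sum_i v ord0 i * l i.
Proof.
move=> fl; apply/cvgrPdist_le => e e0.
have v0 : 0 < `|v| + 1 by rewrite ltr_wpDl.
have [d d0 hd] := fl (e / (`|v| + 1)) (divr_gt0 e0 v0).
exists (d / (`|v| + 1)) => /=; first by rewrite divr_gt0.
move=> h /=; rewrite sub0r normrN => hv h0.
have hv' : `|h *: v| < d.
  rewrite normrZ; apply: (@le_lt_trans _ _ (`|h| * (`|v| + 1))); first by rewrite ler_wpM2l// lerDl.
  by rewrite -ltr_pdivlMr.
rewrite distrC /dq; have -> : \sum_i v ord0 i * l i = h^-1 * \sum_i (h *: v) ord0 i * l i.
  by rewrite mulr_sumr; apply: eq_bigr => i _; rewrite mxE !mulrA mulVf// mul1r.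
rewrite -mulrBr normrM normfV ler_pdivrMl ?normr_gt0// (le_trans (hd _ hv'))//.
rewrite normrZ mulrCA ler_wpM2l// -mulrA ler_piMr ?(ltW e0)//.
by rewrite mulrC ler_pdivrMr// mul1r lerDl.
Qed.

Section lipschitz.
Variables (f : E -> R) (C : R).
Hypothesis fC : lip_with C f.
Let K := `|C| * n%:R.
Let K0 : 0 <= K. Proof. by rewrite mulr_ge0. Qed.
Let fK : forall x y : 'rV[R]_n, `|f x - f y| <= K * `|x - y|.
Proof. exact: lip_with_sup fC. Qed.

Lemma rational_diff_frechet x : rational_diff f x -> frechet f x (grad f x).
Proof.
move=> [_ h]; apply: (frechet_of_rational K0 fK) => q.
have [/derivable_cvg + dE] := h q; rewrite dE.
suff -> : \sum_i qv q ord0 i * grad f x i = \sum_i ratr (q i) * grad f x i by [].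
by apply: eq_bigr => i _; rewrite mxE.
Qed.

Lemma frechet_rational_diff x l : frechet f x l -> rational_diff f x /\ forall i, grad f x i = l i.
Proof.
move=> fl; have gE i : grad f x i = l i.
  rewrite /grad (derive_cvgE (frechet_dq (v := e_ i) fl)).
  rewrite (bigD1 i)//= mxE !eqxx mul1r big1 ?addr0// => j ji.
  by rewrite mxE eqxx (negbTE ji) mul0r.
split => //; split=> [i|q]; last split.
- by apply/derivable_dq/cvg_ex; eexists; exact: (frechet_dq fl).
- by apply/derivable_dq/cvg_ex; eexists; exact: (frechet_dq fl).
- rewrite (derive_cvgE (frechet_dq (v := qv q) fl)); apply: eq_bigr => i _; by rewrite gE.
Qed.

Lemma ae_rational_diff : {ae L, forall x, rational_diff f x}.
Proof.
apply: ae_and; first by apply: ae_count => i; exact: (ae_derivable K0 fK).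
apply: ae_count => q; apply: ae_and; [exact: (ae_derivable K0 fK)|exact: (ae_derive_linear K0 fK)].
Qed.

Lemma measurable_rational_diff : measurable (rational_diff f).
Proof.
pose G := \bigcap_(i in [set: 'I_n]) der_set f (e_ i).
have mG : measurable G.
  by apply: fin_bigcap_measurable => // i _; exact: (measurable_der_set K0 fK).
pose H (q : {ffun 'I_n -> rat}) := G `&` der_set f (qv q).
have mH q : measurable (H q) by apply: measurableI => //; exact: (measurable_der_set K0 fK).
have HG q i : H q `<=` der_set f (e_ i) by move=> x [/(_ i I)].
have Hq q : H q `<=` der_set f (qv q) by move=> x [].
pose u q x := \1_(H q) x * 'D_(qv q) (f : 'rV[R]_n -> R) x -
   \sum_i qv q ord0 i * (\1_(H q) x * grad f x i).
have mu q : measurable_fun setT (u q : borel E -> R).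
  apply: measurable_funB; first exact: (measurable_dv K0 fK (mH q) (@Hq q)).
  apply: measurable_sum => i; apply: measurable_funM => //.
  exact: (measurable_dv K0 fK (mH q) (@HG q i)).
pose A q := H q `&` u q @^-1` [set 0].
have mA q : measurable (A q).
  by apply: measurableI => //; rewrite -[X in measurable X]setTI; apply: mu.
have -> : rational_diff f = G `&` ~` (\bigcup_q ~` A q).
  apply/seteqP; split => [x [hi hq]|x [hi hA]].
    split; first by move=> i _; exact: hi.
    rewrite setC_bigcup => q _; rewrite setCK; have [dq dE] := hq q.
    have Hx : H q x by split; [move=> i _; exact: hi|exact: dq].
    split => //; rewrite /u /= indicE mem_set//= mul1r dE; apply/eqP; rewrite subr_eq0; apply/eqP.
    by apply: eq_bigr => i _; rewrite mul1r.
  split; first by move=> i; exact: (hi i I).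
  move=> q; move: hA; rewrite setC_bigcup => /(_ q I); rewrite setCK => -[Hx].
  rewrite /u /= indicE mem_set//= mul1r => /eqP; rewrite subr_eq0 => /eqP ->; split; first exact: Hx.2.
  by apply: eq_bigr => i _; rewrite mul1r.
apply: measurableI => //; apply: measurableC; apply: measurable_bigcup_count => q.
exact: measurableC.
Qed.

Lemma measurable_grad i : measurable_fun setT (fun x => \1_(rational_diff f) x * grad f x i).
Proof.
apply: (measurable_dv K0 fK measurable_rational_diff) => x [h _]; exact: h.
Qed.

(** Stated with the Euclidean norm and the Euclidean Lipschitz constant, without the dimensional
    loss of the sup norm; the sharp determinant bound depends on it. *)
Lemma frechet_le x l (v : 'rV[R]_n) : 0 <= C -> frechet f x l ->
  `|\sum_i v ord0 i * l i| <= C * enorm v.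
Proof.
move=> C0 /(frechet_dq (v := v))/cvg_norm dc; rewrite -(cvg_lim _ dc)//.
apply: limr_le; first by apply: cvgP dc.
have enormZ h : enorm (h *: v) = `|h| * enorm v.
  rewrite /enorm; under eq_bigr do rewrite mxE exprMn.
  by rewrite -mulr_sumr sqrtrM ?sqr_ge0// sqrtr_sqr.
exists 1 => //= h _ h0; rewrite /dq normrM normfV ler_pdivrMl ?normr_gt0//.
have := fC (x + h *: v) x; rewrite euclid_mdist addrAC subrr add0r enormZ.
by rewrite mulrCA.
Qed.

End lipschitz.
End scalar_differentiability.

(** * Differentials and Jacobian matrices *)

Section abstract_differentiability.
Context {R : realType} {V W : normedModType R}.

Lemma linear_bound_continuous (l : {linear V -> W}) (M : R) :
  (forall y, `|l y| <= M * `|y|) -> continuous l.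
Proof.
move=> lM x; apply/cvgrPdist_le => e e0; have M0 : 0 < `|M| + 1 by rewrite ltr_wpDl.
near=> y; rewrite -linearB (le_trans (lM _))//.
apply: (@le_trans _ _ ((`|M| + 1) * `|x - y|)).
  by rewrite ler_wpM2r// (le_trans (ler_norm _))// lerDl.
rewrite mulrC -ler_pdivlMr//; near: y; apply: cvgr_dist_le; rewrite ?divr_gt0//.
Unshelve. all: by end_near. Qed.

Lemma differentiable_intro (F : V -> W) x (l : {linear V -> W}) (M : R) :
  (forall y, `|l y| <= M * `|y|) ->
  (forall e, 0 < e -> exists2 d, 0 < d & forall y, `|y| < d ->
    `|F (x + y) - F x - l y| <= e * `|y|) ->
  differentiable F x /\ 'd F x = l :> (V -> W).
Proof.
move=> /linear_bound_continuous cl h.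
have hl : F \o shift x = cst (F x) + l +o_ 0 id.
  apply/eqaddoP => e e0; have [d d0 hd] := h e e0.
  apply/nbhs_normP; exists d => // y; rewrite /= sub0r normrN => /hd.
  have -> : (F \o shift x - (cst (F x) + l)) y = F (y + x) - (F x + l y) by [].
  by rewrite [y + x]addrC opprD addrA.
have dE : 'd F x = l :> (V -> W) by exact: diff_unique.
by split => //; apply/diff_locallyP; rewrite dE.
Qed.

Lemma differentiable_elim (F : V -> W) x : differentiable F x ->
  forall e, 0 < e -> exists2 d, 0 < d & forall y, `|y| < d ->
    `|F (x + y) - F x - 'd F x y| <= e * `|y|.
Proof.
move=> /diff_locallyP[_ /eqaddoP h] e e0.
have /nbhs_normP[d /= d0 hd] := h e e0; exists d => // y yd.
have := hd y; rewrite /= sub0r normrN => /(_ yd).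
have -> : (F \o shift x - (cst (F x) + 'd F x)) y = F (y + x) - (F x + 'd F x y) by [].
by rewrite [y + x]addrC opprD addrA.
Qed.

Lemma finite_common_radius (I : finType) (P : I -> V -> Prop) :
  (forall i, exists2 d : R, 0 < d & forall y, `|y| < d -> P i y) ->
  exists2 d : R, 0 < d & forall y, `|y| < d -> forall i, P i y.
Proof.
move=> h; have /choice[d hd] : forall i, exists d : R, 0 < d /\ forall y, `|y| < d -> P i y.
  by move=> i; have [d] := h i; exists d.
exists (\big[Num.min/1]_i d i).
  by apply: (big_ind (fun z => 0 < z)) => // [a b a0 b0|i _]; [rewrite lt_min a0|case: (hd i)].
move=> y yd i; apply: (hd i).2; apply: lt_le_trans yd _.
exact: bigmin_le_cond.
Qed.

(** The differential is selected by a choice operator whose default is the zero map, so it is known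
    even where no differential exists. *)
Lemma diff_not_differentiable (F : V -> W) x : ~ differentiable F x ->
  'd F x = (\0 : {linear V -> W}) :> (V -> W).
Proof.
move=> nd; rewrite /diff getPN// => df hdf; apply: nd; apply/diffP; rewrite /diff.
by case: xgetP => [l _ //|/(_ df)]; case.
Qed.

End abstract_differentiability.

Section jacobian_matrix.
Context {R : realType} {n : nat}.
Local Notation E := (euclid R n).
Local Notation L := (@lebesgueRn R n).

Lemma mulmx_norm_le (y : 'rV[R]_n) (J : 'M[R]_n) :
  `|y *m J| <= (\sum_i \sum_j `|J i j|) * `|y|.
Proof.
apply: rV_norm_le => [|j]; first by rewrite mulr_ge0// sumr_ge0// => i _; exact: sumr_ge0.
rewrite mxE (le_trans (ler_norm_sum _ _ _))// mulr_suml; apply: ler_sum => i _.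
rewrite normrM mulrC ler_pM// ?coord_le_norm// (bigD1 j)//= lerDl; exact: sumr_ge0.
Qed.

Lemma frechet_differentiable (F : 'rV[R]_n -> 'rV[R]_n) x (J : 'M[R]_n) :
  (forall j, frechet (fun y => F y ord0 j) x (fun i => J i j)) ->
  differentiable F x /\ jacobian F x = J.
Proof.
move=> h; have [|dF dE] := @differentiable_intro R _ _ F x (mulmxr J) _ (fun y => mulmx_norm_le y J).
  move=> e e0; have [d d0 hd] := @finite_common_radius R 'rV[R]_n 'I_n
    (fun j y => `|F (x + y) ord0 j - F x ord0 j - \sum_i y ord0 i * J i j| <= e * `|y|)
    (fun j => h j e e0).
  exists d => // y /hd hy; apply: rV_norm_le; first by rewrite mulr_ge0// ltW.
  by move=> j; rewrite /= !mxE; exact: hy.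
split => //; apply/row_matrixP => i; by rewrite !rowE mul_rV_lin1 dE.
Qed.

Lemma differentiable_frechet (F : 'rV[R]_n -> 'rV[R]_n) x : differentiable F x ->
  forall j, frechet (fun y => F y ord0 j) x (fun i => jacobian F x i j).
Proof.
move=> /differentiable_elim h j e e0; have [d d0 hd] := h e e0; exists d => // y /hd.
move=> /(le_trans (coord_le_norm _ j)); apply: le_trans.
by rewrite -(mul_rV_lin1 ('d F x)) !mxE.
Qed.

Lemma jacobian_not_differentiable (F : 'rV[R]_n -> 'rV[R]_n) x : ~ differentiable F x ->
  jacobian F x = 0.
Proof.
by move=> nd; apply/matrixP => i j; rewrite mxE diff_not_differentiable// !mxE.
Qed.

Section lipschitz_tuple.
Variables (g : 'I_n -> E -> R) (C : R).
Hypothesis C0 : 0 <= C.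
Hypothesis gC : forall i, lip_with C (g i).

Definition diff_set : set (borel E) := [set x | forall j, rational_diff (g j) x].

Lemma measurable_diff_set : measurable diff_set.
Proof.
have -> : diff_set = \bigcap_(j in [set: 'I_n]) rational_diff (g j).
  by apply/seteqP; split => x h j => [_|]; exact: h.
apply: fin_bigcap_measurable => // j _; exact: (measurable_rational_diff (gC j)).
Qed.

Lemma ae_diff_set : {ae L, forall x, diff_set x}.
Proof. by apply: ae_count => j; exact: (ae_rational_diff (gC j)). Qed.

Lemma DmxE x : diff_set x -> Dmx g x = \matrix_(i, j) grad (g j) x i.
Proof.
move=> dx; apply: (frechet_differentiable _).2 => j.
have := rational_diff_frechet (gC j) (dx j).
congr (frechet _ _ _); apply/funext => y; rewrite ?mxE//.
Qed.

Lemma diff_set_frechet x : diff_set x -> forall j, frechet (g j) x (fun i => Dmx g x i j).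
Proof.
move=> dx j; rewrite DmxE//; have := rational_diff_frechet (gC j) (dx j).
by congr (frechet _ _ _); apply/funext => i; rewrite mxE.
Qed.

Lemma frechet_diff_set x (J : 'M[R]_n) : (forall j, frechet (g j) x (fun i => J i j)) ->
  diff_set x /\ Dmx g x = J.
Proof.
move=> h; have dx : diff_set x by move=> j; have [] := frechet_rational_diff (h j).
split => //; rewrite DmxE//; apply/matrixP => i j; rewrite mxE.
by have [_ ->] := frechet_rational_diff (h j).
Qed.

(** With this default value [Dmx g] is an everywhere defined Borel function, and the integrands of
    currents need no correction on null sets. *)
Lemma Dmx_out x : ~ diff_set x -> Dmx g x = 0.
Proof.
move=> ndx; apply: jacobian_not_differentiable => dx; apply: ndx.
apply: (frechet_diff_set (J := Dmx g x) _).1 => j.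
have := differentiable_frechet dx j; congr (frechet _ _ _).
by apply/funext => y; rewrite mxE.
Qed.

Lemma measurable_Dmx i j : measurable_fun setT (fun x : borel E => Dmx g x i j).
Proof.
have -> : (fun x : borel E => Dmx g x i j) =
   (fun x => \1_diff_set x * (\1_(rational_diff (g j)) x * grad (g j) x i)).
  apply/funext => x; rewrite [X in X * _]indicE; case: (boolP (x \in diff_set)).
    by rewrite inE => dx; rewrite DmxE// mxE indicE mem_set ?mul1r//; exact: dx.
  by rewrite notin_setE => dx; rewrite Dmx_out// mxE mul0r.
apply: measurable_funM; first exact: measurable_indic measurable_diff_set.
exact: (measurable_grad (gC j)).
Qed.

Lemma measurable_det_Dmx : measurable_fun setT (fun x : borel E => \det (Dmx g x)).
Proof.
rewrite /determinant; apply: measurable_sum => s; apply: measurable_funM => //.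
apply: measurable_prod => i _; exact: measurable_Dmx.
Qed.

Lemma Dmx_col_le x j (v : 'rV[R]_n) : `|\sum_i v ord0 i * Dmx g x i j| <= C * enorm v.
Proof.
have [dx|dx] := pselect (diff_set x).
  exact: (frechet_le (gC j) v C0 (diff_set_frechet dx j)).
rewrite Dmx_out// big1 ?normr0 ?mulr_ge0 ?enorm_ge0// => i _; by rewrite mxE mulr0.
Qed.

Lemma Dmx_entry_le x i j : `|Dmx g x i j| <= C.
Proof.
have := Dmx_col_le x j (delta_mx ord0 i).
rewrite (bigD1 i)//= mxE !eqxx mul1r big1 ?addr0; last first.
  by move=> k ki; rewrite mxE eqxx (negbTE ki) mul0r.
move=> /le_trans; apply; rewrite /enorm (bigD1 i)//= mxE !eqxx expr1n big1 ?addr0 ?sqrtr1 ?mulr1//.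
by move=> k ki; rewrite mxE eqxx (negbTE ki) expr0n.
Qed.

Lemma det_Dmx_le x : `|\det (Dmx g x)| <= n`!%:R * C ^+ n.
Proof.
rewrite /determinant (le_trans (ler_norm_sum _ _ _))//.
apply: (@le_trans _ _ (\sum_(s : 'S_n) C ^+ n)); last first.
  by rewrite sumr_const card_Sn mulr_natl.
apply: ler_sum => s _; rewrite normrM normr_sign mul1r normr_prod.
rewrite -[X in _ <= _ ^+ X](card_ord n) -prodr_const; apply: ler_prod => i _.
by rewrite normr_ge0 Dmx_entry_le.
Qed.

End lipschitz_tuple.
End jacobian_matrix.

(** * The area formula *)

Section injective_images.
Context {R : realType} {n : nat}.
Local Notation E := (euclid R n).
Local Notation L := (@lebesgueRn R n).
Variables (F : E -> E) (K : set E).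
Hypothesis cF : continuous F.
Hypothesis cK : compact K.
Hypothesis Finj : forall x y, K x -> K y -> F x = F y -> x = y.

Lemma compact_borel (A : set E) : compact A -> measurable (A : set (borel E)).
Proof. by move=> /(compact_closed (@metric_hausdorff _ _)); exact: closed_borel. Qed.

Let compact_image (C : set E) : closed C -> compact (F @` (K `&` C)).
Proof.
move=> cC; apply: continuous_compact; last exact: compact_closedI.
exact: continuous_subspaceT.
Qed.

Let G (y : E) : E := get [set x | K x /\ F x = y].

Let GF x : K x -> G (F x) = x.
Proof.
move=> Kx; have [Gx FG] : [set z | K z /\ F z = F x] (G (F x)).
  by apply: (@getPex _ [set z | K z /\ F z = F x]); exists x.
exact: Finj.
Qed.

Let Gpre (B : set E) : G @^-1` B `&` F @` K = F @` (K `&` B).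
Proof.
apply/seteqP; split => [y [By [x Kx xy]]|_ [x [Kx Bx] <-]].
  by exists x => //; split => //; move: By; rewrite /= -xy GF.
by split; [rewrite /= GF|exists x].
Qed.

Let mFK : measurable (F @` K : set (borel E)).
Proof. by apply: compact_borel; rewrite -[K]setIT; apply: compact_image; exact: closedT. Qed.

Let Gout y : ~ (F @` K) y -> G y = point.
Proof. by move=> h; apply: getPN => x [Kx xy]; apply: h; exists x. Qed.

Let mG : measurable_fun setT (G : borel E -> borel E).
Proof.
apply: (@measurability _ _ _ (borel E) _ _ (@open E)) => //.
move=> _ [V oV <-]; rewrite setTI.
have -> : G @^-1` V = ~` (F @` (K `&` ~` V) `|` (~` (F @` K) `&` [set y | ~ V point])).
  rewrite -Gpre; apply/seteqP; split => y.
    move=> Vy [[/=]|[/Gout /= Gy nV]] //.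
    by apply: nV; rewrite -Gy.
  move=> h; apply: contrapT => nV; apply: h.
  have [Ky|Ky] := pselect ((F @` K) y); first by left.
  by right; split => //=; rewrite -(Gout Ky).
apply: measurableC; apply: measurableU.
  by apply: compact_borel; apply: compact_image; exact: open_closedC.
apply: measurableI; first exact: measurableC.
have [VP|VP] := pselect (V point).
  by rewrite (_ : mkset _ = set0)//; apply/seteqP; split.
by rewrite (_ : mkset _ = setT)//; apply/seteqP; split.
Qed.

(** Relatively closed subsets of the compact [K] have compact images, so the inverse [G], constant
    off [F(K)], is a Borel map; images under [F] are preimages under [G]. *)
Lemma measurable_inj_image (B : set (borel E)) : measurable B ->
  measurable (F @` (K `&` B) : set (borel E)).
Proof.
move=> mB; rewrite -Gpre; apply: measurableI => //.
by rewrite -[X in measurable X]setTI; exact: mG.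
Qed.

(** The volume of the image is itself a measure in [B], namely the push-forward under the inverse of
    Lebesgue measure on [F(K)]. Hence it can be compared with others on cubes. *)
Lemma inj_image_measure : exists nu : {measure set (borel E) -> \bar R},
  forall B, nu B = L (F @` (K `&` B)).
Proof.
exists (pushforward_measure (mrestr L mFK) mG) => B.
by rewrite -Gpre.
Qed.

Lemma inj_preimage_image (B : set E) : K `&` F @^-1` (F @` (K `&` B)) = K `&` B.
Proof.
apply/seteqP; split => [x [Kx [y [Ky By] /Finj yx]]|x [Kx Bx]].
  by split => //; rewrite -yx.
by split => //; exists x.
Qed.

End injective_images.

Section lipschitz_volume.
Context {R : realType} {n : nat}.
Local Notation E := (euclid R n).
Local Notation L := (@lebesgueRn R n).
Variables (F : E -> E) (K : set E) (c : R).
Hypothesis cF : continuous F.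
Hypothesis cK : compact K.
Hypothesis Finj : forall x y, K x -> K y -> F x = F y -> x = y.
Hypothesis c0 : 0 <= c.

(** On a dyadic cube the image has diameter at most [c] times the side, which bounds its volume;
    cube comparison does the rest. *)
Lemma lipschitz_image_le (B : set (borel E)) :
  (forall x y : 'rV[R]_n, K x -> K y -> `|(F x : 'rV[R]_n) - F y| <= c * `|x - y|) ->
  measurable B -> (L (F @` (K `&` B)) <= (c ^+ n)%:E * L B)%E.
Proof.
move=> FK mB; have [nu nuE] := inj_image_measure cF cK Finj; rewrite -nuE.
have cn0 : 0 <= c ^+ n by rewrite exprn_ge0.
have := @cube_comparison R n nu (mscale (NngNum cn0) L) _ _ B mB; apply.
  move=> k z; rewrite nuE -[leRHS]/((c ^+ n)%:E * L (dcube k z))%E lebesgue_dcube -EFinM -exprMn.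
  have mQ := @measurable_dcube R n k z.
  apply: lebesgue_diam_le; [exact: measurable_inj_image|by rewrite mulr_ge0// invr_ge0 exprn_ge0|].
  move=> _ _ [x [Kx Qx] <-] [y [Ky Qy] <-]; rewrite (le_trans (FK _ _ Kx Ky))// ler_wpM2l//.
  exact: (ccube_norm (dcube_ccube Qx) (dcube_ccube Qy)).
by move=> z; rewrite -[X in (X < _)%E]/((c ^+ n)%:E * L (dcube 0 z))%E lte_mul_pinfty// lebesgue_dcube_lty.
Qed.

Lemma lipschitz_preimage_le (B : set (borel E)) :
  (forall x y : 'rV[R]_n, K x -> K y -> `|x - y| <= c * `|(F x : 'rV[R]_n) - F y|) ->
  measurable B -> (L (K `&` B) <= (c ^+ n)%:E * L (F @` (K `&` B)))%E.
Proof.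
move=> FK mB; have mK := compact_borel cK.
have mF : measurable_fun setT (F : borel E -> borel E).
  apply: (@measurability _ _ _ (borel E) _ _ (@open E)) => //.
  move=> _ [V oV <-]; rewrite setTI; apply: open_borel.
  by apply: open_comp => // x _; exact: cF.
have cn0 : 0 <= c ^+ n by rewrite exprn_ge0.
pose nu := pushforward_measure (mrestr L mK) mF.
have nuE A : nu A = L (K `&` F @^-1` A) by rewrite setIC.
have mI := measurable_inj_image cF cK Finj mB.
rewrite -[X in (L X <= _)%E](inj_preimage_image Finj) -nuE.
have := @cube_comparison R n nu (mscale (NngNum cn0) L) _ _ _ mI; apply.
  move=> k z; rewrite nuE -[leRHS]/((c ^+ n)%:E * L (dcube k z))%E lebesgue_dcube -EFinM -exprMn.
  have mQ := @measurable_dcube R n k z.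
  apply: lebesgue_diam_le; [|by rewrite mulr_ge0// invr_ge0 exprn_ge0|].
    by apply: measurableI => //; rewrite -[X in measurable X]setTI; exact: (mF measurableT _ mQ).
  move=> x y [Kx Qx] [Ky Qy]; rewrite (le_trans (FK _ _ Kx Ky))// ler_wpM2l//.
  exact: (ccube_norm (dcube_ccube Qx) (dcube_ccube Qy)).
by move=> z; rewrite -[X in (X < _)%E]/((c ^+ n)%:E * L (dcube 0 z))%E lte_mul_pinfty// lebesgue_dcube_lty.
Qed.

End lipschitz_volume.

Section near_linear.
Context {R : realType} {n : nat}.
Local Notation E := (euclid R n.+1).
Local Notation L := (@lebesgueRn R n.+1).
Variables (F : E -> E) (K : set E) (M : 'M[R]_n.+1) (e : R).
Hypothesis cF : continuous F.
Hypothesis cK : compact K.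
Hypothesis uM : M \in unitmx.
Hypothesis e01 : 0 <= e < 1.
Hypothesis FM : forall x y : 'rV[R]_n.+1, K x -> K y ->
  `|((F x : 'rV[R]_n.+1) - F y) *m M - (x - y)| <= e * `|x - y|.

Lemma near_linear_inj x y : K x -> K y -> F x = F y -> x = y.
Proof.
move=> Kx Ky Fxy; have := FM Kx Ky; rewrite Fxy subrr mul0mx sub0r normrN => h.
apply/eqP; rewrite -subr_eq0 -normr_eq0; apply/eqP.
have := normr_ge0 ((x : 'rV[R]_n.+1) - y); set a := `|_| in h *; case/andP: e01 => e0 e1 a0.
by have : a * (1 - e) <= 0; [lra|rewrite pmulr_lle0 ?subr_gt0// => a1; lra].
Qed.

Let FMx x : E := (F x : 'rV[R]_n.+1) *m M.

Let cFM : continuous FMx.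
Proof.
move=> x A /nbhs_euclid; have := @linear_bound_continuous R _ _ (mulmxr M : {linear 'rV[R]_n.+1 -> 'rV[R]_n.+1}) _ (fun y => mulmx_norm_le y M).
move=> /(_ (F x : 'rV_n.+1)) h /h /nbhs_euclid; exact: cF.
Qed.

Let FMinj x y : K x -> K y -> FMx x = FMx y -> x = y.
Proof.
move=> Kx Ky; rewrite /FMx => /(congr1 (fun z : 'rV[R]_n.+1 => z *m invmx M)).
by rewrite !mulmxK//; exact: near_linear_inj.
Qed.

Let FMup (x y : 'rV[R]_n.+1) : K x -> K y -> `|(FMx x : 'rV[R]_n.+1) - FMx y| <= (1 + e) * `|x - y|.
Proof.
move=> Kx Ky; have := FM Kx Ky; rewrite mulmxBl -/(FMx x) -/(FMx y) => h.
have := ler_normD ((FMx x : 'rV[R]_n.+1) - FMx y - (x - y)) (x - y); rewrite subrK.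
by move=> /le_trans; apply; rewrite mulrDl mul1r addrC lerD2l.
Qed.

Let FMlow (x y : 'rV[R]_n.+1) : K x -> K y -> `|x - y| <= (1 - e)^-1 * `|(FMx x : 'rV[R]_n.+1) - FMx y|.
Proof.
move=> Kx Ky; have := FM Kx Ky; rewrite mulmxBl -/(FMx x) -/(FMx y) => h.
case/andP: e01 => e0 e1; rewrite ler_pdivlMl ?subr_gt0//.
have := ler_normB ((FMx x : 'rV[R]_n.+1) - FMx y) ((FMx x : 'rV[R]_n.+1) - FMx y - (x - y)).
rewrite opprB addrC subrK => h2; rewrite mulrBl mul1r lerBlDr.
exact: le_trans h2 (lerD (lexx _) h).
Qed.

Let imageE (B : set E) : F @` (K `&` B) =
  [set y : 'rV[R]_n.+1 | (FMx @` (K `&` B)) (y *m M)].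
Proof.
apply/seteqP; split => [_ [x KBx <-]|y [x KBx]]; first by exists x.
move=> /(congr1 (fun z : 'rV[R]_n.+1 => z *m invmx M)); rewrite /FMx !mulmxK// => <-.
by exists x.
Qed.

Lemma measurable_near_linear_image (B : set (borel E)) : measurable B ->
  measurable (F @` (K `&` B) : set (borel E)).
Proof. exact: (measurable_inj_image cF cK near_linear_inj). Qed.

(** Following [F] by the linear map [M] gives a map with Lipschitz constant [1 + e] and inverse
    constant [(1 - e)^-1], whose volume distortion is controlled on both sides. The linear change of
    variables then removes [M]. *)
Lemma near_linear_volume (B : set (borel E)) : measurable B ->
  (((1 - e) ^+ n.+1 * `|\det M|^-1)%:E * L (K `&` B) <= L (F @` (K `&` B)) <=
   ((1 + e) ^+ n.+1 * `|\det M|^-1)%:E * L (K `&` B))%E.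
Proof.
move=> mB; case/andP: e01 => e0 e1; have mK := compact_borel cK.
have mKB : measurable (K `&` B : set (borel E)) by exact: measurableI.
have mFM := measurable_inj_image cFM cK FMinj mB.
have dM : (0 <= (`|\det M|^-1)%:E)%E by rewrite lee_fin.
rewrite imageE lebesgue_preimage_mulmx//; apply/andP; split.
  have := lipschitz_preimage_le cFM cK FMinj _ FMlow mB; rewrite invr_ge0 subr_ge0 ltW// => /(_ isT) h.
  rewrite EFinM -muleA [(_%:E * L _)%E in leLHS]muleC muleA [leLHS]muleC; apply: lee_wpmul2l => //.
  rewrite exprVn in h.
  have p0 : 0 < (1 - e) ^+ n.+1 by rewrite exprn_gt0// subr_gt0.
  by rewrite -lee_pdivlMl.
have := lipschitz_image_le cFM cK FMinj _ FMup mKB; rewrite addr_ge0// => /(_ isT).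
rewrite setIA setIid => h.
by rewrite mulrC EFinM -muleA; apply: lee_wpmul2l.
Qed.

End near_linear.

Lemma prod_close {R : realDomainType} (I : Type) (s : seq I) (a b : I -> R) (e : R) :
  0 <= e <= 1 -> (forall i, `|a i - b i| <= e) -> (forall i, `|b i| <= 1) ->
  `|\prod_(i <- s) a i - \prod_(i <- s) b i| <= (2 ^+ size s - 1) * e.
Proof.
move=> /andP[e0 e1] ab b1; elim: s => [|i s IH]; first by rewrite !big_nil !subrr normr0 mul0r.
have a2 : `|a i| <= 2.
  have := ler_normD (a i - b i) (b i); rewrite subrK => /le_trans; apply.
  by have := ab i; have := b1 i; lra.
have pb : `|\prod_(i <- s) b i| <= 1.
  rewrite normr_prod; elim: (s) => [|j t IHt]; first by rewrite big_nil.
  by rewrite big_cons mulr_ile1// prodr_ge0.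
rewrite !big_cons; set A := \prod_(i <- s) a i in IH *; set B := \prod_(i <- s) b i in IH pb *.
have -> : a i * A - b i * B = a i * (A - B) + (a i - b i) * B by ring.
apply: (le_trans (ler_normD _ _)); rewrite !normrM.
apply: (@le_trans _ _ (2 * ((2 ^+ size s - 1) * e) + e * 1)).
  by apply: lerD; apply: ler_pM.
by rewrite /= exprS le_eqVlt; apply/orP; left; apply/eqP; ring.
Qed.

(** Each of the [n!] products in the Leibniz expansion moves by at most [2^n e]. *)
Lemma det_close {R : realFieldType} (n : nat) (A : 'M[R]_n) (e : R) : 0 <= e <= 1 ->
  (forall i j, `|A i j - (i == j)%:R| <= e) -> `|\det A - 1| <= n`!%:R * 2 ^+ n * e.
Proof.
move=> e01 Ae; rewrite -[X in _ - X](det1 R n) /determinant -sumrB (le_trans (ler_norm_sum _ _ _))//.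
apply: (@le_trans _ _ (\sum_(s : 'S_n) 2 ^+ n * e)); last first.
  by rewrite sumr_const card_Sn -mulrA mulr_natl.
apply: ler_sum => s _; rewrite -mulrBr normrM normr_sign mul1r.
have h1 i : `|A i (s i) - (1%:M : 'M[R]_n) i (s i)| <= e by rewrite mxE.
have h2 i : `|(1%:M : 'M[R]_n) i (s i)| <= 1 by rewrite mxE; case: (_ == _); rewrite ?normr1 ?normr0.
have := prod_close (index_enum _) e01 h1 h2; move=> /le_trans; apply.
rewrite ler_wpM2r//; first by case/andP: e01.
have -> : size (index_enum 'I_n) = n by rewrite [index_enum _]unlock -enumT size_enum_ord.
by lra.
Qed.

Lemma bernoulli_sub {R : realFieldType} (x : R) m : 0 <= x <= 1 -> 1 - m%:R * x <= (1 - x) ^+ m.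
Proof.
move=> /andP[x0 x1]; elim: m => [|m IH]; first by rewrite mul0r subr0 expr0.
have : (1 - x) * (1 - m%:R * x) <= (1 - x) ^+ m.+1 by rewrite exprS ler_wpM2l// subr_ge0.
apply: le_trans; rewrite -natr1 -subr_ge0.
have -> : (1 - x) * (1 - m%:R * x) - (1 - (m%:R + 1) * x) = m%:R * x * x by ring.
by rewrite !mulr_ge0.
Qed.

Lemma subrBB (V : zmodType) (a b c d : V) : (a - b) - (c - d) = (a - c) - (b - d).
Proof. by rewrite !opprD !opprK addrACA. Qed.

Lemma row_affineE (R : pzRingType) m (a b v : 'rV[R]_m) (A : 'M[R]_m) k :
  (a - b - v *m A) ord0 k = a ord0 k - b ord0 k - \sum_i v ord0 i * A i k.
Proof. by rewrite !mxE. Qed.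

Section area.
Context {R : realType} {n : nat}.
Local Notation N := n.+1.
Local Notation E := (euclid R N).
Local Notation L := (@lebesgueRn R N).
Variables (F : E -> E) (C : R).
Hypothesis C0 : 0 <= C.
Hypothesis FC : forall j, lip_with C (fun x : E => (F x : 'rV[R]_N) ord0 j).

Local Notation Fj := (fun j (x : E) => (F x : 'rV[R]_N) ord0 j).
Local Notation DF := (Dmx Fj).
Local Notation D := (diff_set Fj).
Local Notation J := (fun x : borel E => `|\det (DF x)|).

Let K := `|C| * N%:R.

Lemma lip_map_sup (x y : 'rV[R]_N) : `|(F x : 'rV[R]_N) - F y| <= K * `|x - y|.
Proof.
apply: rV_norm_le => [|j]; first by rewrite !mulr_ge0.
by rewrite !mxE; exact: lip_with_sup (FC j) _ _.
Qed.

Lemma lip_map_continuous : continuous F.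
Proof.
move=> x A /nbhs_euclid/nbhs_normP[e /= e0 eA].
have K0 : 0 < K + 1 by rewrite ltr_wpDl// !mulr_ge0.
apply: (proj2 (nbhs_euclid x (F @^-1` A))).
apply/(@nbhs_normP R 'rV[R]_N (x : 'rV[R]_N) (F @^-1` A : set 'rV[R]_N)); exists (e / (K + 1)) => /=; first by rewrite divr_gt0.
move=> y /= xy; apply: eA => /=; apply: (le_lt_trans (lip_map_sup _ _)).
apply: (@le_lt_trans _ _ ((K + 1) * `|(x : 'rV[R]_N) - y|)); first by rewrite ler_wpM2r// lerDl.
by rewrite mulrC -ltr_pdivlMr.
Qed.

Lemma measurable_lip_map : measurable_fun setT (F : borel E -> borel E).
Proof. by apply: measurable_to_rV => j; apply: continuous_borel; exact: lip_continuous (FC j). Qed.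

(** [M] plays the role of the inverse of the differential at [x], uniformly within radius [d]. In
    this form no derivative of [F] occurs, so the set is closed, and [M] can be restricted to
    rational matrices. *)
Definition near_lin (e : R) (M : 'M[R]_N) (d : R) : set E :=
  [set x : 'rV[R]_N | forall y : 'rV[R]_N, `|y| < d ->
    `|((F (x + y) : 'rV[R]_N) - F x) *m M - y| <= e * `|y|].

Lemma closed_near_lin e M d : closed (near_lin e M d).
Proof.
have -> : near_lin e M d = \bigcap_(y in [set y : 'rV[R]_N | `|y| < d])
   ((fun x : E => `|((F ((x : 'rV[R]_N) + y) : 'rV[R]_N) - F x) *m M - y|) @^-1` [set r | r <= e * `|y|]).
  by apply/seteqP; split => x.
apply: closed_bigI => y _; apply: closed_comp => [x _|]; last exact: closed_le.
pose S := \sum_i \sum_j `|M i j|; have S0 : 0 <= S by apply: sumr_ge0 => i _; apply: sumr_ge0.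
have KK : 0 <= K by rewrite !mulr_ge0.
apply: (@lip_continuous _ _ (S * (K + K))); apply: sup_lip_with.
  by rewrite mulr_ge0// addr_ge0.
move=> u v; apply: (le_trans (ler_dist_dist _ _)).
rewrite opprB addrA subrK -mulmxBl subrBB (le_trans (mulmx_norm_le _ _))// -mulrA ler_wpM2l//.
rewrite mulrDl (le_trans (ler_normB _ _))// lerD ?lip_map_sup// (le_trans (lip_map_sup _ _))//.
by rewrite opprD addrACA subrr addr0.
Qed.

(** Testing [y = h e_i] and letting [h] tend to [0] replaces the increment of [F] by its
    differential. *)
Lemma near_lin_entries e M d x : 0 < d -> near_lin e M d x -> D x ->
  forall i j, `|(DF x *m M) i j - (i == j)%:R| <= e.
Proof.
move=> d0 hx Dx i j; pose v : 'rV[R]_N := delta_mx ord0 i.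
have vn : `|v| = 1.
  apply/eqP; rewrite eq_le; apply/andP; split.
    by apply: rV_norm_le => // k; rewrite mxE eqxx/=; case: eqP; rewrite ?normr1 ?normr0.
  by have := coord_le_norm v i; rewrite mxE !eqxx normr1.
suff : `|v *m DF x *m M - v| <= e.
  move=> /(le_trans (coord_le_norm _ j)).
  by rewrite -mulmxA -rowE !mxE eqxx/= [j == i]eq_sym.
pose S := \sum_i \sum_j `|M i j|; have S0 : 0 <= S by apply: sumr_ge0 => k _; apply: sumr_ge0.
apply/ler_addgt0Pr => r r0; have r0' : 0 < r / (S + 1) by rewrite divr_gt0// ltr_wpDl.
have [t t0 ht] := @finite_common_radius R 'rV[R]_N 'I_N _ (fun j => diff_set_frechet FC Dx j r0').
pose h := Num.min d t / 2; have h0 : 0 < h by rewrite divr_gt0// lt_min d0.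
have hd : h < d by rewrite ltr_pdivrMr// (@le_lt_trans _ _ d)// ?ge_min ?lexx// ltr_pMr// ltr1n.
have htt : h < t by rewrite ltr_pdivrMr// (@le_lt_trans _ _ t)// ?ge_min ?lexx ?orbT// ltr_pMr// ltr1n.
have hv : `|h *: v| = h by rewrite normrZ vn mulr1 ger0_norm// ltW.
have := hx (h *: v); rewrite hv => /(_ hd) h1.
have h2 : `|(F ((x : 'rV[R]_N) + h *: v) : 'rV[R]_N) - F x - (h *: v) *m DF x| <= r / (S + 1) * h.
  apply: rV_norm_le => [|k]; first by rewrite mulr_ge0// ltW.
  by have := ht (h *: v); rewrite hv => /(_ htt k) /=; rewrite row_affineE.
have -> : v *m DF x *m M - v = h^-1 *: ((h *: v) *m DF x *m M - h *: v).
  by rewrite -!scalemxAl -scalerBr scalerA mulVf ?scale1r// gt_eqF.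
rewrite normrZ ger0_norm ?invr_ge0 ?(ltW h0)// ler_pdivrMl//.
set W := (F (_ + _) : 'rV[R]_N) - F x in h1 h2.
have -> : (h *: v) *m DF x *m M - h *: v = (W *m M - h *: v) - (W - (h *: v) *m DF x) *m M.
  by rewrite [(W - _) *m M]mulmxBl subrBB subrr sub0r opprB.
apply: (le_trans (ler_normB _ _)); rewrite mulrDr; apply: lerD; first by rewrite mulrC.
apply: (le_trans (mulmx_norm_le _ _)); rewrite -/S.
apply: (@le_trans _ _ (S * (r / (S + 1) * h))); first by rewrite ler_wpM2l.
by rewrite [_ * h]mulrC mulrCA ler_pM2l// mulrA ler_pdivrMr ?ltr_wpDl// [leRHS]mulrC ler_pM2r// lerDl.
Qed.

(* A common modulus for the Bernoulli-type bounds and for [det_close]. *)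
Definition area_cst : R := 3 ^+ N + N`!%:R * 2 ^+ N.

Lemma area_cst_gt1 : 1 <= area_cst.
Proof.
rewrite /area_cst -[leLHS]addr0 lerD ?mulr_ge0 ?exprn_ge0//.
by rewrite exprn_ege1// ler1n.
Qed.

Lemma area_cst_bounds (e : R) : 0 <= e -> area_cst * e <= 2^-1 ->
  [/\ e <= 2^-1, (1 + e) ^+ N <= 1 + area_cst * e, 1 - area_cst * e <= (1 - e) ^+ N &
     N`!%:R * 2 ^+ N * e <= area_cst * e].
Proof.
move=> e0 he; have e1 : e <= area_cst * e by rewrite ler_peMl// area_cst_gt1.
have e2 : e <= 2^-1 by exact: le_trans he.
have e01 : 0 <= e <= 1 by rewrite e0; lra.
split => //.
- apply: (le_trans (expr1D_le _ e01)); rewrite lerD2l ler_wpM2r// /area_cst lerDl.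
  by rewrite mulr_ge0// exprn_ge0.
- apply: le_trans (bernoulli_sub _ e01); rewrite lerD2l lerN2 ler_wpM2r// /area_cst.
  apply: (@le_trans _ _ (3 ^+ N)); last by rewrite lerDl mulr_ge0// exprn_ge0.
  by rewrite -natrX ler_nat ltnW// ltn_expl.
- by rewrite ler_wpM2r// /area_cst lerDr exprn_ge0.
Qed.

Lemma near_lin_det e M d x : 0 <= e -> area_cst * e <= 2^-1 -> 0 < d -> near_lin e M d x -> D x ->
  1 - area_cst * e <= \det (DF x) * \det M <= 1 + area_cst * e.
Proof.
move=> e0 he d0 hx Dx; have [e1 _ _ ee] := area_cst_bounds e0 he.
have e01 : 0 <= e <= 1 by rewrite e0; lra.
have := det_close e01 (near_lin_entries d0 hx Dx); rewrite det_mulmx => /le_trans/(_ ee).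
by rewrite ler_norml => /andP[? ?]; apply/andP; split; lra.
Qed.

Lemma measurable_J : measurable_fun setT (J : borel E -> R).
Proof. by apply: measurableT_comp => //; exact: (measurable_det_Dmx FC). Qed.

Lemma J_bound x : J x <= N`!%:R * C ^+ N.
Proof. exact: (det_Dmx_le C0 FC). Qed.

Lemma J_measure : exists lam : {measure set (borel E) -> \bar R},
  forall A, lam A = (\int[L]_(x in A) (J x)%:E)%E.
Proof. by apply: density_measure => //; apply/measurable_EFinP; exact: measurable_J. Qed.

Section piece.
Variables (A : set E) (e : R) (M : 'M[R]_N) (d : R).
Hypothesis cA : compact A.
Hypothesis e0 : 0 <= e.
Hypothesis he : area_cst * e <= 4^-1.
Hypothesis uM : M \in unitmx.
Hypothesis d0 : 0 < d.
Hypothesis Anear : A `<=` near_lin e M d.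
Hypothesis Adiam : forall x y : 'rV[R]_N, A x -> A y -> `|x - y| < d.

Let he2 : area_cst * e <= 2^-1. Proof. by apply: (le_trans he); lra. Qed.

Let e01 : 0 <= e < 1.
Proof. by rewrite e0; have [] := area_cst_bounds e0 he2; lra. Qed.

Let FM (x y : 'rV[R]_N) : A x -> A y -> `|((F x : 'rV[R]_N) - F y) *m M - (x - y)| <= e * `|x - y|.
Proof. by move=> Ax Ay; have := Anear Ay (Adiam Ax Ay); rewrite [y + _]addrC subrK. Qed.

Lemma piece_inj x y : A x -> A y -> F x = F y -> x = y.
Proof. exact: (near_linear_inj e01 FM). Qed.

Lemma measurable_piece_image (B : set (borel E)) : measurable B ->
  measurable (F @` (A `&` B) : set (borel E)).
Proof. exact: (measurable_near_linear_image lip_map_continuous cA e01 FM). Qed.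

Lemma piece_null (B : set (borel E)) : measurable B -> L (A `&` B) = 0%E -> L (F @` (A `&` B)) = 0%E.
Proof.
move=> mB B0; have := near_linear_volume lip_map_continuous cA uM e01 FM mB.
by rewrite B0 !mule0 => h; apply/eqP; rewrite eq_le measure_ge0 andbT; case/andP: h.
Qed.

Lemma piece_det x : A x -> D x -> 0 < \det (DF x) * \det M.
Proof. move=> Ax Dx; have /andP[h _] := near_lin_det e0 he2 d0 (Anear Ax) Dx.
by apply: lt_le_trans h; rewrite subr_gt0 (le_lt_trans he)// invf_lt1// ltr1n. Qed.

(** On such a piece both the Jacobian and the volume distortion are [|det M|^-1] up to factors close
    to [1], so the two sides of the area formula agree up to such a factor. *)
Lemma piece_area_approx (B : set (borel E)) : measurable B ->
  (L (F @` (A `&` B)) <= (1 + 4 * (area_cst * e))%:E * \int[L]_(x in A `&` B) (J x)%:E)%E /\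
  (\int[L]_(x in A `&` B) (J x)%:E <= (1 + 4 * (area_cst * e))%:E * L (F @` (A `&` B)))%E.
Proof.
move=> mB; have := near_linear_volume lip_map_continuous cA uM e01 FM mB.
have mA := compact_borel cA; have mAB : measurable (A `&` B : set (borel E)) by exact: measurableI.
have [e1 up low _] := area_cst_bounds e0 he2; have := he2; have := he.
set a := area_cst * e in up low * => ha ha2.
have a0 : 0 <= a by rewrite mulr_ge0// (le_trans ler01 area_cst_gt1).
have dM0 : 0 < `|\det M| by rewrite normr_gt0 -unitfE -unitmxE.
have mJ : measurable_fun (A `&` B : set (borel E)) (fun x => (J x)%:E).
  by apply/measurable_EFinP; apply: measurable_funS measurable_J.
have aeJ : {ae L, forall x, (A `&` B) x -> (1 - a) * `|\det M|^-1 <= J x <= (1 + a) * `|\det M|^-1}.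
  apply: ae_imp (ae_diff_set FC) => x Dx [Ax _].
  have /andP[h1 h2] := near_lin_det e0 he2 d0 (Anear Ax) Dx.
  have p0 : 0 <= \det (DF x) * \det M by apply: le_trans h1; rewrite subr_ge0 (le_trans ha2)// invf_le1// ler1n.
  by rewrite ler_pdivrMr// ler_pdivlMr// -normrM ger0_norm// h1 h2.
have I1 : (\int[L]_(x in A `&` B) (J x)%:E <= ((1 + a) * `|\det M|^-1)%:E * L (A `&` B))%E.
  rewrite -integral_cst//; apply: ae_ge0_le_integral => //.
  - by move=> x _; rewrite lee_fin mulr_ge0// addr_ge0.
  - by apply: ae_imp aeJ => x h /h /andP[_ ?]; rewrite lee_fin.
have I2 : (((1 - a) * `|\det M|^-1)%:E * L (A `&` B) <= \int[L]_(x in A `&` B) (J x)%:E)%E.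
  rewrite -integral_cst//; apply: ae_ge0_le_integral => //.
  - by move=> x _; rewrite lee_fin mulr_ge0//; lra.
  - by apply: ae_imp aeJ => x h /h /andP[? _]; rewrite lee_fin.
set V := L (A `&` B) in I1 I2 *; set I := (\int[L]_(x in _) _)%E in I1 I2 *; set U := L _.
have V0 : (0 <= V)%E by exact: measure_ge0.
have U0 : (0 <= U)%E by exact: measure_ge0.
have I0 : (0 <= I)%E by apply: integral_ge0 => x _; rewrite lee_fin.
(* The factor [4] in the statement is chosen so that [1 + 4 a] absorbs the quotient
   [(1 + a)/(1 - a)] for [a <= 1/2]. *)
have key : (1 + a) <= (1 + 4 * a) * (1 - a).
  rewrite -subr_ge0 (_ : _ - _ = a * (2 - 4 * a)); last by ring.
  by rewrite mulr_ge0//; lra.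
move=> /andP[W1 W2]; split.
  apply: (le_trans W2); apply: (@le_trans _ _ (((1 + 4 * a) * ((1 - a) * `|\det M|^-1))%:E * V)%E).
    by apply: lee_wpmul2r => //; rewrite lee_fin mulrA ler_wpM2r// (le_trans up).
  by rewrite EFinM -muleA; apply: lee_wpmul2l => //; rewrite lee_fin; lra.
apply: (le_trans I1); apply: (@le_trans _ _ (((1 + 4 * a) * ((1 - e) ^+ N * `|\det M|^-1))%:E * V)%E).
  apply: lee_wpmul2r => //; rewrite lee_fin mulrA ler_wpM2r// (le_trans key)// ler_wpM2l//; lra.
by rewrite EFinM -muleA; apply: lee_wpmul2l => //; rewrite lee_fin; lra.
Qed.

End piece.
End area.

Section density.
Import HBNNSimple.
Context {d : measure_display} {T : measurableType d} {R : realType}.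
Variables (mu nu : {measure set T -> \bar R}) (w : T -> R).
Hypothesis mw : measurable_fun setT w.
Hypothesis w0 : forall x, 0 <= w x.
Hypothesis nuE : forall A, measurable A -> nu A = (\int[mu]_(x in A) (w x)%:E)%E.

Lemma density_nnsfun (g : {nnsfun T >-> R}) :
  (\int[nu]_x (g x)%:E = \int[mu]_x ((g x)%:E * (w x)%:E))%E.
Proof.
have mg y : measurable (g @^-1` [set y]) by [].
under [LHS]eq_integral do rewrite fimfunE -fsumEFin//.
rewrite ge0_integral_fsum//; [|by move=> y; apply/measurable_EFinP; exact: measurable_funM|by move=> y x _; exact: nnfun_muleindic_ge0].
under [RHS]eq_integral => x _.
  rewrite fimfunE -fsumEFin// ge0_mule_fsuml; last by move=> y; exact: nnfun_muleindic_ge0.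
  over.
rewrite ge0_integral_fsum//; last 2 first.
- by move=> y; apply: emeasurable_funM; apply/measurable_EFinP => //; exact: measurable_funM.
- by move=> y x _; apply: mule_ge0; [exact: nnfun_muleindic_ge0|rewrite lee_fin].
apply: eq_fsbigr => y; rewrite inE => -[x0 _ gx0].
have y0 : 0 <= y by rewrite -gx0.
under [LHS]eq_integral do rewrite EFinM.
rewrite ge0_integralZl//; last by apply/measurable_EFinP.
rewrite integral_indic// setIT nuE//.
under [RHS]eq_integral do rewrite EFinM -muleA.
rewrite ge0_integralZl//; last 2 first.
- by apply: emeasurable_funM; apply/measurable_EFinP.
- by move=> x _; apply: mule_ge0; rewrite lee_fin ?indicE.
congr (_ * _)%E; rewrite integral_mkcond; apply: eq_integral => x _.
by rewrite patchE indicE; case: (_ \in _); rewrite ?mul1e ?mul0e.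
Qed.

Lemma density_integral (f : T -> \bar R) : measurable_fun setT f -> (forall x, (0 <= f x)%E) ->
  (\int[nu]_x f x = \int[mu]_x (f x * (w x)%:E))%E.
Proof.
move=> mf f0; pose g := nnsfun_approx measurableT mf.
have gf x : (EFin \o (g ^~ x)) @ \oo --> f x by apply: (cvg_nnsfun_approx measurableT mf (fun y _ => f0 y)).
have gnd x : {homo (fun k => (g k x)%:E) : k l / (k <= l)%N >-> (k <= l)%E}.
  by move=> k l kl; rewrite lee_fin; have /lefP := nd_nnsfun_approx measurableT mf kl; exact.
have E1 : (\int[nu]_x (g k x)%:E)%E @[k --> \oo] --> (\int[nu]_x f x)%E.
  rewrite -(eq_integral _ _ (fun x _ => cvg_lim (@ereal_hausdorff R) (gf x))).
  apply: cvg_monotone_convergence => //; first by move=> k; apply/measurable_EFinP.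
  by move=> k x _; rewrite lee_fin.
have gfw x : ((g k x)%:E * (w x)%:E)%E @[k --> \oo] --> (f x * (w x)%:E)%E.
  by apply: cvgeZr => //; exact: gf.
have E2 : (\int[mu]_x ((g k x)%:E * (w x)%:E))%E @[k --> \oo] --> (\int[mu]_x (f x * (w x)%:E))%E.
  rewrite -(eq_integral _ _ (fun x _ => cvg_lim (@ereal_hausdorff R) (gfw x))).
  apply: cvg_monotone_convergence => //.
  - by move=> k; apply: emeasurable_funM; apply/measurable_EFinP.
  - by move=> k x _; rewrite mule_ge0// lee_fin.
  - by move=> x _ k l kl; apply: lee_wpmul2r; [rewrite lee_fin|exact: gnd].
have {}E1 : (\int[mu]_x ((g k x)%:E * (w x)%:E))%E @[k --> \oo] --> (\int[nu]_x f x)%E.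
  by under eq_fun do rewrite -density_nnsfun.
exact: (cvg_unique _ E1 E2).
Qed.

End density.

Section compact_cubes.
Context {R : realType} {n : nat}.
Local Notation E := (euclid R n).

Lemma compact_ccube k (z : {ffun 'I_n -> int}) : compact (@ccube R n k z).
Proof.
apply/compact_euclid; apply: bounded_closed_compact.
  exists (2 ^- k * \sum_i (`|(z i)%:~R| + 1)); split; first exact: num_real.
  move=> r hr x xz /=; rewrite (le_trans _ (ltW hr))//.
  apply: rV_norm_le => [|i]; first by rewrite mulr_ge0 ?invr_ge0 ?exprn_ge0// sumr_ge0// => i _; rewrite addr_ge0.
  rewrite -(@ler_pM2l _ (2 ^+ k)) ?exprn_gt0// mulrA divff ?gt_eqF ?exprn_gt0// mul1r.
  rewrite -{1}(ger0_norm (exprn_ge0 k (ler0n R 2))) -normrM.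
  apply: (@le_trans _ _ (`|(z i)%:~R| + 1)); last first.
    by rewrite (bigD1 i)//= lerDl sumr_ge0// => j _; rewrite addr_ge0.
  have /andP[h1 h2] := xz i; rewrite ler_norml; apply/andP; split.
    by rewrite (le_trans _ h1)//; have := ler_norm (- (z i)%:~R : R); rewrite normrN; lra.
  by rewrite (le_trans h2)// lerD2r ler_norm.
apply/closed_euclid.
have -> : ccube k z = \bigcap_(i in [set: 'I_n])
    ((fun x : E => 2 ^+ k * (x : 'rV[R]_n) ord0 i) @^-1` `[(z i)%:~R, (z i)%:~R + 1]).
  by apply/seteqP; split => x xz i; [move=> _; rewrite /= in_itv; exact: xz|have := xz i I; rewrite /= in_itv].
apply: closed_bigI => i _; apply: closed_comp => [x _|]; last exact: itv_closed.
exact: (lip_continuous (lip_withZ (2 ^+ k) (coord_lip i))).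
Qed.

End compact_cubes.

Section rational_matrices.
Context {R : realType} {n : nat}.

Lemma rational_matrix_approx (A : 'M[R]_n) (e : R) : 0 < e ->
  exists M : 'M[rat]_n, forall i j, `|ratr (M i j) - A i j| <= e.
Proof.
move=> e0; have /choice[f hf] : forall p : 'I_n * 'I_n, exists q : rat, `|ratr q - A p.1 p.2| <= e.
  move=> p; have : A p.1 p.2 - e < A p.1 p.2 + e by lra.
  move=> /rat_in_itvoo[q]; rewrite in_itv/= => /andP[h1 h2]; exists q.
  by rewrite ler_norml; apply/andP; split; lra.
by exists (\matrix_(i, j) f (i, j)) => i j; rewrite mxE; exact: hf.
Qed.

End rational_matrices.

Section area_formula.
Context {R : realType} {n : nat}.
Local Notation N := n.+1.
Local Notation E := (euclid R N).
Local Notation L := (@lebesgueRn R N).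
Variables (F : E -> E) (C : R).
Hypothesis C0 : 0 <= C.
Hypothesis FC : forall j, lip_with C (fun x : E => (F x : 'rV[R]_N) ord0 j).

Local Notation Fj := (fun j (x : E) => (F x : 'rV[R]_N) ord0 j).
Local Notation DF := (Dmx Fj).
Local Notation D := (diff_set Fj).
Local Notation J := (fun x : borel E => `|\det (DF x)|).
Local Notation cst := (@area_cst R n).

(** The diameter is kept below the radius [d], so that near-linearity at each point controls all
    pairs of points of [P]; for small [e], [F] is then injective on [P]. *)
Definition area_piece (e : R) (P : set E) := compact P /\ exists M d,
  [/\ M \in unitmx, 0 < d, P `<=` near_lin F e M d &
    forall x y : 'rV[R]_N, P x -> P y -> `|x - y| < d].

Lemma area_piece0 e : area_piece e set0.
Proof. by split; [exact: compact0|exists 1%:M, 1; split => //; exact: unitmx1]. Qed.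

Lemma near_lin_exists (e : R) x : 0 < e -> D x -> DF x \in unitmx ->
  exists (M : 'M[rat]_N) d, 0 < d /\ near_lin F e (map_mx ratr M) d x.
Proof.
move=> e0 Dx uA; set A := DF x in uA *.
pose sA := \sum_i \sum_j `|A i j|; pose sV := \sum_i \sum_j `|invmx A i j|.
have sA0 : 0 <= sA by apply: sumr_ge0 => i _; apply: sumr_ge0.
have sV0 : 0 <= sV by apply: sumr_ge0 => i _; apply: sumr_ge0.
pose eta := Num.min 1 (e / 2 / ((N * N)%:R * (sA + 1))).
have NN0 : 0 < (N * N)%:R :> R by rewrite ltr0n muln_gt0.
have sA1 : 0 < sA + 1 by rewrite ltr_wpDl.
have eta0 : 0 < eta by rewrite lt_min ltr01/= !divr_gt0// mulr_gt0.
have [M hM] := rational_matrix_approx (invmx A) eta0; exists M.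
set M' := map_mx ratr M; pose sM := \sum_i \sum_j `|M' i j|.
have sM0 : 0 <= sM by apply: sumr_ge0 => i _; apply: sumr_ge0.
have r0 : 0 < e / 2 / (sM + 1) by rewrite !divr_gt0// ltr_wpDl.
pose Q j (y : 'rV[R]_N) := `|Fj j ((x : 'rV[R]_N) + y) - Fj j x - \sum_i y ord0 i * A i j| <= e / 2 / (sM + 1) * `|y|.
have [d d0 hd] := @finite_common_radius R 'rV[R]_N 'I_N Q (fun j => diff_set_frechet FC Dx j r0).
exists d; split => // y yd.
have h1 : `|(F ((x : 'rV[R]_N) + y) : 'rV[R]_N) - F x - y *m A| <= e / 2 / (sM + 1) * `|y|.
  apply: rV_norm_le => [|k]; first by rewrite mulr_ge0// ltW.
  by have := hd y yd k; rewrite row_affineE.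
set W := (F (_ + _) : 'rV[R]_N) - F x in h1 *.
(* One error comes from differentiability of [F], the other from replacing the inverse differential
   by a rational matrix; each gets half of [e]. *)
have -> : W *m M' - y = (W - y *m A) *m M' + (y *m A) *m (M' - invmx A).
  by rewrite (mulmxBl W) (mulmxBr (y *m A)) mulmxK// addrA subrK.
rewrite (le_trans (ler_normD _ _))// [e]splitr mulrDl lerD//.
  apply: (le_trans (mulmx_norm_le _ _)); rewrite -/sM.
  apply: (@le_trans _ _ (sM * (e / 2 / (sM + 1) * `|y|))); first by rewrite ler_wpM2l.
  rewrite mulrA ler_wpM2r// mulrA ler_pdivrMr ?ltr_wpDl// mulrC.
  by rewrite ler_wpM2l ?lerDl// divr_ge0// ltW.
apply: (le_trans (mulmx_norm_le _ _)).
apply: (@le_trans _ _ (((N * N)%:R * eta) * (sA * `|y|))).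
  apply: ler_pM => //; first by apply: sumr_ge0 => i _; apply: sumr_ge0.
    rewrite (_ : _ * eta = \sum_(i < N) \sum_(j < N) eta).
      by apply: ler_sum => i _; apply: ler_sum => j _; rewrite !mxE.
    by rewrite !sumr_const card_ord -mulrnA mulr_natl.
  exact: mulmx_norm_le.
rewrite mulrA ler_wpM2r//.
apply: (@le_trans _ _ ((N * N)%:R * (e / 2 / ((N * N)%:R * (sA + 1))) * sA)).
  by rewrite ler_wpM2r// ler_wpM2l ?(ltW NN0)// /eta ge_min lexx orbT.
move: NN0; set m := (N * N)%:R => m0.
have -> : m * (e / 2 / (m * (sA + 1))) = e / 2 / (sA + 1) by field; rewrite !gt_eqF.
rewrite mulrAC ler_pdivrMr//.
by rewrite ler_wpM2l ?lerDl// divr_ge0// ltW.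
Qed.

(** The pieces are indexed by a rational matrix, a radius [1/(k+1)] and a cube of generation
    [k + 1], whose diameter [2^-(k+1)] is below that radius. This is a countable family. *)
Lemma area_cover (e : R) : 0 < e -> cst * e <= 4^-1 ->
  exists P : nat -> set E, (forall j, area_piece e (P j)) /\
    forall x, D x -> \det (DF x) != 0 -> exists j, P j x.
Proof.
move=> e0 he; have he2 : cst * e <= 2^-1 by rewrite (le_trans he)// lef_pV2 ?posrE// ler_nat.
pose I := ('M[rat]_N * nat * {ffun 'I_N -> int})%type.
pose P (p : I) : set (borel E) := let M := map_mx ratr p.1.1 : 'M[R]_N in
  if M \in unitmx then near_lin F e M p.1.2.+1%:R^-1 `&` ccube p.1.2.+1 p.2 else set0.
exists (seq_of P); split => [j|x Dx dx].
  rewrite /seq_of; case: pickle_inv => [p|]; last exact: area_piece0.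
  rewrite /P; case: ifPn => uM; last exact: area_piece0.
  split; first by rewrite setIC; apply: compact_closedI; [exact: compact_ccube|exact: (closed_near_lin FC)].
  exists (map_mx ratr p.1.1), p.1.2.+1%:R^-1; split => //.
  move=> x y [_ Px] [_ Py]; apply: (le_lt_trans (ccube_norm Px Py)).
  by rewrite ltf_pV2 ?posrE ?exprn_gt0// -natrX ltr_nat ltn_expl.
have uA : DF x \in unitmx by rewrite unitmxE unitfE.
have [M [d [d0 hM]]] := near_lin_exists e0 Dx uA.
have uM : (map_mx ratr M : 'M[R]_N) \in unitmx.
  have /andP[h _] := near_lin_det FC (ltW e0) he2 d0 hM Dx.
  rewrite unitmxE unitfE; apply: contraPneq h => ->; rewrite mulr0 => h.
  by move: h; rewrite subr_le0 => /le_trans/(_ he2); lra.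
have [k _ kP] := near_infty_natSinv_lt (PosNum d0).
have /= kd := kP _ (leqnn k).
have : (\bigcup_p P p) x.
  exists (M, k, zof k.+1 x) => //; rewrite /P/= uM; split; last exact: dcube_ccube.
  by move=> y yk; apply: hM; exact: lt_trans kd.
by rewrite -bigcup_seq_of => -[j _ Pj]; exists j.
Qed.

End area_formula.

Lemma le_of_factor {R : realType} (x y : \bar R) : (0 <= y)%E ->
  (forall t : R, 0 < t <= 1 -> (x <= (1 + t)%:E * y)%E) -> (x <= y)%E.
Proof.
case: y => [r| |//]; last by move=> _ _; rewrite leey.
rewrite lee_fin => r0 h; apply/lee_addgt0Pr => e e0.
have r1 : 0 < r + 1 by rewrite ltr_wpDl.
pose t := Num.min 1 (e / (r + 1)).
have t0 : 0 < t <= 1 by rewrite lt_min ltr01/= divr_gt0//= ge_min lexx.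
apply: (le_trans (h t t0)); rewrite lee_fin mulrDl mul1r lerD2l.
apply: (@le_trans _ _ (e / (r + 1) * r)); first by rewrite ler_wpM2r// /t ge_min lexx orbT.
by rewrite mulrAC ler_pdivrMr// ler_pM2l// lerDl.
Qed.

Section measure_total.
Context {d : measure_display} {T : measurableType d} {R : realType}.
Implicit Types (mu : {measure set T -> \bar R}) (Q : nat -> set T).

Lemma measure_total_bigcup mu Q (B : set T) : (forall j, measurable (Q j)) -> measurable B ->
  mu (B `\` \bigcup_j Q j) = 0%E -> mu B = mu (\bigcup_j (B `&` Q j)).
Proof.
move=> mQ mB B0; rewrite -setI_bigcupr.
have mU : measurable (\bigcup_j Q j) by exact: bigcup_measurable.
rewrite (measureDI mu mB mU).
by rewrite [X in (X + _)%E]B0 add0e.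
Qed.

Lemma measure_bigcup_nat mu Q : (forall j, measurable (Q j)) -> trivIset setT Q ->
  mu (\bigcup_j Q j) = (\sum_(0 <= j <oo) mu (Q j))%E.
Proof.
by move=> mQ tQ; rewrite measure_bigcup//; apply: eq_eseriesl => i; rewrite in_setT.
Qed.

Lemma measurable_seqDU Q : (forall j, measurable (Q j)) -> forall j, measurable (seqDU Q j).
Proof.
by move=> mQ j; apply: measurableD => //; exact: bigsetU_measurable.
Qed.

Lemma trivIset_setIl Q (B : set T) : trivIset setT Q -> trivIset setT (fun j => B `&` Q j).
Proof. by move=> tQ; apply: trivIset_setIl. Qed.

Lemma null_integral0 mu (A : set T) (f : T -> \bar R) : measurable A -> mu A = 0%E ->
  measurable_fun setT f -> (\int[mu]_(x in A) f x = 0)%E.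
Proof.
by move=> mA A0 mf; apply: null_set_integral => //; apply: measurable_funS mf.
Qed.

End measure_total.

Section area_formula.
Context {R : realType} {n : nat}.
Local Notation N := n.+1.
Local Notation E := (euclid R N).
Local Notation L := (@lebesgueRn R N).
Variables (F : E -> E) (C : R).
Hypothesis C0 : 0 <= C.
Hypothesis FC : forall j, lip_with C (fun x : E => (F x : 'rV[R]_N) ord0 j).

Local Notation Fj := (fun j (x : E) => (F x : 'rV[R]_N) ord0 j).
Local Notation DF := (Dmx Fj).
Local Notation D := (diff_set Fj).
Local Notation J := (fun x : borel E => `|\det (DF x)|).
Local Notation cst := (@area_cst R n).

Let c0 : 0 < cst. Proof. exact: lt_le_trans ltr01 area_cst_gt1. Qed.

Section exact_piece.
Variables (P : set E) (e : R).
Hypothesis e0 : 0 <= e.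
Hypothesis he : cst * e <= 4^-1.
Hypothesis hP : area_piece F e P.

Lemma area_piece_inj x y : P x -> P y -> F x = F y -> x = y.
Proof.
have [cP [M [d [uM d0 Pn Pd]]]] := hP.
exact: (piece_inj e0 he Pn Pd).
Qed.

Lemma measurable_area_piece_image (B : set (borel E)) : measurable B ->
  measurable (F @` (P `&` B) : set (borel E)).
Proof.
have [cP [M [d [uM d0 Pn Pd]]]] := hP.
exact: (measurable_piece_image FC cP e0 he Pn Pd).
Qed.

Lemma area_piece_sign : exists b : bool, forall x, P x -> D x -> 0 < (-1) ^+ b * \det (DF x).
Proof.
have [cP [M [d [uM d0 Pn Pd]]]] := hP.
exists (\det M < 0) => x Px Dx; have h := piece_det FC e0 he d0 Pn Px Dx.
have dM0 : \det M != 0 by rewrite -unitfE -unitmxE.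
case: (ltgtP (\det M) 0) dM0 => // dM _; rewrite ?expr1 ?expr0 ?mulN1r ?mul1r ?oppr_gt0.
  by move: h; rewrite nmulr_lgt0.
by move: h; rewrite pmulr_lgt0.
Qed.

(** The piece is cut further into pieces of arbitrarily fine precision. The approximate formula on
    each of them sums to a factor [1 + t] with [t] as small as desired. *)
Lemma piece_area (B : set (borel E)) : measurable B ->
  L (F @` (P `&` B)) = (\int[L]_(x in P `&` B) (J x)%:E)%E.
Proof.
have [cP [M [d [uM d0 Pn Pd]]]] := hP; have mP := compact_borel cP.
have [mu muE] := inj_image_measure (lip_map_continuous FC) cP area_piece_inj.
have [lam lamE] := J_measure FC.
pose nu := mrestr lam mP.
have nuE A : nu A = (\int[L]_(x in P `&` A) (J x)%:E)%E by rewrite setIC -lamE.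
have mJ : measurable_fun setT (fun x : borel E => (J x)%:E) by apply/measurable_EFinP; exact: measurable_J FC.
have key t : 0 < t <= 1 -> forall B, measurable B ->
    (mu B <= (1 + t)%:E * nu B)%E /\ (nu B <= (1 + t)%:E * mu B)%E.
  (* With this precision the error [4 * (cst * r)] of [piece_area_approx] is exactly [t]. *)
  move=> /andP[t0 t1] {}B mB; pose r := t / (4 * cst).
  have r0 : 0 < r by rewrite divr_gt0// mulr_gt0.
  have ct : cst * r = t / 4 by rewrite /r; field; rewrite gt_eqF.
  have hr : cst * r <= 4^-1 by rewrite ct ler_pdivrMr// mulVf.
  have [Q [hQ Qcov]] := area_cover FC r0 hr.
  have mQ0 j : measurable (Q j : set (borel E)) by apply: compact_borel; exact: (hQ j).1.
  pose Q' := seqDU (Q : nat -> set (borel E)).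
  have mQ : forall j, measurable (Q' j) by exact: measurable_seqDU.
  have tQ : trivIset setT Q' by exact: trivIset_seqDU.
  have QQ : \bigcup_j Q' j = \bigcup_j Q j by rewrite -seqDU_bigcup_eq.
  have mZ : measurable (B `\` \bigcup_j Q' j) by apply: measurableD => //; exact: bigcup_measurable.
  have Z0 : L (P `&` (B `\` \bigcup_j Q' j)) = 0%E.
    apply: ae_null_sub; first exact: measurableI.
    apply: ae_imp (ae_diff_set FC) => x Dx [Px [_ nQ]]; apply: nQ; rewrite QQ.
    have dx : \det (DF x) != 0.
      by have := piece_det FC e0 he d0 Pn Px Dx; apply: contraTneq => ->; rewrite mul0r ltxx.
    by have [j Qj] := Qcov x Dx dx; exists j.
  have t10 : 0 <= 1 + t by rewrite addr_ge0// ltW.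
  have muB : mu B = mu (\bigcup_j (B `&` Q' j)).
    by apply: measure_total_bigcup => //; rewrite muE; exact: (piece_null FC cP e0 he uM Pn Pd).
  have nuB : nu B = nu (\bigcup_j (B `&` Q' j)).
    by apply: measure_total_bigcup => //; apply: (eq_trans (nuE _)); apply: null_integral0 => //; exact: measurableI.
  have tB : trivIset setT (fun j => B `&` Q' j) by exact: trivIset_setIl.
  have mBQ j : measurable (B `&` Q' j) by exact: measurableI.
  have step j : (mu (B `&` Q' j) <= (1 + t)%:E * nu (B `&` Q' j))%E /\
                (nu (B `&` Q' j) <= (1 + t)%:E * mu (B `&` Q' j))%E.
    have [cQ [M' [d' [uM' d0' Qn Qd]]]] := hQ j.
    rewrite muE nuE; set X := P `&` _.
    have XQ : X = Q j `&` X by apply/esym/setIidPr => x [_ [_ [Qx _]]].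
    have mX : measurable (X : set (borel E)) by exact: measurableI.
    have := piece_area_approx FC cQ (ltW r0) hr uM' d0' Qn Qd mX.
    by rewrite -XQ ct mulrCA divff ?mulr1// gt_eqF.
  rewrite muB nuB; split.
    rewrite -[leRHS]/(mscale (NngNum t10) nu _); apply: measure_bigcup_le => // j.
    by have [] := step j.
  rewrite -[leRHS]/(mscale (NngNum t10) mu _); apply: measure_bigcup_le => // j.
  by have [] := step j.
move=> mB; rewrite -muE -nuE; apply/eqP; rewrite eq_le; apply/andP; split.
  by apply: le_of_factor => // t ht; have [] := key t ht B mB.
by apply: le_of_factor => // t ht; have [] := key t ht B mB.
Qed.

End exact_piece.

(* The positive and negative parts of [det DF], for [s = false] and [s = true]. *)
Definition det_part (s : bool) (x : borel E) : R := Num.max 0 ((-1) ^+ s * \det (DF x)).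

Lemma det_part_ge0 s x : 0 <= det_part s x.
Proof. by rewrite /det_part le_max lexx. Qed.

Lemma det_part_le s x : det_part s x <= N`!%:R * C ^+ N.
Proof.
rewrite /det_part ge_max mulr_ge0 ?exprn_ge0//= (le_trans (ler_norm _))//.
by rewrite normrM normr_sign mul1r; exact: (J_bound C0 FC).
Qed.

Lemma det_partB x : det_part false x - det_part true x = \det (DF x).
Proof.
rewrite /det_part expr0 expr1 mul1r mulN1r.
by case: (lerP 0 (\det (DF x))); case: (lerP 0 (- \det (DF x))); lra.
Qed.

Lemma measurable_det_part s : measurable_fun setT (det_part s).
Proof.
apply: measurable_maxr => //; apply: measurable_funM => //.
exact: (measurable_det_Dmx FC).
Qed.

(** The determinant has constant sign on each piece of a countable cover. The [G j] are the images
    of the disjointified pieces with sign [s]; on the other pieces, and off the cover, [det_part s]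
    vanishes almost everywhere. *)
Lemma area_signed (s : bool) (A : set (borel E)) : measurable A ->
  exists G : nat -> set (borel E), (forall j, measurable (G j) /\ G j `<=` F @` A) /\
    forall V : set (borel E), measurable V ->
    (\int[L]_(x in A `&` F @^-1` V) (det_part s x)%:E = \sum_(0 <= j <oo) L (G j `&` V))%E.
Proof.
move=> mA; pose e := (4 * cst)^-1.
have e0 : 0 < e by rewrite invr_gt0 mulr_gt0.
have he : cst * e <= 4^-1 by rewrite /e invfM mulrCA divff ?mulr1// gt_eqF.
have [Q [hQ Qcov]] := area_cover FC e0 he.
have mQ0 j : measurable (Q j : set (borel E)) by apply: compact_borel; exact: (hQ j).1.
pose Q' := seqDU (Q : nat -> set (borel E)).
have mQ : forall j, measurable (Q' j) by exact: measurable_seqDU.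
have tQ : trivIset setT Q' by exact: trivIset_seqDU.
have QQ : \bigcup_j Q' j = \bigcup_j Q j by rewrite -seqDU_bigcup_eq.
have /choice[b hb] : forall j, exists b : bool, forall x, Q j x -> D x -> 0 < (-1) ^+ b * \det (DF x).
  by move=> j; exact: (area_piece_sign (ltW e0) he (hQ j)).
have [lam lamE] : exists lam : {measure set (borel E) -> \bar R},
    forall X, lam X = (\int[L]_(x in X) (det_part s x)%:E)%E.
  apply: density_measure => [|x]; first by apply/measurable_EFinP; exact: measurable_det_part.
  by rewrite lee_fin; exact: det_part_ge0.
have mdp : measurable_fun setT (fun x => (det_part s x)%:E) by apply/measurable_EFinP; exact: measurable_det_part.
have mJ : measurable_fun setT (fun x : borel E => (J x)%:E) by apply/measurable_EFinP; exact: measurable_J FC.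
have lam0 X : measurable X -> {ae L, forall x, X x -> det_part s x = 0} -> lam X = 0%E.
  move=> mX h; rewrite lamE; transitivity (\int[L]_(x in X) 0)%E; last exact: integral0.
  apply: ge0_ae_eq_integral => //.
  - by apply: measurable_funS mdp.
  - by move=> x _; rewrite lee_fin; exact: det_part_ge0.
  - by apply: ae_imp h => x h /h ->.
pose G j := if b j == s then F @` (Q j `&` (A `&` Q' j)) else set0.
exists G; split => [j|V mV].
  rewrite /G; case: ifP => _; last by split.
  split; last by move=> _ [x [_ [Ax _]] <-]; exists x.
  by apply: (measurable_area_piece_image (ltW e0) he (hQ j)); exact: measurableI.
have mFV : measurable (F @^-1` V : set (borel E)) by rewrite -[X in measurable X]setTI; exact: (measurable_lip_map FC measurableT mV).
set B := A `&` _; have mB : measurable B by exact: measurableI.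
rewrite -lamE (measure_total_bigcup mQ mB); last first.
  apply: lam0; first by apply: measurableD => //; exact: bigcup_measurable.
  apply: ae_imp (ae_diff_set FC) => x Dx [_]; rewrite QQ => nQ.
  suff dx : \det (DF x) = 0 by rewrite /det_part dx mulr0 maxxx.
  by apply: contrapT => /eqP /(Qcov x Dx)[j Qj]; apply: nQ; exists j.
rewrite measure_bigcup_nat//; [|by move=> j; exact: measurableI|exact: trivIset_setIl].
apply: eq_eseriesr => j _; set X := B `&` Q' j; have mX : measurable X by exact: measurableI.
have XQ : X `<=` Q j by move=> x [_ [Qx _]].
rewrite /G; case: eqP => bj; last first.
  rewrite set0I measure0; apply: lam0 => //.
  apply: ae_imp (ae_diff_set FC) => x Dx /XQ Qx; have := hb j x Qx Dx.
  rewrite /det_part; move: bj; case: (b j); case: (s) => // _; rewrite ?expr0 ?expr1 ?mul1r ?mulN1r => h;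
    by case: lerP => //; lra.
have -> : F @` (Q j `&` (A `&` Q' j)) `&` V = F @` (Q j `&` X).
  apply/seteqP; split => [_ [[x [Qx [Ax Qx']] <-] Vx]|_ [x [Qx [[Ax Vx] Qx']] <-]].
    by exists x => //; split => //; split => //; split.
  by split => //; exists x => //; split => //; split.
rewrite (piece_area (ltW e0) he (hQ j))// (_ : Q j `&` X = X); last exact/setIidPr.
rewrite lamE; apply: ge0_ae_eq_integral => //.
- by apply: measurable_funS mdp.
- by apply: measurable_funS mJ.
- by move=> x _; rewrite lee_fin; exact: det_part_ge0.
apply: ae_imp (ae_diff_set FC) => x Dx /XQ Qx; have := hb j x Qx Dx; rewrite bj => h.
by congr EFin; rewrite /det_part max_r ?ltW// -(gtr0_norm h) normrM normr_sign mul1r.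
Qed.

(** A null set is hit only where [F] is singular. This rescues the chain rule when the outer
    function is merely differentiable almost everywhere. *)
Lemma area_null (Z : set (borel E)) : measurable Z -> L Z = 0%E ->
  {ae L, forall x, Z (F x) -> \det (DF x) = 0}.
Proof.
move=> mZ Z0.
have h s : {ae L, forall x, Z (F x) -> det_part s x = 0}.
  have mFZ : measurable (F @^-1` Z : set (borel E)).
    by rewrite -[X in measurable X]setTI; exact: (measurable_lip_map FC measurableT mZ).
  have [G [mG GE]] := area_signed s measurableT.
  have := GE Z mZ; rewrite setTI eseries0; last first.
    move=> j _ _; apply/eqP; rewrite eq_le measure_ge0 andbT -Z0.
    by apply: measure_le => //; apply: measurableI => //; have [] := mG j.
  have mdp : measurable_fun (F @^-1` Z : set (borel E)) (fun x => (det_part s x)%:E).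
    by apply/measurable_EFinP; apply: measurable_funS (measurable_det_part s).
  move=> h0; have : (\int[L]_(x in F @^-1` Z) `|(det_part s x)%:E| = 0)%E.
    by rewrite -[RHS]h0; apply: eq_integral => x _; rewrite abse_EFin ger0_norm ?det_part_ge0.
  move=> /(ae_eq_integral_abs _ mFZ mdp); apply: ae_imp => x h1 /h1[]; exact.
apply: ae_imp (ae_and (h false) (h true)) => x [h1 h2] Zx.
by rewrite -det_partB h1// h2// subrr.
Qed.

Lemma cvg_int (u : nat -> R) (l : R) : (forall k, u k \is a Num.int) -> u k @[k --> \oo] --> l ->
  l \is a Num.int.
Proof.
move=> iu ul; have h2 : 0 < 2^-1 :> R by rewrite invr_gt0.
have [K _ hK] := (proj1 (cvgrPdist_lt _ _)) ul _ h2.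
suff h : u k @[k --> \oo] --> u K by rewrite (cvg_unique _ ul h).
apply: cvg_near_cst; exists K => // k /= Kk; apply/eqP; rewrite -subr_eq0.
have : `|u k - u K| < 1.
  have -> : u k - u K = (l - u K) - (l - u k) by ring.
  by rewrite (le_lt_trans (ler_normB _ _))// [ltRHS]splitr mul1r ltrD//; [exact: (hK K (leqnn K))|exact: hK].
have /intrP[m ->] : u k - u K \is a Num.int by rewrite rpredB.
by rewrite -intr_norm (ltr_int R _ 1) -[1]add0r ltzD1 normr_le0 => /eqP ->.
Qed.

(** [v y] counts the indices [j] with [y] in [G j]. The count is integrable because the determinant
    is bounded and [A] has finite volume; where it is infinite, [fine] makes it [0]. *)
Lemma area_multiplicity (s : bool) (A : set (borel E)) : measurable A -> (L A < +oo)%E ->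
  exists v : borel E -> R, [/\ measurable_fun setT v, L.-integrable setT (EFin \o v),
    forall y, 0 <= v y /\ v y \is a Num.int,
    forall y, ~ (F @` A) y -> v y = 0 &
    forall V : set (borel E), measurable V ->
    (\int[L]_(x in A `&` F @^-1` V) (det_part s x)%:E = \int[L]_(y in V) (v y)%:E)%E].
Proof.
move=> mA Afin; have [G [mG GE]] := area_signed s mA.
pose U y := (\sum_(0 <= j <oo) (\1_(G j) y : R)%:E)%E.
have U0 y : (0 <= U y)%E by apply: nneseries_ge0 => j _ _; rewrite lee_fin.
have mU : measurable_fun setT U.
  apply: ge0_emeasurable_sum => [j x _ _|j _]; first by rewrite lee_fin.
  by apply/measurable_EFinP; apply: measurable_indic; have [] := mG j.
have UV (V : set (borel E)) : measurable V -> (\int[L]_(y in V) U y = \sum_(0 <= j <oo) L (G j `&` V))%E.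
  move=> mV; rewrite integral_nneseries//; last first.
    by move=> j; apply/measurable_EFinP; apply: measurable_indic; have [] := mG j.
  by apply: eq_eseriesr => j _; rewrite integral_indic//; have [] := mG j.
have iU : L.-integrable setT U.
  apply/integrableP; split => //.
  rewrite (eq_integral U); last by move=> y _; rewrite gee0_abs.
  rewrite UV// -GE// preimage_setT setIT.
  apply: (@le_lt_trans _ _ (\int[L]_(x in A) (N`!%:R * C ^+ N)%:E)%E).
    apply: ge0_le_integral => //.
    - by move=> x _; rewrite lee_fin det_part_ge0.
    - by apply/measurable_EFinP; apply: measurable_funS (measurable_det_part s).
    - by move=> x _; rewrite lee_fin det_part_le.
  by rewrite integral_cst// lte_mul_pinfty// lee_fin mulr_ge0// exprn_ge0.
have aeU : {ae L, forall y, U y \is a fin_num}.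
  by have := integrable_ae measurableT iU; apply: ae_imp => y; exact.
exists (fine \o U).
have mv : measurable_fun setT (fine \o U) by apply: measurableT_comp.
have Uv : ae_eq L setT U (EFin \o (fine \o U)).
  by apply: ae_imp aeU => y fy _ /=; rewrite fineK.
split => //.
- apply: (le_integrable _ _ _ iU) => //; first exact/measurable_EFinP.
  by move=> y _ /=; case: (U y) => [r| |] //=; rewrite normr0 leey.
- move=> y; split; first by rewrite fine_ge0.
  rewrite /=; have : (\sum_(0 <= j < k) (\1_(G j) y : R)%:E)%E @[k --> \oo] --> U y.
    by apply: is_cvg_nneseries => j _ _; rewrite lee_fin.
  case: (U y) (U0 y) => [r| |//] _ h //=.
  apply: (cvg_int (u := fun k => \sum_(0 <= j < k) \1_(G j) y)).
    by move=> k; apply: rpred_sum => j _; rewrite indicE; exact: natr_int.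
  by move: h; under eq_fun do rewrite sumEFin; move=> /fine_cvgP[_].
- move=> y ny; rewrite /= (_ : U y = 0%E)//; apply: eseries0 => j _ _.
  by rewrite indicE memNset// => /(mG j).2.
move=> V mV; rewrite GE// -UV//; apply: ge0_ae_eq_integral => //.
- by apply: measurable_funS mU.
- by apply/measurable_EFinP; apply: measurable_funS mv.
- by move=> y _; rewrite lee_fin fine_ge0.
by apply: ae_imp Uv => y h _; apply: h.
Qed.

Lemma area_multiplicity_integral (s : bool) (A : set (borel E)) (v h : borel E -> R) :
  measurable A -> measurable_fun setT v -> (forall y, 0 <= v y) ->
  (forall V : set (borel E), measurable V ->
    (\int[L]_(x in A `&` F @^-1` V) (det_part s x)%:E = \int[L]_(y in V) (v y)%:E)%E) ->
  measurable_fun setT h -> (forall y, 0 <= h y) ->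
  \int[L]_x (\1_A x * det_part s x * h (F x)) = \int[L]_y (v y * h y).
Proof.
move=> mA mv v0 hv mh h0; pose w x := \1_A x * det_part s x.
have w0 x : 0 <= w x by rewrite mulr_ge0// ?det_part_ge0// indicE.
have mw : measurable_fun setT w by apply: measurable_funM; [exact: measurable_indic|exact: measurable_det_part].
have [lam lamE] : exists lam : {measure set (borel E) -> \bar R},
    forall X, lam X = (\int[L]_(x in X) (w x)%:E)%E.
  by apply: density_measure => [|x]; [exact/measurable_EFinP|rewrite lee_fin].
pose pm := pushforward_measure lam (measurable_lip_map FC).
have pmE (V : set (borel E)) : measurable V -> pm V = (\int[L]_(y in V) (v y)%:E)%E.
  move=> mV; rewrite -hv// -[LHS]/(lam (F @^-1` V)) lamE setIC integral_mkcondr.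
  apply: eq_integral => x _; rewrite /w patchE indicE; case: (x \in A); by rewrite ?mul1r ?mul0r.
have mhE : measurable_fun setT (EFin \o h) by exact/measurable_EFinP.
have e1 := density_integral mv v0 pmE mhE (fun y => h0 y).
have e2 := density_integral mw w0 (fun A _ => lamE A) (measurableT_comp mhE (measurable_lip_map FC)) (fun x => h0 (F x)).
have e3 := ge0_integral_pushforward (measurable_lip_map FC) lam measurableT mhE (fun y _ => h0 y).
rewrite /Rintegral; congr fine.
transitivity (\int[L]_x (((EFin \o h) \o F) x * (w x)%:E))%E.
  by apply: eq_integral => x _; rewrite /= -EFinM mulrC.
rewrite -e2; transitivity (\int[pm]_y (EFin \o h) y)%E; first exact: (esym e3).
rewrite e1.
by apply: eq_integral => y _ /=; rewrite -EFinM mulrC.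
Qed.

Lemma integrable_mul_bounded (f h : borel E -> R) (M : R) : L.-integrable setT (EFin \o f) ->
  measurable_fun setT h -> (forall y, `|h y| <= M) -> L.-integrable setT (EFin \o (fun x => f x * h x)).
Proof.
move=> fi mh hM; apply: (integrableMl measurableT fi mh).
exists M; split; first exact: num_real.
by move=> x Mx y _ /=; rewrite (le_trans (hM y))// ltW.
Qed.

(* [u] is the sum of the signs of [det DF] over the fibres of [F] in [A]. *)
Lemma area_degree (A : set (borel E)) : measurable A -> (L A < +oo)%E ->
  exists u : borel E -> R, [/\ L.-integrable setT (EFin \o u),
    forall y, u y \is a Num.int &
    forall h : borel E -> R, measurable_fun setT h -> (exists M, forall x, A x -> `|h (F x)| <= M) ->
    \int[L]_x (\1_A x * (h (F x) * \det (DF x))) = \int[L]_y (u y * h y)].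
Proof.
move=> mA Afin.
have [v [mv iv v0 vA vE]] := area_multiplicity false mA Afin.
have [v' [mv' iv' v0' vA' vE']] := area_multiplicity true mA Afin.
exists (fun y => v y - v' y); split.
- exact: (integrableB measurableT iv iv').
- by move=> y; apply: rpredB; [exact: (v0 y).2|exact: (v0' y).2].
move=> h mh [M hM].
(* [h] is bounded on [F(A)] only. The truncation is bounded everywhere and agrees with [h] there,
   while the multiplicities vanish off [F(A)]. *)
pose M' := `|M|; pose g (y : borel E) := Num.max (- M') (Num.min M' (h y)).
have M0 : 0 <= M' by exact: normr_ge0.
have mg : measurable_fun setT g by apply: measurable_maxr => //; exact: measurable_minr.
have gM y : `|g y| <= M'.
  rewrite ler_norml /g le_max lexx/= ge_max ge_min lexx andbT/=.
  by rewrite (le_trans _ M0)// oppr_le0.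
have gh x : A x -> g (F x) = h (F x).
  move=> /hM; move=> /le_trans/(_ (ler_norm M)); rewrite ler_norml -/M' => /andP[h1 h2].
  by rewrite /g min_r// max_r.
have mgF : measurable_fun setT (fun x : borel E => g (F x)) by exact: (measurableT_comp mg (measurable_lip_map FC)).
have i1A : L.-integrable setT (EFin \o (\1_A : borel E -> R)).
  apply/integrableP; split; first by apply/measurable_EFinP; exact: measurable_indic.
  under eq_integral do rewrite /= ger0_norm ?indicE//.
  by under eq_integral do rewrite -indicE; rewrite integral_indic// setIT.
have dp s x : `|det_part s x| <= N`!%:R * C ^+ N by rewrite ger0_norm ?det_part_ge0// det_part_le.
have idp s : L.-integrable setT (EFin \o (fun x => \1_A x * det_part s x)).
  exact: (integrable_mul_bounded i1A (measurable_det_part s) (dp s)).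
have area s w : measurable_fun setT w -> L.-integrable setT (EFin \o w) ->
    (forall y, 0 <= w y /\ w y \is a Num.int) ->
    (forall V : set (borel E), measurable V ->
    (\int[L]_(x in A `&` F @^-1` V) (det_part s x)%:E = \int[L]_(y in V) (w y)%:E)%E) ->
    \int[L]_x (\1_A x * det_part s x * g (F x)) = \int[L]_y (w y * g y).
  move=> mw iw w0 wE.
  (* The change of variables is known for nonnegative functions; adding the constant [M'] and
     subtracting its contribution extends it to [g]. *)
  have h1 : \int[L]_x (\1_A x * det_part s x * (g (F x) + M')) = \int[L]_y (w y * (g y + M')).
    apply: (@area_multiplicity_integral s A w (fun y => g y + M')) => //.
    - by move=> y; exact: (w0 y).1.
    - exact: measurable_funD.
    - by move=> y; have := gM y; rewrite ler_norml => /andP[]; lra.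
  have h2 : \int[L]_x (\1_A x * det_part s x * M') = \int[L]_y (w y * M').
    by apply: (@area_multiplicity_integral s A w (fun=> M')) => // y; exact: (w0 y).1.
  have c1 : forall y : borel E, `|M'| <= M' by move=> y; rewrite ger0_norm.
  have i1 := integrable_mul_bounded (idp s) mgF (fun x => gM (F x)).
  have i2 := integrable_mul_bounded (idp s) (measurable_cst M') c1.
  have i3 := integrable_mul_bounded iw mg gM.
  have i4 := integrable_mul_bounded iw (measurable_cst M') c1.
  move: h1; under eq_Rintegral do rewrite mulrDr; rewrite RintegralD// h2.
  under [X in _ = X -> _]eq_Rintegral do rewrite mulrDr; rewrite RintegralD//.
  by move=> /addIr.
transitivity (\int[L]_x (\1_A x * det_part false x * g (F x) - \1_A x * det_part true x * g (F x))).
  apply: eq_Rintegral => x _; rewrite -mulrBl -mulrBr det_partB indicE.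
  by case: (boolP (x \in A)) => [/set_mem Ax|]; rewrite ?mul0r// !mul1r gh// mulrC.
rewrite RintegralB//; [|exact: integrable_mul_bounded (idp _) mgF (fun x => gM (F x))..].
rewrite (area _ v)// (area _ v')// -RintegralB//; [|exact: integrable_mul_bounded iv mg gM|exact: integrable_mul_bounded iv' mg gM].
apply: eq_Rintegral => y _; rewrite -mulrBl.
have [[x Ax <-]|nA] := pselect ((F @` A) y); first by rewrite gh.
by rewrite vA// vA'// subrr !mul0r.
Qed.

End area_formula.

(** * Integration by parts for Lipschitz determinants *)

Section det_interpolation.
Context {R : realFieldType}.

Lemma vandermonde_weights (m : nat) (a : 'I_m -> R) (k0 : 'I_m) : injective a ->
  exists w : 'I_m -> R, forall k : 'I_m, \sum_i w i * a i ^+ k = (k == k0)%:R.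
Proof.
move=> ainj; pose V := Vandermonde m (\row_i a i : 'rV[R]_m).
have uV : V \in unitmx.
  rewrite unitmxE unitfE det_Vandermonde; apply/prodf_neq0 => i _; apply/prodf_neq0 => j ij.
  by rewrite !mxE subr_eq0; apply: contraTneq ij => /ainj ->; rewrite ltnn.
exists (fun i => invmx V i k0) => k.
have : (V *m invmx V) k k0 = (k == k0)%:R by rewrite mulmxV// mxE.
by rewrite mxE => <-; apply: eq_bigr => i _; rewrite !mxE mulrC.
Qed.

(** After [s] is factored out, this is the characteristic polynomial of [-A] evaluated at [s^-1].
    Its constant coefficient, which is [det A], goes with the power [s ^+ m]. *)
Lemma det_addI (m : nat) (A : 'M[R]_m) (s : R) : s != 0 ->
  \det (1%:M + s *: A) = \sum_(j < m.+1) (char_poly (- A))`_j * s ^+ (m - j).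
Proof.
move=> s0; have -> : 1%:M + s *: A = s *: (s^-1 *: 1%:M + A).
  by rewrite scalerDr scalerA mulfV// scale1r.
rewrite detZ.
have -> : \det (s^-1 *: 1%:M + A) = (char_poly (- A)).[s^-1].
  rewrite /char_poly -horner_evalE -det_map_mx; congr (\det _); apply/matrixP => i j.
  by rewrite !mxE /= /horner_eval !hornerE/= hornerMn hornerX mulr_natr opprK.
rewrite (horner_coef_wide _ (n := m.+1)) ?size_char_poly// big_distrr/=.
apply: eq_bigr => j _; rewrite mulrCA; congr (_ * _).
have jm : (j <= m)%N by rewrite -ltnS.
by rewrite -{1}(subnK jm) exprD -mulrA -exprMn mulfV// expr1n mulr1.
Qed.

(** The map [s |-> det (1 + s A)] is a polynomial of degree at most [m] with leading term [det A];
    Vandermonde weights read off that coefficient from [m + 1] values, independently of [A]. *)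
Lemma det_interpolation (m : nat) (s : 'I_m.+1 -> R) : injective s -> (forall i, s i != 0) ->
  exists w : 'I_m.+1 -> R, forall A : 'M[R]_m, \det A = \sum_i w i * \det (1%:M + s i *: A).
Proof.
move=> sinj s0; have [w hw] := vandermonde_weights ord_max sinj.
exists w => A.
have -> : \det A = (char_poly (- A))`_0.
  rewrite char_poly_det (_ : - A = (-1) *: A); last by rewrite scaleN1r.
  by rewrite detZ mulrA -exprMn mulrNN mulr1 expr1n mul1r.
under eq_bigr => i _ do rewrite det_addI// big_distrr/=.
rewrite exchange_big/= (bigD1 ord0)//= [X in _ + X]big1 => [|j j0].
  rewrite addr0 subn0; under eq_bigr do rewrite mulrCA.
  by rewrite -big_distrr/= (hw ord_max) eqxx mulr1.
have jm : (m - j < m.+1)%N by rewrite ltnS leq_subr.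
under eq_bigr do rewrite mulrCA.
rewrite -big_distrr/= (hw (Ordinal jm)) (_ : _ == _ = false) ?mulr0//.
apply/negbTE; rewrite -val_eqE/=; apply: contra j0 => /eqP h; rewrite -val_eqE/=.
have : (j <= m)%N by rewrite -ltnS.
by move=> /subKn; rewrite h subnn => <-.
Qed.

End det_interpolation.

HB.instance Definition _ (R : realType) (n : nat) := Complete.on 'rV[R]_n.+1.

Lemma row_mul_addI {R : comPzRingType} (m : nat) (v : 'rV[R]_m) (A : 'M[R]_m) (s : R) j :
  \sum_i v ord0 i * (1%:M + s *: A) i j = v ord0 j + \sum_i s * (v ord0 i * A i j).
Proof.
rewrite (bigD1 j)//= [in RHS](bigD1 j)//= addrA; congr (_ + _); first by rewrite !mxE eqxx mulr1n; ring.
by apply: eq_bigr => i ij; rewrite !mxE (negbTE ij) mulr0n; ring.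
Qed.

Section lax.
Context {R : realType} {n : nat}.
Local Notation N := n.+1.
Local Notation E := (euclid R N).
Local Notation L := (@lebesgueRn R N).

Section perturbation.
Variables (g : 'I_N -> E -> R) (C r : R).
Hypothesis C0 : 0 <= C.
Hypothesis gC : forall j, lip_with C (g j).
Hypothesis r0 : 0 < r.
Hypothesis gr : forall j (x : 'rV[R]_N), r < `|x| -> g j x = 0.

Let G : E -> E := fun x => \row_j g j x.
Let K := `|C| * N%:R.
Let c := @area_cst R n.

Let c0 : 0 < c. Proof. exact: lt_le_trans ltr01 area_cst_gt1. Qed.
Let K0 : 0 <= K. Proof. by rewrite !mulr_ge0. Qed.

Let GC j : lip_with C (fun x : E => (G x : 'rV[R]_N) ord0 j).
Proof. by move=> x y; rewrite !mxE; exact: gC. Qed.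

Let Gsup (x y : 'rV[R]_N) : `|(G x : 'rV[R]_N) - G y| <= K * `|x - y|.
Proof. exact: (lip_map_sup GC). Qed.

Let Gr (x : 'rV[R]_N) : r < `|x| -> G x = 0 :> 'rV[R]_N.
Proof. by move=> rx; apply/rowP => j; rewrite !mxE gr. Qed.

Section one_parameter.
Variable s : R.
Hypothesis s0 : 0 < s.
Hypothesis hs : c * (s * K) <= 4^-1.

Let Phi : E -> E := fun x => (x : 'rV[R]_N) + s *: (G x : 'rV[R]_N).

Let e0 : 0 <= s * K. Proof. by rewrite mulr_ge0// ltW. Qed.

Let sK1 : s * K < 1.
Proof.
have : s * K <= c * (s * K) by rewrite ler_peMl// area_cst_gt1.
by move=> /le_trans/(_ hs) /le_lt_trans; apply; rewrite invf_lt1// ltr1n.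
Qed.

Let PhiC j : lip_with (1 + `|s| * C) (fun x : E => (Phi x : 'rV[R]_N) ord0 j).
Proof.
have := lip_withD (@coord_lip R N j) (lip_withZ s (gC j)).
by move=> h x y; have := h x y; rewrite !mxE.
Qed.

Let Phi_near (x y : 'rV[R]_N) : `|((Phi (x + y) : 'rV[R]_N) - Phi x) *m 1%:M - y| <= s * K * `|y|.
Proof.
rewrite mulmx1 (_ : _ - y = s *: ((G (x + y) : 'rV[R]_N) - G x)); last first.
  by apply/rowP => j; rewrite !mxE; ring.
rewrite normrZ gtr0_norm// -mulrA ler_pM2l//.
by rewrite (le_trans (Gsup _ _))// addrC addKr.
Qed.

Let Phi_near_sub (x y : 'rV[R]_N) : `|((Phi x : 'rV[R]_N) - Phi y) - (x - y)| <= s * K * `|x - y|.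
Proof. by have := Phi_near y (x - y); rewrite mulmx1 [y + _]addrC subrK. Qed.

Let Phi_inj (x y : 'rV[R]_N) : Phi x = Phi y -> x = y.
Proof.
move=> xy; apply/eqP; rewrite -subr_eq0 -normr_le0; have := Phi_near_sub x y.
rewrite xy subrr sub0r normrN => h.
have : (1 - s * K) * `|x - y| <= 0 by rewrite mulrBl mul1r subr_le0.
by rewrite pmulr_rle0// subr_gt0.
Qed.

Let Phi_piece rho : 0 <= rho -> area_piece Phi (s * K) (Bx rho).
Proof.
move=> rho0; split.
  apply/compact_euclid; apply: bounded_closed_compact.
    exists rho; split; first exact: num_real.
    by move=> t rt x xr /=; rewrite (le_trans xr)// ltW.
  apply: (closed_comp (f := fun x : 'rV[R]_N => `|x|) (D := [set t | t <= rho])); last exact: closed_le.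
  by move=> x _; exact: norm_continuous.
exists 1%:M, (2 * rho + 1); split.
- exact: unitmx1.
- by rewrite ltr_wpDl// mulr_ge0.
- by move=> x _ y _; exact: Phi_near.
move=> x y xr yr; rewrite (le_lt_trans (ler_normB _ _))//.
by move: xr yr; rewrite /Bx/= => *; lra.
Qed.

(** A preimage of [y] is a fixed point of [x |-> y - s G x], a contraction because [s K < 1]. *)
Let Phi_onto (y : 'rV[R]_N) : exists x : 'rV[R]_N, Phi x = y.
Proof.
pose f (x : 'rV[R]_N) := y - s *: (G x : 'rV[R]_N).
have fT : {homo f : x / [set: 'rV[R]_N] x >-> [set: 'rV[R]_N] x} by [].
have [x _ xE] : exists2 x : 'rV[R]_N, [set: 'rV[R]_N] x & x = mkfun fT x.
  apply: banach_fixed_point; [|exact: closedT|by exists 0].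
  exists (NngNum e0); split => // -[u v] _ /=.
  rewrite /f (_ : _ - _ = s *: ((G v : 'rV[R]_N) - G u)); last first.
    by apply/rowP => j; rewrite !mxE; ring.
  by rewrite normrZ gtr0_norm// -mulrA ler_pM2l// -[leRHS]/(K * `|u - v|) distrC Gsup.
by exists x; rewrite /Phi {1}xE /= /f subrK.
Qed.

(** [Phi] is the identity outside the ball. By injectivity no point of the ball can leave it, and by
    surjectivity every point of it is attained from within. *)
Let Phi_Bx rho : r < rho -> Phi @` (Bx rho) = Bx rho.
Proof.
move=> rrho; have out (x : 'rV[R]_N) : rho < `|x| -> Phi x = x.
  by move=> hx; rewrite /Phi Gr ?scaler0 ?addr0// (lt_trans rrho).
apply/seteqP; split => [_ [x xr <-]|y yr].
  rewrite /Bx/=; case: (leP (`|Phi x : 'rV[R]_N|) rho) => // h.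
  by have := Phi_inj (out _ h) => px; move: h; rewrite px ltNge => /negP; case.
have [x xy] := Phi_onto y; exists x => //.
rewrite /Bx/=; case: (leP `|x : 'rV[R]_N| rho) => // h.
by move: (yr); rewrite -xy (out _ h) /Bx/= leNgt h.
Qed.

(** The whole ball is one piece for [Phi] with [M = 1], so the area formula is exact on it and the
    determinant is positive; the image is the ball itself. *)
Lemma perturbation_volume rho : r < rho ->
  exists F : 'I_N -> E -> R, [/\ forall j, lip_with (1 + `|s| * C) (F j),
    \int[L]_(x in Bx rho) \det (Dmx F x) = fine (L (Bx rho)) &
    {ae L, forall x, Dmx F x = 1%:M + s *: Dmx g x}].
Proof.
move=> rrho; have rho0 : 0 <= rho by rewrite ltW// (lt_trans r0).
pose F j (x : E) := (Phi x : 'rV[R]_N) ord0 j; exists F; split => //.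
  have pc := Phi_piece rho0.
  have := piece_area PhiC e0 hs pc (@measurableT _ (borel E)).
  rewrite setIT Phi_Bx// => ->; rewrite /Rintegral; congr fine.
  have mB := @measurable_Bx R N rho.
  apply: ae_eq_integral => //.
  - by apply/measurable_EFinP; apply: measurable_funS (measurable_det_Dmx PhiC).
  - by apply/measurable_EFinP; apply: measurable_funS (measurable_J PhiC).
  apply: ae_imp (ae_diff_set PhiC) => x Px xr; congr EFin.
  have near1 : Bx rho `<=` near_lin Phi (s * K) 1%:M 1 by move=> u _ v _; exact: Phi_near.
  have := piece_det PhiC e0 hs ltr01 near1 xr Px.
  by rewrite det1 mulr1 => h; rewrite gtr0_norm.
apply: ae_imp (ae_diff_set gC) => x Dx.
apply: (proj2 (frechet_diff_set PhiC _)) => j e ee.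
have e1 : 0 < e / s by rewrite divr_gt0.
have [d d0 hd] := diff_set_frechet gC Dx j e1.
exists d => // y yd; have := hd y yd; move=> h.
rewrite (_ : _ - _ = s * (g j (x + y) - g j x - \sum_i y ord0 i * Dmx g x i j)).
  by rewrite normrM gtr0_norm// -ler_pdivlMl// mulrA [s^-1 * e]mulrC.
rewrite !mxE mulrBr big_distrr/=.
rewrite row_mul_addI.
by ring.
Qed.

End one_parameter.

(* [det Dg] is a fixed linear combination of the [det (1 + t Dg)] for finitely many
   small [t], and the combination annihilates constants. *)
Lemma int_det_eq0 : \int[L]_x \det (Dmx g x) = 0.
Proof.
(* The parameters [s0/(i+1)] are distinct, positive, and all below the threshold [1/4] required of a
   perturbation. *)
pose s0 := 4^-1 / (c * (K + 1)).
have cK : 0 < c * (K + 1) by rewrite mulr_gt0// ltr_wpDl.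
have s00 : 0 < s0 by rewrite divr_gt0.
pose s (i : 'I_N.+1) : R := s0 / i.+1%:R.
have sp i : 0 < s i by rewrite divr_gt0.
have hs i : c * (s i * K) <= 4^-1.
  have h : s i <= s0 by rewrite ler_pdivrMr// ler_peMr ?(ltW s00)// ler1n.
  apply: (@le_trans _ _ (c * (s0 * (K + 1)))).
    by rewrite ler_wpM2l ?(ltW c0)// ler_pM ?(ltW (sp i))// lerDl.
  by rewrite mulrCA /s0 divfK// gt_eqF.
have sinj : injective s.
  move=> i j /(mulfI (lt0r_neq0 s00))/invr_inj/eqP; rewrite eqr_nat eqSS => /eqP ij.
  exact: val_inj.
have [w hw] := det_interpolation sinj (fun i => lt0r_neq0 (sp i)).
have w0 : \sum_i w i = 0.
  have := hw 0; rewrite det0 => h; rewrite [RHS]h; apply: eq_bigr => i _.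
  by rewrite scaler0 addr0 det1 mulr1.
have rr1 : r < r + 1 by rewrite ltrDl.
have /choice[F hF] := fun i => perturbation_volume (sp i) (hs i) rr1.
have mB := @measurable_Bx R N (r + 1).
have iF i : L.-integrable (Bx (r + 1)) (EFin \o (fun x => w i * \det (Dmx (F i) x))).
  have [FC _ _] := hF i; have FC0 : 0 <= 1 + `|s i| * C by rewrite addr_ge0// mulr_ge0.
  apply: (measurable_bounded_integrable mB (lebesgue_Bx_lty _)).
    apply: measurable_funM => //; apply: measurable_funS (measurable_det_Dmx FC) => //.
  exists (`|w i| * (N`!%:R * (1 + `|s i| * C) ^+ N)); split; first exact: num_real.
  move=> t ht x _ /=; rewrite (le_trans _ (ltW ht))// normrM ler_wpM2l//.
  exact: (det_Dmx_le FC0 FC).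
have g0 (x : E) : r < `|x : 'rV[R]_N| -> \det (Dmx g x) = 0.
  move=> rx; rewrite (_ : Dmx g x = 0) ?det0//.
  apply: (proj2 (frechet_diff_set gC _)) => j e ee; exists (`|x : 'rV[R]_N| - r); first by rewrite subr_gt0.
  move=> y hy; rewrite big1 => [|i _]; last by rewrite mxE mulr0.
  rewrite !gr// ?subrr ?normr0 ?mulr_ge0// ?ltW//.
  by have := ler_normB (x + y) y; rewrite addrK; lra.
transitivity (\int[L]_(x in Bx (r + 1)) \det (Dmx g x)).
  rewrite [RHS]Rintegral_mkcond; apply: eq_Rintegral => x _; rewrite patchE.
  case: ifPn => //; rewrite notin_setE /Bx/= => /negP; rewrite -ltNge => h.
  by apply: g0; exact: lt_trans h.
transitivity (\int[L]_(x in Bx (r + 1)) (\sum_i w i * \det (Dmx (F i) x))).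
  rewrite /Rintegral; congr fine; apply: ae_eq_integral => //.
  - by apply/measurable_EFinP; apply: measurable_funS (measurable_det_Dmx gC).
  - apply/measurable_EFinP; apply: measurable_sum => i; apply: measurable_funM => //.
    by have [FC _ _] := hF i; apply: measurable_funS (measurable_det_Dmx FC).
  have : {ae L, forall x, forall i, Dmx (F i) x = 1%:M + s i *: Dmx g x}.
    by apply: ae_count => i; have [] := hF i.
  apply: ae_imp => x Fx _; congr EFin; rewrite [LHS]hw; apply: eq_bigr => i _.
  by rewrite Fx.
transitivity (\sum_i w i * fine (L (Bx (r + 1)))); last by rewrite -big_distrl/= w0 mul0r.
rewrite /Rintegral; under eq_integral do rewrite -sumEFin.
rewrite integral_sum//.
rewrite (eq_bigr (fun i => (w i * fine (L (Bx (r + 1))))%:E)) ?sumEFin// => i _.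
have [_ <- _] := hF i; rewrite -RintegralZl//; last first.
  have [FC _ _] := hF i; have FC0 : 0 <= 1 + `|s i| * C by rewrite addr_ge0// mulr_ge0.
  apply: (measurable_bounded_integrable mB (lebesgue_Bx_lty _)).
    by apply: measurable_funS (measurable_det_Dmx FC).
  exists (N`!%:R * (1 + `|s i| * C) ^+ N); split; first exact: num_real.
  by move=> t ht x _ /=; rewrite (le_trans _ (ltW ht))//; exact: (det_Dmx_le FC0 FC).
by rewrite /Rintegral fineK//; apply: integrable_fin_num => //; exact: iF.
Qed.

End perturbation.
End lax.

Section det_columns.
Context {R : comNzRingType} {m : nat}.
Implicit Types A B C : 'M[R]_m.

Lemma det_col_linear A B C i a : (forall k, A k i = a * B k i + C k i) ->
  (forall k j, j != i -> B k j = A k j) -> (forall k j, j != i -> C k j = A k j) ->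
  \det A = a * \det B + \det C.
Proof.
move=> hA hB hC; rewrite -(det_tr A) -(det_tr B) -(det_tr C) -[\det C^T]mul1r.
apply: (determinant_multilinear (i0 := i)).
- by apply/rowP => k; rewrite !mxE hA mul1r.
- by apply/matrixP => k j; rewrite !mxE hB// eq_sym neq_lift.
- by apply/matrixP => k j; rewrite !mxE hC// eq_sym neq_lift.
Qed.

Lemma det_col0 A i : (forall k, A k i = 0) -> \det A = 0.
Proof. by move=> h; rewrite (expand_det_col _ i) big1// => k _; rewrite h mul0r. Qed.

End det_columns.

Section frechet_calculus.
Context {R : realType} {n : nat}.
Local Notation E := (euclid R n).
Implicit Types (f g : E -> R) (x : 'rV[R]_n) (l : 'I_n -> R).

Lemma frechet_near f g x l d : 0 < d -> (forall y : 'rV[R]_n, `|y| < d -> f (x + y) = g (x + y)) ->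
  frechet f x l -> frechet g x l.
Proof.
move=> d0 fg fl e e0; have [d' d'0 h] := fl e e0.
exists (Num.min d d'); first by rewrite lt_min d0.
move=> y; rewrite lt_min => /andP[yd yd'].
rewrite -fg// -[x in g x]addr0 -fg ?normr0// addr0; exact: h.
Qed.

Lemma frechet_cst c x : frechet (fun=> c) x (fun=> 0).
Proof.
move=> e e0; exists 1 => // y _; rewrite subrr big1 ?subr0 ?normr0 ?mulr_ge0// ?ltW//.
by move=> i _; rewrite mulr0.
Qed.

Lemma frechet_lin a f g x l l' : frechet f x l -> frechet g x l' ->
  frechet (fun y => a * f y + g y) x (fun i => a * l i + l' i).
Proof.
move=> fl gl e e0; have a1 : 0 < `|a| + 1 by rewrite ltr_wpDl.
have e1 : 0 < e / 2 / (`|a| + 1) by rewrite !divr_gt0.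
have e2 : 0 < e / 2 by rewrite divr_gt0.
have [d d0 hd] := fl _ e1; have [d' d'0 hd'] := gl _ e2.
exists (Num.min d d'); first by rewrite lt_min d0.
move=> y; rewrite lt_min => /andP[/hd h1 /hd' h2].
have -> : a * f (x + y) + g (x + y) - (a * f x + g x) - \sum_i y ord0 i * (a * l i + l' i) =
    a * (f (x + y) - f x - \sum_i y ord0 i * l i) + (g (x + y) - g x - \sum_i y ord0 i * l' i).
  have -> : \sum_i y ord0 i * (a * l i + l' i) = a * \sum_i y ord0 i * l i + \sum_i y ord0 i * l' i.
    by rewrite mulr_sumr -big_split/=; apply: eq_bigr => i _; ring.
  by ring.
rewrite (le_trans (ler_normD _ _))// [e in leRHS]splitr mulrDl lerD// normrM.
rewrite (le_trans (ler_wpM2l _ h1))// mulrA ler_wpM2r// mulrCA.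
by apply: ler_piMr; [exact: ltW|rewrite ler_pdivrMr// mul1r lerDl].
Qed.

Lemma frechet_bound f x l C : (forall y z : 'rV[R]_n, `|f y - f z| <= C * `|y - z|) ->
  forall y : 'rV[R]_n, `|f (x + y) - f x| <= C * `|y|.
Proof. by move=> h y; have := h (x + y) x; rewrite [x + y - x]addrC addKr. Qed.

Lemma frechet_mul f g x l l' C D : 0 <= C -> 0 <= D ->
  (forall y z : 'rV[R]_n, `|f y - f z| <= C * `|y - z|) ->
  (forall y z : 'rV[R]_n, `|g y - g z| <= D * `|y - z|) ->
  frechet f x l -> frechet g x l' ->
  frechet (fun y => f y * g y) x (fun i => f x * l' i + g x * l i).
Proof.
move=> C0 D0 fC gD fl gl e e0.
have a1 : 0 < `|f x| + 1 by rewrite ltr_wpDl.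
have b1 : 0 < `|g x| + 1 by rewrite ltr_wpDl.
have c1 : 0 < C * D + 1 by rewrite ltr_wpDl// mulr_ge0.
have e1 : 0 < e / 3 / (`|g x| + 1) by rewrite !divr_gt0.
have e2 : 0 < e / 3 / (`|f x| + 1) by rewrite !divr_gt0.
have e3 : 0 < e / 3 / (C * D + 1) by rewrite !divr_gt0.
have [d d0 hd] := fl _ e1; have [d' d'0 hd'] := gl _ e2.
exists (Num.min (Num.min d d') (e / 3 / (C * D + 1))); first by rewrite !lt_min d0 d'0.
move=> y; rewrite !lt_min => /andP[/andP[/hd h1 /hd' h2] h3].
have fy := frechet_bound x l fC y; have gy := frechet_bound x l gD y.
have -> : f (x + y) * g (x + y) - f x * g x - \sum_i y ord0 i * (f x * l' i + g x * l i) =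
    g x * (f (x + y) - f x - \sum_i y ord0 i * l i) +
    f x * (g (x + y) - g x - \sum_i y ord0 i * l' i) + (f (x + y) - f x) * (g (x + y) - g x).
  have -> : \sum_i y ord0 i * (f x * l' i + g x * l i) =
     f x * \sum_i y ord0 i * l' i + g x * \sum_i y ord0 i * l i.
    by rewrite !mulr_sumr -big_split/=; apply: eq_bigr => i _; ring.
  by ring.
have mono (a b t : R) : 0 <= a -> a < b -> 0 <= t -> a * (e / 3 / b * t) <= e / 3 * t.
  move=> a0 ab t0; have b0 : 0 < b by exact: le_lt_trans ab.
  rewrite mulrA ler_wpM2r// mulrCA ler_piMr// ?divr_ge0// ?(ltW e0)//.
  by rewrite ler_pdivrMr// mul1r ltW.
have -> : e * `|y| = e / 3 * `|y| + e / 3 * `|y| + e / 3 * `|y| by field.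
rewrite (le_trans (ler_normD _ _))// lerD//.
  rewrite (le_trans (ler_normD _ _))// lerD// normrM.
    by rewrite (le_trans (ler_wpM2l _ h1))// mono// ltrDl.
  by rewrite (le_trans (ler_wpM2l _ h2))// mono// ltrDl.
rewrite normrM (le_trans (ler_pM _ _ fy gy))// mulrACA.
apply: (@le_trans _ _ (C * D * (e / 3 / (C * D + 1) * `|y|))); last by rewrite mono ?mulr_ge0// ltrDl.
by rewrite ler_wpM2l ?mulr_ge0// ler_wpM2r// ltW.
Qed.

End frechet_calculus.

Section bounded_lipschitz.
Context {R : realType} {n : nat}.
Local Notation E := (euclid R n).

Lemma lip_sup_norm : lip_with 1 (fun x : E => `|x : 'rV[R]_n|).
Proof.
move=> x y; rewrite mul1r (le_trans (ler_dist_dist _ _))//.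
exact: norm_le_enorm.
Qed.

Definition clamp (b : R) (f : E -> R) (x : E) := Num.max (- b) (Num.min b (f x)).

Lemma clamp_le b f x : 0 <= b -> `|clamp b f x| <= b.
Proof.
move=> b0; rewrite ler_norml /clamp le_max lexx/= ge_max ge_min lexx andbT.
by rewrite (le_trans _ b0)// oppr_le0.
Qed.

Lemma clamp_id b f x : `|f x| <= b -> clamp b f x = f x.
Proof. by rewrite ler_norml => /andP[h1 h2]; rewrite /clamp min_r// max_r. Qed.

Lemma clamp_lip b f L : 0 <= L -> lip_with L f -> lip_with L (clamp b f).
Proof. by move=> L0 fL; apply: lip_max; [exact: lip_with_cst|apply: lip_min => //; exact: lip_with_cst]. Qed.

Lemma is_lip_ge0 (f : E -> R) : is_lip f -> exists2 L, 0 <= L & lip_with L f.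
Proof. by move=> /is_lip_ge1[L L1 h]; exists L => //; exact: le_trans L1. Qed.

Lemma lip_bounded_Bx (f : E -> R) r : is_lip f -> exists2 M, 0 <= M & forall x, Bx r x -> `|f x| <= M.
Proof.
move=> /is_lip_ge0[L L0 fL]; exists (`|f 0| + L * (n%:R * `|r|)).
  by rewrite addr_ge0// mulr_ge0// mulr_ge0.
move=> x xr; have -> : f x = f 0 + (f x - f 0) by rewrite addrC subrK.
rewrite (le_trans (ler_normD _ _))// lerD2l (le_trans (fL _ _))// ler_wpM2l//.
rewrite euclid_mdist subr0 (le_trans (enorm_le_norm _))// ler_wpM2l//.
by rewrite (le_trans xr)// ler_norm.
Qed.

Definition supp_in r (f : E -> R) := forall x : 'rV[R]_n, r < `|x| -> f x = 0.

(** A product of Lipschitz functions is Lipschitz when both are bounded. Outside the support of [f]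
    the values of [g] do not matter, so [g] may be clamped to its bound on the ball. *)
Lemma lip_mul_supp (f g : E -> R) r : is_lip f -> supp_in r f -> is_lip g -> is_lip (fun x => f x * g x).
Proof.
move=> fl fr gl; have [a a0 fa] := lip_bounded_Bx r fl; have [b b0 gb] := lip_bounded_Bx r gl.
have [L L0 fL] := is_lip_ge0 fl; have [M M0 gM] := is_lip_ge0 gl.
have -> : (fun x => f x * g x) = (fun x => f x * clamp b g x).
  apply/funext => x; have [xr|xr] := leP `|x : 'rV[R]_n| r; first by rewrite clamp_id// gb.
  by rewrite fr// !mul0r.
exists (b * L + a * M); apply: lip_withM => //.
- move=> x; have [xr|xr] := leP `|x : 'rV[R]_n| r; first exact: fa.
  by rewrite fr// normr0.
- by move=> x; exact: clamp_le.
- exact: clamp_lip.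
Qed.

Lemma supp_inM r f g : supp_in r f -> supp_in r (fun x => f x * g x).
Proof. by move=> fr x xr; rewrite fr// mul0r. Qed.

Lemma lip_bump r : exists chi : E -> R, [/\ is_lip chi, forall x, 0 <= chi x <= 1,
  forall x : 'rV[R]_n, `|x| <= r -> chi x = 1 & supp_in (r + 1) chi].
Proof.
exists (fun x => Num.max 0 (Num.min 1 (r + 1 - `|x : 'rV[R]_n|))); split.
- exists 1; apply: lip_max; first exact: lip_with_cst.
  apply: lip_min; first exact: lip_with_cst.
  move=> x y; 
  have -> : r + 1 - `|x : 'rV[R]_n| - (r + 1 - `|y : 'rV[R]_n|) = `|y : 'rV[R]_n| - `|x : 'rV[R]_n| by ring.
  by rewrite distrC; exact: lip_sup_norm.
- by move=> x; rewrite le_max lexx/= ge_max ler01 ge_min lexx.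
- by move=> x xr; rewrite min_l ?max_r//; lra.
- by move=> x xr; rewrite max_l// ge_min; apply/orP; right; lra.
Qed.

Lemma lip_measurable (f : E -> R) : is_lip f -> measurable_fun setT (f : borel E -> R).
Proof. by move=> [L fL]; apply: continuous_borel; exact: lip_continuous fL. Qed.

Lemma lip_with_lim (f_ : nat -> E -> R) f L : (forall k, lip_with L (f_ k)) -> unif_cvg f_ f -> lip_with L f.
Proof.
move=> fL fu x y; apply/ler_addgt0Pr => e e0.
have e2 : 0 < e / 2 by rewrite divr_gt0.
have [k _ hk] := fu _ e2; have := hk k (leqnn k) => /= {}hk.
have -> : f x - f y = (f_ k x - f_ k y) + ((f_ k y - f y) - (f_ k x - f x)) by ring.
rewrite (le_trans (ler_normD _ _))// lerD//; first exact: fL.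
by rewrite (le_trans (ler_normB _ _))// [leRHS]splitr lerD// ltW.
Qed.

Lemma bcs_lip (f : E -> R) r : is_lip f -> supp_in r f -> exists2 M, 0 <= M & bcs M r f.
Proof.
move=> fl fr; have [a a0 fa] := lip_bounded_Bx r fl; exists a => //; split => //.
  exact: lip_measurable.
by move=> x; have [xr|xr] := leP `|x : 'rV[R]_n| r; [exact: fa|rewrite fr// normr0].
Qed.

Lemma Rintegral_bcs_le (f : borel E -> R) M r : 0 <= M -> bcs M r f ->
  `|\int[@lebesgueRn R n]_x f x| <= M * fine (@lebesgueRn R n (Bx r)).
Proof.
move=> M0 bf; rewrite (le_trans (le_normr_Rintegral measurableT (bcs_integrable bf)))//.
have mB := @measurable_Bx R n r.
have -> : M * fine (@lebesgueRn R n (Bx r)) = \int[@lebesgueRn R n]_x (M * \1_(Bx r) x).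
  rewrite RintegralZl//; last first.
    by have := integrable_indic_Bx (n := n) 1 r; congr (_.-integrable _ _); apply/funext => x /=; rewrite mul1r.
  by congr (_ * _); rewrite /Rintegral integral_indic// setIT.
apply: le_Rintegral => //; last by move=> x _; exact: bcs_le_indic.
  have := integrable_norm (bcs_integrable bf); congr (_.-integrable _ _).
exact: integrable_indic_Bx.
Qed.

End bounded_lipschitz.

#[local] Opaque Dmx.

Section integration_by_parts.
Context {R : realType} {n : nat}.
Local Notation N := n.+1.
Local Notation E := (euclid R N).
Local Notation L := (@lebesgueRn R N).
Implicit Types (g h : 'I_N -> E -> R) (phi eta : E -> R).

Lemma lip_common (I : finType) (g : I -> E -> R) : (forall i, is_lip (g i)) ->
  exists2 C, 0 <= C & forall i, lip_with C (g i).
Proof.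
move=> gl; have /choice[c hc] : forall i, exists c, 0 <= c /\ lip_with c (g i).
  by move=> i; have [c] := is_lip_ge0 (gl i); exists c.
exists (\sum_i c i); first by apply: sumr_ge0 => i _; exact: (hc i).1.
move=> i; apply: lip_withW (hc i).2; rewrite (bigD1 i)//= lerDl sumr_ge0// => j _.
exact: (hc j).1.
Qed.

Lemma upd_lip g i eta : (forall j, is_lip (g j)) -> is_lip eta ->
  forall j, is_lip ([eta g with i |-> eta] j).
Proof. by move=> gl el j /=; case: ifP. Qed.

Lemma ae_sd (f : E -> R) : is_lip f -> {ae L, forall x, rational_diff f x}.
Proof. by move=> /is_lip_ge0[C C0 fC]; exact: (ae_rational_diff fC). Qed.

Lemma lip_frechet (f : E -> R) x : is_lip f -> rational_diff f x -> frechet f x (grad f x).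
Proof. by move=> /is_lip_ge0[C C0 fC] rd; exact: (rational_diff_frechet fC rd). Qed.

Lemma lip_sup_const (f : E -> R) : is_lip f -> exists2 K, 0 <= K &
  forall y z : 'rV[R]_N, `|f y - f z| <= K * `|y - z|.
Proof.
move=> /is_lip_ge0[C C0 fC]; exists (`|C| * N%:R); first by rewrite mulr_ge0.
exact: lip_with_sup fC.
Qed.

Lemma frechet_grad (f : E -> R) x l : is_lip f -> frechet f x l -> rational_diff f x /\ forall i, grad f x i = l i.
Proof. by move=> /is_lip_ge0[C C0 fC]; exact: frechet_rational_diff. Qed.

Lemma Dmx_updE g i eta x : (forall j, is_lip (g j)) -> is_lip eta ->
  (forall j, rational_diff (g j) x) -> rational_diff eta x ->
  forall a b, Dmx [eta g with i |-> eta] x a b = if b == i then grad eta x a else grad (g b) x a.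
Proof.
move=> gl el gd ed a b; have [C C0 hC] := lip_common (upd_lip i gl el).
rewrite (DmxE hC) ?mxE/=; first by case: ifP.
by move=> j /=; case: ifP.
Qed.

Lemma is_lip_lin a eta phi : is_lip eta -> is_lip phi -> is_lip (fun x => a * eta x + phi x).
Proof. by move=> el pl; apply: is_lipD => //; exact: is_lipZ. Qed.

Lemma det_Dmx_linear g i a eta phi : (forall j, is_lip (g j)) -> is_lip eta -> is_lip phi ->
  {ae L, forall x, \det (Dmx [eta g with i |-> fun y => a * eta y + phi y] x) =
    a * \det (Dmx [eta g with i |-> eta] x) + \det (Dmx [eta g with i |-> phi] x)}.
Proof.
move=> gl el pl; have ll := is_lip_lin a el pl.
have := ae_and (ae_count (fun j => ae_sd (gl j))) (ae_and (ae_sd el) (ae_sd pl)).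
apply: ae_imp => x [gd [ed pd]].
have [ld lE] := frechet_grad ll (frechet_lin a (lip_frechet el ed) (lip_frechet pl pd)).
have EA := Dmx_updE i gl ll gd ld.
have EB := Dmx_updE i gl el gd ed.
have EC := Dmx_updE i gl pl gd pd.
set A := Dmx _ _ in EA *; set B := Dmx _ _ in EB *; set D := Dmx _ _ in EC *.
clearbody A B D.
apply: (det_col_linear (i := i)) => [k|k j /negbTE ji|k j /negbTE ji]; rewrite EA.
- by rewrite EB EC eqxx lE.
- by rewrite EB ji.
- by rewrite EC ji.
Qed.

Lemma det_Dmx_leibniz g i r eta phi : (forall j, is_lip (g j)) -> is_lip eta -> is_lip phi ->
  supp_in r phi ->
  {ae L, forall x, \det (Dmx [eta g with i |-> fun y => phi y * eta y] x) =
    phi x * \det (Dmx [eta g with i |-> eta] x) + eta x * \det (Dmx [eta g with i |-> phi] x)}.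
Proof.
move=> gl el pl pr; have ll := lip_mul_supp pl pr el.
have := ae_and (ae_count (fun j => ae_sd (gl j))) (ae_and (ae_sd el) (ae_sd pl)).
apply: ae_imp => x [gd [ed pd]].
have [C C0 pC] := lip_sup_const pl; have [D D0 eD] := lip_sup_const el.
have [ld lE] := frechet_grad ll (frechet_mul C0 D0 pC eD (lip_frechet pl pd) (lip_frechet el ed)).
have EA := Dmx_updE i gl ll gd ld.
have EB := Dmx_updE i gl el gd ed.
have EC := Dmx_updE i gl pl gd pd.
set A := Dmx _ _ in EA *; set B := Dmx _ _ in EB *; set D' := Dmx _ _ in EC *.
clearbody A B D'.
(* [Z] has a vanishing column; adding it lets the linearity lemma express that the scalar [eta x]
   factors out of column [i]. *)
pose Z : 'M[R]_N := \matrix_(a, b) (if b == i then 0 else grad (g b) x a).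
pose M : 'M[R]_N := \matrix_(a, b) (if b == i then eta x * grad phi x a else grad (g b) x a).
have Z0 : \det Z = 0 by apply: (det_col0 (i := i)) => k; rewrite mxE eqxx.
have ME : \det M = eta x * \det D' + \det Z.
  apply: (det_col_linear (i := i)) => [k|k j /negbTE ji|k j /negbTE ji].
  - by rewrite !mxE EC eqxx addr0.
  - by rewrite mxE EC ji.
  - by rewrite !mxE ji.
have -> : \det A = phi x * \det B + \det M.
  apply: (det_col_linear (i := i)) => [k|k j /negbTE ji|k j /negbTE ji].
  - by rewrite mxE EA EB eqxx lE.
  - by rewrite EA EB ji.
  - by rewrite mxE EA ji.
by rewrite ME Z0 addr0.
Qed.

Lemma frechet_supp r phi x : supp_in r phi -> r < `|x : 'rV[R]_N| -> frechet phi x (fun=> 0).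
Proof.
move=> pr rx; apply: (frechet_near (f := fun=> 0) (d := `|x : 'rV[R]_N| - r)); last exact: frechet_cst.
  by rewrite subr_gt0.
by move=> y hy; rewrite pr//; have := ler_normB ((x : 'rV[R]_N) + y) y; rewrite addrK; lra.
Qed.

Lemma det_Dmx_const g j x : (forall j, is_lip (g j)) -> frechet (g j) x (fun=> 0) -> \det (Dmx g x) = 0.
Proof.
move=> gl gj; have [C C0 hC] := lip_common gl.
have [gd|gd] := pselect (diff_set g x); last by rewrite (Dmx_out hC gd) det0.
apply: (@det_col0 _ _ _ j) => k; rewrite (DmxE hC gd) mxE.
by have [_ ->] := frechet_grad (gl j) gj.
Qed.

Lemma bcs_det M r (u : borel E -> R) g : bcs M r u -> (forall j, is_lip (g j)) ->
  exists M', 0 <= M' /\ bcs M' r (fun x => u x * \det (Dmx g x)).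
Proof.
move=> bu gl; have [C C0 hC] := lip_common gl.
exists (M * (N`!%:R * C ^+ N)); split.
  rewrite mulr_ge0// ?mulr_ge0 ?exprn_ge0//.
  by case: bu => _ h _; exact: le_trans (normr_ge0 _) (h 0).
by apply: bcsM => //; [exact: measurable_det_Dmx hC|exact: det_Dmx_le].
Qed.

Lemma bcs_integralD M M' r r' (u v : borel E -> R) : bcs M r u -> bcs M' r' v ->
  \int[L]_x (u x + v x) = \int[L]_x u x + \int[L]_x v x.
Proof. by move=> bu bv; rewrite RintegralD//; [exact: bcs_integrable bu|exact: bcs_integrable bv]. Qed.

Lemma ae_eq_Rintegral (u v : borel E -> R) : measurable_fun setT u -> measurable_fun setT v ->
  {ae L, forall x, u x = v x} -> \int[L]_x u x = \int[L]_x v x.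
Proof.
move=> mu mv h; rewrite /Rintegral; congr fine; apply: ae_eq_integral => //; try exact/measurable_EFinP.
by apply: ae_imp h => x -> .
Qed.

(** Compact support of one column suffices. The other functions are multiplied by a bump equal to
    [1] near the support of [phi]; beyond that support both determinants vanish, their column [i]
    being zero. *)
Lemma int_det_supp g i r phi : (forall j, is_lip (g j)) -> is_lip phi -> supp_in r phi ->
  \int[L]_x \det (Dmx [eta g with i |-> phi] x) = 0.
Proof.
move=> gl pl pr; have [chi [cl c01 c1 cr]] := @lip_bump R N (`|r| + 1).
pose g' : 'I_N -> E -> R := fun j x => chi x * g j x.
have gl' j : is_lip (g' j) by exact: lip_mul_supp cl cr (gl j).
have [C C0 hC] := lip_common (upd_lip i gl pl).
have [C' C'0 hC'] := lip_common (upd_lip i gl' pl).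
have rpos : 0 < `|r| + 1 + 1 by rewrite -addrA ltr_wpDl.
rewrite -[RHS](int_det_eq0 C'0 hC' rpos); last first.
  move=> j x hx /=; case: ifP => _; last by rewrite /g' cr// mul0r.
  by apply: pr; rewrite (le_lt_trans _ hx)// (le_trans (ler_norm r))// -addrA lerDl.
apply: ae_eq_Rintegral; [exact: measurable_det_Dmx hC|exact: measurable_det_Dmx hC'|].
have := ae_and (ae_count (fun j => ae_sd (gl j))) (ae_sd pl).
apply: ae_imp => x [gd pd].
have [xr|xr] := ltP r `|x : 'rV[R]_N|.
  have fp := frechet_supp pr xr.
  have h0 : forall h : 'I_N -> E -> R, (forall j, is_lip (h j)) -> \det (Dmx [eta h with i |-> phi] x) = 0.
    by move=> h hl; apply: (det_Dmx_const (j := i)); [exact: upd_lip|rewrite /= eqxx].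
  exact: (etrans (h0 g gl) (esym (h0 g' gl'))).
have near1 : forall j (y : 'rV[R]_N), `|y| < 1 -> g j ((x : 'rV[R]_N) + y) = g' j ((x : 'rV[R]_N) + y).
  move=> j y y1; rewrite /g' c1 ?mul1r// (le_trans (ler_normD _ _))// lerD//; last exact: ltW.
  exact: (le_trans xr (ler_norm r)).
have gd' j : rational_diff (g' j) x /\ forall a, grad (g' j) x a = grad (g j) x a.
  by apply: frechet_grad => //; apply: frechet_near (near1 j) _ => //; exact: lip_frechet.
have EA := Dmx_updE i gl pl gd pd.
have EB := Dmx_updE i gl' pl (fun j => (gd' j).1) pd.
set A := Dmx _ _ in EA *; set B := Dmx _ _ in EB *.
clearbody A B.
by congr (\det _); apply/matrixP => a b; rewrite EA EB (gd' b).2.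
Qed.

(** The determinant with [phi * eta] in column [i] has integral [0], and the Leibniz rule splits it
    into the two sides. *)
Lemma int_by_parts g i r eta phi : (forall j, is_lip (g j)) -> is_lip eta -> is_lip phi -> supp_in r phi ->
  \int[L]_x (phi x * \det (Dmx [eta g with i |-> eta] x)) =
  - \int[L]_x (eta x * \det (Dmx [eta g with i |-> phi] x)).
Proof.
move=> gl el pl pr; have [M M0 bp] := bcs_lip pl pr.
have [M1 [M10 b1]] := bcs_det bp (upd_lip i gl el).
have e0 : \int[L]_x \det (Dmx [eta g with i |-> fun y => phi y * eta y] x) = 0.
  exact: (int_det_supp _ gl (lip_mul_supp pl pr el) (supp_inM _ pr)).
have [Ce Ce0 hCe] := lip_common (upd_lip i gl el).
have [Cp Cp0 hCp] := lip_common (upd_lip i gl pl).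
have [Cm Cm0 hCm] := lip_common (upd_lip i gl (lip_mul_supp pl pr el)).
have [B B0 eB] := lip_bounded_Bx r el.
have d0 (x : E) : r < `|x : 'rV[R]_N| -> \det (Dmx [eta g with i |-> phi] x) = 0.
  move=> xr; apply: (det_Dmx_const (j := i)); first exact: upd_lip.
  by rewrite /= eqxx; exact: frechet_supp pr xr.
have b2 : bcs (B * (N`!%:R * Cp ^+ N)) r (fun x => eta x * \det (Dmx [eta g with i |-> phi] x)).
  split; first by apply: measurable_funM; [exact: lip_measurable|exact: measurable_det_Dmx hCp].
    move=> x; have [xr|xr] := leP `|x : 'rV[R]_N| r.
      by rewrite normrM ler_pM// ?eB//; exact: det_Dmx_le.
    by rewrite (d0 x xr) mulr0 normr0 ?mulr_ge0 ?exprn_ge0.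
  by move=> x xr; rewrite (d0 x xr) mulr0.
apply/eqP; rewrite -addr_eq0 -(bcs_integralD b1 b2) -e0; apply/eqP/esym.
apply: ae_eq_Rintegral; first exact: measurable_det_Dmx hCm.
  by apply: measurable_funD; [case: b1|case: b2].
exact: det_Dmx_leibniz pr.
Qed.

End integration_by_parts.

Lemma mulr_lin_comb {R : comPzRingType} (c a d d1 d2 : R) : d = a * d1 + d2 ->
  c * d = a * (c * d1) + c * d2.
Proof. by move=> ->; ring. Qed.

Lemma dist_chain {R : realDomainType} (a b c d e : R) :
  `|a - e| <= `|a - b| + `|c - b| + `|d - c| + `|e - d|.
Proof.
rewrite (le_trans (ler_distD d _ _))// [`|e - d|]distrC lerD2r.
rewrite (le_trans (ler_distD c _ _))// [`|d - c|]distrC lerD2r.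
by rewrite (le_trans (ler_distD b _ _))// [`|c - b|]distrC.
Qed.

(** * Currents carried by sets *)

Section set_currents.
Context {R : realType} {n : nat}.
Local Notation N := n.+1.
Local Notation E := (euclid R N).
Local Notation L := (@lebesgueRn R N).
Implicit Types (g h : 'I_N -> E -> R) (phi eta f : E -> R).

Lemma compact_Bx r : compact (Bx r : set E).
Proof.
apply/compact_euclid; apply: bounded_closed_compact.
  exists r; split; first exact: num_real.
  by move=> t rt x xr /=; rewrite (le_trans xr)// ltW.
apply: (closed_comp (f := fun x : 'rV[R]_N => `|x|) (D := [set t | t <= r])); last exact: closed_le.
by move=> x _; exact: norm_continuous.
Qed.

Definition vol r : R := fine (L (Bx r)).

Lemma vol_ge0 r : 0 <= vol r. Proof. exact: fine_ge0. Qed.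

(** Integration by parts moves the derivative from [a - b] to [psi], so only the uniform size of
    [a - b] enters, not its gradient. *)
Lemma det_swap_one h i a b psi C r t : 0 <= C -> (forall j, lip_with C (h j)) ->
  lip_with C psi -> supp_in r psi -> is_lip a -> is_lip b -> 0 <= t -> (forall x, `|a x - b x| <= t) ->
  `|\int[L]_x (psi x * \det (Dmx [eta h with i |-> a] x)) -
    \int[L]_x (psi x * \det (Dmx [eta h with i |-> b] x))| <= t * (N`!%:R * C ^+ N) * vol r.
Proof.
move=> C0 hC pC pr al bl t0 ab.
have hl j : is_lip (h j) by exists C.
have pl : is_lip psi by exists C.
have hpC : forall j, lip_with C ([eta h with i |-> psi] j) by move=> j /=; case: ifP.
have mdet := measurable_det_Dmx hpC.
have d0 (x : E) : r < `|x : 'rV[R]_N| -> \det (Dmx [eta h with i |-> psi] x) = 0.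
  move=> xr; apply: (det_Dmx_const (j := i)); first exact: upd_lip.
  by rewrite /= eqxx; exact: frechet_supp pr xr.
have bc (c : E -> R) M : measurable_fun setT (c : borel E -> R) -> 0 <= M ->
    (forall x, Bx r x -> `|c x| <= M) ->
    bcs (M * (N`!%:R * C ^+ N)) r (fun x => c x * \det (Dmx [eta h with i |-> psi] x)).
  move=> mc M0 cM; split; first exact: measurable_funM.
    move=> x; have [xr|xr] := leP `|x : 'rV[R]_N| r.
      by rewrite normrM ler_pM// ?cM//; exact: det_Dmx_le.
    by rewrite (d0 x xr) mulr0 normr0 ?mulr_ge0 ?exprn_ge0.
  by move=> x xr; rewrite (d0 x xr) mulr0.
have [A A0 aA] := lip_bounded_Bx r al; have [B B0 bB] := lip_bounded_Bx r bl.
have ba := bc a A (lip_measurable al) A0 aA; have bb := bc b B (lip_measurable bl) B0 bB.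
have E1 := f_equal2 (fun u v => u - v) (int_by_parts i hl al pl pr) (int_by_parts i hl bl pl pr).
rewrite {}E1 opprK addrC.
rewrite -RintegralB//; [|exact: bcs_integrable bb|exact: bcs_integrable ba].
under eq_Rintegral do rewrite -mulrBl.
apply: Rintegral_bcs_le; first by rewrite !mulr_ge0// exprn_ge0.
apply: bc => //; first by apply: measurable_funB; exact: lip_measurable.
by move=> x _; rewrite distrC.
Qed.

(* Replace the components one at a time. *)
Lemma det_weak_continuity g g' psi C r t : 0 <= C -> (forall j, lip_with C (g j)) ->
  (forall j, lip_with C (g' j)) -> lip_with C psi -> supp_in r psi -> 0 <= t ->
  (forall j x, `|g' j x - g j x| <= t) ->
  `|\int[L]_x (psi x * \det (Dmx g' x)) - \int[L]_x (psi x * \det (Dmx g x))|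
    <= N%:R * (t * (N`!%:R * C ^+ N) * vol r).
Proof.
move=> C0 gC gC' pC pr t0 gg; set B := _ * vol r.
pose h m : 'I_N -> E -> R := fun j => if (j < m)%N then g' j else g j.
pose I (g : 'I_N -> E -> R) := \int[L]_x (psi x * \det (Dmx g x)).
have hC m j : lip_with C (h m j) by rewrite /h; case: ifP.
have step m : (m < N)%N -> `|I (h m.+1) - I (h m)| <= B.
  move=> mN; pose i := Ordinal mN.
  have e1 : h m.+1 = [eta h m with i |-> g' i].
    apply/funext => j; rewrite /h /= -val_eqE/= ltnS leq_eqVlt.
    by case: eqP => [ji|//]; congr g'; exact: val_inj.
  have e0 : h m = [eta h m with i |-> g i].
    apply/funext => j; rewrite /h /= -val_eqE/=.
    by case: eqP => [ji|//]; rewrite ji ltnn; congr g; exact: val_inj.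
  rewrite e1 [X in _ - I X]e0; apply: det_swap_one => //.
  - by exists C.
  - by exists C.
have all m : (m <= N)%N -> `|I (h m) - I (h 0%N)| <= m%:R * B.
  elim: m => [_|m IH mN]; first by rewrite subrr normr0 mul0r.
  rewrite (le_trans (ler_distD (I (h m)) _ _))// -natr1 mulrDl mul1r addrC lerD//; last exact: step.
  by apply: IH; exact: ltnW.
have eN : h N = g' by apply/funext => j; rewrite /h ltn_ord.
by have := all N (leqnn N); rewrite eN.
Qed.

Lemma bcs_indic_sub (A B : set (borel E)) r : measurable A -> measurable B -> B `<=` Bx r ->
  A `<=` B -> \int[L]_x (\1_B x - \1_A x) = fine (L B) - fine (L A).
Proof.
move=> mA mB Br AB; have bB := bcs_indic mB Br.
have bA := bcs_indic mA (subset_trans AB Br).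
rewrite RintegralB//; [|exact: bcs_integrable bB|exact: bcs_integrable bA].
by congr (_ - _); rewrite /Rintegral integral_indic// setIT.
Qed.

(** An open set slightly larger in measure than [A] is found by regularity, and its cutoffs
    approximate it from below in [L^1]. Intersecting with an open ball keeps the supports
    bounded. *)
Lemma lip_approx_indic (A : set (borel E)) r e : measurable A -> A `<=` Bx r -> 0 < e ->
  exists phi, [/\ is_lip phi, forall x, 0 <= phi x <= 1, supp_in (r + 1) phi &
    \int[L]_x `|\1_A x - phi x| <= e].
Proof.
move=> mA Ar e0; have e2 : 0 < e / 2 by rewrite divr_gt0.
have mB := @measurable_Bx R N (r + 1).
have [|V [oV AV hV]] := @outer_regular _ _ (mrestr L mB) _ A mA (e / 2) e2.
  by rewrite /= /mrestr setTI; exact: lebesgue_Bx_lty.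
have oB : open [set x : E | `|x : 'rV[R]_N| < r + 1].
  apply: (open_comp (f := fun x : E => `|x : 'rV[R]_N|) (D := [set t | t < r + 1])); last exact: open_lt.
  by move=> x _; apply: lip_continuous; exact: lip_sup_norm.
pose W : set E := V `&` [set x : E | `|x : 'rV[R]_N| < r + 1].
have oW : open W by exact: openI.
have mW : measurable (W : set (borel E)) by exact: open_borel.
have Wr : W `<=` Bx (r + 1) by move=> x [_ /= h]; exact: ltW.
have AW : A `<=` W by move=> x Ax; split; [exact: AV|rewrite /= (le_lt_trans (Ar _ Ax))// ltrDl].
have bW := bcs_indic mW Wr.
have ml k : measurable_fun setT (cutoff W k : borel E -> R).
  by apply: lip_measurable; exists k%:R; exact: cutoff_lip.
have cr k : supp_in (r + 1) (cutoff W k).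
  by move=> x xr; apply: cutoff_out => -[_ /=]; rewrite ltNge ltW.
have bk k : bcs 1 (r + 1) (cutoff W k : borel E -> R).
  by split => [//|x|]; [rewrite ger0_norm ?cutoff_ge0// cutoff_le1|exact: cr].
have lim0 : \int[L]_x (\1_W x - cutoff W k x) @[k --> \oo] --> (0 : R).
  have -> : 0 = \int[L]_x (0 : R) by rewrite /Rintegral integral0.
  apply: (bcs_dct (M := 1 + 1) (r := r + 1)) => //; first by move=> k; exact: bcsB.
  apply: aeW => x; rewrite -(subrr (\1_W x : R)).
  by apply: cvgB; [exact: cvg_cst|exact: cutoff_cvg].
have [k _ hk] := (proj1 (cvgrPdist_lt _ _)) lim0 _ e2.
have {hk} hk := hk k (leqnn k); rewrite sub0r normrN in hk.
exists (cutoff W k); split.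
- by exists k%:R; exact: cutoff_lip.
- by move=> x; rewrite cutoff_ge0 cutoff_le1.
- exact: cr.
have i1 := bcs_integrable (bcsB bW (bk k)).
have bA : bcs 1 (r + 1) (\1_A : borel E -> R).
  by apply: bcs_indic => //; exact: subset_trans AW Wr.
have i2 := bcs_integrable (bcsB bW bA).
apply: (@le_trans _ _ (\int[L]_x ((\1_W x - cutoff W k x) + (\1_W x - \1_A x)))).
  apply: le_Rintegral => //.
  - by have := integrable_norm (bcs_integrable (bcsB bA (bk k))).
  - exact: (integrableD measurableT i1 i2).
  move=> x _; have h1 := cutoff_le_indic W k x; have h2 : \1_A x <= \1_W x :> R.
    rewrite !indicE ler_nat; case: (boolP (x \in A)) => // /set_mem/AW/mem_set -> //.
  have -> : \1_A x - cutoff W k x = (\1_W x - cutoff W k x) - (\1_W x - \1_A x) by ring.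
  by rewrite (le_trans (ler_normB _ _))// !ger0_norm// subr_ge0.
rewrite RintegralD// [leRHS]splitr lerD//; first by rewrite (le_trans (ler_norm _))// ltW.
rewrite (bcs_indic_sub mA mW Wr AW) lerBlDr -lee_fin EFinD addrC.
have fA (B : set (borel E)) : measurable B -> B `<=` Bx (r + 1) -> (fine (L B))%:E = L B.
  move=> mB' Br; rewrite fineK// ge0_fin_numE//.
  by apply: le_lt_trans (lebesgue_Bx_lty (r + 1)); exact: measure_le.
rewrite !fA//; last exact: subset_trans AW Wr.
apply: (le_trans (measure_le L mW (measurableI _ _ (open_borel oV) mB) _)).
  by move=> x Wx; split; [exact: Wx.1|exact: Wr].
have hV' : (L (V `&` Bx (r + 1)) <= L (A `&` Bx (r + 1)) + (e / 2)%:E)%E := hV.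
by rewrite (_ : A `&` _ = A) in hV'; last exact: (setIidl (subset_trans AW Wr)).
Qed.

Section one_set.
Variables (A : set (borel E)) (r : R).
Hypothesis mA : measurable A.
Hypothesis Ar : A `<=` Bx r.

Lemma set_currentE f g : set_current (A : set E) f g = \int[L]_x (\1_A x * f x * \det (Dmx g x)).
Proof.
rewrite /set_current Rintegral_mkcond; apply: eq_Rintegral => x _.
by rewrite patchE indicE; case: (_ \in _); rewrite ?mul1r ?mul0r.
Qed.

Lemma bcs_indic_lip f : is_lip f -> exists2 M, 0 <= M & bcs M r (fun x => \1_A x * f x).
Proof.
move=> fl; have [M M0 fM] := lip_bounded_Bx r fl; exists M => //.
have mf := lip_measurable fl; split.
- by apply: measurable_funM => //; exact: measurable_indic.
- move=> x; rewrite indicE; case: (boolP (x \in A)) => [/set_mem/Ar/fM|]; first by rewrite mul1r.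
  by rewrite mul0r normr0.
- move=> x xr; rewrite indicE memNset ?mul0r// => /Ar; rewrite /Bx/=.
  by rewrite leNgt xr.
Qed.

Lemma bcs_set_current f g : is_lip f -> (forall j, is_lip (g j)) ->
  exists M, 0 <= M /\ bcs M r (fun x => \1_A x * f x * \det (Dmx g x)).
Proof. by move=> fl gl; have [M M0 bM] := bcs_indic_lip fl; exact: bcs_det bM gl. Qed.

Lemma set_current_eq0 f g : (forall x, A x -> f x * \det (Dmx g x) = 0) -> set_current (A : set E) f g = 0.
Proof.
move=> h; rewrite set_currentE; transitivity (\int[L]_x (0 : R)); last by rewrite /Rintegral integral0.
apply: eq_Rintegral => x _; rewrite -mulrA indicE; case: (boolP (x \in A)) => [/set_mem/h ->|].
  by rewrite mulr0.
by rewrite mul0r.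
Qed.

Lemma sptP f x : ~ spt f x -> exists2 d, 0 < d & forall y : 'rV[R]_N, `|y| < d -> f ((x : 'rV[R]_N) + y) = 0.
Proof.
move=> nx; have oU : open (~` spt f) by apply: closed_openC; exact: closed_closure.
have : nbhs (x : 'rV[R]_N) (~` spt f : set 'rV[R]_N) by apply/nbhs_euclid; apply: open_nbhs_nbhs; split.
move=> /nbhs_normP[d /= d0 hd]; exists d => // y yd.
apply: contrapT => /eqP fy; apply: (hd (x + y)); last exact: subset_closure.
by rewrite /= opprD addrA subrr sub0r normrN.
Qed.

Lemma open_radius (V : set E) x : open V -> V x ->
  exists2 d, 0 < d & forall y : 'rV[R]_N, `|y| < d -> V ((x : 'rV[R]_N) + y).
Proof.
move=> oV Vx; have : nbhs (x : 'rV[R]_N) (V : set 'rV[R]_N) by apply/nbhs_euclid; apply: open_nbhs_nbhs; split.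
move=> /nbhs_normP[d /= d0 hd]; exists d => // y yd; apply: hd.
by rewrite /= opprD addrA subrr sub0r normrN.
Qed.

Lemma frechet_locally_cst f x c d : 0 < d -> (forall y : 'rV[R]_N, `|y| < d -> f ((x : 'rV[R]_N) + y) = c) ->
  frechet f x (fun=> 0).
Proof.
move=> d0 h; apply: (frechet_near (f := fun=> c) (d := d)) => //; last exact: frechet_cst.
by move=> y /h.
Qed.

Lemma frechet_spt f x : ~ spt f x -> frechet f x (fun=> 0).
Proof. by move=> /sptP[d d0 h]; exact: frechet_locally_cst d0 h. Qed.

Lemma current_set_current : current (set_current (A : set E)).
Proof.
split.
- move=> a f f' g [fl gl] fl'.
  have [M [M0 b1]] := bcs_set_current fl gl; have [M' [M'0 b2]] := bcs_set_current fl' gl.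
  rewrite !set_currentE -RintegralZl//; last exact: bcs_integrable b1.
  rewrite -RintegralD//; last exact: bcs_integrable b2.
    by apply: eq_Rintegral => x _; ring.
  by have := integrableZl measurableT a (bcs_integrable b1).
- move=> i a h h' f g [fl gl] hl hl'.
  have [M [M0 b1]] := bcs_set_current fl (upd_lip i gl hl).
  have [M' [M'0 b2]] := bcs_set_current fl (upd_lip i gl hl').
  have [M3 [M30 b3]] := bcs_set_current fl (upd_lip i gl (is_lip_lin a hl hl')).
  rewrite !set_currentE -RintegralZl//; last exact: bcs_integrable b1.
  rewrite -RintegralD//; [|by have := integrableZl measurableT a (bcs_integrable b1)|exact: bcs_integrable b2].
  have [_ _ _] := b1; have [_ _ _] := b2.
  apply: ae_eq_Rintegral; first by case: b3.
    apply: measurable_funD; last by case: b2.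
    by apply: measurable_funM => //; case: b1.
  apply: ae_imp (det_Dmx_linear i a gl hl hl') => x.
  exact: mulr_lin_comb.
- move=> f g [fl gl] [i [V [c [oV fV gV]]]]; apply: set_current_eq0 => x _.
  have [fx|fx] := eqVneq (f x) 0; first by rewrite fx mul0r.
  have Vx : V x by apply: fV; exact: subset_closure.
  have [d d0 hd] := open_radius oV Vx.
  rewrite (det_Dmx_const (j := i)) ?mulr0//.
  by apply: (frechet_locally_cst d0 (c := c)) => y /hd; exact: gV.
- exists (Bx r); first exact: compact_Bx.
  move=> f g [fl gl] fK; apply: set_current_eq0 => x /Ar xr.
  suff -> : f x = 0 by rewrite mul0r.
  apply: contrapT => /eqP fx; suff : (spt f `&` Bx r) x by rewrite fK.
  by split => //; exact: subset_closure.
- move=> f_ g_ f g L0 fL gL fu gu.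
  pose Lp := `|L0|; have Lp0 : 0 <= Lp by exact: normr_ge0.
  have {}fL k : lip_with Lp (f_ k) by apply: lip_withW (fL k); exact: ler_norm.
  have {}gL k i : lip_with Lp (g_ k i) by apply: lip_withW (gL k i); exact: ler_norm.
  have fl : lip_with Lp f := lip_with_lim fL fu.
  have gl i : lip_with Lp (g i) := lip_with_lim (fun k => gL k i) (gu i).
  have fi : is_lip f by exists Lp.
  have gi j : is_lip (g j) by exists Lp.
  have gki k j : is_lip (g_ k j) by exists Lp.
  have [M M0 fM] := lip_bounded_Bx (r + 1) fi.
  pose K1 := N`!%:R * Lp ^+ N; have K10 : 0 <= K1 by rewrite mulr_ge0// exprn_ge0.
  have detK h : (forall j, lip_with Lp (h j)) -> forall x, `|\det (Dmx h x)| <= K1.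
    by move=> hL x; exact: det_Dmx_le.
  apply/cvgrPdist_le => e e0.
  (* The indicator of [A] is not Lipschitz, so it is first replaced by [phi]. All determinants
     involved are bounded by [K1] and [f] by [M], so this costs at most [e/4], once at [g] and once
     at [g_ k]. *)
  have e1 : 0 < e / 4 / (M * K1 + 1) by rewrite !divr_gt0// ltr_wpDl// mulr_ge0.
  have [phi [phil phi01 phir phiA]] := lip_approx_indic mA Ar e1.
  pose psi x := phi x * f x; have psil : is_lip psi by exact: lip_mul_supp phil phir fi.
  have psir : supp_in (r + 1) psi by exact: supp_inM.
  have [Lq Lq0 hLq] := is_lip_ge0 psil.
  pose C := Lp + Lq; have C0 : 0 <= C by rewrite addr_ge0.
  have psiC : lip_with C psi by apply: lip_withW hLq; rewrite lerDr.
  have CL (q : E -> R) : lip_with Lp q -> lip_with C q by apply: lip_withW; rewrite lerDl.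
  pose K0 := N`!%:R * C ^+ N; have K00 : 0 <= K0 by rewrite mulr_ge0// exprn_ge0.
  pose B := K1 * vol r + N%:R * (K0 * vol (r + 1)) + 1.
  have B0 : 0 < B.
    apply: ltr_wpDl => //; apply: addr_ge0; first by rewrite mulr_ge0 ?vol_ge0.
    by rewrite mulr_ge0// mulr_ge0 ?vol_ge0.
  (* [B] collects the constants of the two remaining changes, [f_ k] to [f] and [g_ k] to [g], so
     that together they stay below [e/2]. *)
  pose t := e / 2 / B; have t0 : 0 < t by rewrite !divr_gt0.
  have gnear : \forall k \near \oo, forall i x, `|g_ k i x - g i x| < t.
    have /choice[m hm] : forall i, exists m, forall k, (m <= k)%N -> forall x, `|g_ k i x - g i x| < t.
      by move=> i; have [m _ hm] := gu i _ t0; exists m => k mk; exact: hm.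
    exists (\max_i m i)%N => // k /= mk i; apply: hm.
    by apply: leq_trans mk; exact: (leq_bigmax i).
  near=> k.
  have hf : forall x, `|f_ k x - f x| < t by near: k; exact: fu.
  have hg : forall i x, `|g_ k i x - g i x| < t by near: k.
  have [M1 [M10 bkk]] := bcs_set_current (ex_intro _ Lp (fL k)) (gki k).
  have [M2 [M20 bk]] := bcs_set_current fi (gki k).
  pose Ip h := \int[L]_x (psi x * \det (Dmx h x)).
  have d1 : `|set_current (A : set E) (f_ k) (g_ k) - set_current (A : set E) f (g_ k)| <= t * K1 * vol r.
    rewrite !set_currentE -RintegralB//; [|exact: bcs_integrable bkk|exact: bcs_integrable bk].
    under eq_Rintegral => x _ do rewrite -mulrBl -mulrBr.
    apply: Rintegral_bcs_le; first by rewrite mulr_ge0// ltW.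
    apply: bcsM; [split|exact: measurable_det_Dmx (gL k)|exact: detK].
    - apply: measurable_funM; first exact: measurable_indic.
      by apply: measurable_funB; apply: lip_measurable => //; exists Lp.
    - move=> x; rewrite normrM -[leRHS]mul1r; apply: ler_pM => //; last exact: ltW.
      by rewrite indicE; case: (_ \in _); rewrite ?normr1 ?normr0.
    - move=> x xr; rewrite indicE memNset ?mul0r// => /Ar; rewrite /Bx/=.
      by rewrite leNgt xr.
  have d2 h : (forall j, lip_with Lp (h j)) -> `|set_current (A : set E) f h - Ip h| <= e / 4.
    move=> hL; have hi j : is_lip (h j) by exists Lp.
    have [M3 [M30 b3]] := bcs_set_current fi hi.
    have [M4 M40 b4] := bcs_lip psil psir; have [M5 [M50 b5]] := bcs_det b4 hi.
    have [M6 M60 b6] := bcs_lip phil phir.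
    have bA : bcs 1 (r + 1) (\1_A : borel E -> R).
      apply: bcs_indic => //; apply: subset_trans Ar _ => x xr.
      by rewrite /Bx/= (le_trans xr)// lerDl.
    rewrite set_currentE -RintegralB//; [|exact: bcs_integrable b3|exact: bcs_integrable b5].
    apply: (le_trans (le_normr_Rintegral measurableT _)).
      exact: (integrableB measurableT (bcs_integrable b3) (bcs_integrable b5)).
    have i7 : L.-integrable setT (EFin \o (fun x => `|\1_A x - phi x|)).
      by have := integrable_norm (bcs_integrable (bcsB bA b6)).
    apply: (@le_trans _ _ (\int[L]_x (M * K1 * `|\1_A x - phi x|))).
      apply: le_Rintegral => //.
      - by have := integrable_norm (integrableB measurableT (bcs_integrable b3) (bcs_integrable b5)).
      - by have := integrableZl measurableT (M * K1) i7.
      move=> x _; rewrite /psi -mulrBl -mulrBl normrM [leRHS]mulrC mulrA ler_pM//.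
        rewrite normrM; have [xr|xr] := leP `|x : 'rV[R]_N| (r + 1).
          by rewrite ler_wpM2l// fM.
        rewrite phir// indicE memNset ?subrr ?normr0 ?mul0r// => /Ar; rewrite /Bx/=.
        by move=> xr'; move: xr; rewrite ltNge (le_trans xr')// lerDl.
      exact: detK.
    have MK0 : 0 <= M * K1 := mulr_ge0 M0 K10.
    rewrite RintegralZl//; apply: (le_trans (ler_wpM2l MK0 phiA)).
    by rewrite mulrCA ler_piMr ?divr_ge0 ?(ltW e0)// ler_pdivrMr ?mul1r ?lerDl// ltr_wpDl.
  have d3 : `|Ip (g_ k) - Ip g| <= N%:R * (t * K0 * vol (r + 1)).
    apply: det_weak_continuity => //; try by move=> *; exact: CL.
    - exact: ltW.
    - by move=> i x; exact: ltW.
  have tB : t * K1 * vol r + N%:R * (t * K0 * vol (r + 1)) <= e / 2.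
    have -> : t * K1 * vol r + N%:R * (t * K0 * vol (r + 1)) = t * (B - 1) by rewrite /B; ring.
    have -> : e / 2 = t * B by rewrite /t divfK// gt_eqF.
    by rewrite ler_wpM2l ?(ltW t0)// gerBl.
  apply: le_trans (dist_chain _ (Ip g) (Ip (g_ k)) (set_current (A : set E) f (g_ k)) _) _.
  have h1 := lerD (lerD (lerD (d2 _ gl) d3) (d2 _ (gL k))) d1.
  by apply: (le_trans h1); move: tB; clear; lra.
Unshelve. all: by end_near. Qed.

End one_set.
End set_currents.

Lemma indicIE {T : Type} {R : nzRingType} (A B : set T) (x : T) :
  \1_(A `&` B) x = \1_A x * \1_B x :> R.
Proof. by rewrite !indicE in_setI -natrM mulnb. Qed.

(** * Hadamard's inequality *)

Section hadamard.
Context {R : rcfType}.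

(** The Householder reflection in the hyperplane orthogonal to [v]. For [v = 0] the division by zero
    gives [0], so it is the identity. *)
Definition reflection m (v : 'cV[R]_m) : 'M[R]_m :=
  1%:M - (2 / (v^T *m v) ord0 ord0) *: (v *m v^T).

Lemma reflection_tr m (v : 'cV[R]_m) : (reflection v)^T = reflection v.
Proof. by rewrite /reflection linearB/= linearZ/= trmx1 trmx_mul trmxK. Qed.

Lemma sqr_colE m (v : 'cV[R]_m) : (v^T *m v) ord0 ord0 = \sum_i v i ord0 ^+ 2.
Proof. by rewrite mxE; apply: eq_bigr => i _; rewrite mxE expr2. Qed.

Lemma sqr_col_eq0 m (v : 'cV[R]_m) : (v^T *m v) ord0 ord0 = 0 -> v = 0.
Proof.
rewrite sqr_colE => /eqP; rewrite psumr_eq0 => [/allP h|i _]; last exact: sqr_ge0.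
apply/colP => i; rewrite mxE; have := h i (mem_index_enum _).
by rewrite sqrf_eq0 => /eqP.
Qed.

Lemma reflection_inv m (v : 'cV[R]_m) : reflection v *m reflection v = 1%:M.
Proof.
have [v0|v0] := eqVneq ((v^T *m v) ord0 ord0) 0.
  by rewrite /reflection (sqr_col_eq0 v0) mul0mx scaler0 subr0 mulmx1.
set w := (v^T *m v) ord0 ord0 in v0; rewrite /reflection -/w; set P := v *m v^T.
have PP : P *m P = w *: P.
  rewrite /P mulmxA -(mulmxA v) [v^T *m v]mx11_scalar -/w mul_mx_scalar.
  by rewrite -scalemxAl.
rewrite mulmxBl mul1mx mulmxBr mulmx1 -scalemxAl -scalemxAr PP !scalerA.
have -> : 2 / w * (2 / w) * w = 2 / w + 2 / w by field.
rewrite scalerDl; set a := (2 / w) *: P.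
have -> : a - (a + a) = - a by rewrite opprD addrA subrr sub0r.
by rewrite opprK subrK.
Qed.

(** For [v = c - s e] with [e] the first basis vector and [s] of absolute value [|c|], one has
    [v^T v = 2 v^T c], so reflecting subtracts exactly [v] from [c]. *)
Lemma reflection_col m (c : 'cV[R]_m.+1) (s : R) : s ^+ 2 = \sum_i c i ord0 ^+ 2 ->
  reflection (c - s *: delta_mx ord0 ord0) *m c = s *: delta_mx ord0 ord0.
Proof.
move=> hs; set e : 'cV[R]_m.+1 := delta_mx ord0 ord0; set v := c - s *: e.
suff h : (2 / (v^T *m v) ord0 ord0) *: (v *m v^T) *m c = v.
  by rewrite /reflection mulmxBl mul1mx h /v opprB addrC subrK.
rewrite -scalemxAl -mulmxA [v^T *m c]mx11_scalar mul_mx_scalar scalerA.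
have [v0|v0] := eqVneq ((v^T *m v) ord0 ord0) 0.
  by rewrite (sqr_col_eq0 v0) scaler0.
have ee : (e^T *m e) ord0 ord0 = 1.
  by rewrite sqr_colE (bigD1 ord0)//= mxE !eqxx expr1n big1 ?addr0// => i i0; rewrite mxE (negbTE i0) expr0n.
have cc : (c^T *m c) ord0 ord0 = s ^+ 2 by rewrite sqr_colE hs.
have ec : (e^T *m c) ord0 ord0 = (c^T *m e) ord0 ord0.
  by rewrite -[e^T *m c]trmxK trmx_mul trmxK [in LHS]mxE.
have vv : (v^T *m v) ord0 ord0 = 2 * (v^T *m c) ord0 ord0.
  have sub (a b d : 'cV[R]_m.+1) (t : R) : ((a - t *: b)^T *m d) ord0 ord0 =
      (a^T *m d) ord0 ord0 - t * (b^T *m d) ord0 ord0.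
    by rewrite linearB/= linearZ/= mulmxBl -scalemxAl mxE [X in _ + X]mxE [X in _ - X]mxE.
  have subr' (a b d : 'cV[R]_m.+1) (t : R) : (d^T *m (a - t *: b)) ord0 ord0 =
      (d^T *m a) ord0 ord0 - t * (d^T *m b) ord0 ord0.
    by rewrite mulmxBr -scalemxAr mxE [X in _ + X]mxE [X in _ - X]mxE.
  by rewrite /v !sub !subr' cc ee ec; ring.
by rewrite vv invfM mulrA divff ?pnatr_eq0// mul1r mulVf ?scale1r//; move: v0; rewrite vv mulf_eq0 negb_or => /andP[].
Qed.

(** A reflection turns the first column into a multiple of the first basis vector. It preserves the
    absolute determinant and all column norms, and deleting the first row only shortens the
    remaining columns, so induction applies. *)
Lemma hadamard m (A : 'M[R]_m) : (forall j, \sum_i A i j ^+ 2 <= 1) -> `|\det A| <= 1.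
Proof.
elim: m => [|m IH] in A *; first by rewrite det_mx00 normr1.
move=> hA; pose s := Num.sqrt (\sum_i A i ord0 ^+ 2).
have s2 : s ^+ 2 = \sum_i (col ord0 A) i ord0 ^+ 2.
  rewrite sqr_sqrtr; last by apply: sumr_ge0 => i _; exact: sqr_ge0.
  by apply: eq_bigr => i _; rewrite mxE.
have s0 : 0 <= s by exact: sqrtr_ge0.
have s1 : s <= 1 by rewrite -[leRHS]sqrtr1 ler_wsqrtr.
set H := reflection (col ord0 A - s *: delta_mx ord0 ord0).
have HH : H *m H = 1%:M by exact: reflection_inv.
have dH : `|\det H| = 1.
  have : \det H ^+ 2 = 1 by rewrite expr2 -det_mulmx HH det1.
  by move=> /eqP; rewrite sqrf_eq1 => /orP[/eqP ->|/eqP ->]; rewrite ?normrN normr1.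
pose B := H *m A.
have BB : B^T *m B = A^T *m A.
  by rewrite /B trmx_mul reflection_tr -mulmxA (mulmxA H) HH mul1mx.
have B0 i : B i ord0 = s * (i == ord0)%:R.
  have -> : B i ord0 = (H *m col ord0 A) i ord0 
    by rewrite !mxE; apply: eq_bigr => k _; rewrite [col _ _ _ _]mxE.
  by rewrite (reflection_col s2) !mxE eqxx andbT.
have -> : `|\det A| = `|\det B| by rewrite det_mulmx normrM dH mul1r.
rewrite (expand_det_col _ ord0) (bigD1 ord0)//= big1 => [|i /negbTE i0]; last by rewrite B0 i0 mulr0 mul0r.
rewrite addr0 B0 eqxx mulr1 normrM /cofactor addn0 expr0 mul1r ger0_norm//.
rewrite -[leRHS]mulr1 ler_pM//; apply: IH => j.
have colE (M : 'M[R]_m.+1) k : \sum_i M i k ^+ 2 = (M^T *m M) k k.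
  by rewrite mxE; apply: eq_bigr => i _; rewrite mxE expr2.
apply: (@le_trans _ _ (\sum_i B i (lift ord0 j) ^+ 2)); last by rewrite colE BB -colE.
rewrite big_ord_recl; apply: ler_wpDl; first exact: sqr_ge0.
by apply: ler_sum => i _; rewrite !mxE.
Qed.

End hadamard.

(** Pairing a column with itself shows that its Euclidean norm is at most the Lipschitz constant
    [1]. Then Hadamard's inequality applies. *)
Lemma det_Dmx_le1 {R : realType} {n : nat} (g : 'I_n -> euclid R n -> R) x :
  (forall j, lip_with 1 (g j)) -> `|\det (Dmx g x)| <= 1.
Proof.
move=> g1; apply: hadamard => j; set S := \sum_i _.
have S0 : 0 <= S by apply: sumr_ge0 => i _; exact: sqr_ge0.
pose v : 'rV[R]_n := \row_i Dmx g x i j.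
have := Dmx_col_le ler01 g1 x j v; rewrite mul1r.
have -> : \sum_i v ord0 i * Dmx g x i j = S by apply: eq_bigr => i _; rewrite [v _ _]mxE expr2.
have -> : enorm v = Num.sqrt S by congr Num.sqrt; apply: eq_bigr => i _; rewrite [v _ _]mxE.
rewrite ger0_norm// -{1}(sqr_sqrtr S0) => h; rewrite -[leRHS]sqrtr1 -(sqr_sqrtr S0).
have [->|p] := eqVneq (Num.sqrt S) 0; first by rewrite expr0n/= sqrtr1.
have p0 : 0 < Num.sqrt S by rewrite lt_neqAle eq_sym p sqrtr_ge0.
move: h; rewrite expr2 ger_pMr// => h.
by rewrite sqrtr1 -[leRHS]mulr1 ler_pM.
Qed.

Section boundary.
Context {R : realType} {n : nat}.
Local Notation N := n.+1.
Local Notation E := (euclid R N).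
Local Notation L := (@lebesgueRn R N).
Implicit Types (f : E -> R) (g : 'I_n -> E -> R).

(** The tuple occurring in [current_bd], so that boundaries of set currents unfold by
    computation. *)
Definition bd_tuple f g : 'I_N -> E -> R := fun i => if unlift ord0 i is Some j then g j else f.

Lemma bd_tuple0 f g : bd_tuple f g ord0 = f.
Proof. by rewrite /bd_tuple unlift_none. Qed.

Lemma bd_tupleS f g j : bd_tuple f g (lift ord0 j) = g j.
Proof. by rewrite /bd_tuple liftK. Qed.

Lemma bd_tuple_forall (P : (E -> R) -> Prop) f g : P f -> (forall j, P (g j)) -> forall i, P (bd_tuple f g i).
Proof. by move=> Pf Pg i; case: (unliftP ord0 i) => [j|] ->; rewrite ?bd_tupleS ?bd_tuple0. Qed.

Lemma bd_tuple_upd0 f f' g : bd_tuple f' g = [eta bd_tuple f g with ord0 |-> f'].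
Proof.
apply/funext => i /=; case: (unliftP ord0 i) => [j|] ->; last by rewrite bd_tuple0 eqxx.
by rewrite !bd_tupleS eq_sym (negbTE (neq_lift _ _)).
Qed.

Lemma bd_tuple_updS f g i h : bd_tuple f [eta g with i |-> h] = [eta bd_tuple f g with lift ord0 i |-> h].
Proof.
apply/funext => k /=; case: (unliftP ord0 k) => [j|] ->; last by rewrite !bd_tuple0 (negbTE (neq_lift _ _)).
by rewrite !bd_tupleS /= (inj_eq lift_inj).
Qed.

Section one_set.
Variables (A : set (borel E)) (r : R).
Hypothesis mA : measurable A.
Hypothesis Ar : A `<=` Bx r.

Lemma current_bdE f g : current_bd (set_current (A : set E)) f g = set_current (A : set E) (fun=> 1) (bd_tuple f g).
Proof. by []. Qed.

Lemma current_bd_eq0 f g : is_lip f -> (forall j, is_lip (g j)) ->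
  (forall x, A x -> exists i, frechet (bd_tuple f g i) x (fun=> 0)) ->
  current_bd (set_current (A : set E)) f g = 0.
Proof.
move=> fl gl h; rewrite current_bdE; apply: set_current_eq0 => x /h[i hi].
by rewrite (det_Dmx_const _ hi) ?mulr0//; exact: bd_tuple_forall.
Qed.

Lemma current_bd_set_current : current (current_bd (set_current (A : set E))).
Proof.
have cur := current_set_current mA Ar.
have one : is_lip (fun _ : E => 1 : R) by exact: is_lip_cst.
split.
- move=> a f f' g [fl gl] fl'; rewrite !current_bdE.
  rewrite (bd_tuple_upd0 f (fun x => a * f x + f' x)) (bd_tuple_upd0 f f') [in X in _ = a * X + _](bd_tuple_upd0 f f).
  by apply: (current_linear_r cur) => //; split => //; exact: bd_tuple_forall.
- move=> i a h h' f g [fl gl] hl hl'; rewrite !current_bdE !bd_tuple_updS.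
  by apply: (current_linear_r cur) => //; split => //; exact: bd_tuple_forall.
- move=> f g [fl gl] [i [V [c [oV fV gV]]]]; apply: current_bd_eq0 => // x _.
  (* In the boundary [f] itself sits inside the determinant, so locality does not follow from that
     of the current alone: on the support of [f] the column of [g i] vanishes, off it that of
     [f]. *)
  have [sx|sx] := pselect (spt f x).
    exists (lift ord0 i); rewrite bd_tupleS.
    have [d d0 hd] := open_radius oV (fV x sx).
    by apply: (frechet_locally_cst d0 (c := c)) => y /hd; exact: gV.
  by exists ord0; rewrite bd_tuple0; exact: frechet_spt.
- have [K cK hK] := current_compact cur; exists (Bx r); first exact: compact_Bx.
  move=> f g [fl gl] fK; apply: current_bd_eq0 => // x /Ar xr; exists ord0.
  rewrite bd_tuple0; apply: frechet_spt => sx.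
  by suff : (spt f `&` Bx r) x by rewrite fK.
- move=> f_ g_ f g L0 fL gL fu gu.
  have fL' k : lip_with `|L0| (f_ k) by apply: lip_withW (fL k); exact: ler_norm.
  have gL' k i : lip_with `|L0| (g_ k i) by apply: lip_withW (gL k i); exact: ler_norm.
  apply: (current_continuous cur (L := `|L0|) (f_ := fun _ _ => 1) (g_ := fun k => bd_tuple (f_ k) (g_ k))).
  + by move=> k; apply: lip_with_cst.
  + by move=> k i; apply: (bd_tuple_forall (P := lip_with `|L0|)).
  + by move=> e e0; near=> k => x; rewrite subrr normr0.
  + move=> i; case: (unliftP ord0 i) => [j|] ->.
      suff -> : (fun k => bd_tuple (f_ k) (g_ k) (lift ord0 j)) = fun k => g_ k j by exact: gu.
      by apply/funext => k; rewrite bd_tupleS.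
    suff -> : (fun k => bd_tuple (f_ k) (g_ k) ord0) = f_ by exact: fu.
    by apply/funext => k; rewrite bd_tuple0.
Unshelve. all: by end_near. Qed.

End one_set.
End boundary.

Section support.
Context {R : realType} {X : pmetricType R}.

Lemma current_spt_sub m (T : mfunctional X m) (A : set X) : closed A ->
  (forall f g, lip_tuple f g -> spt f `&` A = set0 -> T f g = 0) -> current_spt T `<=` A.
Proof. by move=> cA h x; apply; split. Qed.

End support.

(** * Mass measure and integer rectifiability *)

Section mass_measure.
Context {R : realType} {n : nat}.
Local Notation N := n.+1.
Local Notation E := (euclid R N).
Local Notation L := (@lebesgueRn R N).
Variables (A : set (borel E)) (r : R).
Hypothesis mA : measurable A.
Hypothesis Ar : A `<=` Bx r.

Lemma set_lty : (L A < +oo)%E.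
Proof.
have mB := @measurable_Bx R N r.
by apply: le_lt_trans (lebesgue_Bx_lty r); exact: measure_le.
Qed.

Definition restrL : {finite_measure set (borel E) -> \bar R} := mfrestr mA set_lty.

Lemma restrLE (B : set (borel E)) : restrL B = L (B `&` A).
Proof. by []. Qed.

Lemma restrL_integral (f : borel E -> R) : measurable_fun setT f ->
  (\int[restrL]_x `|f x|%:E = \int[L]_x (\1_A x * `|f x|)%:E)%E.
Proof.
move=> mf; rewrite (density_integral (mu := L) (w := \1_A)).
- by apply: eq_integral => x _; rewrite -EFinM mulrC.
- exact: measurable_indic.
- by move=> x; rewrite indicE.
- by move=> B mB; rewrite -[LHS]/(L (B `&` A)) integral_indic// setIC.
- by apply/measurable_EFinP; exact: measurableT_comp.
- by move=> x; rewrite lee_fin.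
Qed.

Lemma mass_bound_restrL : mass_bound (set_current (A : set E)) restrL.
Proof.
move=> f g fl g1; have gl j : is_lip (g j) by exists 1.
have [M [M0 b]] := bcs_set_current mA Ar fl gl; have [M' M'0 b'] := bcs_indic_lip mA Ar fl.
rewrite restrL_integral; last exact: lip_measurable.
have i1 := integrable_norm (bcs_integrable b'); have i2 := integrable_norm (bcs_integrable b).
rewrite set_currentE.
apply: (@le_trans _ _ (\int[L]_x `|\1_A x * f x|)%:E).
  rewrite lee_fin (le_trans (le_normr_Rintegral measurableT (bcs_integrable b)))//.
  apply: le_Rintegral => // x _; rewrite normrM ler_piMr//; exact: det_Dmx_le1.
rewrite /Rintegral fineK; last exact: integrable_fin_num.
apply: ge0_le_integral => //.
- by apply/measurable_EFinP; apply: measurableT_comp => //; case: b'.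
- apply/measurable_EFinP; apply: measurable_funM; first exact: measurable_indic.
  by apply: measurableT_comp => //; exact: lip_measurable.
- by move=> x _; rewrite lee_fin normrM ger0_norm// indicE.
Qed.

Lemma Dmx_coord x : Dmx (fun i (y : E) => (y : 'rV[R]_N) ord0 i) x = 1%:M.
Proof.
apply: (proj2 (frechet_diff_set (C := 1) _ _)); first by move=> i; exact: coord_lip.
move=> j e e0; exists 1 => // y _; rewrite (bigD1 j)//= big1 => [|i ij]; last by rewrite mxE (negbTE ij) mulr0.
rewrite [_%:M _ _]mxE eqxx mulr1 addr0.
have -> : (x + y : 'rV[R]_N) ord0 j = y ord0 j + (x : 'rV[R]_N) ord0 j by rewrite mxE addrC.
by rewrite addrK subrr normr0 mulr_ge0// ltW.
Qed.

(** The coordinate functions are admissible and have determinant [1], so testing with the cutoffs of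
    [V] recovers the volume of [A] in [V] from below. *)
Lemma mass_bound_open nu (V : set E) : mass_bound (set_current (A : set E)) nu -> open V ->
  (L (A `&` V) <= nu V)%E.
Proof.
move=> hnu oV; have mV : measurable (V : set (borel E)) by exact: open_borel.
have mAV : measurable (A `&` V) by exact: measurableI.
have nuf : (nu V < +oo)%E by rewrite ltey_eq fin_num_measure.
have cl k : is_lip (cutoff V k) by exists k%:R; exact: cutoff_lip.
have step k : ((\int[L]_x (\1_A x * cutoff V k x))%:E <= nu V)%E.
  have := hnu _ _ (cl k) (fun i => @coord_lip R N i).
  rewrite set_currentE; under eq_Rintegral do rewrite Dmx_coord det1 mulr1.
  move=> h; apply: (@le_trans _ _ (\int[nu]_x `|cutoff V k x|%:E)%E).
    by apply: le_trans h; rewrite lee_fin ler_norm.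
  rewrite -[X in (_ <= nu X)%E](setIT V) -(integral_indic nu measurableT mV); apply: ge0_le_integral => //.
  - by apply/measurable_EFinP; apply: measurableT_comp => //; exact: lip_measurable.
  - by apply/measurable_EFinP; exact: measurable_indic.
  - by move=> x _; rewrite lee_fin ger0_norm ?cutoff_ge0// cutoff_le_indic.
have bA : bcs 1 r (\1_A : borel E -> R) by exact: bcs_indic.
have lim : \int[L]_x (\1_A x * cutoff V k x) @[k --> \oo] --> \int[L]_x (\1_A x * \1_V x).
  apply: (bcs_dct (M := 1 * 1) (r := r)).
  - move=> k; apply: bcsM => //; first exact: lip_measurable.
    by move=> x; rewrite ger0_norm ?cutoff_ge0// cutoff_le1.
  - by apply: measurable_funM; exact: measurable_indic.
  - by apply: aeW => x; apply: cvgM; [exact: cvg_cst|exact: cutoff_cvg].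
have E1 : (\int[L]_x (\1_A x * \1_V x))%:E = L (A `&` V).
  under eq_Rintegral do rewrite -indicIE; rewrite /Rintegral integral_indic// setIT fineK//.
  rewrite ge0_fin_numE//; apply: le_lt_trans set_lty; exact: measure_le.
rewrite -E1 -(fineK (fin_num_measure nu V mV)) lee_fin.
apply: (ler_cvg_to lim (cvg_cst _)).
apply: nearW => k; rewrite -lee_fin [X in (_ <= X)%E](fineK (fin_num_measure nu V mV)).
exact: (step k).
Qed.

(** Hadamard's inequality shows that Lebesgue measure on [A] is a bound; minimality passes from open
    sets to Borel sets by outer regularity of the competitor. *)
Lemma mass_measure_restrL : mass_measure (set_current (A : set E)) restrL.
Proof.
split; first exact: mass_bound_restrL.
move=> nu hnu B mB; apply/lee_addgt0Pr => e e0.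
have [|V [oV BV hV]] := @outer_regular _ _ nu _ B mB e e0.
  by rewrite ltey_eq fin_num_measure.
apply: le_trans hV; apply: le_trans (mass_bound_open hnu oV).
rewrite restrLE setIC; apply: measure_le => //; try exact: measurableI; last exact: setIS.
by apply: measurableI => //; exact: open_borel.
Qed.

End mass_measure.

Section chain_rule.
Context {R : realType} {n : nat}.
Local Notation N := n.+1.
Local Notation E := (euclid R N).
Local Notation L := (@lebesgueRn R N).
Variables (F : E -> E) (C : R).
Hypothesis FC : forall j, lip_with C (fun x : E => (F x : 'rV[R]_N) ord0 j).
Local Notation Fj := (fun j (x : E) => (F x : 'rV[R]_N) ord0 j).

Let K := `|C| * N%:R.
Let K0 : 0 <= K. Proof. by rewrite mulr_ge0. Qed.

Lemma frechet_comp (f : E -> R) (x : 'rV[R]_N) l (J : 'M[R]_N) :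
  frechet f (F x) l -> (forall k, frechet (Fj k) x (fun i => J i k)) ->
  frechet (f \o F) x (fun i => \sum_k J i k * l k).
Proof.
move=> fl FJ e e0.
pose S := \sum_k `|l k|; have S0 : 0 <= S by apply: sumr_ge0.
have e1 : 0 < e / 2 / (K + 1) by rewrite !divr_gt0// ltr_wpDl.
have e2 : 0 < e / 2 / (S + 1) by rewrite !divr_gt0// ltr_wpDl.
have [d1 d10 h1] := fl _ e1.
have [d2 d20 h2] := @finite_common_radius R 'rV[R]_N 'I_N _ (fun k => FJ k _ e2).
exists (Num.min d2 (d1 / (K + 1))); first by rewrite lt_min d20 divr_gt0// ltr_wpDl.
move=> y; rewrite lt_min => /andP[yd2 yd1].
pose W : 'rV[R]_N := (F (x + y) : 'rV[R]_N) - F x.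
have WK : `|W| <= K * `|y|.
  by rewrite (le_trans (lip_map_sup FC _ _))// [x + y]addrC addrK.
have W1 : `|W| < d1.
  apply: (le_lt_trans WK); apply: (@le_lt_trans _ _ ((K + 1) * `|y|)); first by rewrite ler_wpM2r// lerDl.
  by rewrite mulrC -ltr_pdivlMr// ltr_wpDl.
have FW : F (x + y) = (F x : 'rV[R]_N) + W :> 'rV[R]_N by rewrite /W [_ + (_ - _)]addrC subrK.
have H1 := h1 W W1; rewrite -FW in H1.
have -> : (f \o F) (x + y) - (f \o F) x - \sum_i y ord0 i * (\sum_k J i k * l k) =
   (f (F (x + y)) - f (F x) - \sum_i W ord0 i * l i) +
   \sum_k (W ord0 k - \sum_i y ord0 i * J i k) * l k.
  have -> : \sum_i y ord0 i * (\sum_k J i k * l k) = \sum_k (\sum_i y ord0 i * J i k) * l k.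
    under eq_bigr do rewrite mulr_sumr; rewrite exchange_big/=; apply: eq_bigr => k _.
    by rewrite mulr_suml; apply: eq_bigr => i _; rewrite mulrA.
  under [X in _ = _ + X]eq_bigr do rewrite mulrBl.
  by rewrite sumrB /=; ring.
rewrite (le_trans (ler_normD _ _))// [e in leRHS]splitr mulrDl lerD//.
  rewrite (le_trans H1)//; apply: (@le_trans _ _ (e / 2 / (K + 1) * (K * `|y|))).
    by rewrite ler_wpM2l// ltW.
  rewrite mulrA ler_wpM2r// mulrAC ler_pdivrMr ?ltr_wpDl//.
  by rewrite ler_wpM2l ?lerDl// divr_ge0// ltW.
apply: (@le_trans _ _ (\sum_k (e / 2 / (S + 1) * `|y|) * `|l k|)).
  rewrite (le_trans (ler_norm_sum _ _ _))//; apply: ler_sum => k _; rewrite normrM ler_wpM2r//.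
  by have := h2 y yd2 k; rewrite /W !mxE.
rewrite -mulr_sumr -/S mulrAC ler_wpM2r// mulrAC ler_pdivrMr ?ltr_wpDl//.
by rewrite ler_wpM2l ?lerDl// divr_ge0// ltW.
Qed.

Lemma lip_comp (f : E -> R) : is_lip f -> lip_map setT F -> is_lip (f \o F).
Proof.
move=> /is_lip_ge0[M M0 fM] [D FD]; exists (M * D) => x y.
by rewrite (le_trans (fM _ _))// -mulrA ler_wpM2l// FD.
Qed.

(** Where [DF] is singular, [g] need not be differentiable at [F x]. Along a kernel vector of [DF]
    the map [F] moves by [o(t)] and, [g] being Lipschitz, so does each [g j \o F]; the same vector
    annihilates the Jacobian of the composition. *)
Lemma det_comp_eq (g : 'I_N -> E -> R) (x : 'rV[R]_N) (A B D : 'M[R]_N) :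
  (forall j, is_lip (g j)) -> lip_map setT F ->
  (forall k, frechet (Fj k) x (fun i => A i k)) ->
  (forall j, frechet (g j \o F) x (fun i => D i j)) ->
  \det A = 0 \/ (forall j, frechet (g j) (F x) (fun i => B i j)) ->
  \det D = \det B * \det A.
Proof.
move=> gl Fl hA hD [A0|hB].
  rewrite A0 mulr0; move/eqP: A0 => /det0P[v v0 vF].
  apply/eqP/det0P; exists v => //; apply/rowP => j; rewrite [RHS]mxE [LHS]mxE.
  have [K1 K10 gK] := lip_sup_const (gl j).
  set s := \sum_k _; apply/eqP; rewrite -normr_le0; apply/ler_addgt0Pr => e e0; rewrite add0r.
  have vn : 0 < `|v| by rewrite normr_gt0.
  pose t := e / `|v| / (K1 + 1); have t0 : 0 < t by rewrite !divr_gt0// ltr_wpDl.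
  have [d1 d10 h1] := hD j _ t0.
  have [d2 d20 h2] := @finite_common_radius R 'rV[R]_N 'I_N _ (fun k => hA k _ t0).
  pose a := Num.min d1 d2 / 2 / `|v|.
  have a0 : 0 < a by rewrite !divr_gt0// lt_min d10.
  have av : `|a *: v| = Num.min d1 d2 / 2 by rewrite normrZ gtr0_norm// /a divfK// gt_eqF.
  have m0 : 0 < Num.min d1 d2 by rewrite lt_min d10.
  have mlt : Num.min d1 d2 / 2 < Num.min d1 d2 by rewrite ltr_pdivrMr// ltr_pMr// ltr1n.
  have l1 : `|a *: v| < d1 by rewrite av (lt_le_trans mlt)// ge_min lexx.
  have l2 : `|a *: v| < d2 by rewrite av (lt_le_trans mlt)// ge_min lexx orbT.
  have F1 : `|(F ((x : 'rV[R]_N) + a *: v) : 'rV[R]_N) - F x| <= t * `|a *: v|.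
    apply: rV_norm_le => [|k]; first by rewrite mulr_ge0// ltW.
    have := h2 _ l2 k; rewrite (_ : \sum_i _ = 0); first by rewrite subr0 !mxE.
    transitivity (a * (v *m A) ord0 k); last by rewrite vF mxE mulr0.
    by rewrite [in RHS]mxE mulr_sumr; apply: eq_bigr => i _; rewrite [(a *: v) _ _]mxE mulrA.
  have H1 := h1 _ l1.
  have sE : \sum_i (a *: v) ord0 i * D i j = a * s.
    by rewrite /s mulr_sumr; apply: eq_bigr => i _; rewrite [(a *: v) _ _]mxE mulrA.
  rewrite sE in H1.
  have H2 : `|(g j \o F) ((x : 'rV[R]_N) + a *: v) - (g j \o F) x| <= K1 * (t * `|a *: v|).
    by rewrite (le_trans (gK _ _))// ler_wpM2l.
  have : `|a * s| <= (K1 + 1) * t * `|a *: v|.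
    set u := (g j \o F) _ - _ in H1 H2; have -> : a * s = u - (u - a * s) by rewrite opprB addrC subrK.
    rewrite (le_trans (ler_normB _ _))// -mulrA mulrDl mul1r.
    by apply: lerD; [exact: H2|exact: H1].
  move=> h; have h' : a * `|s| <= a * ((K1 + 1) * t * `|v|).
    have e1 : `|a * s| = a * `|s| by rewrite normrM gtr0_norm.
    have e2 : `|a *: v| = a * `|v| by rewrite normrZ gtr0_norm.
    by rewrite -e1 mulrCA -e2.
  rewrite -(ler_pM2l a0) (le_trans h')// ler_wpM2l ?(ltW a0)// le_eqVlt; apply/orP; left; apply/eqP.
  by rewrite /t; field; rewrite !gt_eqF// ltr_wpDl.
rewrite mulrC -det_mulmx; congr (\det _); apply/matrixP => i j; rewrite mxE.
have gFl := lip_comp (gl j) Fl.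
have [_ <-] := frechet_grad gFl (frechet_comp (hB j) hA).
by have [_ ->] := frechet_grad gFl (hD j).
Qed.

(** The points where [g] is not differentiable form a null set, so almost every [x] sent there has
    [det DF = 0], the degenerate case of [det_comp_eq]. *)
Lemma ae_det_comp (g : 'I_N -> E -> R) : (forall j, is_lip (g j)) -> lip_map setT F ->
  {ae L, forall x, \det (Dmx (fun j => g j \o F) x) = \det (Dmx g (F x)) * \det (Dmx Fj x)}.
Proof.
move=> gl Fl; have gFl j : is_lip (g j \o F) by exact: lip_comp.
have [M M0 gM] := lip_common gl; have [M' M'0 gFM] := lip_common gFl.
pose Z : set (borel E) := ~` diff_set g.
have mZ : measurable Z by apply: measurableC; exact: measurable_diff_set gM.
have Z0 : L Z = 0%E.
  by apply: ae_null_sub => //; apply: ae_imp (ae_diff_set gM) => x h; apply.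
have hN := area_null FC mZ Z0; have hF := ae_diff_set FC; have hG := ae_diff_set gFM.
have := ae_and hN (ae_and hF hG); apply: ae_imp => x [hZ [DF DgF]].
apply: (det_comp_eq gl Fl (diff_set_frechet FC DF) (diff_set_frechet gFM DgF)).
have [Fx|Fx] := pselect (diff_set g (F x)); first by right => j; exact: (diff_set_frechet gM Fx j).
by left; exact: hZ.
Qed.

End chain_rule.

Section restriction.
Context {R : realType} {n : nat}.
Local Notation N := n.+1.
Local Notation E := (euclid R N).
Local Notation L := (@lebesgueRn R N).
Variables (A : set (borel E)) (r : R).
Hypothesis mA : measurable A.
Hypothesis Ar : A `<=` Bx r.

(** The extension chooses a limit, so one has to show that some approximating sequence exists and
    that all of them give the same value. The latter holds because the determinant is bounded and
    the current is continuous in [L^1] of the mass measure. *)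
Lemma current_ext_set (B : set (borel E)) (f : E -> R) (g : 'I_N -> E -> R) :
  measurable B -> is_lip f -> (forall j, is_lip (g j)) ->
  current_ext (set_current (A : set E)) (restrL mA Ar) (fun x => \1_B x * f x) g =
  \int[L]_x (\1_(A `&` B) x * (f x * \det (Dmx g x))).
Proof.
move=> mB fl gl; have mAB : measurable (A `&` B) by exact: measurableI.
have ABr : A `&` B `<=` Bx r by move=> x [/Ar].
have [C C0 gC] := lip_common gl; pose K := N`!%:R * C ^+ N.
have K0 : 0 <= K by rewrite mulr_ge0// exprn_ge0.
have dK x : `|\det (Dmx g x)| <= K by exact: det_Dmx_le.
have mf := lip_measurable fl.
have mv : measurable_fun setT (fun x : borel E => \1_B x * f x).
  by apply: measurable_funM => //; exact: measurable_indic.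
have [M M0 bAB] := bcs_indic_lip mAB ABr fl.
have vE x : \1_A x * (\1_B x * f x) = \1_(A `&` B) x * f x.
  by rewrite mulrA indicIE.
have [M' [M'0 bT]] := bcs_set_current mAB ABr fl gl.
set S := \int[L]_x _.
have dist h : is_lip h -> exists2 b, bcs b r (fun x => \1_A x * h x - \1_(A `&` B) x * f x) &
   (\int[restrL mA Ar]_x `|h x - \1_B x * f x|%:E)%E =
   (\int[L]_x `|\1_A x * h x - \1_(A `&` B) x * f x|)%:E.
  move=> hl; have [M1 M10 b1] := bcs_indic_lip mA Ar hl.
  exists (M1 + M); first exact: bcsB.
  rewrite restrL_integral; last by apply: measurable_funB => //; exact: lip_measurable.
  rewrite /Rintegral fineK; last first.
    apply: integrable_fin_num => //; exact: (integrable_norm (bcs_integrable (bcsB b1 bAB))).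
  apply: eq_integral => x _; congr EFin.
  by rewrite -vE -mulrBr normrM ger0_norm// indicE.
have close h : is_lip h -> (`|S - set_current (A : set E) h g|%:E <=
    K%:E * \int[restrL mA Ar]_x `|h x - \1_B x * f x|%:E)%E.
  move=> hl; have [b bb ->] := dist h hl; have [M2 [M20 b2]] := bcs_set_current mA Ar hl gl.
  rewrite -EFinM lee_fin /S set_currentE -RintegralB//; last exact: bcs_integrable b2.
    apply: (le_trans (le_normr_Rintegral measurableT _)).
      have := integrableB measurableT (bcs_integrable bT) (bcs_integrable b2).
      by congr (_.-integrable _ _); apply/funext => x /=; rewrite mulrA.
    rewrite -RintegralZl//; last exact: (integrable_norm (bcs_integrable bb)).
    apply: le_Rintegral => //.
    - have := integrable_norm (integrableB measurableT (bcs_integrable bT) (bcs_integrable b2)).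
      by congr (_.-integrable _ _); apply/funext => x /=; rewrite mulrA.
    - exact: (integrableZl measurableT K (integrable_norm (bcs_integrable bb))).
    move=> x _; rewrite mulrA -mulrBl normrM mulrC distrC; exact: ler_wpM2r.
  have := bcs_integrable bT; congr (_.-integrable _ _); apply/funext => x /=; by rewrite mulrA.
have uniq s : (exists h : nat -> E -> R, [/\ forall k, is_lip (h k),
    (\int[restrL mA Ar]_x `|h k x - \1_B x * f x|%:E)%E @[k --> \oo] --> 0%E &
    set_current (A : set E) (h k) g @[k --> \oo] --> s]) -> s = S.
  move=> [h [hl h0 hs]].
  suff hS : set_current (A : set E) (h k) g @[k --> \oo] --> S by exact: (cvg_unique _ hs hS).
  apply/cvgrPdist_le => e e0.
  have : (K%:E * \int[restrL mA Ar]_x `|h k x - \1_B x * f x|%:E)%E @[k --> \oo] --> (K%:E * 0)%E.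
    by apply: cvgeZl.
  rewrite mule0 => /fine_cvgP[fin /cvgrPdist_le/(_ e e0) H]; near=> k.
  rewrite -lee_fin (le_trans (close _ (hl k)))//.
  have fk : (K%:E * \int[restrL mA Ar]_x `|h k x - \1_B x * f x|%:E)%E \is a fin_num by near: k.
  rewrite -(fineK fk) lee_fin.
  have : `|0 - (fine \o (fun k => (K%:E * \int[restrL mA Ar]_x `|h k x - \1_B x * f x|%:E)%E)) k| <= e by near: k.
  by rewrite sub0r normrN; apply: le_trans; exact: ler_norm.
pose P : set R := [set s | exists h : nat -> E -> R, [/\ forall k, is_lip (h k),
    (\int[restrL mA Ar]_x `|h k x - \1_B x * f x|%:E)%E @[k --> \oo] --> 0%E &
    set_current (A : set E) (h k) g @[k --> \oo] --> s]].
apply: uniq; suff : exists s, P s by exact: getPex.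
have [Mf Mf0 fM] := lip_bounded_Bx r fl.
have /choice[phi hphi] : forall k : nat, exists phi, [/\ is_lip phi, forall x, 0 <= phi x <= 1, supp_in (r + 1) phi &
    \int[L]_x `|\1_(A `&` B) x - phi x| <= k.+1%:R^-1].
  by move=> k; apply: (lip_approx_indic mAB ABr); rewrite invr_gt0.
(* [phi k] approximates the indicator of [A] intersected with [B], which is bounded, instead of that
   of [B]; the mass measure only sees points of [A], where the two agree. *)
exists S; exists (fun k x => phi k x * f x).
have hl k : is_lip (fun x => phi k x * f x).
  by have [pl _ pr _] := hphi k; exact: lip_mul_supp pl pr fl.
have to0 : (\int[restrL mA Ar]_x `|phi k x * f x - \1_B x * f x|%:E)%E @[k --> \oo] --> 0%E.
  have bnd k : (\int[restrL mA Ar]_x `|phi k x * f x - \1_B x * f x|%:E <= (Mf * k.+1%:R^-1)%:E)%E.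
    have [b bb ->] := dist _ (hl k); have [pl p01 pr pi] := hphi k.
    have [M3 M30 b3] := bcs_lip pl pr.
    have b4 : bcs 1 (r + 1) (\1_(A `&` B) : borel E -> R).
      apply: bcs_indic => //; apply: subset_trans ABr _ => x xr.
      by rewrite /Bx/= (le_trans xr)// lerDl.
    have i5 := integrable_norm (bcs_integrable (bcsB b4 b3)).
    rewrite lee_fin; apply: le_trans (ler_wpM2l Mf0 pi).
    rewrite -RintegralZl//; apply: le_Rintegral => //.
    - exact: (integrable_norm (bcs_integrable bb)).
    - exact: (integrableZl measurableT Mf i5).
    move=> x _; rewrite -vE -mulrBr -mulrBl !normrM.
    rewrite indicE; case: (boolP (x \in A)) => xA; last by rewrite normr0 mul0r mulr_ge0.
    rewrite normr1 mul1r mulrC distrC; have -> : \1_(A `&` B) x = \1_B x :> R.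
      by rewrite indicIE [\1_A x]indicE xA mul1r.
    by rewrite ler_wpM2r// fM//; apply: Ar; exact: set_mem.
  apply: (squeeze_cvge (f := fun=> 0%E) (h := fun k => (Mf * k.+1%:R^-1)%:E)).
  - apply: nearW => k; rewrite bnd andbT; apply: integral_ge0 => x _; by rewrite lee_fin.
  - exact: cvg_cst.
  - rewrite -[0%E]/(0%:E) -(mulr0 Mf); apply: cvg_EFin; first by apply: nearW.
    by apply: cvgMr; exact: cvg_harmonic.
split => //.
apply/cvgrPdist_le => e e0.
have : (K%:E * \int[restrL mA Ar]_x `|phi k x * f x - \1_B x * f x|%:E)%E @[k --> \oo] --> (K%:E * 0)%E.
  by apply: cvgeZl.
rewrite mule0 => /fine_cvgP[fin /cvgrPdist_le/(_ e e0) H]; near=> k.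
rewrite -lee_fin (le_trans (close _ (hl k)))//.
have fk : (K%:E * \int[restrL mA Ar]_x `|phi k x * f x - \1_B x * f x|%:E)%E \is a fin_num by near: k.
rewrite -(fineK fk) lee_fin.
have : `|0 - (fine \o (fun k => (K%:E * \int[restrL mA Ar]_x `|phi k x * f x - \1_B x * f x|%:E)%E)) k| <= e by near: k.
by rewrite sub0r normrN; apply: le_trans; exact: ler_norm.
Unshelve. all: by end_near. Qed.

(** The identity charts the whole space. A push-forward becomes, by the chain rule, an integral over
    [A] intersected with [B] against [det DF], and the degree turns it into an integral on the
    target with integer multiplicity. *)
Lemma integer_rectifiable_set_current : integer_rectifiable (set_current (A : set E)).
Proof.
exists (restrL mA Ar); split; first exact: mass_measure_restrL.
  exists setT; split; [exact: measurableT| |by rewrite setCT measure0].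
  exists (fun=> setT), (fun=> id); split.
    by move=> k; exists 1 => x y _ _; rewrite mul1r.
  by move=> x _; exists 0%N => //; exists x.
move=> B F mB Fl.
have mAB : measurable (A `&` B) by exact: measurableI.
have ABr : A `&` B `<=` Bx r by move=> x [/Ar].
have [C C0 FC] : exists2 C, 0 <= C & forall j, lip_with C (fun x : E => (F x : 'rV[R]_N) ord0 j).
  have [D FD] := Fl; exists `|D| => // j x y.
  rewrite (le_trans (coord_lip j (F x) (F y)))// mul1r (le_trans (FD _ _ I I))//.
  by rewrite ler_wpM2r ?mdist_ge0// ler_norm.
have ABfin : (L (A `&` B) < +oo)%E by exact: set_lty mAB ABr.
have [u [iu uint uE]] := area_degree C0 FC mAB ABfin.
exists u; split => // f g [fl gl].
have fFl := lip_comp fl Fl; have gFl j := lip_comp (gl j) Fl.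
rewrite /current_push /current_restr current_ext_set//.
have [C1 C10 gC] := lip_common gl.
have [Mf Mf0 fM] := lip_bounded_Bx r fFl.
have mh : measurable_fun setT (fun y : borel E => f y * \det (Dmx g y)).
  by apply: measurable_funM; [exact: lip_measurable|exact: measurable_det_Dmx gC].
have [C2 C20 gFC] := lip_common gFl.
transitivity (\int[L]_x (\1_(A `&` B) x * (f (F x) * \det (Dmx g (F x)) * \det (Dmx (fun j (x : E) => (F x : 'rV[R]_N) ord0 j) x)))).
  apply: ae_eq_Rintegral.
  - apply: measurable_funM; first exact: measurable_indic.
    by apply: measurable_funM; [exact: lip_measurable|exact: measurable_det_Dmx gFC].
  - apply: measurable_funM; first exact: measurable_indic.
    apply: measurable_funM; last exact: measurable_det_Dmx FC.
    exact: (measurableT_comp mh (measurable_lip_map FC)).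
  apply: ae_imp (ae_det_comp FC gl Fl) => x e.
  by rewrite /= -[in RHS]mulrA; congr (_ * (_ * _)).
rewrite (uE (fun y => f y * \det (Dmx g y)))//; last first.
  exists (Mf * (N`!%:R * C1 ^+ N)) => x /ABr /fM fx; rewrite normrM ler_pM//; exact: det_Dmx_le.
by apply: eq_Rintegral => x _; rewrite mulrA.
Qed.

End restriction.

(** * Box dimension and the Whitney decomposition *)

Section box_dimension.
Context {R : realType} {X : pmetricType R}.
Implicit Types (A : set X) (d delta : R).

Lemma covering_number_lt A (e t : R) : (covering_number A e < t%:E)%E ->
  exists M (c : 'I_M -> X), A `<=` \bigcup_(i in [set: 'I_M]) ball (c i) e /\ M%:R < t.
Proof.
by move=> /ereal_inf_lt[_ [M [c hc] <-]]; rewrite lte_fin => Mt; exists M, c.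
Qed.

Lemma covering_number_ge0 A (e : R) : (0 <= covering_number A e)%E.
Proof. by apply: le_ereal_inf_tmp => _ [M _ <-]; rewrite lee_fin. Qed.

Lemma box_dim_near A d : has_box_dim A d ->
  forall delta, d < delta -> exists2 e0 : R, 0 < e0 & forall e, 0 < e < e0 ->
    (lne (covering_number A e) * ((ln e^-1)^-1)%:E)%E \is a fin_num /\
    (lne (covering_number A e) * ((ln e^-1)^-1)%:E < delta%:E)%E.
Proof.
move=> /fine_cvgP[fin lim] delta dd.
have [e1 /= e10 h1] := fin; have [e2 /= e20 h2] := (cvgr_lt d lim _ dd).
exists (Num.min e1 e2); first by rewrite lt_min e10.
move=> e /andP[e0]; rewrite lt_min => /andP[ee1 ee2].
have f1 : (lne (covering_number A e) * ((ln e^-1)^-1)%:E)%E \is a fin_num.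
  by apply: h1 => //=; rewrite sub0r normrN gtr0_norm.
split => //; rewrite -(fineK f1) lte_fin.
by apply: (h2 e) => //=; rewrite sub0r normrN gtr0_norm.
Qed.

Lemma pow2_small (e0 : R) : 0 < e0 -> exists k0, forall k, (k0 <= k)%N -> (0 : R) < 2 ^- k < e0.
Proof.
move=> e00; have [k0 _ hk] := near_infty_natSinv_lt (PosNum e00).
exists k0 => k /hk /= h; rewrite invr_gt0 exprn_gt0//=; apply: le_lt_trans h.
by rewrite lef_pV2 ?posrE ?exprn_gt0// -natrX ler_nat ltn_expl.
Qed.

Lemma ln_pow2 k : ln (2 ^- k)^-1 = k%:R * ln 2 :> R.
Proof. by rewrite invrK lnXn// mulr_natl. Qed.

Lemma powR2E (x : R) : 2 `^ x = expR (x * ln 2).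
Proof. by rewrite /powR pnatr_eq0. Qed.

Lemma box_count A d delta : has_box_dim A d -> d < delta ->
  exists k0, forall k, (k0 <= k)%N -> exists M (c : 'I_M -> X),
    A `<=` \bigcup_(i in [set: 'I_M]) ball (c i) (2 ^- k) /\ M%:R <= 2 `^ (k%:R * delta) :> R.
Proof.
move=> hd dd; have [e0 e00 he] := box_dim_near hd dd.
(* The shift by one keeps [k] positive, so that dividing by [k ln 2] preserves the inequality. *)
have [k0 hk0] := pow2_small e00; exists k0.+1 => k kk.
have k1 : 0 < k%:R :> R by rewrite ltr0n (leq_trans _ kk).
have [_] := he _ (hk0 k (ltnW kk)); rewrite ln_pow2.
have l2 : 0 < ln 2 :> R by rewrite ln_gt0// ltr1n.
have kl : 0 < k%:R * ln 2 :> R by rewrite mulr_gt0.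
set cov := covering_number _ _ => hcov.
have {}hcov : (lne cov < (delta * (k%:R * ln 2))%:E)%E.
  by rewrite EFinM -lte_pdivrMr.
suff /covering_number_lt[M [c [hc Mc]]] : (cov < (2 `^ (k%:R * delta))%:E)%E.
  by exists M, c; split => //; exact: ltW.
rewrite -lte_lne; last 2 first.
- by rewrite in_itv/= leey andbT covering_number_ge0.
- by rewrite in_itv/= leey andbT lee_fin powR_ge0.
rewrite lne_EFin ?powR_gt0// ln_powR.
by rewrite (_ : k%:R * delta * ln 2 = delta * (k%:R * ln 2))//; ring.
Qed.

(** The empty set needs no ball, and [lne 0 = -oo], so its quotients are never finite. This is what
    guarantees that [U] itself is nonempty later on. *)
Lemma box_dim_neq0 A d : has_box_dim A d -> A !=set0.
Proof.
move=> hd; apply/set0P/eqP => A0; have d1 : d < d + 1 by rewrite ltrDl.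
have [e0 e00 he] := box_dim_near hd d1; have [k0 hk0] := pow2_small e00.
have [] := he _ (hk0 k0.+1 (leqnSn _)); rewrite A0 ln_pow2 => + _.
have -> : covering_number (set0 : set X) (2 ^- k0.+1) = 0%E :> \bar R.
  apply/eqP; rewrite eq_le covering_number_ge0 andbT; apply: ereal_inf_lbound.
  by exists 0%N => //; exists (fun=> point).
rewrite le0_lneNy//.
have l2 : 0 < (k0.+1%:R * ln 2)^-1 :> R by rewrite invr_gt0 mulr_gt0// ln_gt0// ltr1n.
by rewrite gt0_mulNye// lte_fin.
Qed.

End box_dimension.

Section topological_boundary.
Context {R : realType} {n : nat}.
Local Notation N := n.+1.
Local Notation E := (euclid R N).
Local Notation L := (@lebesgueRn R N).
Implicit Types (U : set E).

(** The last parameter up to which points of [U] occur: it is approached from within [U], and if the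
    point there were in [U], openness would allow going further, or the segment would end in [U]. *)
Lemma segment_boundary U (x y : 'rV[R]_N) : open U -> U x -> ~ U y ->
  exists2 t, 0 <= t <= 1 & topo_boundary U (x + t *: (y - x)).
Proof.
move=> oU Ux Uy; pose p t : E := x + t *: (y - x).
pose S := [set t : R | 0 <= t <= 1 /\ U (p t)].
have S0 : S 0 by split; rewrite ?lexx ?ler01// /p scale0r addr0.
have Sub : ubound S 1 by move=> t [/andP[]].
have hS : has_sup S by split; [exists 0|exists 1].
have T0 : 0 <= sup S by apply: ub_le_sup => //; exists 1.
have T1 : sup S <= 1 by apply: ge_sup => //; exists 0.
have vn : 0 < `|y - x| + 1 by rewrite ltr_wpDl.
have pd s t : `|(p s : 'rV[R]_N) - p t| <= `|s - t| * (`|y - x| + 1).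
  rewrite /p opprD addrACA subrr add0r -scalerBl normrZ ler_wpM2l// lerDl//.
exists (sup S); first by rewrite T0.
split.
  move=> V /nbhs_euclid /nbhs_normP[e /= e0 eV].
  have [s Ss hs] := sup_adherent (divr_gt0 e0 vn) hS.
  exists (p s); split; first by case: Ss.
  apply: eV => /=; apply: (le_lt_trans (pd _ _)); rewrite -ltr_pdivlMr//.
  have sT : s <= sup S by apply: ub_le_sup => //; exists 1.
  by rewrite ger0_norm ?subr_ge0//; lra.
move=> /interior_subset UT.
have [T1'|T1'] := eqVneq (sup S) 1.
  by apply: Uy; move: UT; rewrite T1' scale1r addrC subrK.
have lt1 : sup S < 1 by rewrite lt_neqAle T1'.
have [r r0 hr] := open_radius oU UT.
pose t := Num.min 1 (sup S + r / 2 / (`|y - x| + 1)).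
have r20 : 0 < r / 2 / (`|y - x| + 1) by rewrite !divr_gt0.
have tT : sup S < t by rewrite lt_min lt1 ltrDl.
have : S t.
  split; first by rewrite (le_trans T0 (ltW tT)) ge_min lexx.
  have := hr ((p t : 'rV[R]_N) - p (sup S)); rewrite [_ + (_ - _)]addrC subrK; apply.
  apply: (le_lt_trans (pd _ _)); rewrite -ltr_pdivlMr// gtr0_norm ?subr_gt0//.
  have : t <= sup S + r / 2 / (`|y - x| + 1) by rewrite ge_min lexx orbT.
  have : r / 2 / (`|y - x| + 1) < r / (`|y - x| + 1).
    by rewrite ltr_pM2r ?invr_gt0// ltr_pdivrMr// ltr_pMr// ltr1n.
  by lra.
by move=> /(ub_le_sup (ex_intro _ 1 Sub)); rewrite leNgt tT.
Qed.

Lemma measure_cover_le d (T : measurableType d) (mu : {measure set T -> \bar R})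
    M (B : set T) (Q : 'I_M -> set T) (b : R) : measurable B -> (forall i, measurable (Q i)) ->
  B `<=` \bigcup_(i in [set: 'I_M]) Q i -> (forall i, (mu (Q i) <= b%:E)%E) ->
  (mu B <= (M%:R * b)%:E)%E.
Proof.
move=> mB mQ BQ Qb; pose A (m : nat) := oapp Q set0 (insub m).
have mA m : measurable (A m) by rewrite /A; case: insub => [i|] /=; [exact: mQ|exact: measurable0].
apply: (@le_trans _ _ (mu (\big[setU/set0]_(i < M) A i))).
  apply: measure_le => //; first exact: bigsetU_measurable.
  move=> x /BQ[i _ Qx]; rewrite -bigcup_mkord; exists i => /=; first exact: ltn_ord.
  by rewrite /A valK.
apply: (le_trans (Boole_inequality mu (A := A) (n := M) (fun i _ => mA i))).
apply: (@le_trans _ _ (\sum_(i < M) b%:E)%E).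
  by apply: lee_sum => i _; rewrite /A valK; exact: Qb.
by rewrite sumEFin sumr_const card_ord mulr_natl.
Qed.

Lemma powR2_nat (k : nat) (s : R) : 2 `^ (k%:R * s) = (2 `^ s) ^+ k.
Proof. by rewrite mulrC powRrM powR_mulrn// powR_ge0. Qed.

(* Every line parallel to the first axis through a small cube inside [U] crosses
   the boundary, so the projections of a cover of the boundary cover a cube of
   dimension [n]. *)
Lemma boundary_dim_ge U r d : open U -> U `<=` Bx r -> has_box_dim (topo_boundary U) d -> n%:R <= d.
Proof.
move=> oU Ur hd; rewrite leNgt; apply/negP => dn.
have [y0 [cy _]] := box_dim_neq0 hd.
have [x0 [Ux0 _]] : exists x0, (U `&` setT) x0.
  by have [x [Ux _]] := cy setT filterT; exists x.
have r0 : 0 <= r by exact: le_trans (Ur _ Ux0).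
have [rho rho0 hrho] := open_radius oU Ux0.
pose delta := (d + n%:R) / 2; have dd : d < delta by rewrite /delta; lra.
have dn' : delta < n%:R by rewrite /delta; lra.
have [k0 hk0] := box_count hd dd.
pose B : set (borel E) := [set x : 'rV[R]_N | forall i, (x0 : 'rV[R]_N) ord0 i - rho / 2 <= x ord0 i <= (x0 : 'rV[R]_N) ord0 i + rho / 2].
have mB : measurable B by exact: measurable_cbox.
have LB : L B = (rho ^+ N)%:E.
  rewrite lebesgue_cbox => [|i]; last by lra.
  congr _%:E; rewrite (eq_bigr (fun=> rho)) ?prodr_const ?card_ord// => i _.
  by field.
have BU : B `<=` U.
  move=> x Bx; have -> : x = (x0 : 'rV[R]_N) + ((x : 'rV[R]_N) - x0) by rewrite addrC subrK.
  apply: hrho; apply: (@le_lt_trans _ _ (rho / 2)); last by rewrite ltr_pdivrMr// ltr_pMr// ltr1n.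
  apply: rV_norm_le => [|i]; first by rewrite divr_ge0// ltW.
  by have := Bx i; rewrite !mxE ler_norml => /andP[? ?]; apply/andP; split; lra.
pose q : R := 2 `^ (delta - n%:R).
have q01 : 0 <= q < 1.
  by rewrite powR_ge0/= /q powR2E expR_lt1 pmulr_llt0 ?ln_gt0 ?ltr1n// subr_lt0.
have bound k : (k0 <= k)%N -> rho ^+ N <= 2 * r * 2 ^+ n * q ^+ k.
  move=> kk; have [M [c [hc Mc]]] := hk0 k kk.
  (* Each ball of the cover is widened to a slab over its projection: full length in the first
     direction, width [2 * 2^-k] in the others. With [2^(k delta)] slabs and [delta < n] their total
     volume tends to [0]. *)
  pose lo (i : 'I_M) (j : 'I_N) : R := if j == ord0 then - r else (c i : 'rV[R]_N) ord0 j - 2 ^- k.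
  pose hi (i : 'I_M) (j : 'I_N) : R := if j == ord0 then r else (c i : 'rV[R]_N) ord0 j + 2 ^- k.
  pose Q i : set (borel E) := [set x : 'rV[R]_N | forall j, lo i j <= x ord0 j <= hi i j].
  have k2 : 0 < 2 ^- k :> R by rewrite invr_gt0 exprn_gt0.
  have LQ i : L (Q i) = (2 * r * (2 * 2 ^- k) ^+ n)%:E.
    rewrite lebesgue_cbox => [|j]; last by rewrite /lo /hi; case: ifP => _; lra.
    congr _%:E; rewrite big_ord_recl /lo /hi eqxx; congr (_ * _); first by ring.
    rewrite (eq_bigr (fun=> 2 * 2 ^- k)) ?prodr_const ?card_ord// => j _.
    by rewrite eq_sym (negbTE (neq_lift _ _)); ring.
  have BQ : B `<=` \bigcup_(i in [set: 'I_M]) Q i.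
    move=> x Bx; pose e0 : 'rV[R]_N := delta_mx ord0 ord0.
    (* The first coordinate of [x] is at least [-r], so after a shift by [2 r + 1] it exceeds [r]
       and the point has left [U]. *)
    pose y : 'rV[R]_N := (x : 'rV[R]_N) + (2 * r + 1) *: e0.
    have Uy : ~ U y.
      move=> /Ur /(le_trans (coord_le_norm y ord0)); rewrite !mxE !eqxx mulr1.
      have := le_trans (coord_le_norm (x : 'rV[R]_N) ord0) (Ur _ (BU _ Bx)).
      by rewrite !ler_norml; lra.
    have [t t01 bt] := segment_boundary oU (BU _ Bx) Uy.
    have [i _] := hc _ bt; rewrite ballEmdist /= => bi; exists i => // j.
    rewrite /lo /hi; case: ifP => j0.
      have := le_trans (coord_le_norm (x : 'rV[R]_N) j) (Ur _ (BU _ Bx)).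
      by rewrite ler_norml.
    have := le_lt_trans (coord_le_enorm _ j) bi.
    have yx : y - x = (2 * r + 1) *: e0 by rewrite /y [_ + _ *: _]addrC addrK.
    have -> : ((c i : 'rV[R]_N) - ((x : 'rV[R]_N) + t *: (y - x))) ord0 j = (c i : 'rV[R]_N) ord0 j - (x : 'rV[R]_N) ord0 j.
      by rewrite yx !mxE eqxx j0 !mulr0 addr0.
    rewrite ltr_norml => /andP[? ?].
    by apply/andP; split; lra.
  have := measure_cover_le (mu := L) mB (fun i => measurable_cbox (lo i) (hi i)) BQ (b := 2 * r * (2 * 2 ^- k) ^+ n).
  rewrite LB lee_fin => h; apply: (le_trans (h _)); first by move=> i; rewrite LQ.
  apply: (@le_trans _ _ (2 `^ (k%:R * delta) * (2 * r * (2 * 2 ^- k) ^+ n))).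
    by rewrite ler_wpM2r// mulr_ge0 ?mulr_ge0 ?exprn_ge0 ?mulr_ge0// ltW.
  rewrite le_eqVlt; apply/orP; left; apply/eqP.
  rewrite /q powRD ?pnatr_eq0 ?implybT// powRN powR_mulrn// exprMn powR2_nat [in RHS]exprMn.
  by rewrite exprVn -!exprM [(k * n)%N]mulnC exprVn -exprM; ring.
have lim : (2 * r * 2 ^+ n) * q ^+ k @[k --> \oo] --> (2 * r * 2 ^+ n) * 0.
  by apply: cvgMr; apply: cvg_expr; rewrite ger0_norm//; case/andP: q01.
have : rho ^+ N <= (2 * r * 2 ^+ n) * 0.
  apply: (ler_cvg_to (cvg_cst _) lim).
  by exists k0 => // k /= /bound.
by rewrite mulr0 leNgt exprn_gt0.
Qed.

End topological_boundary.

Section whitney.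
Context {R : realType} {n : nat}.
Local Notation N := n.+1.
Local Notation E := (euclid R N).
Local Notation L := (@lebesgueRn R N).
Local Notation idx := {ffun 'I_N -> int}.
Variables (U : set E) (r : R).
Hypothesis oU : open U.
Hypothesis Ur : U `<=` Bx r.

Lemma ccube_center k (z : idx) : (@ccube R N k z) ((\row_i ((z i)%:~R / 2 ^+ k)) : 'rV[R]_N).
Proof.
have e0 : (2 ^+ k : R) != 0 by rewrite expf_neq0.
by move=> i; rewrite mxE mulrCA mulfV// mulr1 lexx lerDl ler01.
Qed.

Lemma finite_selected k : finite_set [set z : idx | selected U k z].
Proof.
pose M : nat := Num.truncn (2 ^+ k * `|r|) + 1.
(* All integer vectors with entries between [-M] and [M], encoded by ordinals shifted by [M]. *)
pose f (a : {ffun 'I_N -> 'I_(M + M).+1}) : idx := [ffun i => (a i)%:Z - M%:Z].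
apply: (sub_finite_set (B := f @` setT)); last by apply: finite_image; exact: finite_finset.
move=> z [zU _]; have := Ur (zU _ (ccube_center k z)); rewrite /Bx/= => h.
have hz i : (`|z i| <= M%:Z)%R.
  have := le_trans (coord_le_norm _ i) (le_trans h (ler_norm r)); rewrite mxE normrM.
  rewrite [X in _ * X]ger0_norm ?invr_ge0 ?exprn_ge0// ler_pdivrMr ?exprn_gt0// => h1.
  rewrite -(ler_int R) intr_norm (le_trans h1)// mulrC -pmulrn /M natrD.
  by have /andP[_] := truncn_itv (mulr_ge0 (exprn_ge0 k (ler0n R 2)) (normr_ge0 r)); rewrite -[X in _ < X]natr1 => /ltW.
have hb i : (absz (z i + M%:Z)%R < (M + M).+1)%N.
  by have := hz i; lia.
exists [ffun i => Ordinal (hb i)] => //; apply/ffunP => i; rewrite !ffunE /=.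
by have := hz i; lia.
Qed.

Lemma selected_list : exists s : nat -> seq idx, forall k, uniq (s k) /\ forall z, (z \in s k) <-> selected U k z.
Proof.
have /choice[s hs] : forall k, exists s : seq idx, uniq s /\ forall z, (z \in s) <-> selected U k z.
  move=> k; have /finite_seqP[s hs] := finite_selected k; exists (undup s); split; first exact: undup_uniq.
  by move=> z; rewrite mem_undup; have := f_equal (fun A => A z) hs => /= ->.
by exists s.
Qed.

Definition whitney_seq : nat -> seq idx := projT1 (cid selected_list).

Lemma whitney_seq_uniq k : uniq (whitney_seq k).
Proof. by rewrite /whitney_seq; case: cid => s hs /=; have [] := hs k. Qed.

Lemma mem_whitney_seq k z : (z \in whitney_seq k) <-> selected U k z.
Proof. by rewrite /whitney_seq; case: cid => s hs /=; have [] := hs k. Qed.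

Definition whitney k : set E := \big[setU/set0]_(z <- whitney_seq k) ccube k z.

Lemma whitneyP k x : whitney k x <-> exists2 z, selected U k z & ccube k z x.
Proof.
rewrite /whitney -bigcup_seq; split => [[z /= /mem_whitney_seq sz xz]|[z sz xz]]; first by exists z.
by exists z => //=; exact/mem_whitney_seq.
Qed.

Lemma compact_whitney k : compact (whitney k).
Proof. by apply: bigsetU_compact => z _; exact: compact_ccube. Qed.

Lemma whitney_sub k : whitney k `<=` U.
Proof. by move=> x /whitneyP[z [zU _]]; exact: zU. Qed.

Lemma measurable_whitney k : measurable (whitney k : set (borel E)).
Proof. by apply: compact_borel; exact: compact_whitney. Qed.

Lemma whitney_Bx k : whitney k `<=` Bx r.
Proof. exact: subset_trans (whitney_sub (k := k)) Ur. Qed.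

(** Points on no dyadic hyperplane: almost every point. For these, closed and half-open cubes cannot
    be told apart, and overlaps of closed cubes along faces disappear. *)
Definition off_grid (x : 'rV[R]_N) := forall (k : nat) (i : 'I_N) (m : int), 2 ^+ k * x ord0 i != m%:~R.

Lemma ae_off_grid : {ae L, forall x, off_grid x}.
Proof.
apply: ae_count => k; apply: ae_count => i; apply: ae_count => m.
have h := lebesgue_hyperplane (n := N) i (m%:~R / 2 ^+ k : R).
have := ae_null (measurable_hyperplane i (m%:~R / 2 ^+ k : R)) h.
apply: ae_imp => x; apply: contra_not_neq => e /=.
by rewrite -e mulrC mulKf// expf_neq0.
Qed.

Lemma off_grid_ccube (x : 'rV[R]_N) k z : off_grid x -> ccube k z x -> zof k x = z.
Proof.
move=> ox xz; apply: zof_eq => i; have /andP[h1 h2] := xz i; rewrite h1/= lt_neqAle h2 andbT.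
by have := ox k i (z i + 1); rewrite intrD.
Qed.

Lemma indic_whitney x k : off_grid x -> \1_(whitney k) x = (`[< selected U k (zof k x) >])%:R :> R.
Proof.
move=> ox; rewrite indicE; congr ((nat_of_bool _)%:R); apply/idP/asboolP => [/set_mem/whitneyP[z sz]|h].
  by move=> /(off_grid_ccube ox) ->.
by apply/mem_set/whitneyP; exists (zof k x) => //; exact: dcube_ccube.
Qed.

Lemma indic_whitney_sum x k : off_grid x ->
  \1_(whitney k) x = \sum_(z <- whitney_seq k) \1_(dcube k z) x :> R.
Proof.
move=> ox; rewrite indic_whitney//.
have E1 (z : idx) : \1_(dcube k z) x = (z == zof k x)%:R :> R.
  by rewrite indicE; congr ((nat_of_bool _)%:R); apply/idP/eqP => [/set_mem|->]; [|exact/mem_set].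
under eq_bigr do rewrite E1.
case: asboolP => h.
  rewrite (bigD1_seq (zof k x)) ?whitney_seq_uniq//=; last exact/mem_whitney_seq.
  by rewrite eqxx big1 ?addr0// => z /negbTE ->.
rewrite big_seq big1// => z /mem_whitney_seq sz; case: eqP => // zx; by rewrite zx in sz.
Qed.

Lemma sum_whitney_le x M : off_grid x -> 0 <= \sum_(k < M) (\1_(whitney k) x : R) <= \1_U x.
Proof.
move=> ox; apply/andP; split; first by apply: sumr_ge0 => k _; rewrite indicE.
have [Ux|Ux] := pselect (U x); last first.
  rewrite big1 ?indicE// => k _; rewrite indicE memNset// => /whitney_sub; exact: Ux.
rewrite indicE mem_set//; have [k0 sk0] := selected_exists oU Ux.
have E1 k : \1_(whitney k) x = (k == k0)%:R :> R.
  rewrite indic_whitney//; congr ((nat_of_bool _)%:R); apply/asboolP/eqP => [sk|->//]; exact: (selected_uniq sk sk0).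
under eq_bigr do rewrite E1; rewrite -natr_sum ler_nat.
have [kM|kM] := ltnP k0 M.
  rewrite (bigD1 (Ordinal kM))//= eqxx big1 ?addn0// => k; rewrite -val_eqE/= => /negbTE -> //.
by rewrite big1// => k _; rewrite ltn_eqF// (leq_trans (ltn_ord k)).
Qed.

Lemma sum_whitney_cvg x : off_grid x -> \sum_(k < M) (\1_(whitney k) x : R) @[M --> \oo] --> (\1_U x : R).
Proof.
move=> ox; have [Ux|Ux] := pselect (U x); last first.
  apply: cvg_near_cst; apply: nearW => M; apply/eqP; rewrite eq_le.
  by have /andP[h1 ->] := sum_whitney_le M ox; rewrite indicE memNset.
have [k0 sk0] := selected_exists oU Ux.
apply: cvg_near_cst; exists k0.+1 => // M /= kM; apply/eqP; rewrite eq_le.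
have /andP[_ ->] := sum_whitney_le M ox; rewrite /= indicE mem_set//.
rewrite (bigD1 (Ordinal kM))//= indic_whitney// asboolT// lerDl.
by apply: sumr_ge0 => k _; rewrite indicE.
Qed.

Lemma measurable_U : measurable (U : set (borel E)). Proof. exact: open_borel. Qed.

Lemma whitney_dct (w : borel E -> R) M : measurable_fun setT w -> (forall x, U x -> `|w x| <= M) ->
  \int[L]_x ((\sum_(k < K) \1_(whitney k) x) * w x) @[K --> \oo] --> \int[L]_x (\1_U x * w x).
Proof.
move=> mw wM.
have mS K : measurable_fun setT (fun x : borel E => \sum_(k < K) (\1_(whitney k) x : R)).
  by apply: measurable_sum => k; apply: measurable_indic; exact: measurable_whitney.
(* On the null set of grid points several closed cubes may overlap and the partial sum may exceed
   [1]. Taking the minimum with [\1_U] gives the pointwise bound required for dominated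
   convergence. *)
pose S K (x : borel E) : R := Num.min (\sum_(k < K) \1_(whitney k) x) (\1_U x).
have mSm K : measurable_fun setT (S K).
  by apply: measurable_minr => //; apply: measurable_indic; exact: measurable_U.
have SE x K : off_grid x -> S K x = \sum_(k < K) \1_(whitney k) x.
  by move=> ox; rewrite /S min_l//; case/andP: (sum_whitney_le K ox).
have S0 K x : 0 <= S K x.
  by rewrite /S le_min; apply/andP; split; [apply: sumr_ge0 => k _|]; rewrite indicE ler0n.
have SU K x : S K x <= \1_U x by rewrite /S ge_min lexx orbT.
have -> : (fun K => \int[L]_x ((\sum_(k < K) \1_(whitney k) x) * w x)) = fun K => \int[L]_x (S K x * w x).
  apply/funext => K; apply: ae_eq_Rintegral; [exact: measurable_funM|exact: measurable_funM|].
  by apply: ae_imp ae_off_grid => x ox; rewrite SE.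
apply: (bcs_dct (M := `|M|) (r := r)).
- move=> K; split; first exact: measurable_funM.
    move=> x; have := SU K x; rewrite indicE; case: (boolP (x \in U)) => [/set_mem Ux|_] h.
      rewrite normrM (ger0_norm (S0 K x)) -[leRHS]mul1r.
      apply: ler_pM; [exact: S0|exact: normr_ge0|exact: h|].
      exact: le_trans (wM x Ux) (ler_norm M).
    have -> : S K x = 0 by apply/eqP; rewrite eq_le h S0.
    by rewrite mul0r normr0.
  move=> x xr; have := SU K x; rewrite indicE memNset; last by move=> /Ur; rewrite /Bx/= leNgt xr.
  move=> h; have -> : S K x = 0 by apply/eqP; rewrite eq_le h S0.
  by rewrite mul0r.
- by apply: measurable_funM => //; apply: measurable_indic; exact: measurable_U.
apply: ae_imp ae_off_grid => x ox; apply: cvgMl.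
have -> : (fun K => S K x) = fun K => \sum_(k < K) (\1_(whitney k) x : R) by apply/funext => K; exact: SE.
exact: sum_whitney_cvg.
Qed.

Lemma whitney_L1 : (\int[L]_x `|\1_U x - \sum_(k < K) (\1_(whitney k) x : R)|%:E)%E @[K --> \oo] --> 0%E.
Proof.
have one : measurable_fun setT (fun _ : borel E => 1 : R) by exact: measurable_cst.
have b1 : forall x : borel E, U x -> `|1 : R| <= 1 by move=> x _; rewrite normr1.
have lim := whitney_dct one b1.
have bU : bcs 1 r (\1_U : borel E -> R) by apply: bcs_indic => //; exact: measurable_U.
have bW k : bcs 1 r (\1_(whitney k) : borel E -> R).
  by apply: bcs_indic; [exact: measurable_whitney|exact: whitney_Bx].
have iS K : L.-integrable setT (EFin \o (fun x => \sum_(k < K) (\1_(whitney k) x : R))).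
  have := @integrable_sum _ _ R L setT measurableT _ (index_enum 'I_K) xpredT (fun k => EFin \o \1_(whitney k)) (fun k _ => bcs_integrable (bW k)).
  by congr (_.-integrable _ _); apply/funext => x; rewrite /= sumEFin.
have E1 K : (\int[L]_x `|\1_U x - \sum_(k < K) (\1_(whitney k) x : R)|%:E)%E =
   (\int[L]_x (\1_U x * 1) - \int[L]_x ((\sum_(k < K) \1_(whitney k) x) * 1))%:E.
  under [X in (X - _)%:E]eq_Rintegral do rewrite mulr1.
  under [X in (_ - X)%:E]eq_Rintegral do rewrite mulr1.
  have iD := integrableB measurableT (bcs_integrable bU) (iS K).
  rewrite -RintegralB//; last exact: bcs_integrable bU.
  rewrite /Rintegral fineK; last exact: integrable_fin_num.
  apply: ae_eq_integral => //.
  - by case/integrableP: (integrable_norm iD).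
  - by case/integrableP: iD.
  apply: ae_imp ae_off_grid => x ox _; congr EFin; rewrite ger0_norm// subr_ge0.
  by case/andP: (sum_whitney_le K ox).
under eq_fun do rewrite E1.
apply: cvg_EFin; first exact: nearW.
have h0 := cvgB (cvg_cst (\int[L]_x (\1_U x * 1))) lim.
rewrite subrr in h0; exact: h0.
Qed.

(** Read backwards, this turns the volume bound into a bound on the number of cubes, which is what
    the perimeter estimate needs. *)
Lemma whitney_measure k : L (whitney k) = ((size (whitney_seq k))%:R * (2 ^- k) ^+ N)%:E.
Proof.
have bQ z : z \in whitney_seq k -> bcs 1 r (\1_(dcube k z) : borel E -> R).
  move=> /mem_whitney_seq[zU _]; apply: bcs_indic; first exact: measurable_dcube.
  by move=> x /dcube_ccube/zU; exact: Ur.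
rewrite -[X in L X]setIT -(integral_indic L measurableT (measurable_whitney k)).
transitivity (\int[L]_x (\sum_(z <- whitney_seq k) \1_(dcube k z) x)%:E)%E.
  apply: ae_eq_integral => //.
  - by apply/measurable_EFinP; apply: measurable_indic; exact: measurable_whitney.
  - by apply/measurable_EFinP; apply: measurable_sum => z; apply: measurable_indic; exact: measurable_dcube.
  by apply: ae_imp ae_off_grid => x ox _; rewrite indic_whitney_sum.
under eq_integral do rewrite -sumEFin.
rewrite ge0_integral_sum//; last first.
  by move=> z; apply/measurable_EFinP; apply: measurable_indic; exact: measurable_dcube.
under eq_bigr => z _ do rewrite (integral_indic L measurableT (measurable_dcube k z)) setIT lebesgue_dcube.
by rewrite sumEFin big_const_seq count_predT iter_addr_0 mulr_natl.
Qed.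

Lemma whitney_cover k p : whitney k.+1 p -> exists2 q, topo_boundary U q & `|(p : 'rV[R]_N) - q| <= 2 ^- k.
Proof.
move=> /whitneyP[z [zU nz] pz].
have [y yz Uy] : exists2 y, ccube k (@parent R N z) y & ~ U y.
  by apply: contrapT => h; apply: nz => y yz; apply: contrapT => Uy; apply: h; exists y.
have [t /andP[t0 t1] bt] := segment_boundary oU (zU _ pz) Uy.
exists ((p : 'rV[R]_N) + t *: ((y : 'rV[R]_N) - p)) => //.
rewrite opprD addrA subrr sub0r normrN normrZ ger0_norm//.
have h := ccube_norm yz (ccube_parent pz).
by rewrite (le_trans _ h)// ler_piMl.
Qed.

Lemma whitney_volume d delta : has_box_dim (topo_boundary U) d -> d < delta -> delta < N%:R ->
  exists2 C : R, 0 <= C & forall k, (L (whitney k) <= (C * 2 `^ (k%:R * (delta - N%:R)))%:E)%E.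
Proof.
move=> hd dd dN; have [k0 hk0] := box_count hd dd.
pose q : R := 2 `^ (delta - N%:R); have q0 : 0 < q by rewrite powR_gt0.
have q1 : q <= 1 by rewrite /q powR2E expR_le1 ltW// pmulr_llt0 ?ln_gt0 ?ltr1n// subr_lt0.
(* The first term serves for large [k]; its divisor [q] compensates for covering at scale [2^-k]
   while estimating generation [k + 1]. The second serves for the finitely many [k <= k0], where the
   volume of the container is a sufficient bound. *)
exists (4 ^+ N / q + vol (n := n) r / q ^+ k0.+1).
  by rewrite addr_ge0// divr_ge0 ?exprn_ge0 ?vol_ge0 ?ltW.
move=> k; rewrite powR2_nat -/q.
have [kk|kk] := leqP k k0.
  apply: (@le_trans _ _ (vol (n := n) r)%:E).
    have mB := @measurable_Bx R N r; rewrite /vol fineK; last first.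
      by rewrite ge0_fin_numE// lebesgue_Bx_lty.
    by apply: measure_le => //; [exact: measurable_whitney|exact: whitney_Bx].
  rewrite lee_fin mulrDl; apply: ler_wpDl.
    by rewrite mulr_ge0 ?divr_ge0 ?exprn_ge0 ?ltW.
  rewrite mulrAC ler_pdivlMr ?exprn_gt0// ler_wpM2l ?vol_ge0//.
  by rewrite ler_wiXn2l ?(ltW q0)// (leq_trans kk).
case: k kk => // k; rewrite ltnS => kk.
have [M [c [hc Mc]]] := hk0 k kk.
(* The half side [2 * 2^-k] is the radius of a covering ball plus the distance to the boundary. *)
pose lo (i : 'I_M) (j : 'I_N) : R := (c i : 'rV[R]_N) ord0 j - 2 * 2 ^- k.
pose hi (i : 'I_M) (j : 'I_N) : R := (c i : 'rV[R]_N) ord0 j + 2 * 2 ^- k.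
pose Q i : set (borel E) := [set x : 'rV[R]_N | forall j, lo i j <= x ord0 j <= hi i j].
have k2 : 0 < 2 ^- k :> R by rewrite invr_gt0 exprn_gt0.
have LQ i : L (Q i) = ((4 * 2 ^- k) ^+ N)%:E.
  rewrite lebesgue_cbox => [|j]; last by rewrite /lo /hi; lra.
  congr _%:E; rewrite (eq_bigr (fun=> 4 * 2 ^- k)) ?prodr_const ?card_ord// => j _.
  by rewrite /lo /hi; ring.
have BQ : whitney k.+1 `<=` \bigcup_(i in [set: 'I_M]) Q i.
  move=> p /whitney_cover[p' bp' pp']; have [i _] := hc _ bp'; rewrite ballEmdist /= => bi.
  exists i => // j; have h1 := le_lt_trans (coord_le_enorm _ j) bi.
  have h2 := le_trans (coord_le_norm _ j) pp'; move: h1 h2; rewrite !mxE ltr_norml ler_norml.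
  by rewrite /lo /hi => /andP[? ?] /andP[? ?]; apply/andP; split; lra.
have h := measure_cover_le (mu := L) (measurable_whitney k.+1) (fun i => measurable_cbox (lo i) (hi i)) BQ (b := (4 * 2 ^- k) ^+ N).
apply: (le_trans (h _)); first by move=> i; rewrite LQ.
rewrite lee_fin [leRHS]mulrDl.
have v0 : 0 <= vol (n := n) r / q ^+ k0.+1 * q ^+ k.+1.
  have : 0 <= vol (n := n) r by exact: vol_ge0.
  have : 0 <= q ^+ k0.+1 by rewrite exprn_ge0// ltW.
  by have : 0 <= q ^+ k.+1 by [rewrite exprn_ge0// ltW]; move=> *; rewrite mulr_ge0// divr_ge0.
rewrite -[leLHS]addr0; apply: lerD v0.
apply: (@le_trans _ _ (2 `^ (k%:R * delta) * (4 * 2 ^- k) ^+ N)).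
  by rewrite ler_wpM2r// exprn_ge0// mulr_ge0// ltW.
rewrite le_eqVlt; apply/orP; left; apply/eqP.
have -> : 4 ^+ N / q * q ^+ k.+1 = 4 ^+ N * q ^+ k by rewrite [q ^+ k.+1]exprS mulrA divfK// gt_eqF.
rewrite /q -powR2_nat mulrBr powRD ?pnatr_eq0 ?implybT//.
by rewrite powRN -natrM powR_mulrn// exprMn exprVn -exprM mulrCA.
Qed.

End whitney.

Lemma cvg_ord_sum (R : realType) K (u : nat -> 'I_K -> R) (l : 'I_K -> R) :
  (forall i, u m i @[m --> \oo] --> l i) -> \sum_(i < K) u m i @[m --> \oo] --> \sum_(i < K) l i.
Proof.
elim: K u l => [|K IH] u l ul.
  by rewrite big_ord0; under eq_fun do rewrite big_ord0; exact: cvg_cst.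
rewrite big_ord_recr; under eq_fun do rewrite big_ord_recr.
by apply: cvgD; [apply: IH => i; exact: ul|exact: ul].
Qed.

Section bcs_sums.
Context {R : realType} {n : nat}.
Local Notation N := n.+1.
Local Notation E := (euclid R N).
Local Notation L := (@lebesgueRn R N).

Lemma bcs_sum K (u : 'I_K -> borel E -> R) r : (forall l, exists M, bcs M r (u l)) ->
  (exists M, bcs M r (fun x => \sum_(l < K) u l x)) /\
  \int[L]_x (\sum_(l < K) u l x) = \sum_(l < K) \int[L]_x u l x.
Proof.
elim: K u => [|K IH] u hu.
  split.
    exists 0; split => [|x|x _]; rewrite ?big_ord0 ?normr0//.
    by apply: (eq_measurable_fun (fun=> 0 : R)) => [x _|]; [rewrite big_ord0|exact: measurable_cst].
  by rewrite big_ord0 /Rintegral integral0_eq// => x _; rewrite big_ord0.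
have [[M hM] eM] := IH (fun l => u (widen_ord (leqnSn K) l)) (fun l => hu _).
have [M' hM'] := hu ord_max.
have -> : (fun x => \sum_(l < K.+1) u l x) =
    fun x => \sum_(l < K) u (widen_ord (leqnSn K) l) x + u ord_max x.
  by apply/funext => x; rewrite big_ord_recr.
rewrite (bcs_integralD hM hM') eM big_ord_recr; split => //.
have [m1 b1 s1] := hM; have [m2 b2 s2] := hM'; exists (M + M'); split => [|x|x xr].
- exact: measurable_funD.
- by rewrite (le_trans (ler_normD _ _))// lerD.
- by rewrite s1// s2// addr0.
Qed.

Lemma bcs_integral_le M M' r (u v : borel E -> R) : bcs M r u -> bcs M' r v ->
  {ae L, forall x, `|u x| <= v x} -> `|\int[L]_x u x| <= \int[L]_x v x.
Proof.
move=> bu bv uv; have iv := bcs_integrable bv.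
(* The comparison of integrals asks for a pointwise inequality, but the hypothesis holds almost
   everywhere; clipping [u] by [|v|] repairs the exceptional set. *)
pose w x := Num.max (- `|v x|) (Num.min (u x) `|v x|).
have [mu bu1 bu2] := bu; have [mv _ bv2] := bv.
have bw : bcs M r w.
  split => [|x|x xr].
  - apply: measurable_maxr; first by apply: measurableT_comp => //; exact: measurableT_comp.
    by apply: measurable_minr => //; exact: measurableT_comp.
  - apply: le_trans (bu1 x); rewrite /w; have := normr_ge0 (v x).
    move: (`|v x|) (u x) => p q p0; rewrite ler_norml; apply/andP; split.
      have [h|h] := leP p `|q|; rewrite le_max; first by rewrite lerN2 h.
      have hq : - `|q| <= q by rewrite lerNl; have := ler_norm (- q); rewrite normrN.
      by rewrite le_min hq (le_trans _ p0) ?oppr_le0// orbT.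
    by rewrite ge_max ge_min ler_norm/= andbT (le_trans _ (normr_ge0 q))// oppr_le0.
  - by rewrite /w bu2// bv2// normr0 oppr0 minxx maxxx.
have -> : \int[L]_x u x = \int[L]_x w x.
  apply: ae_eq_Rintegral => //; first by case: bw.
  apply: ae_imp uv => x h; rewrite /w min_l; last exact: le_trans (ler_norm _) (le_trans h (ler_norm _)).
  rewrite max_r// lerNl (le_trans _ (le_trans h (ler_norm _)))//.
  by have := ler_norm (- u x); rewrite normrN.
have bv' : bcs M' r (fun x => `|v x|).
  by case: bv => a b c; split => [|x|x xr]; [exact: measurableT_comp|rewrite normr_id|rewrite c ?normr0].
have -> : \int[L]_x v x = \int[L]_x `|v x|.
  apply: ae_eq_Rintegral => //; first by case: bv'.
  by apply: ae_imp uv => x h; rewrite ger0_norm// (le_trans _ h).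
rewrite (le_trans (le_normr_Rintegral measurableT (bcs_integrable bw)))//.
apply: le_Rintegral => //; [exact: integrable_norm (bcs_integrable bw)|exact: bcs_integrable bv'|].
move=> x _; rewrite /w ler_norml le_max lexx/= ge_max ge_min lexx orbT andbT.
by rewrite (le_trans _ (normr_ge0 _))// oppr_le0.
Qed.

Lemma det_lip_bounded (g : 'I_N -> E -> R) : (forall j, is_lip (g j)) -> exists2 M, 0 <= M &
  measurable_fun setT (fun x : borel E => \det (Dmx g x)) /\ forall x, `|\det (Dmx g x)| <= M.
Proof.
move=> /lip_common[C C0 hC]; exists (N`!%:R * C ^+ N); first by rewrite mulr_ge0// exprn_ge0.
by split; [exact: measurable_det_Dmx hC|exact: det_Dmx_le].
Qed.

Lemma ae_scale_det (g : 'I_N -> E -> R) i (eta : E -> R) a : (forall j, is_lip (g j)) -> is_lip eta ->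
  {ae L, forall x, \det (Dmx [eta g with i |-> fun y => a * eta y] x) = a * \det (Dmx [eta g with i |-> eta] x)}.
Proof.
move=> gl el; have cl : is_lip (fun _ : E => 0 : R) by exact: is_lip_cst.
have fe : (fun y : E => a * eta y) = fun y => a * eta y + 0 by apply/funext => y; rewrite addr0.
rewrite fe; apply: ae_imp (det_Dmx_linear i a gl el cl) => x.
have z : \det (Dmx [eta g with i |-> fun=> 0] x) = 0.
  apply: (det_Dmx_const (j := i)); first exact: upd_lip.
  by rewrite /= eqxx; exact: frechet_cst.
move=> h; apply: (etrans h); apply: (etrans (congr1 _ z)); exact: addr0.
Qed.

End bcs_sums.

(** * The perimeter of a cube *)

Section box_perimeter.
Context {R : realType} {n : nat}.
Local Notation N := n.+1.
Local Notation E := (euclid R N).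
Local Notation L := (@lebesgueRn R N).
Variables (a : 'I_N -> R) (s : R).
Hypothesis s0 : 0 < s.
Hypothesis s1 : s <= 1.

Definition box e : set (borel E) := [set x : 'rV[R]_N | forall i, a i - e <= x ord0 i <= a i + s + e].
Let c : 'rV[R]_N := \row_i a i.
(** Since [s] and the widening [e] are at most [1], this radius contains every widened box. *)
Let rho := `|c| + 2.
Let chi e (x : E) : R := Num.max 0 (1 - e^-1 * dist_set (box 0 : set E) x).

Lemma measurable_box e : measurable (box e).
Proof. exact: (measurable_cbox (fun i => a i - e) (fun i => a i + s + e)). Qed.

Lemma box_sub (e : R) : 0 <= e -> box 0 `<=` box e.
Proof. by clear s0 s1 => e0 x xQ i; have /andP[? ?] := xQ i; apply/andP; split; lra. Qed.

Lemma box_Bx (e : R) : 0 <= e <= 1 -> box e `<=` Bx rho.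
Proof.
move=> /andP[e0 e1] x xe; rewrite /Bx/= -(subrK c x) addrC (le_trans (ler_normD _ _))// lerD2l.
apply: rV_norm_le => // i; have /andP[h1 h2] := xe i; rewrite !mxE ler_norml.
by have := s1; have := s0 => ? ?; apply/andP; split; lra.
Qed.

Lemma box_center : box 0 c.
Proof. by move=> i; rewrite mxE subr0 addr0 lexx lerDl ltW. Qed.

Lemma chi_lip (e : R) : 0 < e -> lip_with e^-1 (chi e).
Proof.
move=> e0; have ei : 0 <= e^-1 by rewrite invr_ge0 ltW.
apply: lip_max; first exact: lip_with_cst.
have := lip_withD (lip_with_cst (L := 0) 1 (lexx 0)) (lip_withZ (- e^-1) (dist_set_lip (box 0 : set E))).
rewrite normrN ger0_norm// mulr1 add0r; congr (lip_with _ _).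
by apply/funext => x; rewrite mulNr.
Qed.

Lemma chi01 (e : R) x : 0 < e -> 0 <= chi e x <= 1.
Proof.
move=> e0; rewrite le_max lexx/= ge_max ler01/= gerBl mulr_ge0 ?dist_set_ge0//.
by rewrite invr_ge0 ltW.
Qed.

Lemma chi_in (e : R) (x : E) : box 0 x -> chi e x = 1.
Proof. by move=> xQ; rewrite /chi dist_set0// mulr0 subr0 max_r. Qed.

Lemma boxNP (e : R) (x : 'rV[R]_N) : ~ box e x -> exists i, x ord0 i < a i - e \/ a i + s + e < x ord0 i.
Proof.
move=> h; apply: contrapT => h'; apply: h => i; apply/andP; split; rewrite leNgt; apply/negP => hi.
  by apply: h'; exists i; left.
by apply: h'; exists i; right.
Qed.

Lemma chi_out (e : R) (x : E) : 0 < e -> ~ box e x -> chi e x = 0.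
Proof.
move=> e0 /boxNP[i hi]; rewrite /chi max_l// subr_le0 -(mulVf (lt0r_neq0 e0)).
rewrite ler_wpM2l ?invr_ge0 ?(ltW e0)//; apply: dist_set_glb; first by exists c; exact: box_center.
move=> y yQ; have /andP[y1 y2] := yQ i.
have := coord_le_enorm ((x : 'rV[R]_N) - y) i; rewrite !mxE; apply: le_trans.
by rewrite ler_normr; case: hi => h; apply/orP; [right|left]; lra.
Qed.

Lemma chi_frechet_out (e : R) (x : E) : 0 < e -> ~ box e x -> frechet (chi e) x (fun=> 0).
Proof.
move=> e0 /boxNP[i hi].
have h (d : R) : 0 < d -> (forall t : R, `|t| < d -> (x : 'rV[R]_N) ord0 i + t < a i - e \/ a i + s + e < (x : 'rV[R]_N) ord0 i + t) ->
    frechet (chi e) x (fun=> 0).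
  move=> d0 hd; apply: (frechet_locally_cst (c := 0) d0) => y yd.
  apply: chi_out => // /(_ i)/andP[h1 h2]; have := hd _ (le_lt_trans (coord_le_norm y i) yd).
  by move: h1 h2; rewrite !mxE; case=> ?; lra.
case: hi => hi.
  apply: (h (a i - e - (x : 'rV[R]_N) ord0 i)) => [|t]; first by lra.
  by rewrite ltr_norml => /andP[? ?]; left; lra.
apply: (h ((x : 'rV[R]_N) ord0 i - (a i + s + e))) => [|t]; first by lra.
by rewrite ltr_norml => /andP[? ?]; right; lra.
Qed.

Lemma chi_frechet_in (e : R) (x : E) : (forall i, a i < (x : 'rV[R]_N) ord0 i < a i + s) -> frechet (chi e) x (fun=> 0).
Proof.
move=> hx.
have [|d d0 hd] := @finite_common_radius R 'rV[R]_N 'I_N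
    (fun j y => a j <= ((x : 'rV[R]_N) + y) ord0 j <= a j + s).
  move=> j; have /andP[h1 h2] := hx j.
  exists (Num.min ((x : 'rV[R]_N) ord0 j - a j) (a j + s - (x : 'rV[R]_N) ord0 j)).
    by rewrite lt_min; apply/andP; split; lra.
  move=> y; rewrite lt_min => /andP[y1 y2]; rewrite mxE.
  have := le_lt_trans (coord_le_norm y j) y1; have := le_lt_trans (coord_le_norm y j) y2.
  by rewrite !ltr_norml => /andP[? ?] /andP[? ?]; apply/andP; split; lra.
apply: (frechet_locally_cst (c := 1) d0) => y /hd hy; apply: chi_in => i.
by rewrite subr0 addr0.
Qed.

(** The cutoff is constant inside the box and outside the widened one, so the determinant lives on
    the shell between them. There, [e] times the cutoff is Lipschitz with constant [1], and
    Hadamard's inequality bounds the rescaled determinant by [1]. *)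
Lemma ae_chi_det (e : R) (h : 'I_N -> E -> R) i : 0 < e -> (forall j, lip_with 1 (h j)) ->
  {ae L, forall x, `|\det (Dmx [eta h with i |-> chi e] x)| <= e^-1 * (\1_(box e) x - \1_(box 0) x)}.
Proof.
move=> e0 h1; have hl j : is_lip (h j) by exists 1.
have cl : is_lip (chi e) by exists e^-1; exact: chi_lip.
have off : {ae L, forall x, forall j, (x : 'rV[R]_N) ord0 j <> a j /\ (x : 'rV[R]_N) ord0 j <> a j + s}.
  apply: ae_count => j; apply: ae_and.
    by apply: ae_null; [exact: measurable_hyperplane|exact: lebesgue_hyperplane].
  by apply: ae_null; [exact: measurable_hyperplane|exact: lebesgue_hyperplane].
apply: ae_imp (ae_and off (ae_scale_det i e hl cl)) => x [ox sx].
have b0e := box_sub (ltW e0).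
have [xQ|xQ] := pselect (box 0 x).
  rewrite (det_Dmx_const (j := i)); last 2 first.
  - exact: upd_lip.
  - rewrite /= eqxx; apply: chi_frechet_in => j; have /andP[q1 q2] := xQ j; case: (ox j) => o1 o2.
    rewrite subr0 in q1; rewrite addr0 in q2.
    by rewrite !lt_neqAle q1 q2 !andbT; apply/andP; split; apply/eqP => // o; apply: o1.
  by rewrite normr0 !indicE !mem_set// ?subrr ?mulr0//; exact: b0e.
have [xe|xe] := pselect (box e x); last first.
  rewrite (det_Dmx_const (j := i)); last 2 first.
  - exact: upd_lip.
  - by rewrite /= eqxx; exact: chi_frechet_out.
  by rewrite normr0 !indicE !memNset// subrr mulr0.
rewrite [X in _ * (X - _)]indicE [X in _ * (_ - X)]indicE mem_set// memNset// subr0 mulr1.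
rewrite -(ler_pM2l e0) mulfV ?gt_eqF// -{1}(ger0_norm (ltW e0)) -normrM -sx.
apply: det_Dmx_le1 => j /=; case: eqP => // _.
have := lip_withZ e (chi_lip e0); rewrite ger0_norm ?(ltW e0)// mulfV ?gt_eqF//.
Qed.

(** With [x = 2 e / s] in [[0, 1]], [expr1D_le] bounds [(s + 2 e)^N - s^N] by [3^N x s^N], linear in
    [e]. *)
Lemma shell_measure (e : R) : 0 < e -> e <= s / 2 ->
  \int[L]_x (\1_(box e) x - \1_(box 0) x) <= e * (2 * 3 ^+ N * s ^+ n).
Proof.
move=> e0 es; have e1 : e <= 1 by have := s1; lra.
rewrite (bcs_indic_sub (r := rho) (measurable_box 0) (measurable_box e)); last 2 first.
- by apply: box_Bx; rewrite (ltW e0).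
- exact: box_sub (ltW e0).
have V t : 0 <= t -> L (box t) = ((s + 2 * t) ^+ N)%:E.
  move=> t0; rewrite (lebesgue_cbox (a := fun i => a i - t) (b := fun i => a i + s + t)) => [|j]; last by lra.
  congr _%:E; rewrite (eq_bigr (fun=> s + 2 * t)) ?prodr_const ?card_ord// => j _; by ring.
rewrite !V// ?(ltW e0)// mulr0 addr0 /=.
have sN : s != 0 by rewrite gt_eqF.
have -> : s + 2 * e = s * (1 + 2 * e / s) by field.
have h01 : 0 <= 2 * e / s <= 1.
  by rewrite divr_ge0 ?mulr_ge0 ?(ltW s0) ?(ltW e0)//= ler_pdivrMr// mul1r; lra.
rewrite exprMn lerBlDr.
apply: (@le_trans _ _ (s ^+ N * (1 + 3 ^+ N * (2 * e / s)))).
  by rewrite ler_wpM2l ?exprn_ge0 ?(ltW s0)//; exact: expr1D_le.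
rewrite le_eqVlt; apply/orP; left; apply/eqP; rewrite mulrDr mulr1 addrC; congr (_ + _).
by rewrite [s ^+ N]exprS; field.
Qed.

(** The families [f], [h], [i] are general so that one estimate serves two purposes: with
    [i l = ord0] it bounds the mass of a boundary, with [i l = l] and coordinate functions the
    integral of a divergence. The factor [e^-1] of the gradient cancels the thickness of the
    shell. *)
Lemma box_cutoff_bound (e : R) B K (f : 'I_K -> E -> R) (h : 'I_K -> 'I_N -> E -> R) (i : 'I_K -> 'I_N) :
  0 < e -> e <= s / 2 ->
  (forall l, is_lip (f l)) -> (forall x, \sum_(l < K) `|f l x| <= B) -> (forall l j, lip_with 1 (h l j)) ->
  `|\sum_(l < K) \int[L]_x (chi e x * \det (Dmx [eta h l with i l |-> f l] x))| <= B * (2 * 3 ^+ N * s ^+ n).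
Proof.
move=> e0 es fl fB h1; have hl l j : is_lip (h l j) by exists 1.
have e1 : e <= 1 by have := s1; lra.
have B0 : 0 <= B by apply: le_trans (fB (0 : 'rV[R]_N)); exact: sumr_ge0.
have cl : is_lip (chi e) by exists e^-1; exact: chi_lip.
have cr : supp_in rho (chi e).
  move=> x xr; apply: chi_out => // /box_Bx; rewrite (ltW e0) e1 => /(_ isT).
  by rewrite /Bx/= leNgt xr.
pose W l (x : borel E) := f l x * \det (Dmx [eta h l with i l |-> chi e] x).
have bW l : exists M, bcs M rho (W l).
  have [M M0 [mD bD]] := det_lip_bounded (upd_lip (i l) (hl l) cl).
  exists (B * M); split => [|x|x xr].
  - by apply: measurable_funM => //; exact: lip_measurable.
  - rewrite normrM ler_pM// (le_trans _ (fB x))// (bigD1 l)//= lerDl; exact: sumr_ge0.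
  - rewrite /W (det_Dmx_const (j := i l)) ?mulr0//; first exact: upd_lip.
    rewrite /= eqxx; apply: chi_frechet_out => // /box_Bx; rewrite (ltW e0) e1 => /(_ isT).
    by rewrite /Bx/= leNgt xr.
have [[M bS] eS] := bcs_sum bW.
have -> : \sum_(l < K) \int[L]_x (chi e x * \det (Dmx [eta h l with i l |-> f l] x)) = - \int[L]_x (\sum_(l < K) W l x).
  rewrite eS -sumrN; apply: eq_bigr => l _.
  exact: int_by_parts (hl l) (fl l) cl cr.
rewrite normrN.
have bI : bcs (1 + 1) rho (fun x => \1_(box e) x - \1_(box 0) x : R).
  by apply: bcsB; apply: bcs_indic; [exact: measurable_box|apply: box_Bx|exact: measurable_box|apply: box_Bx];
    rewrite ?lexx ?ler01 ?(ltW e0).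
have ei : 0 <= e^-1 by rewrite invr_ge0 ltW.
have bV : bcs ((1 + 1) * (B * e^-1)) rho (fun x => (\1_(box e) x - \1_(box 0) x) * (B * e^-1)).
  by apply: bcsM => // x; rewrite ger0_norm// mulr_ge0.
apply: le_trans (bcs_integral_le bS bV _) _.
  apply: ae_imp (ae_count (fun l => ae_chi_det (i l) e0 (h1 l))) => x hx.
  have D0 : 0 <= e^-1 * (\1_(box e) x - \1_(box 0) x) -> `|\sum_(l < K) W l x| <= (\1_(box e) x - \1_(box 0) x) * (B * e^-1).
    move=> D0; rewrite mulrC -mulrA; apply: (@le_trans _ _ (\sum_(l < K) `|f l x| * (e^-1 * (\1_(box e) x - \1_(box 0) x)))).
      apply: le_trans (ler_norm_sum _ _ _) _; apply: ler_sum => l _; rewrite normrM ler_wpM2l//; exact: hx.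
    by rewrite -mulr_suml ler_wpM2r.
  apply: D0; rewrite mulr_ge0// subr_ge0 !indicE ler_nat.
  case: (boolP (x \in box 0)) => // /set_mem xQ; rewrite mem_set//.
  exact: box_sub (ltW e0) _ xQ.
rewrite RintegralZr//; last exact: bcs_integrable bI.
move: (\int[L]_x (\1_(box e) x - \1_(box 0) x)) (shell_measure e0 es) => I hI.
by rewrite mulrCA ler_wpM2l// ler_pdivrMr// mulrC.
Qed.

Lemma closed_box : closed (box 0 : set E).
Proof.
have -> : (box 0 : set E) = \bigcap_(i in [set: 'I_N])
    ((fun x : E => (x : 'rV[R]_N) ord0 i) @^-1` `[a i - 0, a i + s + 0]).
  by apply/seteqP; split => x xz i; [move=> _; rewrite /= in_itv; exact: xz|have := xz i I; rewrite /= in_itv].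
apply: closed_bigI => i _; apply: closed_comp => [x _|]; last exact: itv_closed.
exact: (lip_continuous (coord_lip i)).
Qed.

Lemma box_perimeter B K (f : 'I_K -> E -> R) (h : 'I_K -> 'I_N -> E -> R) (i : 'I_K -> 'I_N) :
  (forall l, is_lip (f l)) -> (forall x, \sum_(l < K) `|f l x| <= B) -> (forall l j, lip_with 1 (h l j)) ->
  `|\sum_(l < K) \int[L]_x (\1_(box 0) x * \det (Dmx [eta h l with i l |-> f l] x))| <= B * (2 * 3 ^+ N * s ^+ n).
Proof.
move=> fl fB h1; have hl l j : is_lip (h l j) by exists 1.
pose e (m : nat) : R := s / 2 * m.+1%:R^-1.
have e0 m : 0 < e m by rewrite /e !mulr_gt0 ?invr_gt0.
have es m : e m <= s / 2.
  by rewrite /e ler_piMr ?divr_ge0 ?(ltW s0)// invf_le1 ?ltr0n// ler1n.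
have e_0 : e m @[m --> \oo] --> 0.
  by rewrite -[X in _ --> X](mulr0 (s / 2)); apply: cvgMr; exact: cvg_harmonic.
have lim : \sum_(l < K) \int[L]_x (chi (e m) x * \det (Dmx [eta h l with i l |-> f l] x)) @[m --> \oo] -->
    \sum_(l < K) \int[L]_x (\1_(box 0) x * \det (Dmx [eta h l with i l |-> f l] x)).
  apply: cvg_ord_sum => l.
  have [M M0 [mD bD]] := det_lip_bounded (upd_lip (i l) (hl l) (fl l)).
  apply: (bcs_dct (M := 1 * M) (r := rho)).
  - move=> m; apply: bcsM => //; split => [|x|x xr].
    + by apply: lip_measurable; exists (e m)^-1; exact: chi_lip.
    + by have /andP[c0 c1] := chi01 x (e0 m); rewrite ger0_norm.
    + apply: chi_out => // /box_Bx; rewrite (ltW (e0 m))/= (le_trans (es m)); last by have := s1; lra.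
      by move=> /(_ isT); rewrite /Bx/= leNgt xr.
  - by apply: measurable_funM => //; apply: measurable_indic; exact: measurable_box.
  apply: nearW => x; apply: cvgMl; apply: cvg_near_cst.
  have [xQ|xQ] := pselect (box 0 x).
    by apply: nearW => m; rewrite chi_in// indicE mem_set.
  (* The box is closed, so an outside point has positive distance to it and its cutoff vanishes as
     soon as [e m] is smaller. *)
  have d0 : 0 < dist_set (box 0 : set E) x.
    rewrite -[box 0]setCK; apply: dist_set_gt0 => //; first by rewrite openC; exact: closed_box.
    by rewrite setCK; exists c; exact: box_center.
  have := e_0; move=> /cvgrPdist_lt /(_ _ d0); apply: filterS => m.
  rewrite sub0r normrN (gtr0_norm (e0 m)) => em; rewrite indicE memNset// /chi max_l//.
  by rewrite subr_le0 mulrC ler_pdivlMr// mul1r ltW.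
have bnd m := box_cutoff_bound i (e0 m) (es m) fl fB h1.
pose u m : R := \sum_(l < K) \int[L]_x (chi (e m) x * \det (Dmx [eta h l with i l |-> f l] x)).
have {}bnd m : `|u m| <= B * (2 * 3 ^+ N * s ^+ n) := bnd m.
have {}lim : u @ \oo --> \sum_(l < K) \int[L]_x (\1_(box 0) x * \det (Dmx [eta h l with i l |-> f l] x)) := lim.
move: lim bnd; clearbody u; move: (\sum_(l < K) _) => v; move: (B * _) => b lim bnd.
have lim' : `|u m| @[m --> \oo] --> `|v| by exact: cvg_norm lim.
have cc : (fun _ : nat => b) @ \oo --> b by exact: cvg_cst.
by apply: (ler_cvg_to lim' cc); apply: nearW => m; exact: bnd.
Qed.

End box_perimeter.

(** * Mass bounds *)

Section masses.
Context {R : realType} {n : nat}.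
Local Notation N := n.+1.
Local Notation E := (euclid R N).
Local Notation L := (@lebesgueRn R N).

Lemma mass_ge0 (X : pmetricType R) m (T : mfunctional X m) : (0 <= mass T)%E.
Proof.
apply: ereal_sup_ubound; exists 0%N, (fun _ _ => 0), (fun _ _ _ => 0); split => //.
- by case.
- by move=> x; rewrite big_ord0 ler01.
- by case.
- by rewrite big_ord0.
Qed.

Lemma mass_set_current_le (A : set (borel E)) r : measurable A -> A `<=` Bx r ->
  (mass (set_current (A : set E)) <= L A)%E.
Proof.
move=> mA Ar; apply: ge_ereal_sup => _ [K [f [g [fl f1 g1 ->]]]].
have gl l j : is_lip (g l j) by exists 1.
have bs l : exists M, bcs M r (fun x => \1_A x * f l x * \det (Dmx (g l) x)).
  by have [M [_ hM]] := bcs_set_current mA Ar (fl l) (gl l); exists M.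
have [[M bS] eS] := bcs_sum bs.
have bA : bcs 1 r (\1_A : borel E -> R) by exact: bcs_indic.
have -> : L A = (\int[L]_x \1_A x)%:E.
  rewrite /Rintegral fineK; last exact: integrable_fin_num (bcs_integrable bA).
  by rewrite integral_indic// setIT.
rewrite lee_fin; under eq_bigr do rewrite set_currentE; rewrite -eS.
apply: le_trans (ler_norm _) _; apply: bcs_integral_le bS bA _.
apply: nearW => x; under eq_bigr do rewrite -mulrA; rewrite -mulr_sumr normrM ger0_norm ?indicE ?ler0n//.
rewrite ler_piMr ?ler0n//; apply: le_trans (ler_norm_sum _ _ _) _; apply: le_trans (f1 x).
by apply: ler_sum => l _; rewrite normrM ler_piMr//; exact: det_Dmx_le1.
Qed.

End masses.

Section whitney_perimeter.
Context {R : realType} {n : nat}.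
Local Notation N := n.+1.
Local Notation E := (euclid R N).
Local Notation L := (@lebesgueRn R N).
Local Notation idx := {ffun 'I_N -> int}.
Variables (U : set E) (r : R).
Hypothesis oU : open U.
Hypothesis Ur : U `<=` Bx r.
Local Notation W k := (whitney Ur k).

Lemma ccube_box k (z : idx) : ccube k z = box (fun i => (z i)%:~R / 2 ^+ k) (2 ^- k) 0 :> set E.
Proof.
have k0 : 0 < 2 ^+ k :> R by rewrite exprn_gt0.
apply/seteqP; split => x h i; have /andP[h1 h2] := h i; apply/andP.
  rewrite subr0 addr0 -[X in _ + X]mul1r -mulrDl; split.
    by rewrite ler_pdivrMr// mulrC.
  by rewrite ler_pdivlMr// mulrC.
move: h1 h2; rewrite subr0 addr0 -[X in _ + X]mul1r -mulrDl.
by rewrite ler_pdivrMr// ler_pdivlMr// ![_ * 2 ^+ k]mulrC.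
Qed.

Lemma whitney_perimeter (k : nat) (B : R) (K : nat) (f : 'I_K -> E -> R) (h : 'I_K -> 'I_N -> E -> R) (i : 'I_K -> 'I_N) :
  (forall l, is_lip (f l)) -> (forall x, \sum_(l < K) `|f l x| <= B) -> (forall l j, lip_with 1 (h l j)) ->
  `|\sum_(l < K) \int[L]_x (\1_(W k) x * \det (Dmx [eta h l with i l |-> f l] x))| <=
  (size (whitney_seq Ur k))%:R * (B * (2 * 3 ^+ N * (2 ^- k) ^+ n)).
Proof.
move=> fl fB h1; have hl l j : is_lip (h l j) by exists 1.
set s := whitney_seq Ur k; pose t j := tnth (in_tuple s) j.
have sU j : selected U k (t j) by apply/(mem_whitney_seq Ur k); exact: mem_tnth.
have mC z : measurable (ccube k z : set (borel E)) by apply: compact_borel; exact: compact_ccube.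
have split_int l : \int[L]_x (\1_(W k) x * \det (Dmx [eta h l with i l |-> f l] x)) =
    \sum_(j < size s) \int[L]_x (\1_(ccube k (t j)) x * \det (Dmx [eta h l with i l |-> f l] x)).
  have [M M0 [mD bD]] := det_lip_bounded (upd_lip (i l) (hl l) (fl l)).
  have bs j : exists M, bcs M r (fun x => \1_(ccube k (t j)) x * \det (Dmx [eta h l with i l |-> f l] x)).
    exists (1 * M); apply: bcsM => //; apply: bcs_indic => //.
    by move=> x /(proj1 (sU j))/Ur.
  have [[M' [mS _ _]] <-] := bcs_sum bs.
  apply: ae_eq_Rintegral => //.
    by apply: measurable_funM => //; apply: measurable_indic; exact: measurable_whitney.
  apply: ae_imp ae_off_grid => x ox; rewrite -mulr_suml; congr (_ * _).
  rewrite indic_whitney_sum// big_tnth; apply: eq_bigr => j _.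
  rewrite !indicE; congr ((nat_of_bool _)%:R); apply/idP/idP => /set_mem hx; apply/mem_set.
    exact: dcube_ccube.
  exact: off_grid_ccube ox hx.
under eq_bigr do rewrite split_int.
rewrite exchange_big /=; apply: le_trans (ler_norm_sum _ _ _) _.
apply: (@le_trans _ _ (\sum_(j < size s) B * (2 * 3 ^+ N * (2 ^- k) ^+ n))); last first.
  by rewrite sumr_const card_ord [leRHS]mulr_natl.
apply: ler_sum => j _; rewrite ccube_box; apply: box_perimeter => //.
by rewrite invf_le1 ?exprn_gt0// exprn_ege1// ler1n.
Qed.

(** Up to a constant, the perimeter of a cube of side [2^-k] is [2^k] times its volume. The volume
    estimate thus loses one power of the scale, and [delta - N] becomes [delta - n]. *)
Lemma whitney_perimeter_le d delta : has_box_dim (topo_boundary U) d -> d < delta -> delta < N%:R ->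
  exists2 C : R, 0 <= C & forall (k : nat) (B : R) (K : nat) (f : 'I_K -> E -> R) (h : 'I_K -> 'I_N -> E -> R) (i : 'I_K -> 'I_N),
  (forall l, is_lip (f l)) -> (forall x, \sum_(l < K) `|f l x| <= B) -> (forall l j, lip_with 1 (h l j)) ->
  `|\sum_(l < K) \int[L]_x (\1_(W k) x * \det (Dmx [eta h l with i l |-> f l] x))| <=
  B * C * 2 `^ (k%:R * (delta - n%:R)).
Proof.
move=> hd dd dN; have [C C0 hC] := whitney_volume oU Ur hd dd dN.
exists (2 * 3 ^+ N * C); first by rewrite !mulr_ge0// exprn_ge0.
move=> k B K f h i fl fB h1; apply: le_trans (whitney_perimeter k i fl fB h1) _.
have B0 : 0 <= B by apply: le_trans (fB (0 : 'rV[R]_N)); exact: sumr_ge0.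
have := hC k; rewrite whitney_measure lee_fin => {}hC.
have k0 : (2 ^+ k : R) != 0 by rewrite expf_neq0.
have E1 : (2 ^- k) ^+ n = (2 ^- k) ^+ N * 2 ^+ k :> R by rewrite exprS mulrAC mulVf// mul1r.
have E2 : 2 `^ (k%:R * (delta - n%:R)) = 2 `^ (k%:R * (delta - N%:R)) * 2 ^+ k :> R.
  rewrite -powR_mulrn// -powRD ?pnatr_eq0 ?implybT//; congr (_ `^ _).
  by rewrite -[N]addn1 natrD; ring.
rewrite E1 E2; set S := _%:R in hC *; set p := (2 ^- k) ^+ N in hC *; set q := 2 `^ _ in hC *.
have -> : S * (B * (2 * 3 ^+ N * (p * 2 ^+ k))) = (S * p) * (B * (2 * 3 ^+ N * 2 ^+ k)) by ring.
have -> : B * (2 * 3 ^+ N * C) * (q * 2 ^+ k) = (C * q) * (B * (2 * 3 ^+ N * 2 ^+ k)) by ring.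
by rewrite ler_wpM2r// !mulr_ge0// exprn_ge0.
Qed.

Lemma mass_bd_whitney_le (C : R) (k : nat) (t : R) : (forall (B : R) (K : nat) (f : 'I_K -> E -> R) (h : 'I_K -> 'I_N -> E -> R) (i : 'I_K -> 'I_N),
  (forall l, is_lip (f l)) -> (forall x, \sum_(l < K) `|f l x| <= B) -> (forall l j, lip_with 1 (h l j)) ->
  `|\sum_(l < K) \int[L]_x (\1_(W k) x * \det (Dmx [eta h l with i l |-> f l] x))| <= B * C * t) ->
  (mass (current_bd (set_current (W k))) <= (C * t)%:E)%E.
Proof.
move=> hC; apply: ge_ereal_sup => _ [K [f [g [fl f1 g1 ->]]]].
rewrite lee_fin; apply: le_trans (ler_norm _) _.
have z1 : lip_with 1 (fun _ : E => 0 : R) by exact: lip_with_cst.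
(* Slot [0] of the tuple is overwritten by [f l], so the zero function placed there is a mere
   filler. *)
have H := hC 1 K f (fun l => bd_tuple (fun=> 0) (g l)) (fun=> ord0) fl f1
  (fun l => bd_tuple_forall z1 (g1 l)).
have e l : \int[L]_x (\1_(W k) x * \det (Dmx [eta bd_tuple (fun=> 0) (g l) with ord0 |-> f l] x)) =
    current_bd (set_current (W k)) (f l) (g l).
  rewrite current_bdE set_currentE (bd_tuple_upd0 (fun=> 0) (f l) (g l)).
  by apply: eq_Rintegral => x _; rewrite mulr1.
rewrite mul1r in H.
have e2 := eq_bigr (P := xpredT) (r := index_enum 'I_K) (op := +%R) (idx := 0) _ (fun l _ => e l).
exact: (eq_ind _ (fun z => `|z| <= C * t) H _ e2).
Qed.

End whitney_perimeter.

(** * Smooth vector fields and the variation *)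

Section smooth_fields.
Context {R : realType} {n : nat}.
Local Notation N := n.+1.
Local Notation E := (euclid R N).
Local Notation L := (@lebesgueRn R N).

Lemma frechet_is_derive (f : E -> R) (x v : 'rV[R]_N) (l : 'I_N -> R) (t : R) :
  frechet f (x + t *: v) l -> is_derive t 1 (fun u : R => f (x + u *: v : 'rV[R]_N)) (\sum_i v ord0 i * l i).
Proof.
move=> fl; set df := \sum_i _.
suff cv : (h : R)^-1 *: (((fun u : R => f (x + u *: v : 'rV[R]_N)) \o shift t) (h *: 1) - f (x + t *: v : 'rV[R]_N))
    @[h --> 0^'] --> df.
  by apply: DeriveDef; [exact: cvgP cv|exact: cvg_lim cv].
apply/cvgrPdist_le => e e0.
have v0 : 0 < `|v| + 1 by rewrite ltr_wpDl.
have [d d0 hd] := fl (e / (`|v| + 1)) (divr_gt0 e0 v0).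
exists (d / (`|v| + 1)) => /=; first exact: divr_gt0.
move=> h /=; rewrite sub0r normrN ltr_pdivlMr// => hd1 h0.
have hv : `|h *: v| < d.
  by rewrite normrZ (le_lt_trans _ hd1)// ler_wpM2l// lerDl.
have := hd _ hv.
have -> : \sum_i (h *: v) ord0 i * l i = h * df.
  by rewrite /df mulr_sumr; apply: eq_bigr => i _; rewrite mxE mulrA.
have -> : x + (h *: (1 : R) + t) *: v = x + t *: v + h *: v.
  by rewrite scalerDl [h *: (1 : R)]mulr1 [h *: v + _]addrC addrA.
move: (f (x + t *: v + h *: v)) (f (x + t *: v)) => p q hh.
have -> : df - h^-1 *: (p - q) = - (h^-1 * (p - q - h * df)) by rewrite -[_ *: _]/(_ * _); field.
rewrite normrN normrM normfV ler_pdivrMl ?normr_gt0//; apply: le_trans hh _.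
rewrite normrZ mulrCA ler_wpM2l// mulrAC ler_pdivrMr// ler_wpM2l ?(ltW e0)//.
by rewrite lerDl.
Qed.

(** The Jacobian is continuous, hence bounded on a ball containing the support, and it vanishes off
    the support; the mean value theorem on segments concludes. Test fields thereby fall under the
    Lipschitz estimates. *)
Lemma C1c_lip (phi : E -> E) : C1c phi -> forall i, is_lip (fun x => (phi x : 'rV[R]_N) ord0 i).
Proof.
move=> [dphi cJ cK] i.
have [rho hrho] : exists rho, closure [set x | phi x != 0] `<=` Bx rho.
  have := continuous_compact (f := fun x : E => `|x : 'rV[R]_N|) (A := closure [set x | phi x != 0]).
  move=> /(_ _ cK) => h; have /h/compact_bounded[M [_ hM]] : {within closure [set x | phi x != 0], continuous (fun x : E => `|x : 'rV[R]_N|)}.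
    by apply: continuous_subspaceT; exact: lip_continuous lip_sup_norm.
  exists (M + 1) => x xK; rewrite /Bx/= -[leLHS]normr_id; apply: (hM (M + 1)); first by rewrite ltrDl.
  by exists x.
have jb a : exists M, forall x : 'rV[R]_N, Bx rho x -> `|jacobian (phi : 'rV[R]_N -> 'rV[R]_N) x a i| <= M.
  have cB : compact (Bx rho : set 'rV[R]_N) by apply/compact_euclid; exact: compact_Bx.
  have cF : continuous (fun x : 'rV[R]_N => jacobian (phi : 'rV[R]_N -> 'rV[R]_N) x a i).
    move=> x; apply: (@continuous_comp _ _ _ (jacobian (phi : 'rV[R]_N -> 'rV[R]_N)) (fun A : 'M[R]_N => A a i)); first exact: cJ.
    exact: coord_continuous.
  have /compact_bounded[M [_ hM]] := continuous_compact (continuous_subspaceT cF) cB.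
  exists (M + 1) => x xB; apply: (hM (M + 1)); first by rewrite ltrDl.
  by exists x.
have /choice[M hM] := jb.
have J0 a (x : 'rV[R]_N) : ~ closure [set x | phi x != 0] x -> jacobian (phi : 'rV[R]_N -> 'rV[R]_N) x a i = 0.
  move=> nx; have zf : frechet (fun y : E => (phi y : 'rV[R]_N) ord0 i) x (fun=> 0).
    apply: frechet_spt => sx; apply: nx; move: sx; apply: closure_subset => y /=.
    by apply: contra_neq => ->; rewrite mxE.
  have := deriveEjacobian (delta_mx ord0 a) (dphi x).
  have -> : 'D_(delta_mx ord0 a) (phi : 'rV[R]_N -> 'rV[R]_N) x = 0.
    rewrite -(derive_cst (0 : 'rV[R]_N) x (delta_mx ord0 a)); apply: near_eq_derive.
    have oC : open (~` closure [set x | phi x != 0]) by apply: closed_openC; exact: closed_closure.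
    have [d d0 hd] := open_radius oC nx.
    apply/nbhs_normP; exists d => //= y yd; apply: contrapT => /eqP py.
    apply: (hd (y - x)); first by rewrite distrC.
    by rewrite addrC subrK; exact: subset_closure.
  by move=> /(congr1 (fun A : 'rV[R]_N => A ord0 i)); rewrite -rowE !mxE => <-.
have {}hM a x : `|jacobian (phi : 'rV[R]_N -> 'rV[R]_N) x a i| <= `|M a|.
  have [xc|xc] := pselect (closure [set x | phi x != 0] x); last by rewrite J0 ?normr0.
  exact: le_trans (hM a x (hrho _ xc)) (ler_norm _).
exists (\sum_a `|M a|) => x y; pose v := (x : 'rV[R]_N) - y.
pose g (t : R) : R := (phi ((y : 'rV[R]_N) + t *: v) : 'rV[R]_N) ord0 i.
have dg (t : R) : is_derive t 1 g (\sum_a v ord0 a * jacobian (phi : 'rV[R]_N -> 'rV[R]_N) ((y : 'rV[R]_N) + t *: v) a i).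
  apply: (frechet_is_derive (f := fun z => (phi z : 'rV[R]_N) ord0 i)).
  exact: differentiable_frechet (dphi _) i.
have [|c _] := MVT (ltr01 : (0 : R) < 1) (fun t _ => dg t).
  apply: continuous_subspaceT => t; apply: differentiable_continuous.
  by apply/derivable1_diffP; case: (dg t).
have e1 : (y : 'rV[R]_N) + 1 *: v = x by rewrite scale1r /v addrC subrK.
rewrite /g e1 scale0r addr0 subr0 mulr1 => ->.
rewrite mulr_suml; apply: le_trans (ler_norm_sum _ _ _) _; apply: ler_sum => a _.
rewrite normrM mulrC ler_pM//.
by rewrite euclid_mdist; exact: coord_le_enorm.
Qed.

(** Replacing the [i]-th coordinate by [f] gives the identity matrix with column [i] exchanged for
    the gradient, and its determinant is the [i]-th partial derivative. The divergence is thus a sum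
    of determinants. *)
Lemma det_coord_upd (f : E -> R) i x (l : 'I_N -> R) : is_lip f -> frechet f x l ->
  \det (Dmx [eta (fun j (y : E) => (y : 'rV[R]_N) ord0 j) with i |-> f] x) = l i.
Proof.
move=> fl fx; pose J : 'M[R]_N := \matrix_(a, b) if b == i then l a else (a == b)%:R.
have cl j : is_lip (fun y : E => (y : 'rV[R]_N) ord0 j) by exists 1; exact: coord_lip.
have [C C0 hC] := lip_common (upd_lip i cl fl).
have [_ ->] : diff_set [eta (fun j (y : E) => (y : 'rV[R]_N) ord0 j) with i |-> f] x /\
    Dmx [eta (fun j (y : E) => (y : 'rV[R]_N) ord0 j) with i |-> f] x = J.
  apply: (frechet_diff_set hC) => j /=; case: eqP => [->|/eqP ji].
    by have -> : (fun a => J a i) = l by apply/funext => a; rewrite mxE eqxx.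
  move=> e e0; exists 1 => // y _; rewrite (bigD1 j)//= big1 => [|a aj]; last first.
    by rewrite mxE (negbTE ji) (negbTE aj) mulr0.
  rewrite [J j j]mxE (negbTE ji) eqxx mulr1 addr0.
  have -> : (x + y : 'rV[R]_N) ord0 j = y ord0 j + (x : 'rV[R]_N) ord0 j by rewrite mxE addrC.
  by rewrite addrK subrr normr0 mulr_ge0// ltW.
rewrite /determinant (bigD1 1%g)//= odd_perm1 expr0 mul1r [X in _ + X]big1 ?addr0 => [|s s1].
  rewrite (bigD1 i)//= mxE perm1 eqxx big1 ?mulr1// => a ai.
  by rewrite mxE perm1 (negbTE ai) eqxx.
(* A nontrivial permutation moves at least two indices, so it moves one to a column other than [i];
   the matrix entry there is off-diagonal and zero. *)
have [a sa si] : exists2 a, s a != a & s a != i.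
  have [c sc] : exists c, s c != c.
    apply: contrapT => h; move/eqP: s1; apply; apply/permP => c; rewrite perm1; apply/eqP.
    by apply: contrapT => /negP hc; apply: h; exists c.
  have [sci|sci] := eqVneq (s c) i; last by exists c.
  have ic : i != c by rewrite -sci.
  have sii : s i != i by rewrite -[X in _ != X]sci (inj_eq perm_inj).
  by exists i.
by rewrite (bigD1 a)//= mxE (negbTE si) eq_sym (negbTE sa) mul0r mulr0.
Qed.

Lemma bv_variation_le (A : set (borel E)) r b : measurable A -> A `<=` Bx r ->
  (forall (f : 'I_N -> E -> R), (forall l, is_lip (f l)) -> (forall x, \sum_(l < N) `|f l x| <= N%:R) ->
   `|\sum_(l < N) \int[L]_x (\1_A x * \det (Dmx [eta (fun j (y : E) => (y : 'rV[R]_N) ord0 j) with l |-> f l] x))| <= b) ->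
  (bv_variation (\1_(A : set E)) <= b%:E)%E.
Proof.
move=> mA Ar hb; apply: ge_ereal_sup => _ [phi [cphi phi1] <-].
pose f l (x : E) : R := (phi x : 'rV[R]_N) ord0 l.
have fl l : is_lip (f l) by exact: C1c_lip.
have f1 x : \sum_(l < N) `|f l x| <= N%:R.
  apply: (@le_trans _ _ (\sum_(l < N) 1)); last by rewrite sumr_const card_ord.
  by apply: ler_sum => l _; exact: le_trans (coord_le_enorm _ l) (phi1 x).
have cl j : is_lip (fun y : E => (y : 'rV[R]_N) ord0 j) by exists 1; exact: coord_lip.
have bs l : exists M, bcs M r (fun x => \1_A x * \det (Dmx [eta (fun j (y : E) => (y : 'rV[R]_N) ord0 j) with l |-> f l] x)).
  have [M [_ hM]] := bcs_det (bcs_indic mA Ar) (upd_lip l cl (fl l)); by exists M.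
have [[M bS] eS] := bcs_sum bs.
have -> : (\int[L]_x (\1_A x * divergence phi x)%:E)%E =
    (\int[L]_x (\sum_(l < N) \1_A x * \det (Dmx [eta (fun j (y : E) => (y : 'rV[R]_N) ord0 j) with l |-> f l] x))%:E)%E.
  apply: eq_integral => x _; congr EFin; rewrite -mulr_sumr; congr (_ * _); apply: eq_bigr => l _.
  have [dphi _ _] := cphi.
  by rewrite (det_coord_upd l (fl l) (differentiable_frechet (dphi x) l)).
rewrite -(fineK (integrable_fin_num measurableT (bcs_integrable bS))) lee_fin.
by apply: le_trans (ler_norm _) _; have := hb f fl f1; rewrite -eS.
Qed.

End smooth_fields.

(** * Fractal currents *)

Section null_current.
Context {R : realType} {n : nat}.
Local Notation N := n.+1.
Local Notation E := (euclid R N).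

Definition null_current m : mfunctional E m := fun _ _ => 0.

Lemma current_bd_null m (f : E -> R) (g : 'I_m.-1 -> E -> R) :
  current_bd (@null_current m) f g = 0.
Proof. by case: m g. Qed.

Lemma mass_null m (T : mfunctional E m) : (forall f g, T f g = 0) -> mass T = 0%E.
Proof.
move=> T0; apply/eqP; rewrite eq_le mass_ge0 andbT; apply: ge_ereal_sup => _ [K [f [g [_ _ _ ->]]]].
by rewrite big1 => [|l _]; rewrite ?T0.
Qed.

Lemma current_spt_null m (K : set E) : current_spt (@null_current m) `<=` K.
Proof.
by apply: (@subset_trans _ set0) => //; apply: current_spt_sub => //; exact: closed0.
Qed.

Lemma integral_current_null m : integral_current (@null_current m).
Proof.
have s0 : (set0 : set E) `<=` Bx 0 by [].
split.
- split.
  + by move=> *; rewrite mulr0 addr0.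
  + by move=> *; rewrite mulr0 addr0.
  + by [].
  + by exists set0 => //; exact: compact0.
  + by move=> *; exact: cvg_cst.
- exists (restrL (r := 0) measurable0 s0); split.
  + split=> [f g _ _|nu _ B mB]; first by rewrite normr0; apply: integral_ge0 => x _; rewrite lee_fin.
    by rewrite restrLE setI0 measure0.
  + exists set0; split; [exact: measurable0| |by rewrite restrLE setI0 measure0].
    exists (fun=> set0), (fun _ _ => 0 : 'rV[R]_N); split => [k|//].
    by exists 0 => x y [].
  move=> B F mB _; exists (fun=> 0); split => [|x|f g _]; [exact: integrable0|exact: rpred0|].
  transitivity (0 : R); last first.
    rewrite /fun_current /Rintegral integral0_eq// => x _; by rewrite !mul0r.
  rewrite /current_push /current_restr /current_ext.
  set P := [set s : R | _]; have P0 s : P s -> s = 0.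
    by case=> h [_ _ hs]; apply: (cvg_unique (@Rhausdorff R) hs); exact: cvg_cst.
  (* [get] of an empty set is [0] as well. *)
  have [[s Ps]|nP] := pselect (exists s, P s); first exact: (P0 _ (getPex (ex_intro _ s Ps))).
  by rewrite getPN// => s Ps; apply: nP; exists s.
- by rewrite !mass_null// => f g; exact: current_bd_null.
Qed.

End null_current.

(** The partial sums are compared with the closed form [C (1 - q^m) / (1 - q)] of the geometric
    series. *)
Lemma nneseries_geometric_lty (R : realType) (a : nat -> \bar R) (C q : R) : 0 <= C -> 0 <= q < 1 ->
  (forall k, (0 <= a k)%E) -> (forall k, (a k <= (C * q ^+ k)%:E)%E) -> (\sum_(0 <= k <oo) a k < +oo)%E.
Proof.
move=> C0 /andP[q0 q1] a0 aC; have p0 : 0 < 1 - q by rewrite subr_gt0.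
apply: (@le_lt_trans _ _ (C / (1 - q))%:E); last exact: ltry.
apply: lime_le; first by apply: is_cvg_nneseries => k _ _; exact: a0.
apply: nearW => m; apply: (@le_trans _ _ (C * (1 - q ^+ m) / (1 - q))%:E).
  elim: m => [|m IH]; first by rewrite big_geq// expr0 subrr mulr0 mul0r.
  rewrite big_nat_recr//=; apply: le_trans (leeD IH (aC m)) _.
  rewrite -EFinD lee_fin le_eqVlt; apply/orP; left; apply/eqP.
  by rewrite exprS; field; rewrite gt_eqF.
rewrite lee_fin ler_pdivrMr// divfK ?gt_eqF// ler_piMr// gerBl; exact: exprn_ge0.
Qed.

Lemma powR2_geometric (R : realType) (k : nat) (x y : R) :
  2 `^ (k%:R * x) * 2 `^ (k%:R * y) = (2 `^ (x + y)) ^+ k.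
Proof. by rewrite -powRD ?pnatr_eq0 ?implybT// -mulrDr powR2_nat. Qed.

Section fractal.
Context {R : realType} {n : nat}.
Local Notation N := n.+1.
Local Notation E := (euclid R N).
Local Notation L := (@lebesgueRn R N).
Variables (U : set E) (r d : R).
Hypothesis oU : open U.
Hypothesis Ur : U `<=` Bx r.
Hypothesis hd : has_box_dim (topo_boundary U) d.
Local Notation W k := (whitney Ur k).

Lemma whitney_sum_cvg f g : is_lip f -> (forall j, is_lip (g j)) ->
  \sum_(k < K) set_current (W k) f g @[K --> \oo] --> set_current (U : set E) f g.
Proof.
move=> fl gl; rewrite set_currentE.
have [M M0 [mD bD]] := det_lip_bounded gl; have [Mf Mf0 fM] := lip_bounded_Bx r fl.
have mw : measurable_fun setT (fun x : borel E => f x * \det (Dmx g x)).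
  by apply: measurable_funM => //; exact: lip_measurable.
have := whitney_dct oU Ur mw (M := Mf * M).
have bw x : U x -> `|f x * \det (Dmx g x)| <= Mf * M.
  by move=> /Ur/fM h; rewrite normrM ler_pM.
move=> /(_ bw) lim.
have -> : \int[L]_x (\1_U x * f x * \det (Dmx g x)) = \int[L]_x (\1_U x * (f x * \det (Dmx g x))).
  by apply: eq_Rintegral => x _; rewrite mulrA.
suff -> : (fun K => \sum_(k < K) set_current (W k) f g) =
    fun K => \int[L]_x ((\sum_(k < K) \1_(W k) x) * (f x * \det (Dmx g x))) by exact: lim.
apply/funext => K; under eq_bigr do rewrite set_currentE.
have bs (k : 'I_K) : exists M, bcs M r (fun x => \1_(W k) x * f x * \det (Dmx g x)).
  have [M' [_ hM]] := bcs_set_current (measurable_whitney Ur k) (@whitney_Bx _ _ _ _ Ur k) fl gl.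
  by exists M'.
have [_ <-] := bcs_sum bs; apply: eq_Rintegral => x _.
by rewrite mulr_suml; apply: eq_bigr => k _; rewrite mulrA.
Qed.

Lemma closed_Bx : closed (Bx r : set E).
Proof. apply: compact_closed; [exact: metric_hausdorff|exact: compact_Bx]. Qed.

Lemma set_current_disjoint (A : set (borel E)) f g : A `<=` Bx r -> spt f `&` (Bx r : set E) = set0 ->
  set_current (A : set E) f g = 0.
Proof.
move=> Ar fK; apply: set_current_eq0 => x /Ar xr.
suff -> : f x = 0 by rewrite mul0r.
apply: contrapT => /eqP fx; suff : (spt f `&` Bx r) x by rewrite fK.
by split => //; exact: subset_closure.
Qed.

Lemma current_bd_disjoint (A : set (borel E)) f g : A `<=` Bx r -> is_lip f -> (forall j, is_lip (g j)) ->
  spt f `&` (Bx r : set E) = set0 -> current_bd (set_current (A : set E)) f g = 0.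
Proof.
move=> Ar fl gl fK; apply: current_bd_eq0 => // x /Ar xr; exists ord0; rewrite bd_tuple0; apply: frechet_spt => sx.
by suff : (spt f `&` Bx r) x by rewrite fK.
Qed.

Variable delta : R.
Hypothesis ddelta : d < delta.
Hypothesis deltaN : delta < N%:R.

Lemma whitney_bounds : exists2 C : R, 0 <= C & forall k,
  [/\ (L (W k) <= (C * 2 `^ (k%:R * (delta - N%:R)))%:E)%E,
      (mass (set_current (W k)) <= (C * 2 `^ (k%:R * (delta - N%:R)))%:E)%E,
      (mass (current_bd (set_current (W k))) <= (C * 2 `^ (k%:R * (delta - n%:R)))%:E)%E &
      (bv_variation (\1_(W k)) <= (C * 2 `^ (k%:R * (delta - n%:R)))%:E)%E].
Proof.
have [C1 C10 h1] := whitney_volume oU Ur hd ddelta deltaN.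
have [C2 C20 h2] := whitney_perimeter_le oU Ur hd ddelta deltaN.
have C3 : C1 <= C1 + N%:R * C2 by rewrite lerDl mulr_ge0.
have C4 : N%:R * C2 <= C1 + N%:R * C2 by rewrite lerDr.
have C5 : C2 <= C1 + N%:R * C2 by apply: le_trans C4; rewrite ler_peMl// ler1n.
have up (a b t : R) : a <= b -> ((a * 2 `^ t)%:E <= (b * 2 `^ t)%:E)%E.
  by move=> ab; rewrite lee_fin ler_wpM2r// powR_ge0.
(* The factor [N] comes from the variation: the components of a field of norm at most [1] have
   absolute values summing to at most [N]. *)
exists (C1 + N%:R * C2) => [|k]; first exact: le_trans C3.
have mW := measurable_whitney Ur k; have Wr : W k `<=` Bx r by exact: whitney_Bx.
have LW := le_trans (h1 k) (up _ _ _ C3).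
split => //.
- exact: le_trans (mass_set_current_le mW Wr) LW.
- by apply: le_trans (up _ _ _ C5); apply: mass_bd_whitney_le => B K f h i; exact: h2.
- apply: le_trans (up _ _ _ C4); apply: (bv_variation_le mW Wr) => f fl f1.
  by apply: h2 => // l j; exact: coord_lip.
Qed.

Lemma integral_current_whitney k : integral_current (set_current (W k)).
Proof.
have mW := measurable_whitney Ur k; have Wr : W k `<=` Bx r by exact: whitney_Bx.
have [C C0 hC] := whitney_bounds; have [_ b1 b2 _] := hC k.
split; first exact: current_set_current mW Wr.
  exact: integer_rectifiable_set_current mW Wr.
by split; [apply: le_lt_trans b1 _|apply: le_lt_trans b2 _]; exact: ltry.
Qed.

End fractal.

Section theorem.
Context {R : realType} {n : nat}.
Local Notation N := n.+1.
Local Notation E := (euclid R N).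
Local Notation L := (@lebesgueRn R N).
Variables (U : set E) (r d delta : R).
Hypothesis oU : open U.
Hypothesis Ur : U `<=` Bx r.
Hypothesis hd : has_box_dim (topo_boundary U) d.
Hypothesis ddelta : d < delta.
Hypothesis deltaN : delta < N%:R.
Local Notation W k := (whitney Ur k).

(** This places [delta] in the half-open interval that the definition of fractal currents
    prescribes, both for the set and for its boundary. *)
Let nd : n%:R <= d. Proof. exact: boundary_dim_ge oU Ur hd. Qed.
Let cU : current (set_current (U : set E)). Proof. exact: current_set_current (measurable_U oU) Ur. Qed.
Let dm := (d + delta) / 2.
Let ddm : d < dm. Proof. by rewrite /dm; have := ddelta; lra. Qed.
Let dmd : dm < delta. Proof. by rewrite /dm; have := ddelta; lra. Qed.
Let dmN : dm < N%:R. Proof. exact: lt_trans deltaN. Qed.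

Let ratio : 0 <= (2 `^ (dm - delta) : R) < 1.
Proof.
rewrite powR_ge0/= powR2E expR_lt1.
by have := dmd; rewrite pmulr_llt0 ?ln_gt0 ?ltr1n// subr_lt0.
Qed.

Let series_lty (a : nat -> \bar R) (C x y : R) : 0 <= C -> x + y = dm - delta -> (forall k, (0 <= a k)%E) ->
  (forall k, (a k <= (C * 2 `^ (k%:R * x))%:E)%E) ->
  (\sum_(0 <= k <oo) a k * (2 `^ (k%:R * y))%:E < +oo)%E.
Proof.
move=> C0 xy a0 aC; apply: (nneseries_geometric_lty C0 ratio) => k.
  by rewrite mule_ge0// lee_fin powR_ge0.
apply: (@le_trans _ _ ((C * 2 `^ (k%:R * x))%:E * (2 `^ (k%:R * y))%:E)%E).
  by rewrite lee_wpmul2r// lee_fin powR_ge0.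
by rewrite -EFinM lee_fin -mulrA powR2_geometric xy.
Qed.

Let null_series m (y : R) : (\sum_(0 <= k <oo) mass (@null_current R n m) * (2 `^ (k%:R * y))%:E < +oo)%E /\
  (\sum_(0 <= k <oo) mass (current_bd (@null_current R n m)) * (2 `^ (k%:R * y))%:E < +oo)%E.
Proof.
rewrite !mass_null//; last by move=> f g; exact: current_bd_null.
by rewrite !eseries0 ?ltry// => k _ _; rewrite mul0e.
Qed.

Lemma fractal_current_set : fractal_current N%:R delta (set_current (U : set E)).
Proof.
have [C C0 hC] := whitney_bounds oU Ur hd ddm dmN.
split; first by rewrite lexx ltrDl ltr01.
- by rewrite deltaN andbT -natr1 addrK; exact: le_trans nd (ltW ddelta).
- exact: cU.
(* No filling is used: the sets form the first family and the second is zero, so only the two series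
   in [rho] carry information. *)
exists (Bx r), (fun k => set_current (W k)), (fun _ _ _ => 0), 2, 2; split.
- exact: compact_Bx.
- move=> k; split; first exact: (@integral_current_whitney R n U r d oU Ur hd dm ddm dmN k).
  apply: current_spt_sub; first exact: closed_Bx.
  by move=> f g _; apply: set_current_disjoint; exact: whitney_Bx.
- move=> k; split; first exact: integral_current_null.
  exact: current_spt_null.
- by rewrite ltr1n.
split.
- split.
    exists (Bx r); [exact: compact_Bx|split; [|move=> K]]; apply: current_spt_sub; try exact: closed_Bx.
      by move=> f g _; exact: set_current_disjoint.
    move=> f g _ fr; rewrite big1// => k _; rewrite (set_current_disjoint _ _ fr); last exact: whitney_Bx.
    by rewrite add0r; exact: current_bd_null.
  move=> f g [fl gl]; apply: cvg_trans (whitney_sum_cvg oU Ur fl gl).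
  apply: near_eq_cvg; apply: nearW => K; apply: eq_bigr => k _.
  by rewrite [X in _ = _ + X](_ : _ = 0) ?addr0//; exact: current_bd_null.
- by split; [have [h _] := null_series N.+1 (N%:R + 1 - N%:R)|have [_ h] := null_series N.+1 (N%:R - N%:R)].
- split.
    apply: (series_lty (C := C) (x := dm - N%:R)) => // [|k|k]; [by ring|exact: mass_ge0|].
    by have [] := hC k.
  apply: (series_lty (C := C) (x := dm - n%:R)) => // [|k|k]; [|exact: mass_ge0|].
    by rewrite -[N%:R]natr1; ring.
  by have [] := hC k.
- by [].
Qed.

Lemma fractal_current_boundary : fractal_current delta (N%:R - 2) (current_bd (set_current (U : set E))).
Proof.
have [C C0 hC] := whitney_bounds oU Ur hd ddm dmN.
have N1 : N%:R = n%:R + 1 :> R by rewrite natr1.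
have one : is_lip (fun _ : E => 1 : R) by exact: is_lip_cst.
split.
- by rewrite -N1 deltaN andbT; exact: le_trans nd (ltW ddelta).
- by rewrite N1; apply/andP; split; lra.
- exact: current_bd_set_current (measurable_U oU) Ur.
(* The roles are exchanged: the boundary of [U] is the sum of the boundaries of the sets, which now
   form the family one dimension higher. The same volume and perimeter bounds appear with the
   exponents in [sigma]. *)
exists (Bx r), (fun _ _ _ => 0), (fun k => set_current (W k)), 2, 2; split.
- exact: compact_Bx.
- move=> k; split; first exact: integral_current_null.
  exact: current_spt_null.
- move=> k; split; first exact: (@integral_current_whitney R n U r d oU Ur hd dm ddm dmN k).
  apply: current_spt_sub; first exact: closed_Bx.
  by move=> f g _; apply: set_current_disjoint; exact: whitney_Bx.
- by rewrite ltr1n.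
split.
- split.
    exists (Bx r); [exact: compact_Bx|split; [|move=> K]]; apply: current_spt_sub; try exact: closed_Bx.
      by move=> f g [fl gl]; exact: current_bd_disjoint.
    move=> f g [fl gl] fr; rewrite big1// => k _; rewrite add0r.
    have Wr : W k `<=` Bx r by exact: whitney_Bx.
    exact: current_bd_disjoint Wr fl gl fr.
  move=> f g [fl gl]; apply: cvg_trans (whitney_sum_cvg oU Ur one (bd_tuple_forall fl gl)).
  apply: near_eq_cvg; apply: nearW => K; apply: eq_bigr => k _.
  by rewrite add0r.
- split.
    apply: (series_lty (C := C) (x := dm - N%:R)) => // [|k|k]; [by rewrite N1; ring|exact: mass_ge0|].
    by have [] := hC k.
  apply: (series_lty (C := C) (x := dm - n%:R)) => // [|k|k]; [by ring|exact: mass_ge0|].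
  by have [] := hC k.
- by split; [have [h _] := null_series n (n%:R - (N%:R - 2))|have [_ h] := null_series n (n%:R - 1 - (N%:R - 2))].
(* On the line the boundary has degree [0]; the convention for that degree holds because the first
   family vanishes. *)
- by [].
Qed.

End theorem.

Lemma bounded_subset_Bx (R : realType) n (U : set (euclid R n.+1)) : bounded_subset U -> exists r, U `<=` Bx r.
Proof.
move=> [s hs]; have [[x Ux]|nU] := pselect (exists x, U x); last first.
  by exists 0 => x Ux; exfalso; apply: nU; exists x.
exists (`|x : 'rV[R]_n.+1| + s) => y Uy; rewrite /Bx/= -(subrK (x : 'rV[R]_n.+1) y) addrC.
rewrite (le_trans (ler_normD _ _))// lerD2l (le_trans _ (hs y x Uy Ux))// euclid_mdist.
by apply: rV_norm_le => [|i]; [exact: enorm_ge0|exact: coord_le_enorm].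
Qed.

Theorem lemma4p4 (R : realType) (n : nat) (hn : (1 <= n)%N)
    (U : set (euclid R n)) (hUbounded : bounded_subset U) (hUopen : open U)
    (d : R) (hd : has_box_dim (topo_boundary U) d) (hdn : d < n%:R) :
  (forall delta : R, d < delta < n%:R ->
    exists C : R, 0 <= C /\ exists Rk : nat -> set (euclid R n),
    [/\ forall k, compact (Rk k) /\ Rk k `<=` U,
        {ae lebesgueRn n, forall x,
           (\sum_(k < N) (\1_(Rk k) x : R)) @[N --> \oo] --> (\1_U x : R)},
        (\int[lebesgueRn n]_x `|\1_U x - \sum_(k < N) (\1_(Rk k) x : R)|%:E)%E
          @[N --> \oo] --> 0%E &
        forall k,
          (lebesgueRn n (Rk k) <= (C * 2 `^ (k%:R * (delta - n%:R)))%:E)%E /\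
          (bv_variation (\1_(Rk k))
             <= (C * 2 `^ (k%:R * (delta - (n%:R - 1))))%:E)%E]) /\
  (forall delta : R, d < delta < n%:R ->
    fractal_current n%:R delta (set_current U) /\
    fractal_current delta (n%:R - 2) (current_bd (set_current U))).
Proof.
(* The positive dimension is written as a successor, the form in which determinants and volume
   factors were treated. *)
case: n hn U hUbounded hUopen hd hdn => // n _ U /bounded_subset_Bx[r Ur] oU hd _.
split => delta /andP[dd dN]; last first.
  by split; [exact: fractal_current_set oU Ur hd dd dN|exact: fractal_current_boundary oU Ur hd dd dN].
have [C C0 hC] := whitney_bounds oU Ur hd dd dN.
exists C; split => //; exists (whitney Ur); split.
- by move=> k; split; [exact: compact_whitney|exact: whitney_sub].
- by apply: ae_imp ae_off_grid => x; exact: sum_whitney_cvg.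
- exact: whitney_L1.
move=> k; have [h1 _ _ h2] := hC k; split => //.
by have -> : n.+1%:R - 1 = n%:R :> R by rewrite -natr1 addrK.
Qed.
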